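(* Let $k \geq 2$ be an integer and let $G$ be a graph with $n := |G| \geq 4k$ vertices and $\sigma_2(G) \geq 6k-2$. Then $G$ does not contain $k$ vertex-disjoint chorded cycles if and only if $G \in \{G_1(n,k), G_2(k)\}$.
   Context: All graphs are finite and simple. For a non-complete graph $G$, $\sigma_2(G) := \min\{d_G(x)+d_G(y) : x,y \in V(G),\ x \neq y,\ xy \notin E(G)\}$ is the minimum degree-sum over pairs of distinct nonadjacent vertices. A chorded cycle is a cycle in $G$ together with at least one edge of $G$ joining two vertices of the cycle that are not consecutive on it. For $n \geq 6k-2$, $G_1(n,k) := K_{3k-1,\,n-3k+1}$ (complete bipartite graph); for $k \geq 2$, $G_2(k) := K_{3k-2,\,3k-2,\,1}$ (complete tripartite graph with parts of sizes $3k-2$, $3k-2$, $1$). *)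

(* Defs.v *)
From mathcomp Require Import all_boot.

Set Implicit Arguments.
Unset Strict Implicit.
Unset Printing Implicit Defensive.

Record sgraph := SGraph {
  vertex :> finType;
  adj : rel vertex;
  adj_sym : symmetric adj;
  adj_irr : irreflexive adj
}.

Definition degree (G : sgraph) (x : G) : nat := #|[set y | adj x y]|.

(* [oAC minnA minnC] is the minimum on [option nat] with [None] as neutral element,
   so [None] plays the role of +oo: [sigma2 G = None] iff [G] is complete. *)
Definition sigma2 (G : sgraph) : option nat :=
  \big[oAC minnA minnC/None]_(p : G * G | (p.1 != p.2) && ~~ adj p.1 p.2)
     Some (degree p.1 + degree p.2).

Definition leq_sigma2 (m : nat) (G : sgraph) : bool :=
  if sigma2 G is Some s then m <= s else true.

Definition has_chord (G : sgraph) (c : seq G) : bool :=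
  [exists x in c, exists y in c,
     [&& adj x y, y != next c x & x != next c y]].

(* A cycle is given by its cyclic list of distinct vertices; [ucycleb] alone
   would also accept lists of length 0 and 2. *)
Definition chorded_cycle (G : sgraph) (c : seq G) : bool :=
  [&& 2 < size c, ucycleb (@adj G) c & has_chord c].

Definition has_disjoint_chorded_cycles (k : nat) (G : sgraph) : Prop :=
  exists C : 'I_k -> seq G,
    (forall i, chorded_cycle (C i)) /\
    (forall i j, i != j -> [disjoint C i & C j]).

Definition graph_iso (G H : sgraph) : Prop :=
  exists f : G -> H, bijective f /\ {mono f : x y / adj x y}.

Section CompleteMultipartite.
Variable s : seq nat.

Definition multipartite_vertex : finType :=
  {i : 'I_(size s) & 'I_(nth 0 s i)}.

Definition multipartite_adj : rel multipartite_vertex :=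
  fun x y => tag x != tag y.

Lemma multipartite_adj_sym : symmetric multipartite_adj.
Proof. by move=> x y; rewrite /multipartite_adj eq_sym. Qed.

Lemma multipartite_adj_irr : irreflexive multipartite_adj.
Proof. by move=> x; rewrite /multipartite_adj eqxx. Qed.

(* The complete multipartite graph whose parts have the sizes listed in [s]. *)
Definition complete_multipartite : sgraph :=
  SGraph multipartite_adj_sym multipartite_adj_irr.

End CompleteMultipartite.

(* Only meaningful for [6 * k - 2 <= n]. *)
Definition G1 (n k : nat) : sgraph :=
  complete_multipartite [:: 3 * k - 1; n - 3 * k + 1].

Definition G2 (k : nat) : sgraph :=
  complete_multipartite [:: 3 * k - 2; 3 * k - 2; 1].

(* Main.v *)
Require Import Defs.
From mathcomp Require Import all_boot zify.
From Stdlib Require Classical_Prop.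

(* Put [m = k - 1]. If adding an edge [xy] to [G] creates [k] disjoint chorded cycles, then [m] of
   them avoid [xy] and leave at least four vertices uncovered; if it creates an extremal graph,
   then [G] violates the degree condition. So, adding edges one by one, we reach a packing [F]
   of [m] chorded cycles with at least four uncovered vertices. Choose it to cover as few
   vertices as possible and, subject to that, to have as many inner edges as possible. Then an
   uncovered vertex has at most four neighbours in a member of [F], four only if the member is
   [K_4], and three only if it is [K_4], [K_4] minus an edge or [K_{3,3}].

   The uncovered part [R] contains no chorded cycle, so an end of a longest path of [R] has at
   most two neighbours in [R], and the degree condition forces the ends to send three edges on
   average to every member. The path together with the further neighbours of its ends is a
   cycle, a dumbbell (two cycles joined by a path) or a theta graph. Exchanging vertices between
   [R] and the members produces [k] disjoint chorded cycles unless [R] is [K_{2,t}], every member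
   is a [K_{3,3}], and all vertices in the part of size [t] have the same neighbours in it;
   only for [t = 3] may one member be [K_4] minus an edge. Further exchanges show that each
   vertex outside the neighbourhood [X] of a vertex of that part is adjacent to all of [X],
   which leaves only the two extremal graphs.

   Conversely, a chorded cycle of a bipartite graph has three vertices on either side. *)

Set Implicit Arguments.
Unset Strict Implicit.
Unset Printing Implicit Defensive.

(** Two nonadjacent uncovered vertices with at most two uncovered neighbours each send at least
    [6 * m] edges to the [m] members. For suitable lists of vertices of a path, with repetitions as
    weights, a member receives at most three edges per entry; this either contradicts the degree
    condition or forces equality at every member, which fixes its type. Only a K_4 can receive four
    edges from one vertex, so every count needs a separate bound for it: a vertex with three
    neighbours in a K_4 can replace any of its vertices [z], and [z] then sees at most two vertices
    of a path that stays uncovered. The tie-break by inner edges gives an exchange of [z] for [v]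
    two uses: it cannot gain edges, and if it loses none the new packing is again optimal, so that
    all that is proved for [F] applies to it. Both extremal graphs attain the degree bound, hence
    the estimates have to be sharp; the only slack is at vertices with three uncovered neighbours,
    and it is what admits the second graph. *)

Lemma exists_minimizer (A : Type) (P : A -> Prop) (mu : A -> nat) :
  (exists a, P a) -> exists a, P a /\ forall b, P b -> mu a <= mu b.
Proof.
case=> a Pa; have [n] := ubnP (mu a); elim: n a Pa => // n IHn a Pa lt_a.
case: (Classical_Prop.classic (exists2 b, P b & mu b < mu a)) => [[b Pb lt_ba]|noB].
  by apply: (IHn b) => //; lia.
exists a; split=> // b Pb; rewrite leqNgt; apply/negP => lt_ba.
by apply: noB; exists b.
Qed.

(** Cuts at the first entry satisfying [a]. Repeated on the tail it produces the first, second and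
    third neighbour of a vertex along a path. *)
Lemma split_count (A : Type) (a : pred A) s :
  0 < count a s -> exists s1 y s2,
    [/\ s = s1 ++ y :: s2, a y, count a s1 = 0 & count a s = (count a s2).+1].
Proof.
elim: s => //= x s IHs; case: (boolP (a x)) => ax.
  by exists [::], x, s; rewrite /= add1n.
rewrite add0n => /IHs[s1 [y [s2 [-> ay s1a cs]]]].
by exists (x :: s1), y, s2; rewrite /= (negPf ax).
Qed.

(** Decides [perm_eq] between concatenations and reversals: counts of an arbitrary predicate are
    compared, and once the boolean summands are named this is linear arithmetic. *)
Ltac permt := apply/permP => ?;
  do 5 rewrite -?cats1 /= ?(count_cat, count_rev) /=;
  repeat match goal with |- context [nat_of_bool ?x] =>
    let b := fresh in set b := nat_of_bool x; clearbody b end; clear; lia.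

(** * Chorded cycles and packings *)

Section Graph.
Variable G : sgraph.
Implicit Types (x y z u v w : G) (S A B C D : {set G}) (s t : seq G).
Implicit Types (F : {set {set G}}).

Local Notation adj := (@adj G).

Lemma adjC x y : adj x y = adj y x. Proof. exact: adj_sym. Qed.

Lemma adj_neq x y : adj x y -> x != y.
Proof. by apply: contraTneq => ->; rewrite adj_irr. Qed.

Definition nb v S := #|[set u in S | adj v u]|.

Lemma nbE v S : nb v S = \sum_(u in S) adj v u.
Proof.
rewrite /nb -sum1_card [RHS]big_mkcond /= big_mkcond /=.
by apply: eq_bigr => u _; rewrite inE; case: (u \in S); case: (adj v u).
Qed.

Lemma nb_le v S : nb v S <= #|S|.
Proof. by apply: subset_leq_card; apply/subsetP => u; rewrite inE => /andP[]. Qed.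

Lemma nbS v A B : A \subset B -> nb v A <= nb v B.
Proof.
move=> sAB; apply: subset_leq_card; apply/subsetP => u; rewrite !inE.
by case/andP=> /(subsetP sAB) ->.
Qed.

Lemma nbU v A B : [disjoint A & B] -> nb v (A :|: B) = nb v A + nb v B.
Proof.
move=> dAB; rewrite !nbE -bigU //=; apply: eq_bigl => u; by rewrite !inE.
Qed.

Lemma nbD1 v z S : z \in S -> nb v S = adj v z + nb v (S :\ z).
Proof. by move=> zS; rewrite !nbE (big_setD1 z). Qed.

Lemma nbID v A S : nb v S = nb v (S :&: A) + nb v (S :\: A).
Proof. by rewrite !nbE (big_setID A). Qed.

Lemma sub_set_seq s : {subset s <= [set u in s]}.
Proof. by move=> u us; rewrite inE. Qed.

Lemma sum_set_seq (f : G -> nat) s : uniq s ->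
  \sum_(u in [set x in s]) f u = \sum_(u <- s) f u.
Proof.
by move=> us; rewrite big_uniq //=; apply: eq_bigl => u; rewrite inE.
Qed.

Lemma nb_seq v s : uniq s -> nb v [set x in s] = count (adj v) s.
Proof.
move=> us; rewrite nbE sum_set_seq // -sum1_count [RHS]big_mkcond /=.
by apply: eq_bigr => u _; case: (adj v u).
Qed.

Lemma count_le_nb v s S : uniq s -> {subset s <= S} -> count (adj v) s <= nb v S.
Proof.
move=> us sS; rewrite -nb_seq //; apply: nbS; apply/subsetP => u.
by rewrite inE; apply: sS.
Qed.

Lemma nb_le_count v s S : (forall u, u \in S -> adj v u -> u \in s) ->
  nb v S <= count (adj v) s.
Proof.
move=> sS; rewrite -size_filter; apply: leq_trans (card_size _).
by apply: subset_leq_card; apply/subsetP => u; rewrite inE mem_filter => /andP[/sS H] /[dup] /H -> ->.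
Qed.

Lemma nb_full v S : #|S| <= nb v S -> forall u, u \in S -> adj v u.
Proof.
move=> le u uS.
have /eqP E : [set u in S | adj v u] == S.
  by rewrite eqEcard le andbT; apply/subsetP => z; rewrite inE => /andP[].
by move: uS; rewrite -{1}E inE => /andP[].
Qed.

Lemma nb_gt0 v S : 0 < nb v S -> exists2 u, u \in S & adj v u.
Proof. by rewrite card_gt0 => /set0Pn[u]; rewrite inE => /andP[uS vu]; exists u. Qed.

Lemma nb_lt v S : nb v S < #|S| -> exists2 u, u \in S & ~~ adj v u.
Proof.
move=> lt; case: (boolP [exists u in S, ~~ adj v u]) => [/exists_inP[u]|]; first by exists u.
rewrite negb_exists_in => /forall_inP H; move: lt; rewrite ltnNge => /negP[].
by apply: subset_leq_card; apply/subsetP => u uS; rewrite inE uS; move/negPn: (H u uS) => ->.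
Qed.

(** Double counting: it turns a bound for each vertex of a member into a bound for the vertices of a
    path. *)
Lemma nb_double_seq s B : \sum_(u <- s) nb u B = \sum_(z in B) count (adj z) s.
Proof.
under eq_bigr => u _ do rewrite nbE.
rewrite exchange_big /=; apply: eq_bigr => z _; rewrite -sum1_count [RHS]big_mkcond.
by apply: eq_bigr => u _ /=; rewrite adjC; case: (adj z u).
Qed.

Lemma degree_nb v A : degree v = nb v A + nb v (~: A).
Proof.
rewrite -nbU ?setUCr; last by rewrite disjoints_subset setCK.
by rewrite /degree; apply: eq_card => u; rewrite !inE.
Qed.

Lemma nb_cover v F : trivIset F -> nb v (cover F) = \sum_(C in F) nb v C.
Proof.
move=> tF; rewrite nbE big_trivIset //; apply: eq_bigr => C _; by rewrite nbE.
Qed.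

(* A chorded cycle inside [S], written as a chord [x y] and the two arcs between its ends. *)
Definition chs S := exists x s1 y s2,
  [/\ uniq (x :: s1 ++ y :: s2), cycle adj (x :: s1 ++ y :: s2),
      (0 < size s1) && (0 < size s2), adj x y & {subset x :: s1 ++ y :: s2 <= S}].

Lemma chsS A B : A \subset B -> chs A -> chs B.
Proof.
move=> sAB [x [s1 [y [s2 [? ? ? ? sA]]]]]; exists x, s1, y, s2; split=> //.
by move=> z /sA; apply: (subsetP sAB).
Qed.

Lemma chs_card S : chs S -> 4 <= #|S|.
Proof.
move=> [x [s1 [y [s2 [us _ /andP[h1 h2] _ sS]]]]].
have := uniq_leq_size us (s2 := enum S).
rewrite -cardE /= size_cat /= => H; apply: leq_trans (H _); first by lia.
by move=> z /sS; rewrite mem_enum.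
Qed.

Lemma chs_mk S x s1 y s2 : uniq (x :: s1 ++ y :: s2) ->
  cycle adj (x :: s1 ++ y :: s2) -> 0 < size s1 -> 0 < size s2 -> adj x y ->
  {subset x :: s1 ++ y :: s2 <= S} -> chs S.
Proof. by move=> ? ? h1 h2 ? ?; exists x, s1, y, s2; rewrite h1 h2. Qed.

Lemma chs_k4m S (p q r s : G) : adj p q -> adj q r -> adj r s -> adj s p -> adj p r ->
  q != s -> {subset [:: p; q; r; s] <= S} -> chs S.
Proof.
move=> pq qr rs sp pr nqs sS; apply: (@chs_mk S p [:: q] r [:: s]) => //=.
  rewrite !inE !negb_or (adj_neq pq) (adj_neq qr) (adj_neq pr) (adj_neq rs) nqs.
  by rewrite eq_sym (adj_neq sp).
by rewrite pq qr rs sp.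
Qed.

(* The cycle closes through the outer two neighbours of [z]; the middle one gives the chord. *)
Lemma chs_path3 S z s : sorted adj s -> uniq (z :: s) -> 2 < count (adj z) s ->
  {subset z :: s <= S} -> chs S.
Proof.
move=> ps us c3 sS.
have [|s0 [u [s' [Es zu _ Ec]]]] := @split_count _ (adj z) s; first by lia.
have [|s2 [w [s'' [Es' zw _ Ec']]]] := @split_count _ (adj z) s'; first by lia.
have [|s3 [u' [s4 [Es'' zu' _ Ec'']]]] := @split_count _ (adj z) s''; first by lia.
have sub : subseq (z :: (u :: s2) ++ w :: rcons s3 u') (z :: s).
  rewrite /= eqxx Es Es' Es''; apply: subseq_trans (suffix_subseq s0 _).
  have -> : u :: s2 ++ w :: s3 ++ u' :: s4 = (u :: s2 ++ w :: rcons s3 u') ++ s4.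
    by rewrite -cats1 /= -!catA /= -catA.
  exact: prefix_subseq.
apply: (@chs_mk S z (u :: s2) w (rcons s3 u')) => //.
- exact: subseq_uniq sub us.
- have [_] := cat_sorted2 (eq_ind _ (sorted adj) ps _ Es); rewrite Es' Es'' /=.
  rewrite cat_path /= cat_path /= => /and3P[p2 lw /and3P[p3 lu' _]].
  rewrite /= zu rcons_cat cat_path p2 /= lw /= !rcons_path p3 lu' /= last_rcons adjC zu'.
  by [].
- by rewrite size_rcons.
- by move=> v /(mem_subseq sub); apply: sS.
Qed.

Lemma path_end_nb x t : sorted adj (x :: t) -> uniq (x :: t) ->
  2 < count (adj x) t -> chs [set u in x :: t].
Proof.
move=> /= /path_sorted pt ut c3; apply: (@chs_path3 _ x t) => //; exact: sub_set_seq.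
Qed.

(* [z] closes the path [x :: t] into a cycle; a second neighbour of [x] on [t] gives the chord. *)
Lemma chs_close S z x t : sorted adj (x :: t) -> uniq (z :: x :: t) -> adj z x ->
  adj z (last x t) -> 1 < count (adj x) t -> {subset z :: x :: t <= S} -> chs S.
Proof.
case: t => [|v2 t'] //= /andP[xv2 pt] us zx zl c2 sS.
have [|t1 [u [t2 [Et xu _ _]]]] := @split_count _ (adj x) t'; first by move: c2; case: (adj x v2) => /=; lia.
have sub : perm_eq (x :: (v2 :: t1) ++ u :: rcons t2 z) (z :: x :: v2 :: t').
  by rewrite Et; permt.
apply: (@chs_mk S x (v2 :: t1) u (rcons t2 z)) => //.
- by rewrite (perm_uniq sub).
- move: pt zl; rewrite Et /= cat_path last_cat /= => /and3P[p1 l1 p2] zl.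
  rewrite /= xv2 rcons_cat cat_path /= p1 l1 !rcons_path p2 last_rcons zx adjC zl.
  by [].
- by rewrite size_rcons.
- by move=> v; rewrite (perm_mem sub); apply: sS.
Qed.

(* The ends of the path [x :: t] are joined through [a2], [b], [a1]; the chord is [x a2]. *)
Lemma chs_arc S x t a1 a2 b : sorted adj (x :: t) -> uniq (a1 :: a2 :: b :: x :: t) ->
  0 < size t -> adj x a1 -> adj x a2 -> adj (last x t) a2 -> adj b a1 -> adj b a2 ->
  {subset a1 :: a2 :: b :: x :: t <= S} -> chs S.
Proof.
move=> pt us st xa1 xa2 la2 ba1 ba2 sS.
have sub : perm_eq (x :: t ++ a2 :: [:: b; a1]) (a1 :: a2 :: b :: x :: t).
  by permt.
apply: (@chs_mk S x t a2 [:: b; a1]) => //.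
- by rewrite (perm_uniq sub).
- rewrite /= rcons_cat /= cat_path /= la2 (adjC a2) ba2 ba1 (adjC a1) xa1 !andbT.
  exact: pt.
- by move=> v; rewrite (perm_mem sub); apply: sS.
Qed.

(** Members are vertex sets that contain a chorded cycle, not cycles, so that exchanges become set
    operations. They are nonempty and disjoint, hence the cardinality of the family counts disjoint
    cycles. *)
Definition packing F := trivIset F /\ forall C, C \in F -> chs C.

Lemma packing_set0 : packing set0.
Proof. by split=> [|C]; rewrite ?inE //; apply/trivIsetP => A B; rewrite inE. Qed.

Lemma packing1 D : chs D -> packing [set D].
Proof.
move=> cD; split=> [|C /set1P-> //].
by apply/trivIsetP => A B /set1P-> /set1P->; rewrite eqxx.
Qed.

Lemma cover_set1 D : cover [set D] = D. Proof. by rewrite /cover big_set1. Qed.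

Lemma coverU (F1 F2 : {set {set G}}) : cover (F1 :|: F2) = cover F1 :|: cover F2.
Proof. by rewrite /cover bigcup_setU. Qed.

Lemma mem_cover_sub F C : C \in F -> C \subset cover F.
Proof. exact: (bigcup_sup C). Qed.

Lemma disjoint_mem A B : (forall u, u \in A -> u \in B -> False) -> [disjoint A & B].
Proof.
move=> H; rewrite -setI_eq0; apply/eqP/setP => u; rewrite !inE.
by apply/negP => /andP[uA uB]; apply: (H u).
Qed.

Lemma disjointE A B : [disjoint A & B] -> forall u, u \in A -> u \in B -> False.
Proof. by move=> d u uA uB; rewrite (disjointFr d uA) in uB. Qed.

Lemma packingU (F1 F2 : {set {set G}}) : packing F1 -> packing F2 ->
  [disjoint cover F1 & cover F2] ->
  [/\ packing (F1 :|: F2), [disjoint F1 & F2] & #|F1 :|: F2| = #|F1| + #|F2|].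
Proof.
move=> [t1 c1] [t2 c2] d.
have dF : forall A B, A \in F1 -> B \in F2 -> [disjoint A & B].
  move=> A B A1 B2; apply: disjoint_mem => u uA uB; apply: (disjointE d (u := u)).
    exact: subsetP (mem_cover_sub A1) _ uA.
  exact: subsetP (mem_cover_sub B2) _ uB.
(* A common member would be disjoint from itself and so empty, but it contains a chorded cycle. *)
have d12 : [disjoint F1 & F2].
  rewrite -setI_eq0; apply/eqP/setP => A; rewrite !inE; apply/negP => /andP[A1 A2].
  have := dF _ _ A1 A2; rewrite -setI_eq0 setIid => /eqP A0.
  by have := chs_card (c1 _ A1); rewrite A0 cards0.
split=> //; last by rewrite cardsU (disjoint_setI0 d12) cards0 subn0.
split=> [|C /setUP[/c1|/c2] //].
apply/trivIsetP => A B /setUP[A1|A2] /setUP[B1|B2] nAB.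
- exact: (trivIsetP t1).
- exact: dF.
- by rewrite disjoint_sym; apply: dF.
- exact: (trivIsetP t2).
Qed.

Lemma packing_subset F F' : F' \subset F -> packing F -> packing F'.
Proof.
move=> sF [t c]; split=> [|C /(subsetP sF)/c //].
by apply/trivIsetP => A B /(subsetP sF) A1 /(subsetP sF) B1; apply: (trivIsetP t).
Qed.

Lemma packing2 D1 D2 : chs D1 -> chs D2 -> [disjoint D1 & D2] ->
  packing [set D1; D2] /\ #|[set D1; D2]| = 2.
Proof.
move=> c1 c2 d; have [] := packingU (packing1 c1) (packing1 c2); first by rewrite !cover_set1.
by move=> p _ ->; rewrite !cards1.
Qed.

Lemma packing3 D1 D2 D3 : chs D1 -> chs D2 -> chs D3 ->
  [disjoint D1 & D2] -> [disjoint D1 & D3] -> [disjoint D2 & D3] ->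
  packing [set D1; D2; D3] /\ #|[set D1; D2; D3]| = 3.
Proof.
move=> c1 c2 c3 d12 d13 d23; have [p12 n12] := packing2 c1 c2 d12.
have [] := packingU p12 (packing1 c3).
  rewrite coverU !cover_set1; apply: disjoint_mem => u /setUP[] u1 u3.
    exact: (disjointE d13 u1 u3).
  exact: (disjointE d23 u1 u3).
by move=> p _ ->; rewrite n12 cards1.
Qed.

(** The general exchange: the members [Cs] are rebuilt from their own and the uncovered vertices, so
    the remaining members stay disjoint from the new ones. *)
Lemma packing_replace F (Cs Ds : {set {set G}}) : packing F -> Cs \subset F -> packing Ds ->
  cover Ds \subset cover Cs :|: ~: cover F ->
  [/\ packing ((F :\: Cs) :|: Ds), [disjoint F :\: Cs & Ds]
    & #|(F :\: Cs) :|: Ds| + #|Cs| = #|F| + #|Ds|].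
Proof.
move=> pF sC pD sD; have [] := packingU (packing_subset (subsetDl F Cs) pF) pD.
  apply: disjoint_mem => u /bigcupP[A /setDP[AF AC] uA] /(subsetP sD) /setUP[].
    case/bigcupP=> B BC uB; have BF := subsetP sC _ BC.
    have nAB : A != B by apply: contraNneq AC => ->.
    exact: (disjointE (trivIsetP pF.1 _ _ AF BF nAB) uA uB).
  by rewrite inE => /negP[]; apply: (subsetP (mem_cover_sub AF)).
move=> p d ->; split=> //; rewrite cardsD (setIidPr sC).
by have := subset_leq_card sC; lia.
Qed.

End Graph.

(** * Optimal packings and exchanges *)

Section Optimal.
Variable G : sgraph.
Implicit Types (x y z u v w : G) (S A B C D : {set G}) (s t : seq G).
Implicit Types (F : {set {set G}}).

Local Notation adj := (@adj G).

Definition edges C := \sum_(x in C) nb x C.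

Definition rest F := ~: cover F.

(* Here [m = k - 1]. Maximality of the number of inner edges (each counted twice by [edges])
   only breaks ties between packings covering the same number of vertices. *)
Record opt (m : nat) F : Prop := Opt {
  opt_pack : packing F;
  opt_card : #|F| = m;
  opt_min : forall F', packing F' -> #|F'| = m -> #|cover F| < #|cover F'| \/
     #|cover F| = #|cover F'| /\ \sum_(C in F') edges C <= \sum_(C in F) edges C;
  opt_max : forall F', packing F' -> #|F'| <> m.+1;
  opt_ore : forall x y, x != y -> ~~ adj x y -> 6 * m + 4 <= degree x + degree y }.

Lemma edgesD1 z S : z \in S -> edges S = edges (S :\ z) + 2 * nb z S.
Proof.
move=> zS; rewrite /edges (big_setD1 z) //=.
have -> : \sum_(x in S :\ z) nb x S = \sum_(x in S :\ z) nb x (S :\ z) + nb z (S :\ z).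
  by rewrite nbE -big_split /=; apply: eq_bigr => x _; rewrite (nbD1 x zS) addnC adjC.
by rewrite (nbD1 z zS) adj_irr; lia.
Qed.

Lemma sum_replace (f : {set G} -> nat) F (Cs Ds : {set {set G}}) :
  Cs \subset F -> [disjoint F :\: Cs & Ds] ->
  \sum_(C in (F :\: Cs) :|: Ds) f C + \sum_(C in Cs) f C =
  \sum_(C in F) f C + \sum_(C in Ds) f C.
Proof.
move=> sC d; rewrite [X in _ = X + _](big_setID Cs) /= (setIidPr sC).
have -> : \sum_(C in F :\: Cs :|: Ds) f C =
    \sum_(C in F :\: Cs) f C + \sum_(C in Ds) f C.
  by rewrite -bigU //=; apply: eq_bigl => C; rewrite !inE.
by rewrite addnAC; congr (_ + _); rewrite addnC.
Qed.

Lemma sum1 (f : {set G} -> nat) D : \sum_(C in [set D]) f C = f D.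
Proof. by rewrite big_set1. Qed.

Variable m : nat.

Lemma mem_rest_notin F C v : C \in F -> v \in rest F -> v \notin C.
Proof.
by move=> CF; rewrite inE; apply: contra => vC; apply: (subsetP (mem_cover_sub CF)).
Qed.

Lemma inU_C F C u : u \in C -> u \in C :|: rest F.
Proof. by rewrite in_setU => ->. Qed.

Lemma inU_R F C u : u \in rest F -> u \in C :|: rest F.
Proof. by rewrite in_setU => ->; rewrite orbT. Qed.

Section WithF.
Variable F : {set {set G}}.
Hypothesis oF : opt m F.

Lemma opt_chs C : C \in F -> chs C. Proof. exact: (opt_pack oF).2. Qed.

Lemma opt_triv : trivIset F. Proof. exact: (opt_pack oF).1. Qed.

Lemma mem_disj C C' : C \in F -> C' \in F -> C != C' -> [disjoint C & C'].
Proof. exact: (trivIsetP opt_triv). Qed.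

(** Trading one member for two contradicts [opt_max]; most configurations are excluded in this
    way. *)
Lemma win1 C D1 D2 : C \in F -> chs D1 -> chs D2 -> [disjoint D1 & D2] ->
  D1 \subset C :|: rest F -> D2 \subset C :|: rest F -> False.
Proof.
move=> CF c1 c2 d s1 s2; have [p n] := packing2 c1 c2 d.
have [||p' _ n'] := @packing_replace _ F [set C] _ (opt_pack oF) _ p.
- by rewrite sub1set.
- by rewrite /cover big_set1 bigcup_setU !big_set1 subUset s1.
apply: (opt_max oF p'); move: n'; rewrite n cards1 (opt_card oF); lia.
Qed.

Lemma win2 C C' D1 D2 D3 : C \in F -> C' \in F -> C != C' ->
  chs D1 -> chs D2 -> chs D3 ->
  [disjoint D1 & D2] -> [disjoint D1 & D3] -> [disjoint D2 & D3] ->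
  D1 \subset C :|: C' :|: rest F -> D2 \subset C :|: C' :|: rest F ->
  D3 \subset C :|: C' :|: rest F -> False.
Proof.
move=> CF CF' nCC c1 c2 c3 d12 d13 d23 s1 s2 s3.
have [p n] := packing3 c1 c2 c3 d12 d13 d23.
have [||p' _ n'] := @packing_replace _ F [set C; C'] _ (opt_pack oF) _ p.
- by apply/subsetP => A /set2P[]->.
- by rewrite /cover !bigcup_setU !big_set1 !subUset s1 s2.
apply: (opt_max oF p'); move: n'; rewrite n cards2 nCC (opt_card oF); lia.
Qed.

Definition upd C D := (F :\ C) :|: [set D].

(** The new family still has [m] members, so optimality compares [D] with [C], first by size, then
    by inner edges. If both agree, the new family is as good as the old one. *)
Lemma upd_opt C D : C \in F -> chs D -> D \subset C :|: rest F ->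
  #|C| <= #|D| /\ (#|C| = #|D| -> edges D <= edges C /\ (edges D = edges C -> opt m (upd C D))).
Proof.
move=> CF cD sD.
have [||p d n] := @packing_replace _ F [set C] [set D] (opt_pack oF) _ (packing1 cD).
- by rewrite sub1set.
- by rewrite !cover_set1.
have sCF : [set C] \subset F by rewrite sub1set.
have eC := sum_replace (fun C => #|C|) sCF d.
have eE := sum_replace edges sCF d.
rewrite !sum1 (eqP p.1) (eqP opt_triv) in eC; rewrite !sum1 in eE.
have n' : #|upd C D| = m by move: n; rewrite !cards1 (opt_card oF) -/(upd C D); lia.
have := opt_min oF p n'; rewrite -/(upd C D) in eC eE p *.
move=> H; split; first by case: H => [|[]]; lia.
move=> eqC; split; first by case: H => [|[]]; lia.
move=> eqE; split=> //; try exact: (opt_max oF); try exact: (opt_ore oF).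
by move=> F' p' nF'; have [|[]] := opt_min oF p' nF'; [left|right]; lia.
Qed.

Lemma opt_small C D : C \in F -> chs D -> D \subset C :|: rest F -> #|C| <= #|D|.
Proof. by move=> CF cD sD; have [] := upd_opt CF cD sD. Qed.

Lemma rest_upd C D v : C \in F -> (v \in rest (upd C D)) = (v \in C :|: rest F) && (v \notin D).
Proof.
move=> CF; rewrite /upd inE coverU cover_set1 inE negb_or; congr (_ && _).
apply/idP/idP.
  case: (boolP (v \in cover F)) => [/bigcupP[A AF vA] H|H _]; last by rewrite !inE H orbT.
  rewrite inE; case: (eqVneq A C) => [<-|nAC]; first by rewrite vA.
  by case/negP: H; apply/bigcupP; exists A => //; rewrite !inE nAC.
rewrite inE => /orP[vC|]; last first.
  by rewrite inE; apply: contra; apply: subsetP; apply/bigcupsP => A /setD1P[_ /mem_cover_sub].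
apply/negP => /bigcupP[A /setD1P[nAC AF] vA].
exact: (disjointE (mem_disj AF CF nAC) vA vC).
Qed.

Definition sw C z v := v |: (C :\ z).

Lemma sw_card C z v : C \in F -> z \in C -> v \in rest F -> #|sw C z v| = #|C|.
Proof.
move=> CF zC vR; rewrite cardsU1 (cardsD1 z C) zC !inE.
by rewrite (negPf (mem_rest_notin CF vR)) andbF.
Qed.

Lemma sw_sub C z v : v \in rest F -> sw C z v \subset C :|: rest F.
Proof.
move=> vR; apply/subsetP => u; rewrite !inE => /orP[/eqP->|/andP[_ ->] //].
by move: vR; rewrite inE => ->; rewrite orbT.
Qed.

(** [C] and [sw C z v] share [C :\ z], so their inner edges differ only at [z] and [v]. In the case
    of equality later lemmas may be applied with [z] uncovered in place of [v]. *)
Lemma swap C z v : C \in F -> z \in C -> v \in rest F -> chs (sw C z v) ->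
  nb v (C :\ z) <= nb z C /\ (nb z C <= nb v (C :\ z) -> opt m (upd C (sw C z v))).
Proof.
move=> CF zC vR cs; have [_] := upd_opt CF cs (sw_sub C z vR).
rewrite sw_card // => /(_ erefl)[le H].
have eD : edges (sw C z v) = edges (C :\ z) + 2 * nb v (C :\ z).
  have vnC := mem_rest_notin CF vR.
  have vS : v \in sw C z v by rewrite !inE eqxx.
  have ED : sw C z v :\ v = C :\ z.
    apply/setP => u; rewrite !inE; case: eqP => //= ->.
    by rewrite (negPf vnC) andbF.
  rewrite (edgesD1 vS) ED (nbD1 v vS) adj_irr ED; lia.
have eC := edgesD1 zC.
by split=> [|le']; [lia|apply: H; lia].
Qed.

Lemma swap_rest C z v u : C \in F -> z \in C -> v \in rest F ->
  (u \in rest (upd C (sw C z v))) = (u == z) || (u \in rest F) && (u != v).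
Proof.
move=> CF zC vR; rewrite rest_upd // !inE negb_or negb_and negbK.
have vC := mem_rest_notin CF vR.
case: (eqVneq u z) => [->|nuz] /=.
  by rewrite zC /= andbT; apply: contraNneq vC => <-.
case: (boolP (u \in C)) => uC /=; last by rewrite !andbT.
by rewrite andbF (subsetP (mem_cover_sub CF) _ uC).
Qed.

Lemma swap_mem C z v C' : C \in F -> (C' \in upd C (sw C z v)) =
  (C' == sw C z v) || (C' \in F) && (C' != C).
Proof. by move=> CF; rewrite !inE orbC andbC. Qed.

End WithF.
End Optimal.

Ltac adjt := solve [assumption | by rewrite adjC].

(** * Members seeing three neighbours of an uncovered vertex *)

Section Members.
Variable G : sgraph.
Implicit Types (x y z u v w : G) (S A B C D : {set G}) (s t : seq G).
Implicit Types (F : {set {set G}}).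

Local Notation adj := (@adj G).

Definition cyc C c := [/\ uniq c, cycle adj c & C = [set u in c]].

Lemma cyc_rot C s t : cyc C (s ++ t) -> cyc C (t ++ s).
Proof.
rewrite /cyc -(rot_size_cat s t) rot_uniq rot_cycle => -[? ? ->]; split=> //.
by apply/setP => u; rewrite !inE mem_rot.
Qed.

Lemma cyc_eq C s t : cyc C s -> s = t -> cyc C t. Proof. by move=> ? <-. Qed.

Lemma cyc_mem C s u : cyc C s -> u \in s -> u \in C.
Proof. by case=> _ _ ->; rewrite inE. Qed.

Lemma cyc_card C c : cyc C c -> #|C| = size c.
Proof. by case=> uc _ ->; rewrite cardsE; apply/card_uniqP. Qed.

Lemma nb_cyc v C c : cyc C c -> nb v C = count (adj v) c.
Proof. by case=> uc _ ->; apply: nb_seq. Qed.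

Definition cl4 C := #|C| = 4 /\ {in C &, forall u v, u != v -> adj u v}.

Definition dia C a b c d := C = [set u in [:: a; b; c; d]] /\
  [/\ uniq [:: a; b; c; d], adj a b, adj a c, adj a d & adj b c /\ adj b d /\ ~~ adj c d].

(* Edges inside [A] or [C :\: A] are not excluded here; [no_inner6] does it for members of [F]. *)
Definition k33 C A := [/\ A \subset C, #|A| = 3, #|C| = 6
  & forall a b, a \in A -> b \in C -> b \notin A -> adj a b].

Definition nbs v C := [set u in C | adj v u].

Variables (m : nat) (F : {set {set G}}).
Hypothesis oF : opt m F.

(** A chorded cycle that missed a vertex of [C] would be a smaller member. *)
Lemma member_form C : C \in F -> exists x s1 y s2,
  [/\ cyc C (x :: s1 ++ y :: s2), 0 < size s1, 0 < size s2 & adj x y].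
Proof.
move=> CF; have [x [s1 [y [s2 [us cs /andP[h1 h2] xy sS]]]]] := opt_chs oF CF.
exists x, s1, y, s2; split=> //; split=> //.
set c := x :: s1 ++ y :: s2 in us cs sS *.
have cD : chs [set u in c] by apply: (@chs_mk _ _ x s1 y s2) => //; apply: sub_set_seq.
have sDC : [set u in c] \subset C by apply/subsetP => u; rewrite inE; apply: sS.
apply/eqP; rewrite eq_sym eqEcard sDC /=; apply: (opt_small oF CF cD).
exact: subset_trans sDC (subsetUl _ _).
Qed.

(** The cycle from [v] to [y1], along [C] to [y3] and back to [v] has the chord [v y2]. It trades
    the arc [s3] for the single vertex [v], so a longer arc would contradict the minimal cover. *)
Lemma arc_le C v y1 s1 y2 s2 y3 s3 : C \in F -> v \in rest F ->
  cyc C (y1 :: s1 ++ y2 :: s2 ++ y3 :: s3) -> adj v y1 -> adj v y2 -> adj v y3 ->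
  size s3 <= 1.
Proof.
move=> CF vR cC vy1 vy2 vy3; have vC := mem_rest_notin CF vR.
set c0 := y1 :: s1 ++ y2 :: s2 ++ [:: y3].
have Ec : y1 :: s1 ++ y2 :: s2 ++ y3 :: s3 = c0 ++ s3 by rewrite /c0 /= -!catA /= -catA.
have sC := cyc_card cC; case: cC; rewrite Ec in sC * => uc cc EC.
have u0 : uniq (v :: c0).
  rewrite cons_uniq; move: uc; rewrite cat_uniq => /andP[-> _]; rewrite andbT.
  by apply: contra vC => v0; rewrite EC inE mem_cat v0.
have p0 : sorted adj c0.
  by move: cc; rewrite /= rcons_cat cat_path => /andP[].
have cD : chs [set u in v :: c0].
  apply: (chs_path3 p0 u0); last exact: sub_set_seq.
  by rewrite /c0 /= count_cat /= count_cat /= vy1 vy2 vy3; clear; lia.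
have := opt_small oF CF cD; rewrite sC cardsE (card_uniqP u0) /= size_cat.
move=> H; suff : (size c0 + size s3 <= (size c0).+1) by clear; lia.
apply: H; apply/subsetP => u; rewrite inE in_cons => /orP[/eqP->|uc0].
  by rewrite inE vR orbT.
by rewrite inE EC inE mem_cat uc0.
Qed.

(** [arc_le] is applied to the three rotations of the cycle that begin at [y1], [y2] and [y3]. *)
Lemma nb3_form C v : C \in F -> v \in rest F -> 2 < nb v C ->
  exists y1 s1 y2 s2 y3 s3, cyc C (y1 :: s1 ++ y2 :: s2 ++ y3 :: s3) /\
   [/\ [&& adj v y1, adj v y2 & adj v y3], count (adj v) s1 = 0, count (adj v) s2 = 0
     & [&& size s1 <= 1, size s2 <= 1 & size s3 <= 1]].
Proof.
move=> CF vR c3; have [x [s1' [y [s2' [cC _ _ _]]]]] := member_form CF.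
rewrite (nb_cyc v cC) in c3; move: (x :: _) cC c3 => c cC c3 {x s1' y s2'}.
have [|s0 [y1 [t1 [E1 v1 _ c1]]]] := @split_count _ (adj v) c; first by lia.
have [|s1 [y2 [t2 [E2 v2 z1 c2]]]] := @split_count _ (adj v) t1; first by lia.
have [|s2 [y3 [t3 [E3 v3 z2 _]]]] := @split_count _ (adj v) t2; first by lia.
move: cC; rewrite E1 E2 E3 => /cyc_rot cC.
have {}cC : cyc C (y1 :: s1 ++ y2 :: s2 ++ y3 :: (t3 ++ s0)).
  by move: cC; rewrite /= -!catA /= -!catA /=.
exists y1, s1, y2, s2, y3, (t3 ++ s0); split=> //; split=> //; first by apply/and3P.
have l3 := arc_le CF vR cC v1 v2 v3; set s3 := t3 ++ s0 in cC l3 *.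
have cC1 : cyc C (y2 :: s2 ++ y3 :: s3 ++ y1 :: s1).
  apply: cyc_eq (@cyc_rot C (y1 :: s1) (y2 :: s2 ++ y3 :: s3) cC) _ ; by rewrite /= -?catA /= -?catA.
have cC2 : cyc C (y3 :: s3 ++ y1 :: s1 ++ y2 :: s2).
  apply: cyc_eq (@cyc_rot C (y2 :: s2) (y3 :: s3 ++ y1 :: s1) cC1) _ ; by rewrite /= -?catA /= -?catA.
have l1 := arc_le CF vR cC1 v2 v3 v1; have l2 := arc_le CF vR cC2 v3 v1 v2.
by apply/and3P.
Qed.

Lemma nb3_card C v : C \in F -> v \in rest F -> 2 < nb v C -> 4 <= #|C| <= 6.
Proof.
move=> CF vR c3; rewrite (chs_card (opt_chs oF CF)) /=.
have [y1 [s1 [y2 [s2 [y3 [s3 [cC [_ _ _ /and3P[? ? ?]]]]]]]]] := nb3_form CF vR c3.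
by rewrite (cyc_card cC) /= !size_cat /= !size_cat /=; lia.
Qed.

(** A fourth neighbour has to be the single vertex of the last arc. Then [arc_le], for two triples
    of neighbours that contain it, leaves no vertex on the other arcs. *)
Lemma nb4_card C v : C \in F -> v \in rest F -> 3 < nb v C -> #|C| = 4 /\ nb v C = 4.
Proof.
move=> CF vR c4.
have [y1 [s1 [y2 [s2 [y3 [s3 [cC [/and3P[v1 v2 v3] z1 z2 /and3P[l1 l2 l3]]]]]]]]] := nb3_form CF vR (ltnW c4).
move: c4; rewrite (nb_cyc v cC) (cyc_card cC) /= !count_cat /= !count_cat /= v1 v2 v3 z1 z2.
case: s3 l3 cC => [|y4 [|//]] _ cC; first by move=> /=; lia.
rewrite /= addn0; case v4: (adj v y4) => //= _.
have cC1 : cyc C (y2 :: (s2 ++ [:: y3]) ++ y4 :: [::] ++ y1 :: s1).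
  apply: cyc_eq (@cyc_rot C (y1 :: s1) (y2 :: s2 ++ [:: y3; y4]) cC) _ ; by rewrite /= -?catA /= -?catA.
have cC2 : cyc C (y3 :: [::] ++ y4 :: [::] ++ (y1 :: s1 ++ y2 :: s2)).
  apply: cyc_eq (@cyc_rot C (y1 :: s1 ++ y2 :: s2) [:: y3; y4] _) _ => //.
  by apply: cyc_eq cC _; rewrite /= -catA.
have k1 : size s1 = 0.
  have cC3 : cyc C (y3 :: [::] ++ y4 :: (y1 :: s1) ++ y2 :: s2) by [].
  have cC4 : cyc C (y2 :: s2 ++ y3 :: [::] ++ y4 :: (y1 :: s1)).
    apply: cyc_eq (@cyc_rot C (y1 :: s1) (y2 :: s2 ++ [:: y3; y4]) cC) _ ; by rewrite /= -?catA /= -?catA.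
  have := arc_le CF vR cC4 v2 v3 v4; rewrite /=; lia.
have k2 : size s2 = 0.
  have cC3 : cyc C (y3 :: [::] ++ y4 :: [::] ++ y1 :: (s1 ++ y2 :: s2)) by [].
  have := arc_le CF vR cC3 v3 v4 v1; rewrite size_cat /=; lia.
by rewrite !size_cat /= !size_cat /= k1 k2.
Qed.

Lemma nb_le4 C v : C \in F -> v \in rest F -> nb v C <= 4.
Proof. by move=> CF vR; rewrite leqNgt; apply/negP => c5; have [_ E] := nb4_card CF vR (ltnW c5); move: c5; rewrite E. Qed.

Lemma card4_form C : C \in F -> #|C| = 4 -> cl4 C \/ exists a b c d, dia C a b c d.
Proof.
move=> CF c4; have [x [[|u [|? s1]] [y [[|w [|? s2]] [cC // h1 h2 xy]]]]] := member_form CF;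
  have := cyc_card cC; rewrite c4 /= ?size_cat /= => // Es; try by lia.
case: (cC) => us cs EC; move: cs => /= /and5P[xu uy yw wx _].
case uw: (adj u w); last first.
  right; exists x, y, u, w; split; last first.
    split; try adjt; last by rewrite uw; split; [adjt|split=> //; adjt].
    by rewrite (perm_uniq (_ : perm_eq _ [:: x; u; y; w])) //; permt.
  rewrite EC; apply/setP => z; rewrite !inE.
  by case: (z == x); case: (z == u); case: (z == y); case: (z == w).
left; split=> // p q; rewrite EC !inE.
by do 2 case/or4P=> /eqP->; rewrite ?eqxx // => _; rewrite // adjC.
Qed.

(** In K_4 minus an edge, an end [d] of the missing edge has two neighbours, while [v] has three
    besides [d]; the exchange would gain inner edges. *)
Lemma nb4_cl4 C v : C \in F -> v \in rest F -> 3 < nb v C -> cl4 C.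
Proof.
move=> CF vR c4; have [C4 n4] := nb4_card CF vR c4.
have [//|[a [b [c [d [EC [us ab ac ad [bc [bd cd]]]]]]]]] := card4_form CF C4.
have va : {in C, forall u, adj v u} by move=> u; apply: nb_full; rewrite n4 C4.
have dC : d \in C by rewrite EC !inE eqxx !orbT.
have vC := mem_rest_notin CF vR.
have cs : chs (sw C d v).
  have mC u : u \in [:: a; b; c; d] -> u \in C by rewrite EC inE.
  apply: (@chs_k4m _ _ v a c b); try adjt.
  - by apply: va; apply: mC; rewrite !inE eqxx.
  - by rewrite adjC; apply: va; apply: mC; rewrite !inE eqxx !orbT.
  - by apply: va; apply: mC; rewrite !inE eqxx !orbT.
  - exact: adj_neq.
  - move=> u; rewrite !inE => /or4P[]/eqP->; rewrite ?eqxx //; apply/orP; right;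
      (rewrite EC !inE eqxx ?orbT andbT; move: us; rewrite /= !inE !negb_or => /and4P[/and3P[? ? ?] /andP[? ?] ? _] //).
have [le _] := swap oF CF dC vR cs.
have : nb v (C :\ d) = 3 by move: n4; rewrite (nbD1 v dC) va //; clear; lia.
have : nb d C <= 2.
  by rewrite EC nb_seq //= adj_irr (adjC d c) (negPf cd) /=; case: (adj d a); case: (adj d b).
by move: le; clear; lia.
Qed.

Lemma dichotomy C : C \in F -> cl4 C \/ forall v, v \in rest F -> nb v C <= 3.
Proof.
move=> CF; case: (boolP [exists v in rest F, 3 < nb v C]) => [/exists_inP[v vR c4]|].
  by left; apply: nb4_cl4 c4.
rewrite negb_exists_in => /forall_inP H; right=> v /H; lia.
Qed.

(** The five edges form a K_4 minus an edge, a chorded cycle on four vertices that could replace the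
    larger member. *)
Lemma no_k4m C (p q r s : G) : C \in F -> 4 < #|C| ->
  {subset [:: p; q; r; s] <= C :|: rest F} ->
  adj p q -> adj q r -> adj r s -> adj s p -> adj p r -> q != s -> False.
Proof.
move=> CF C5 sub pq qr rs sp pr nqs.
have cD : chs [set u in [:: p; q; r; s]] by apply: (@chs_k4m _ _ p q r s) => //; apply: sub_set_seq.
have := opt_small oF CF cD; rewrite cardsE => H; have := card_size [:: p; q; r; s].
suff : #|C| <= #|[:: p; q; r; s]| by rewrite /=; lia.
by apply: H; apply/subsetP => u; rewrite inE => /sub.
Qed.

(** The chord [p r] makes [p q r] a triangle. Two neighbours of [v] in it would give a K_4 minus an
    edge, so at most one of three neighbours lies there. *)
Lemma card5_nb C (p q r s t v : G) : C \in F -> cyc C [:: p; q; r; s; t] ->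
  adj p r -> v \in rest F -> 2 < nb v C -> adj v s /\ adj v t.
Proof.
move=> CF cC pr vR; have C5 := cyc_card cC; rewrite (nb_cyc v cC) /=.
case: (cC) => us /= /and5P[pq qr rs st /andP[tp _]] EC.
have vC := mem_rest_notin CF vR.
have inC u : u \in [:: p; q; r; s; t] -> u \in C :|: rest F by move=> /(cyc_mem cC)/inU_C.
have vU : v \in C :|: rest F by apply: inU_R.
have [pU qU rU sU] : [/\ p \in C :|: rest F, q \in C :|: rest F, r \in C :|: rest F & s \in C :|: rest F].
  by split; apply: inC; rewrite !inE eqxx ?orbT.
have tU : t \in C :|: rest F by apply: inC; rewrite !inE eqxx ?orbT.
have sub4 a b c d : a \in C :|: rest F -> b \in C :|: rest F -> c \in C :|: rest F ->
    d \in C :|: rest F -> {subset [:: a; b; c; d] <= C :|: rest F}.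
  by move=> aS bS cS dS; apply/allP; rewrite /= aS bS cS dS.
have neq u : u \in [:: p; q; r; s; t] -> u != v by move=> uc; apply: contraNneq vC => <-; apply: cyc_mem uc.
have [nvp nvq nvr] : [/\ p != v, q != v & r != v] by split; apply: neq; rewrite !inE eqxx ?orbT.
have [nvs nvt] : s != v /\ t != v by split; apply: neq; rewrite !inE eqxx ?orbT.
have nk a b c d := @no_k4m C a b c d CF.
have C4 : 4 < #|C| by rewrite C5.
have npq : ~~ (adj v p && adj v q).
  by apply/negP => /andP[vp vq]; apply: (nk p v q r) => //; try adjt; try (rewrite eq_sym //); exact: sub4.
have npr : ~~ (adj v p && adj v r).
  by apply/negP => /andP[vp vq]; apply: (nk p v r q) => //; try adjt; try (rewrite eq_sym //); exact: sub4.
have nqr : ~~ (adj v q && adj v r).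
  by apply/negP => /andP[vp vq]; apply: (nk q v r p) => //; try adjt; try (rewrite eq_sym //); exact: sub4.
by move: npq npr nqr; case: (adj v p); case: (adj v q); case: (adj v r);
   case: (adj v s); case: (adj v t).
Qed.

(** Both vertices see the ends of the edge [s t], which yields a chorded cycle on [s], [u], [t],
    [v], smaller than [C]. *)
Lemma card5_pair C u v : C \in F -> u \in rest F -> v \in rest F -> u != v ->
  #|C| = 5 -> 2 < nb u C -> 2 < nb v C -> False.
Proof.
move=> CF uR vR nuv C5 cu cv.
have [p [q [r [s [t [cC pr]]]]]] : exists p q r s t : G, cyc C [:: p; q; r; s; t] /\ adj p r.
  have [x [s1 [y [s2 [cC h1 h2 xy]]]]] := member_form CF.
  have := cyc_card cC; rewrite C5.
  case: s1 h1 cC => [//|a1 [|a2 [|? ?]]] _; case: s2 h2 => [//|b1 [|b2 [|? ?]]] _ cC //= E;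
    try by move: E; rewrite ?size_cat /=; lia.
    by exists x, a1, y, b1, b2.
  have cC' := @cyc_rot C [:: x; a1; a2] [:: y; b1] cC.
  by exists y, b1, x, a1, a2; split=> //; adjt.
have [us ut] := card5_nb CF cC pr uR cu; have [vs vt] := card5_nb CF cC pr vR cv.
case: (cC) => _ /= /and5P[_ _ _ st _] EC.
apply: (@no_k4m C s u t v) => //; try adjt; first by rewrite C5.
have inC z : z \in [:: p; q; r; s; t] -> z \in C :|: rest F by move=> /(cyc_mem cC)/inU_C.
by apply/allP; rewrite /= (inU_R _ uR) (inU_R _ vR) !inC //; rewrite !inE eqxx ?orbT.
Qed.

(** An edge inside one side and two vertices of the other form a K_4 minus an edge. *)
Lemma no_inner6 C A : C \in F -> k33 C A -> forall a b, a \in C -> b \in C ->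
  (a \in A) = (b \in A) -> ~~ adj a b.
Proof.
move=> CF [sAC A3 C6 kA] a b aC bC eqA; apply/negP => ab.
have two (B : {set G}) : 2 < #|B| -> exists p q, [/\ p \in B, q \in B & p != q].
  by move=> /ltnW/card_gt1P[p [q [? ? ?]]]; exists p, q.
have sU u : u \in C -> u \in C :|: rest F by rewrite inE => ->.
have CA3 : #|C :\: A| = 3 by rewrite cardsD (setIidPr sAC) A3 C6.
case aA: (a \in A) eqA => bA.
  have [p [q [/setDP[pC pA] /setDP[qC qA] npq]]] := two (C :\: A) (eq_leq (esym CA3)).
  apply: (@no_k4m C a p b q) => //; rewrite ?C6 //; try (by apply: kA); try (rewrite adjC; by apply: kA).
  by apply/allP; rewrite /= !inU_C.
have [p [q [pA qA npq]]] := two A (eq_leq (esym A3)).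
have [pC qC] : p \in C /\ q \in C by split; apply: (subsetP sAC).
apply: (@no_k4m C a p b q) => //; rewrite ?C6 //; try (apply: kA => //; by rewrite ?aA -?bA);
  try (rewrite adjC; apply: kA => //; by rewrite ?aA -?bA).
by apply/allP; rewrite /= !inU_C.
Qed.

(** Two neighbours on one side and one on the other would form a K_4 minus an edge with [v], so
    three neighbours fill a side. *)
Lemma k33_nb C A v : C \in F -> k33 C A -> v \in rest F -> 2 < nb v C ->
  nbs v C = A \/ nbs v C = C :\: A.
Proof.
move=> CF kC vR c3; case: (kC) => sAC A3 C6 kA.
have CA3 : #|C :\: A| = 3 by rewrite cardsD (setIidPr sAC) A3 C6.
have vC := mem_rest_notin CF vR.
have E : nb v C = nb v A + nb v (C :\: A).
  by rewrite (nbID v A) (setIidPr sAC).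
have nk a a' b : a \in A -> a' \in A -> a != a' -> b \in C -> b \notin A ->
    adj v a -> adj v a' -> adj v b -> False.
  move=> aA a'A naa bC bA va va' vb; have aC := subsetP sAC _ aA; have a'C := subsetP sAC _ a'A.
  have ab := kA _ _ aA bC bA; have a'b := kA _ _ a'A bC bA.
  apply: (@no_k4m C v a b a') => //; rewrite ?C6 //; try adjt.
  by apply/allP; rewrite /= (inU_R _ vR) !inU_C.
have nk' a b b' : a \in A -> b \in C -> b \notin A -> b' \in C -> b' \notin A -> b != b' ->
    adj v a -> adj v b -> adj v b' -> False.
  move=> aA bC bA b'C b'A nbb va vb vb'; have aC := subsetP sAC _ aA.
  have ab := kA _ _ aA bC bA; have ab' := kA _ _ aA b'C b'A.
  apply: (@no_k4m C v b a b') => //; rewrite ?C6 //; try adjt.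
  by apply/allP; rewrite /= (inU_R _ vR) !inU_C.
have eqs B : B \subset C -> #|B| <= nb v B -> nb v (C :\: B) = 0 -> nbs v C = B.
  move=> sBC full z0; apply/setP => u; rewrite !inE.
  case: (boolP (u \in B)) => uB; first by rewrite (subsetP sBC _ uB) (nb_full full uB).
  apply/negP => /andP[uC vu]; have : 0 < nb v (C :\: B); last by rewrite z0.
  by rewrite card_gt0; apply/set0Pn; exists u; rewrite !inE uB uC.
have zeroA : 1 < nb v A -> nb v (C :\: A) = 0.
  move=> /card_gt1P[a [a' []]]; rewrite !inE => /andP[aA va] /andP[a'A va'] naa.
  apply/eqP; rewrite -leqn0 leqNgt; apply/negP => /nb_gt0[b /setDP[bC bA] vb].
  exact: (nk a a' b).
have zeroB : 1 < nb v (C :\: A) -> nb v A = 0.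
  move=> /card_gt1P[b [b' []]]; rewrite !inE => /andP[/andP[bA bC] vb] /andP[/andP[b'A b'C] vb'] nbb.
  apply/eqP; rewrite -leqn0 leqNgt; apply/negP => /nb_gt0[a aA va].
  exact: (nk' a b b').
have leA := nb_le v A; have leB := nb_le v (C :\: A).
case: (leqP 2 (nb v A)) => [hA|hA].
  by left; apply: eqs => //; [have := zeroA hA; lia|apply: zeroA].
right; apply: eqs; first exact: subsetDl.
  have := zeroB; lia.
rewrite setDDr setDv set0U (setIidPr sAC); apply: zeroB; lia.
Qed.

Lemma nbs_card v C : #|nbs v C| = nb v C. Proof. by []. Qed.

End Members.

Section Members6.
Variable G : sgraph.
Implicit Types (x y z u v w : G) (S A B C D : {set G}) (s t : seq G).
Implicit Types (F : {set {set G}}).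

Local Notation adj := (@adj G).

Variables (m : nat) (F : {set {set G}}).
Hypothesis oF : opt m F.

Lemma no_small_path3 C z s : C \in F -> (size s).+1 < #|C| ->
  {subset z :: s <= C :|: rest F} -> sorted adj s -> uniq (z :: s) ->
  2 < count (adj z) s -> False.
Proof.
move=> CF lt sub ps us c3.
have cD : chs [set u in z :: s] by apply: (chs_path3 ps us c3); apply: sub_set_seq.
have := opt_small oF CF cD; rewrite cardsE (card_uniqP us) /= => H.
suff : #|C| <= (size s).+1 by lia.
by apply: H; apply/subsetP => u; rewrite inE => /sub.
Qed.

(** [x1] can be exchanged for [v], because the cycle [v y2 x2 y3 x3 y1] has the chord [v y3]; so
    [x1] has at least three neighbours in [C]. They can only be [y1], [y2], [y3], since an edge to
    [x2] or [x3] would give a chorded cycle on five vertices. *)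
Lemma k6_chord C (v y1 x1 y2 x2 y3 x3 : G) : C \in F -> v \in rest F ->
  cyc C [:: y1; x1; y2; x2; y3; x3] -> adj v y1 -> adj v y2 -> adj v y3 -> adj x1 y3.
Proof.
move=> CF vR cC v1 v2 v3; have C6 : #|C| = 6 := cyc_card cC.
have [us /= /and5P[a1 a2 a3 a4 /and3P[a5 a6 _]] EC] := cC.
have vC := mem_rest_notin CF vR.
have mC u : u \in [:: y1; x1; y2; x2; y3; x3] -> u \in C by apply: cyc_mem cC.
have [m1 n1 m2 n2] : [/\ y1 \in C, x1 \in C, y2 \in C & x2 \in C].
  by split; apply: mC; rewrite !inE eqxx ?orbT.
have [m3 n3] : y3 \in C /\ x3 \in C by split; apply: mC; rewrite !inE eqxx ?orbT.
have uv : uniq [:: v; y1; x1; y2; x2; y3; x3].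
  by rewrite cons_uniq us andbT; apply: contra vC => /mC.
have n12 : ~~ adj x1 x2.
  apply/negP => x12; apply: (@no_small_path3 C y2 [:: v; y1; x1; x2]) => //; rewrite ?C6 //.
  - by apply/allP; rewrite /= (inU_R _ vR) !inU_C.
  - by rewrite /= v1 a1 x12.
  - apply: subseq_uniq (_ : uniq [:: y2; v; y1; x1; x2; y3; x3]).
      exact: (prefix_subseq _ [:: y3; x3]).
    by rewrite (perm_uniq (_ : perm_eq _ [:: v; y1; x1; y2; x2; y3; x3])) //; permt.
  - by rewrite /= (adjC y2 v) v2 (adjC y2 x1) a2 a3; case: (adj y2 y1).
have n13 : ~~ adj x1 x3.
  apply/negP => x13; apply: (@no_small_path3 C y1 [:: v; y2; x1; x3]) => //; rewrite ?C6 //.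
  - by apply/allP; rewrite /= (inU_R _ vR) !inU_C.
  - by rewrite /= v2 (adjC y2) a2 x13.
  - apply: subseq_uniq (_ : uniq [:: y1; v; y2; x1; x3; y3; x2]).
      exact: (prefix_subseq _ [:: y3; x2]).
    by rewrite (perm_uniq (_ : perm_eq _ [:: v; y1; x1; y2; x2; y3; x3])) //; permt.
  - by rewrite /= (adjC y1 v) v1 a1 (adjC y1 x3) a6; case: (adj y1 y2).
have us' : uniq [:: x1; y1; y2; x2; y3; x3].
    by rewrite (perm_uniq (_ : perm_eq _ [:: y1; x1; y2; x2; y3; x3])) //; permt.
have neq u : u \in [:: y1; y2; x2; y3; x3] -> u != x1.
    by move=> uI; apply: contraTneq us' => <-; rewrite cons_uniq uI.
have cs : chs (sw C x1 v).
  apply: (@chs_mk _ _ v [:: y2; x2] y3 [:: x3; y1]) => //.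
  - have uv' : uniq [:: v; y2; x2; y3; x3; y1; x1].
      by rewrite (perm_uniq (_ : perm_eq _ [:: v; y1; x1; y2; x2; y3; x3])) //; permt.
    exact: subseq_uniq (prefix_subseq [:: v; y2; x2; y3; x3; y1] [:: x1]) uv'.
  - by rewrite /= v2 a3 a4 a5 a6 (adjC y1) v1.
  - apply/allP; rewrite /= !in_setU1 !in_setD1 eqxx m1 m2 m3 n2 n3 /= !andbT.
    by rewrite !neq ?orbT // ?(in_cons, eqxx, orbT).
have [le _] := swap oF CF n1 vR cs.
have : 2 < nb v (C :\ x1).
  have /count_le_nb : uniq [:: y1; y2; y3].
    have us3 : uniq [:: y1; y2; y3; x1; x2; x3].
      by rewrite (perm_uniq (_ : perm_eq _ [:: y1; x1; y2; x2; y3; x3])) //; permt.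
    exact: subseq_uniq (prefix_subseq [:: y1; y2; y3] [:: x1; x2; x3]) us3.
  move=> /(_ v (C :\ x1)); rewrite /= v1 v2 v3; apply.
  by apply/allP; rewrite /= !in_setD1 m1 m2 m3 !neq // !inE eqxx ?orbT.
move=> lt; have := leq_trans lt le; rewrite (nb_cyc x1 cC) /= adj_irr (negPf n12) (negPf n13).
by case: (adj x1 y3) => //; case: (adj x1 y1); case: (adj x1 y2).
Qed.

(** On six vertices the neighbours of [v] alternate with the others, and [k6_chord] for the three
    rotations supplies the long diagonals of the hexagon. *)
Lemma card6_k33 C v : C \in F -> v \in rest F -> #|C| = 6 -> 2 < nb v C ->
  k33 C (nbs v C).
Proof.
move=> CF vR C6 c3; have n3 : nb v C = 3.
  apply/eqP; rewrite eqn_leq c3 andbT leqNgt; apply/negP => c4.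
  by have [] := nb4_card oF CF vR c4; rewrite C6.
have [y1 [s1 [y2 [s2 [y3 [s3 [cC [/and3P[v1 v2 v3] z1 z2 l]]]]]]]] := nb3_form oF CF vR c3.
have := cyc_card cC; rewrite C6 /= !size_cat /= !size_cat /=.
case: s1 z1 l cC => [|x1 [|? ?]] z1; case: s2 z2 => [|x2 [|? ?]] z2;
  case: s3 => [|x3 [|? ?]] //= _ cC _.
have cC1 := @cyc_rot G C [:: y1; x1] [:: y2; x2; y3; x3] cC.
have cC2 := @cyc_rot G C [:: y1; x1; y2; x2] [:: y3; x3] cC.
have k1 := k6_chord CF vR cC v1 v2 v3; have k2 := k6_chord CF vR cC1 v2 v3 v1.
have k3 := k6_chord CF vR cC2 v3 v1 v2.
have [us /= /and5P[a1 a2 a3 a4 /and3P[a5 a6 _]] EC] := cC.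
have vx : [/\ ~~ adj v x1, ~~ adj v x2 & ~~ adj v x3].
  move: n3; rewrite (nb_cyc v cC) /= v1 v2 v3.
  by case: (adj v x1); case: (adj v x2); case: (adj v x3).
case: vx => vx1 vx2 vx3; split=> //.
- by apply/subsetP => u; rewrite inE => /andP[].
- move=> a b; rewrite !inE => /andP[aC va] bC; rewrite bC /= => nvb.
  move: aC bC va nvb; rewrite EC !inE.
  do 2 (case/or4P=> [/eqP->|/eqP->|/eqP->|/or3P[]/eqP->]);
    rewrite ?v1 ?v2 ?v3 ?(negPf vx1) ?(negPf vx2) ?(negPf vx3) // => _ _; adjt.
Qed.

End Members6.

(** * Counting edges to the members, and exchanging one vertex of a member *)

Section Principle.
Variable G : sgraph.
Implicit Types (x y z u v w : G) (S A B C D : {set G}) (s t : seq G).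
Implicit Types (F : {set {set G}}).

Local Notation adj := (@adj G).

Variables (m : nat) (F : {set {set G}}).
Hypothesis oF : opt m F.

Definition load v := \sum_(C in F) nb v C.

Lemma degree_load v : degree v = nb v (rest F) + load v.
Proof. by rewrite (degree_nb v (cover F)) addnC (nb_cover _ (opt_triv oF)). Qed.

Lemma ore_load x y : x != y -> ~~ adj x y ->
  6 * m + 4 <= nb x (rest F) + nb y (rest F) + (load x + load y).
Proof. by move=> nxy axy; have := opt_ore oF nxy axy; rewrite !degree_load; lia. Qed.

Lemma sumF_le (f : {set G} -> nat) c : (forall C, C \in F -> f C <= c) ->
  \sum_(C in F) f C <= c * m.
Proof.
move=> le; have : \sum_(C in F) f C <= \sum_(C in F) c by apply: leq_sum.
by rewrite sum_nat_const (opt_card oF) mulnC.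
Qed.

Lemma sumF_lt (f : {set G} -> nat) c d C0 : (forall C, C \in F -> f C <= c) ->
  C0 \in F -> f C0 + d <= c -> \sum_(C in F) f C + d <= c * m.
Proof.
move=> le C0F lt; rewrite (big_setD1 C0) //=.
have : \sum_(C in F :\ C0) f C <= \sum_(C in F :\ C0) c.
  by apply: leq_sum => C /setD1P[_ /le].
have := cardsD1 C0 F; rewrite C0F (opt_card oF) sum_nat_const => ->.
by move: (\sum_(C in F :\ C0) f C) #|F :\ C0| (f C0) lt => s n f0; clear; nia.
Qed.

Lemma sumF_eq (f : {set G} -> nat) c : (forall C, C \in F -> f C <= c) ->
  c * m <= \sum_(C in F) f C -> forall C, C \in F -> f C = c.
Proof.
move=> le ge C CF; apply/eqP; rewrite eqn_leq le //= leqNgt; apply/negP => lt.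
have := sumF_lt (d := 1) le CF; rewrite addn1 => /(_ lt); move: ge; clear; lia.
Qed.

Lemma rest_nochs : chs (rest F) -> False.
Proof.
move=> cR; have [|p _] := packing_replace (opt_pack oF) (sub0set F) (packing1 cR).
  by rewrite cover_set1 subsetUr.
by rewrite cards0 cards1 addn0 (opt_card oF) addn1; apply: (opt_max oF p).
Qed.

Lemma end_nb x t : sorted adj (x :: t) -> uniq (x :: t) -> {subset x :: t <= rest F} ->
  (forall u, u \in rest F -> adj x u -> u \in t) -> nb x (rest F) <= 2.
Proof.
move=> pt ut sR sx; rewrite leqNgt; apply/negP => lt; apply: rest_nochs.
apply: chsS (path_end_nb pt ut _); first by apply/subsetP => u; rewrite inE; apply: sR.
exact: leq_trans lt (nb_le_count sx).
Qed.

Lemma path3_rest z t : sorted adj t -> uniq (z :: t) -> {subset z :: t <= rest F} ->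
  count (adj z) t <= 2.
Proof.
move=> pt ut sR; rewrite leqNgt; apply/negP => lt; apply: rest_nochs.
exact: chs_path3 pt ut lt sR.
Qed.

(** Two neighbours [p], [q] of [v] and a further vertex [r] of [C :\ z] form with [v] a K_4 minus an
    edge, whose chord is [p q]. *)
Lemma cl4_sw C z v : C \in F -> cl4 C -> z \in C -> v \in rest F -> 1 < nb v (C :\ z) ->
  chs (sw C z v).
Proof.
move=> CF [C4 cl] zC vR /card_gt1P[p [q []]].
rewrite !inE => /andP[/andP[pz pC] vp] /andP[/andP[qz qC] vq] npq.
have vC := mem_rest_notin CF vR.
have [r rC] : exists2 r, r \in C :\ z & (r != p) && (r != q).
  have : 0 < #|C :\ z :\ p :\ q|.
    have := cardsD1 z C; have := cardsD1 p (C :\ z); have := cardsD1 q (C :\ z :\ p).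
    by rewrite !inE zC pC pz qC qz eq_sym npq C4 /=; clear; lia.
  by rewrite card_gt0 => /set0Pn[r]; rewrite !inE => /and4P[? ? ? ?]; exists r; rewrite ?inE; apply/andP.
case/setD1P: rC => rz rC /andP[rp rq].
have nrv : r != v by apply: contraNneq vC => <-.
apply: (@chs_k4m _ _ p r q v) => //; try (by apply: cl => //; rewrite eq_sym); try by apply: cl.
- by rewrite adjC.
- by apply/allP; rewrite /= !in_setU1 !in_setD1 pz pC rz rC qz qC eqxx !orbT.
Qed.

(** The working form of [win1]: [z] and [v] change places, and the uncovered part with [z] instead
    of [v] holds the second chorded cycle. *)
Lemma win_sw C z v : C \in F -> z \in C -> v \in rest F -> chs (sw C z v) ->
  chs (z |: (rest F :\ v)) -> False.
Proof.
move=> CF zC vR c1 c2; have vC := mem_rest_notin CF vR; apply: (win1 oF CF c1 c2).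
- apply: disjoint_mem => u; rewrite !in_setU1 !in_setD1 => /orP[/eqP->|/andP[/negPf-> uC]] /=.
    by rewrite eqxx /= orbF => /eqP vz; rewrite vz zC in vC.
  by case/andP=> _ uR; rewrite (negPf (mem_rest_notin CF uR)) in uC.
- exact: sw_sub.
- apply/subsetP => u; rewrite in_setU1 in_setD1 => /orP[/eqP->|/andP[_ uR]]; first exact: inU_C.
  exact: inU_R.
Qed.

(* Otherwise [z] and the path contain a second chorded cycle disjoint from [sw C z v]. *)
Lemma sw_path C z v t : C \in F -> z \in C -> v \in rest F -> chs (sw C z v) ->
  sorted adj t -> uniq t -> {subset t <= rest F :\ v} -> count (adj z) t <= 2.
Proof.
move=> CF zC vR cs pt ut st; rewrite leqNgt; apply/negP => lt.
apply: (win_sw CF zC vR cs); apply: (chs_path3 pt _ lt).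
  rewrite cons_uniq ut andbT; apply/negP => /st /setD1P[_ zR].
  by rewrite (negPf (mem_rest_notin CF zR)) in zC.
move=> u; rewrite in_cons in_setU1 => /orP[-> //|/st ->]; exact: orbT.
Qed.

Lemma cl4_nb_sw C z v : C \in F -> cl4 C -> z \in C -> v \in rest F -> 2 < nb v C ->
  chs (sw C z v).
Proof.
move=> CF cl zC vR lt; apply: cl4_sw => //.
by move: lt; rewrite (nbD1 v zC); case: (adj v z) => /=; clear; lia.
Qed.

(** [v] can replace any [z] in [C], so [sw_path] allows each of the four vertices at most two
    neighbours on the path. *)
Lemma cl4_path C v t us : C \in F -> cl4 C -> v \in rest F -> 2 < nb v C ->
  sorted adj t -> uniq t -> {subset t <= rest F :\ v} -> uniq us -> {subset us <= t} ->
  \sum_(u <- us) nb u C <= 8.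
Proof.
move=> CF cl vR lt pt ut st uus sus; rewrite nb_double_seq.
have -> : 8 = \sum_(z in C) 2 by rewrite sum_nat_const cl.1.
apply: leq_sum => z zC; apply: leq_trans (sw_path CF zC vR (cl4_nb_sw CF cl zC vR lt) pt ut st).
rewrite -!size_filter; apply: uniq_leq_size; first exact: filter_uniq.
by move=> u; rewrite !mem_filter => /andP[-> /sus].
Qed.

Lemma dia_perm C a b c d : dia C a b c d -> dia C b a c d.
Proof.
move=> [-> [us ab ac ad [bc [bd ncd]]]]; split; last first.
  split=> //; try adjt.
  by rewrite (perm_uniq (_ : perm_eq _ [:: a; b; c; d])) //; permt.
by apply/setP => u; rewrite !inE orbCA.
Qed.

Lemma dia_swap C a b c d : dia C a b c d -> dia C a b d c.
Proof.
move=> [-> [us ab ac ad [bc [bd ncd]]]]; split; last first.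
  split=> //; last by do 2 split=> //; rewrite adjC.
  by rewrite (perm_uniq (_ : perm_eq _ [:: a; b; c; d])) //; permt.
by apply/setP => u; rewrite !inE [(u == d) || _]orbC.
Qed.

Lemma dia_mem C a b c d : dia C a b c d -> [/\ a \in C, b \in C, c \in C & d \in C].
Proof. by move=> [-> _]; split; rewrite !inE eqxx ?orbT. Qed.

Lemma dia_nbE v C a b c d : dia C a b c d -> nb v C = adj v a + adj v b + adj v c + adj v d.
Proof. by move=> [-> [us _ _ _ _]]; rewrite nb_seq //= addn0 !addnA. Qed.

(** The triangle [a b c] and a vertex adjacent to two of its corners form a K_4 minus an edge. *)
Lemma dia_sw C a b c d v : C \in F -> dia C a b c d -> v \in rest F ->
  1 < adj v a + adj v b + adj v c -> chs (sw C d v).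
Proof.
move=> CF dC vR; have vC := mem_rest_notin CF vR.
have [aC bC cC dC'] := dia_mem dC; case: dC => EC [us ab ac ad [bc [bd ncd]]].
have [nad nbd ncd'] : [/\ a != d, b != d & c != d].
  by move: us; rewrite /= !inE !negb_or => /and4P[/and3P[_ _ ->] /andP[_ ->] -> _].
have neq u : u \in C -> u != v by move=> uC; apply: contraNneq vC => <-.
have [mv ma mb mc] : [/\ v \in sw C d v, a \in sw C d v, b \in sw C d v & c \in sw C d v].
  by split; rewrite in_setU1 in_setD1 ?eqxx ?aC ?bC ?cC ?nad ?nbd ?ncd' ?orbT.
case va: (adj v a); case vb: (adj v b); case vc: (adj v c) => // _.
- by apply: (@chs_k4m _ _ a c b v) => //; try adjt; [exact: neq|apply/allP; rewrite /= mv ma mb mc].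
- by apply: (@chs_k4m _ _ a c b v) => //; try adjt; [exact: neq|apply/allP; rewrite /= mv ma mb mc].
- by apply: (@chs_k4m _ _ a b c v) => //; try adjt; [exact: neq|apply/allP; rewrite /= mv ma mb mc].
- by apply: (@chs_k4m _ _ b a c v) => //; try adjt; [exact: neq|apply/allP; rewrite /= mv ma mb mc].
Qed.

(** If [v] missed an end of the non-edge [c d], that end, with two neighbours in [C], could be
    exchanged for [v] with a gain. If [v] saw all of [C], then [nb4_cl4] would make [c d] an
    edge. *)
Lemma dia_nb3 C a b c d v : C \in F -> dia C a b c d -> v \in rest F -> 2 < nb v C ->
  [/\ adj v c, adj v d & adj v a + adj v b = 1].
Proof.
move=> CF dC vR lt; have E := dia_nbE v dC.
have key c' d' : dia C a b c' d' -> nb v C = adj v a + adj v b + adj v c' + adj v d' -> adj v d'.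
  move=> dC' E'; apply/idPn => nvd; have [aC bC cC dC0] := dia_mem dC'.
  have h : adj v a + adj v b + adj v c' = 3.
    by move: lt; rewrite E' (negPf nvd); case: (adj v a); case: (adj v b); case: (adj v c').
  have cs : chs (sw C d' v) by apply: (dia_sw CF dC' vR); rewrite h.
  have [le _] := swap oF CF dC0 vR cs.
  have : 2 < nb v (C :\ d') by move: lt; rewrite (nbD1 v dC0) (negPf nvd).
  move=> lt2; have := leq_trans lt2 le; rewrite (dia_nbE d' dC') adj_irr.
  case: dC' => _ [_ _ _ _ [_ [_ ncd]]]; rewrite (adjC d' c') (negPf ncd).
  by case: (adj d' a); case: (adj d' b).
have vd := key c d dC E; have vc : adj v c by apply: (key d c (dia_swap dC)); rewrite E addnAC.
split=> //; move: lt; rewrite E vc vd; case va: (adj v a); case vb: (adj v b) => // _.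
have [_ cl] : cl4 C by apply: (nb4_cl4 oF CF vR); rewrite E va vb vc vd.
have [_ _ cC dC'] := dia_mem dC; case: dC => _ [us _ _ _ [_ [_ /negP[]]]].
by apply: cl => //; move: us; rewrite /= !inE !negb_or => /and4P[_ _ -> _].
Qed.

(** The second vertex [u] serves to exclude members on five vertices by [card5_pair]. *)
Lemma member_type C u v : C \in F -> u \in rest F -> v \in rest F -> u != v ->
  2 < nb u C -> 2 < nb v C ->
  [\/ cl4 C, exists a b c d, dia C a b c d | k33 C (nbs v C)].
Proof.
move=> CF uR vR nuv cu cv; have := nb3_card oF CF vR cv.
case: (eqVneq #|C| 4) => [C4 _|n4].
  by case: (card4_form oF CF C4) => ?; [constructor 1|constructor 2].
case: (eqVneq #|C| 5) => [C5|n5 le]; first by have := card5_pair oF CF uR vR nuv C5 cu cv.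
by constructor 3; apply: (card6_k33 oF) => //; move: n4 n5 le; clear; lia.
Qed.

End Principle.

(** * Spanning paths with a pendant end *)

Section Pendant.
Variable G : sgraph.
Implicit Types (u v w x y z : G) (S A B C D : {set G}) (s t : seq G).
Implicit Types (F : {set {set G}}).

Local Notation adj := (@adj G).

Variables (m : nat) (F : {set {set G}}).
Hypothesis oF : opt m F.

Local Notation R := (rest F).
Local Notation load := (load F).

Definition ham P := [/\ sorted adj P, uniq P & P =i R].

Lemma loads_sum us : \sum_(u <- us) load u = \sum_(C in F) \sum_(u <- us) nb u C.
Proof. by rewrite /load exchange_big. Qed.

Lemma loads_le us c : (forall C, C \in F -> \sum_(u <- us) nb u C <= c) ->
  \sum_(u <- us) load u <= c * m.
Proof. by move=> H; rewrite loads_sum; apply: (sumF_le oF). Qed.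

Lemma loads_eq us c : (forall C, C \in F -> \sum_(u <- us) nb u C <= c) ->
  c * m <= \sum_(u <- us) load u -> forall C, C \in F -> \sum_(u <- us) nb u C = c.
Proof. by move=> H; rewrite loads_sum; apply: (sumF_eq oF). Qed.

Lemma loads_lt us c d C0 : (forall C, C \in F -> \sum_(u <- us) nb u C <= c) ->
  C0 \in F -> \sum_(u <- us) nb u C0 + d <= c -> \sum_(u <- us) load u + d <= c * m.
Proof. by move=> H; rewrite loads_sum; apply: (sumF_lt oF). Qed.

Lemma sum_nb_le us c C : (forall u, u \in us -> nb u C <= c) ->
  \sum_(u <- us) nb u C <= c * size us.
Proof.
elim: us => [|u us IHus] H; first by rewrite big_nil.
rewrite big_cons /= mulnS leq_add ?H ?mem_head //.
by apply: IHus => v vus; apply: H; rewrite in_cons vus orbT.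
Qed.

Lemma ham_rev P : ham P -> ham (rev P).
Proof.
case=> pP uP eP; split; last by move=> u; rewrite mem_rev.
  by rewrite rev_sorted (eq_sorted (e' := adj)) // => u v; rewrite adjC.
by rewrite rev_uniq.
Qed.

Lemma ham_nb P v : ham P -> nb v R = count (adj v) P.
Proof.
case=> _ uP eP; rewrite -(nb_seq v uP); congr (nb _ _).
by apply/setP => u; rewrite inE eP.
Qed.

Lemma ham_split P s1 v s2 : ham P -> P = s1 ++ v :: s2 ->
  count (adj v) s1 <= 2 /\ count (adj v) s2 <= 2.
Proof.
case=> pP uP eP E; rewrite E in pP uP eP.
have [p1 /path_sorted p2] := cat_sorted2 pP.
move: (uP); rewrite -cat_rcons cat_uniq rcons_uniq => /and3P[/andP[v1 u1] h u2].
have v2 : v \notin s2 by move: h; apply: contra => v2; apply/hasP; exists v => //; rewrite mem_rcons mem_head.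
have sub s : {subset s <= s1 ++ v :: s2} -> {subset s <= R} by move=> sub u /sub; rewrite eP.
split; apply: (path3_rest oF) => //; rewrite ?cons_uniq ?v1 ?v2 //; apply: sub => u.
  by rewrite in_cons mem_cat in_cons => /orP[->|->]; rewrite ?orbT.
by rewrite in_cons mem_cat in_cons => ->; rewrite orbT.
Qed.

Lemma nb_ge2 v (a b : G) S : a \in S -> b \in S -> a != b -> adj v a -> adj v b -> 1 < nb v S.
Proof.
move=> aS bS nab va vb; apply/card_gt1P; exists a, b; split=> //; rewrite inE.
  by rewrite aS.
by rewrite bS.
Qed.

(* By [dichotomy] only the copies of [K_4] have to be checked. *)
Lemma loads_le_cl4 us : {subset us <= R} ->
  (forall C, C \in F -> cl4 C -> \sum_(u <- us) nb u C <= 3 * size us) ->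
  \sum_(u <- us) load u <= 3 * size us * m.
Proof.
move=> sR H; apply: loads_le => C CF; case: (dichotomy oF CF) => [cl|le3]; first exact: H.
by apply: sum_nb_le => u /sR; apply: le3.
Qed.

(** With [x] counted twice, the degree conditions for [x y] and [x y'] ask for [12 * m + 2] edges to
    the members. A K_4 receives at most 12: if [x] has three neighbours in it, then [x] can replace
    any [z], and a [z] that sees both [y] and [y'] would form a chorded cycle with the triangle
    [v y y']. *)
Lemma pendant_triangle x y y' v : x \in R -> y \in R -> y' \in R -> v \in R ->
  x != y -> x != y' -> x != v -> nb x R <= 1 -> nb y R <= 2 -> nb y' R <= 2 ->
  ~~ adj x y -> ~~ adj x y' -> adj y y' -> adj v y -> adj v y' -> False.
Proof.
move=> xR yR y'R vR nxy nxy' nxv dx dy dy' axy axy' yy' vy vy'.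
have := ore_load oF nxy axy; have := ore_load oF nxy' axy'.
have : \sum_(u <- [:: x; x; y; y']) load u <= 3 * 4 * m.
  apply: (loads_le_cl4 (us := [:: x; x; y; y'])).
    by apply/allP; rewrite /= xR yR y'R.
  move=> C CF cl; rewrite !big_cons big_nil /=.
  have := nb_le4 oF CF xR; have := nb_le4 oF CF yR; have := nb_le4 oF CF y'R.
  case: (leqP (nb x C) 2) => [|lt]; first by clear; lia.
  have : \sum_(u <- [:: y; y']) nb u C <= 4.
    rewrite nb_double_seq; have -> : 4 = \sum_(z in C) 1 by rewrite sum_nat_const cl.1.
    apply: leq_sum => z zC /=; case zy: (adj z y); case zy': (adj z y') => //.
    case: (win_sw oF CF zC xR (cl4_nb_sw CF cl zC xR lt)).
    have nzv : z != v by apply: contraTneq zC => ->; apply: mem_rest_notin vR.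
    apply: (@chs_k4m _ _ y z y' v) => //; try adjt.
    by apply/allP; rewrite /= !in_setU1 !in_setD1 yR y'R vR ![_ == x]eq_sym nxy nxy' nxv eqxx !orbT.
  by rewrite !big_cons big_nil; clear; lia.
rewrite !big_cons big_nil; move: (load x) (load y) (load y') dx dy dy'.
by move: (nb x R) (nb y R) (nb y' R); clear; lia.
Qed.

Lemma subset_behead x t : ham (x :: t) -> {subset t <= R :\ x}.
Proof.
case=> _ /= /andP[xt _] e u ut; rewrite in_setD1 -e in_cons ut orbT andbT.
by apply: contraNneq xt => <-.
Qed.

Lemma ham_cl4 x t us C : ham (x :: t) -> C \in F -> cl4 C -> 2 < nb x C -> uniq us ->
  {subset us <= t} -> \sum_(u <- us) nb u C <= 8.
Proof.
move=> h CF cl lt uus sus; have [p u e] := h.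
apply: (cl4_path oF CF cl _ lt (path_sorted p) _ (subset_behead h) uus sus).
  by rewrite -e mem_head.
by case/andP: u.
Qed.

(** The weights are four for [x] and one for each of [v3], [w], [y'], [y]. These four have at most
    11 uncovered neighbours in all and [x] has at most one, so the four degree conditions ask for
    [24 * m + 1] edges. A K_4 receives at most 24, as [4 * 2 + 4 * 4] or as [4 * 4 + 8]. *)
Lemma ham_long_pendant x v2 v3 s (w y' y : G) :
  ham (x :: v2 :: v3 :: s ++ [:: w; y'; y]) -> nb x R <= 1 -> False.
Proof.
set P := x :: _ => hP dx; have [pP uP eP] := hP.
have mP u : u \in P -> u \in R by rewrite eP.
have xv2 : adj x v2 by case/andP: pP.
have ms : [/\ v3 \in P, w \in P, y' \in P & y \in P].
  by split; rewrite !(in_cons, mem_cat) eqxx ?orbT.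
case: ms => m3 mw my' my; have mv2 : v2 \in P by rewrite !in_cons eqxx orbT.
have uU : uniq [:: x; v2; v3; w; y'; y].
  apply: subseq_uniq uP; rewrite /P /= !eqxx; exact: suffix_subseq.
have nadj u : u \in [:: v3; w; y'; y] -> (x != u) && ~~ adj x u.
  move=> uU'; have uP' : u \in P by move: uU'; rewrite !inE => /or4P[]/eqP->.
  have [nxu nv2u] : x != u /\ v2 != u.
    move: uU; rewrite !cons_uniq => /and3P[]; rewrite in_cons negb_or => /andP[_ h1] h2 _.
    by split; [apply: contraNneq h1 => ->|apply: contraNneq h2 => ->].
  rewrite nxu /=; apply/negP => xu; move: dx; rewrite leqNgt => /negP[].
  by apply: (nb_ge2 (mP _ mv2) (mP _ uP')).
have ore u : u \in [:: v3; w; y'; y] -> 6 * m + 3 <= nb u R + (load x + load u).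
  by move/nadj => /andP[n a]; have := ore_load oF n a; move: dx; clear; lia.
have d3 : nb v3 R <= 3.
  have [_ h] := @ham_split P [:: x; v2] v3 _ hP erefl.
  have /andP[_ x3] : (x != v3) && ~~ adj x v3 by apply: nadj; rewrite !inE eqxx.
  by rewrite (ham_nb _ hP) /= adj_irr (adjC v3 x) (negPf x3); case: (adj v3 v2); move: h; clear; lia.
have EP : P = (x :: v2 :: v3 :: s ++ [:: w; y']) ++ [:: y].
  by rewrite /P /= -catA.
have EP' : P = (x :: v2 :: v3 :: s ++ [:: w]) ++ [:: y'; y].
  by rewrite /P /= -catA.
have EPw : P = (x :: v2 :: v3 :: s) ++ [:: w; y'; y] by [].
have dy : nb y R <= 2.
  have [h _] := ham_split hP EP.
  by rewrite (ham_nb _ hP) EP count_cat [count _ [:: y]]/= adj_irr; move: h; clear; lia.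
(* If [w y] is an edge, interchanging the last two vertices makes [y'] the end of a Hamiltonian path
   and bounds its neighbours by two. Otherwise [w] and [y'] have at most three each. *)
have dw : nb w R + nb y' R <= 6.
  have [hw _] := ham_split hP EPw; have [hy' _] := ham_split hP EP'.
  rewrite [nb w _](ham_nb _ hP) EPw count_cat [count _ [:: w; y'; y]]/= adj_irr.
  case wy: (adj w y); last first.
    rewrite [nb y' _](ham_nb _ hP) EP' count_cat [count _ [:: y'; y]]/= adj_irr.
    by move: hw hy'; case: (adj w y'); case: (adj y' y); clear; lia.
  have : nb y' R <= 2; last by move: hw; case: (adj w y'); clear; lia.
  have y'y : adj y' y by move: pP; rewrite EP' => /cat_sorted2[_] /= /andP[].
  have hP' : ham ((x :: v2 :: v3 :: s ++ [:: w; y]) ++ [:: y']).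
    have pm : perm_eq ((x :: v2 :: v3 :: s ++ [:: w; y]) ++ [:: y']) P by rewrite /P; permt.
    split; [|by rewrite (perm_uniq pm)|by move=> u; rewrite (perm_mem pm)].
    move: pP; rewrite EPw /= -catA !cat_path /= => /and3P[-> -> /andP[-> /andP[-> _]]] /=.
    by rewrite wy (adjC y) y'y.
  have [h _] := ham_split hP' erefl.
  by rewrite (ham_nb _ hP') count_cat [count _ [:: y']]/= adj_irr; move: h; clear; lia.
have : \sum_(u <- [:: x; x; x; x; v3; w; y'; y]) load u <= 3 * 8 * m.
  apply: (loads_le_cl4 (us := [:: x; x; x; x; v3; w; y'; y])).
    by apply/allP; rewrite /= (mP x) ?mem_head // !mP.
  move=> C CF cl; have le4 u : u \in P -> nb u C <= 4 by move/mP; apply: (nb_le4 oF CF).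
  have := le4 x (mem_head _ _); have := le4 _ m3; have := le4 _ mw.
  have := le4 _ my'; have := le4 _ my.
  case: (leqP (nb x C) 2) => [|lt]; first by rewrite !big_cons big_nil /=; clear; lia.
  have := @ham_cl4 _ _ [:: v3; w; y'; y] _ hP CF cl lt.
  rewrite !big_cons big_nil /= => H; suff : nb v3 C + (nb w C + (nb y' C + (nb y C + 0))) <= 8 by clear; lia.
  apply: H; first by move: uU => /= /and3P[_ _ ->].
  by apply/allP; rewrite /= !(in_cons, mem_cat) !eqxx !orbT.
rewrite !big_cons big_nil /=.
have := ore v3; have := ore w; have := ore y'; have := ore y.
rewrite !inE !eqxx !orbT => /(_ isT) o1 /(_ isT) o2 /(_ isT) o3 /(_ isT) o4.
by move: o1 o2 o3 o4 d3 dy dw; clear; lia.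
Qed.

End Pendant.

Section PendantSmall.
Variable G : sgraph.
Implicit Types (u v w x y z : G) (S A B C D : {set G}) (s t : seq G).
Implicit Types (F : {set {set G}}).

Local Notation adj := (@adj G).

Variables (m : nat) (F : {set {set G}}).
Hypothesis oF : opt m F.

Local Notation R := (rest F).
Local Notation load := (load F).
Local Notation ham := (ham F).

Lemma ham_cl4_rev y t us C : ham (rcons t y) -> C \in F -> cl4 C -> 2 < nb y C -> uniq us ->
  {subset us <= t} -> \sum_(u <- us) nb u C <= 8.
Proof.
move=> /ham_rev; rewrite rev_rcons => h CF cl lt uus sus.
by apply: (ham_cl4 oF h) => // u /sus; rewrite mem_rev.
Qed.

Lemma ham_last_nb P s y : ham P -> P = rcons s y -> nb y R <= 2.
Proof.
move=> hP E; have [h _] := @ham_split _ _ _ oF P s y [::] hP (etrans E (esym (cats1 s y))).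
by rewrite (ham_nb _ hP) E -cats1 count_cat [count _ [:: y]]/= adj_irr; move: h; clear; lia.
Qed.

Lemma ham_head_nb x t : ham (x :: t) -> nb x R <= 2.
Proof. by move=> h; apply: (ham_last_nb (ham_rev h) (rev_cons _ _)). Qed.

(** The four vertices have at most six uncovered neighbours in all, so the pairs [x v] and [v2 y]
    send [12 * m + 2] edges to the members. A K_4 receives at most 2 + 2 + 4 + 4 or 4 + 8. *)
Lemma pathlike_false x v2 s v y : ham (x :: v2 :: s ++ [:: v; y]) ->
  nb x R <= 1 -> nb y R <= 1 -> nb v2 R <= 2 -> nb v R <= 2 ->
  ~~ adj x v -> ~~ adj v2 y -> False.
Proof.
set P := x :: _ => hP dx dy d2 dv axv a2y; have [pP uP eP] := hP.
have mP u : u \in P -> u \in R by rewrite eP.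
have [m2 mv my] : [/\ v2 \in P, v \in P & y \in P].
  by split; rewrite !(in_cons, mem_cat) eqxx ?orbT.
have uU : uniq [:: x; v2; v; y].
  apply: subseq_uniq uP; rewrite /P /= !eqxx; exact: suffix_subseq.
have [nxv n2y] : x != v /\ v2 != y.
  by move: uU; rewrite /= !inE !negb_or => /and4P[/and3P[_ -> _] /andP[_ ->]].
have o1 := ore_load oF nxv axv; have o2 := ore_load oF n2y a2y.
have : \sum_(u <- [:: x; v2; v; y]) load u <= 3 * 4 * m.
  apply: (loads_le_cl4 oF (us := [:: x; v2; v; y])).
    by apply/allP; rewrite /= (mP x) ?mem_head // !mP.
  move=> C CF cl; have le4 u : u \in P -> nb u C <= 4 by move/mP; apply: (nb_le4 oF CF).
  have := le4 x (mem_head _ _); have := le4 _ m2; have := le4 _ mv; have := le4 _ my.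
  case: (leqP (nb x C) 2) => [|lt]; last first.
    have := @ham_cl4 _ _ _ oF _ _ [:: v2; v; y] _ hP CF cl lt.
    rewrite !big_cons big_nil /= => H; suff : nb v2 C + (nb v C + (nb y C + 0)) <= 8 by clear; lia.
    apply: H; first by case/andP: uU.
    by apply/allP; rewrite /= !(in_cons, mem_cat) !eqxx !orbT.
  case: (leqP (nb y C) 2) => [|lt]; first by rewrite !big_cons big_nil /=; clear; lia.
  have := @ham_cl4_rev y (x :: v2 :: s ++ [:: v]) [:: x; v2; v] C.
  rewrite -cats1 /= -catA => H _; have := H hP CF cl lt.
  rewrite !big_cons big_nil /= => {}H; suff : nb x C + (nb v2 C + (nb v C + 0)) <= 8 by clear; lia.
  apply: H; last by apply/allP; rewrite /= !(in_cons, mem_cat) !eqxx !orbT.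
  exact: subseq_uniq (prefix_subseq [:: x; v2; v] [:: y]) uU.
by rewrite !big_cons big_nil; move: o1 o2 dx dy d2 dv; clear; lia.
Qed.

Lemma pendant_nadj x v t : ham (x :: v :: t) -> nb x R <= 1 -> forall u, u \in t -> ~~ adj x u.
Proof.
move=> [pP uP eP] dx u ut; have xv : adj x v by case/andP: pP.
apply/negP => xu; move: dx; rewrite leqNgt => /negP[]; apply: (@nb_ge2 _ x v u) => //.
- by rewrite -eP !in_cons eqxx orbT.
- by rewrite -eP !in_cons ut !orbT.
- by move: uP => /= /and3P[_ h _]; apply: contraNneq h => ->.
Qed.

Lemma pendant4 x v2 v3 y : ham [:: x; v2; v3; y] -> nb x R <= 1 -> False.
Proof.
move=> hP dx; have [pP uP eP] := hP; have nx := pendant_nadj hP dx.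
have /andP[nx3 nxy] : ~~ adj x v3 && ~~ adj x y by rewrite !nx ?inE ?eqxx ?orbT.
have /= /and4P[x2 a23 a3y _] := pP.
have dy := ham_last_nb hP (s := [:: x; v2; v3]) erefl.
case a2y: (adj v2 y).
  have [mx m2 m3 my] : [/\ x \in R, v2 \in R, v3 \in R & y \in R].
    by split; rewrite -eP !inE eqxx ?orbT.
  have d3 : nb v3 R <= 2 by rewrite (ham_nb _ hP) /= adj_irr (adjC v3 x) (negPf nx3); case: (adj v3 v2); case: (adj v3 y).
  move: uP; rewrite /= !inE !negb_or => /and4P[/and3P[n2 n3 ny] _ _ _].
  by apply: (@pendant_triangle _ _ _ oF x y v3 v2) => //; adjt.
apply: (@pathlike_false x v2 [::] v3 y hP) => //; rewrite ?a2y // (ham_nb _ hP) /= adj_irr.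
- by rewrite (adjC y x) (negPf nxy) (adjC y v2) a2y; case: (adj y v3).
- by rewrite a2y; case: (adj v2 x); case: (adj v2 v3).
- by rewrite (adjC v3 x) (negPf nx3); case: (adj v3 v2); case: (adj v3 y).
Qed.

Lemma pendant5 x v2 v3 v4 y : ham [:: x; v2; v3; v4; y] -> nb x R <= 1 -> False.
Proof.
move=> hP dx; have [pP uP eP] := hP; have nx := pendant_nadj hP dx.
have /and3P[nx3 nx4 nxy] : [&& ~~ adj x v3, ~~ adj x v4 & ~~ adj x y].
  by rewrite !nx ?inE ?eqxx ?orbT.
have /= /and5P[x2 a23 a34 a4y _] := pP.
have dy := ham_last_nb hP (s := [:: x; v2; v3; v4]) erefl.
have [mx m2 m3 m4] : [/\ x \in R, v2 \in R, v3 \in R & v4 \in R].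
  by split; rewrite -eP !inE eqxx ?orbT.
have my : y \in R by rewrite -eP !inE eqxx ?orbT.
have mP u : u \in [:: x; v2; v3; v4; y] -> u \in R by rewrite eP.
have us := uP; move: us; rewrite /= !inE !negb_or.
case/and5P=> /and4P[n2 n3 n4 ny] /and3P[n23 n24 n2y] /andP[n34 n3y] n4y _.
have [_ s2] := @ham_split _ _ _ oF _ [:: x] v2 _ hP erefl.
have [s4 _] := @ham_split _ _ _ oF _ [:: x; v2; v3; v4] y _ hP erefl.
have le4 C u : C \in F -> u \in R -> nb u C <= 4 by move=> CF; apply: (nb_le4 oF CF).
(* [v2] has at most one neighbour among [v4], [y], and [y] at most one among [v2], [v3]. The five
   cases left are, in order: a K_4 minus an edge; the triangle [v2 v3 v4] with pendant vertices [x]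
   and [y]; the 4-cycle [v2 v3 v4 y] with pendant vertex [x]; the triangle [v3 v4 y] at the end of a
   path; a path without these chords. *)
move: s2 s4; rewrite /= a23 (adjC y v4) a4y (adjC y x) (negPf nxy) (adjC y v2) (adjC y v3).
case a24: (adj v2 v4); case a2y: (adj v2 y); case a3y: (adj v3 y) => //= _ _.
- case: (rest_nochs oF); apply: (@chs_k4m _ _ v3 v2 v4 y) => //; try adjt.
  by apply/allP; rewrite /= m2 m3 m4 my.
- have nn : ~~ adj y v3 by rewrite adjC a3y.
  have nx3' := ore_load oF n3 nx3; have nxy' := ore_load oF ny nxy.
  have n3y' := ore_load oF n3y (negbT a3y).
  have d3 : nb v3 R <= 2.
    by rewrite (ham_nb _ hP) /= adj_irr (adjC v3 x) (negPf nx3) a3y; case: (adj v3 v2); case: (adj v3 v4).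
  have dy1 : nb y R <= 1.
    by rewrite (ham_nb _ hP) /= adj_irr (adjC y x) (negPf nxy) (adjC y v2) a2y (adjC y v3) a3y; case: (adj y v4).
  (* [x], [y], [v3] are pairwise nonadjacent, and half the sum of the three degree conditions is
     [9 * m + 2]. *)
  have : \sum_(u <- [:: x; y; v3]) load u <= 3 * 3 * m.
    apply: (loads_le_cl4 oF (us := [:: x; y; v3])); first by apply/allP; rewrite /= mx my m3.
    move=> C CF cl; have l3 := le4 C v3 CF m3; have lx := le4 C x CF mx; have ly := le4 C y CF my.
    have key u w : u \in R -> w \in R -> 2 < nb u C -> 
        (forall z, z \in C -> adj z w -> adj z v3 -> chs (z |: (R :\ u))) -> nb w C + nb v3 C <= 4.
      move=> uR wR lt H; have : \sum_(a <- [:: w; v3]) nb a C <= 4.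
        rewrite nb_double_seq; have -> : 4 = \sum_(z in C) 1 by rewrite sum_nat_const cl.1.
        apply: leq_sum => z zC /=; case zw: (adj z w); case z3: (adj z v3) => //.
        case: (win_sw oF CF zC uR (cl4_nb_sw CF cl zC uR lt)); exact: H.
      by rewrite !big_cons big_nil addn0.
    rewrite !big_cons big_nil /=.
    case: (leqP (nb x C) 2) => [lx2|lt].
      case: (leqP (nb y C) 2) => [ly2|lt]; first by move: l3 lx2 ly2; clear; lia.
      suff : nb x C + nb v3 C <= 4 by move: ly; clear; lia.
      apply: (key y x) => // z zC zx z3.
      have nz u : u \in R -> z != u by move=> uR; apply: contraTneq zC => ->; apply: mem_rest_notin uR.
      apply: (@chs_close _ _ z v3 [:: v4; v2; x]) => //=.
      + by rewrite a34 (adjC v4) a24 (adjC v2) x2.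
      + rewrite !inE !negb_or !nz //= (eq_sym v3 v2) (eq_sym v3 x) (eq_sym v4 v2) (eq_sym v4 x) (eq_sym v2 x).
        by rewrite n34 n23 n3 n24 n4 n2.
      + by rewrite a34 (adjC v3) a23; case: (adj v3 x).
      + apply/allP; rewrite /= !in_setU1 !in_setD1 m3 m4 m2 mx eqxx /= !andbT.
        by rewrite n3y n4y n2y ny !orbT.
    suff : nb y C + nb v3 C <= 4 by move: lx; clear; lia.
    apply: (key x y) => // z zC zy z3.
    have nz u : u \in R -> z != u by move=> uR; apply: contraTneq zC => ->; apply: mem_rest_notin uR.
    apply: (@chs_close _ _ z v3 [:: v2; v4; y]) => //=.
    + by rewrite (adjC v3) a23 a24 a4y.
    + rewrite !inE !negb_or !nz //= (eq_sym v3 v2).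
      by rewrite n34 n23 n3y n24 n2y n4y.
    + by rewrite a34 (adjC v3) a23; case: (adj v3 y).
    + apply/allP; rewrite /= !in_setU1 !in_setD1 m3 m4 m2 my eqxx /= !andbT.
      by rewrite ![_ == x]eq_sym n3 n4 n2 ny !orbT.
  rewrite !big_cons big_nil /=; move: nx3' nxy' n3y' d3 dy1 dx; clear; lia.
- have d3 : nb v3 R <= 2.
    by rewrite (ham_nb _ hP) /= adj_irr (adjC v3 x) (negPf nx3) a3y; case: (adj v3 v2); case: (adj v3 v4).
  have d4 : nb v4 R <= 2.
    by rewrite (ham_nb _ hP) /= adj_irr (adjC v4 x) (negPf nx4) (adjC v4 v2) a24; case: (adj v4 v3); case: (adj v4 y).
  have o1 := ore_load oF n4 nx4; have o2 := ore_load oF n3y (negbT a3y).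
  have : \sum_(u <- [:: x; v4; v3; y]) load u <= 3 * 4 * m.
    apply: (loads_le_cl4 oF (us := [:: x; v4; v3; y])); first by apply/allP; rewrite /= mx my m3 m4.
    move=> C CF cl; have l3 := le4 C v3 CF m3; have lx := le4 C x CF mx; have ly := le4 C y CF my.
    have l4 := le4 C v4 CF m4; rewrite !big_cons big_nil /=.
    have key u t us : u \in R -> 2 < nb u C -> sorted adj t -> uniq (u :: t) -> {subset t <= R} ->
        uniq us -> {subset us <= t} -> \sum_(a <- us) nb a C <= 8.
      move=> uR lt pt /= /andP[ut ut'] tR uus sus; apply: (cl4_path oF CF cl uR lt pt ut' _ uus sus).
      move=> a at'; rewrite in_setD1 tR // andbT; by apply: contraNneq ut => <-.
    case: (leqP (nb x C) 2) => [lx2|lt]; last first.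
      have := key x [:: v2; v3; v4; y] [:: v4; v3; y] mx lt; rewrite !big_cons big_nil /= => H.
      suff : nb v4 C + (nb v3 C + (nb y C + 0)) <= 8 by move: lx; clear; lia.
      apply: H => //; first by rewrite a23 a34 a4y.
      + by apply/allP; rewrite /= m2 m3 m4 my.
      + by rewrite !inE !negb_or eq_sym n34 n4y n3y.
      + by apply/allP; rewrite /= !inE !eqxx !orbT.
    case: (leqP (nb y C) 2) => [ly2|lt]; last first.
      have := key y [:: x; v2; v3; v4] [:: x; v4; v3] my lt; rewrite !big_cons big_nil /= => H.
      suff : nb x C + (nb v4 C + (nb v3 C + 0)) <= 8 by move: ly; clear; lia.
      apply: H => //; first by rewrite x2 a23 a34.
      + by rewrite -/(uniq [:: y; x; v2; v3; v4]) (perm_uniq (_ : perm_eq _ [:: x; v2; v3; v4; y])) //; permt.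
      + by apply/allP; rewrite /= m2 m3 m4 mx.
      + by rewrite !inE !negb_or n4 n3 eq_sym n34.
      + by apply/allP; rewrite /= !inE !eqxx !orbT.
    case: (leqP (nb v3 C) 2) => [l32|lt]; first by move: l4 l32 ly2 lx2; clear; lia.
    have := key v3 [:: x; v2; y; v4] [:: x; v4; y] m3 lt; rewrite !big_cons big_nil /= => H.
    suff : nb x C + (nb v4 C + (nb y C + 0)) <= 8 by move: l3; clear; lia.
    apply: H => //; first by rewrite x2 a2y adjC a4y.
    + by rewrite -/(uniq [:: v3; x; v2; y; v4]) (perm_uniq (_ : perm_eq _ [:: x; v2; v3; v4; y])) //; permt.
    + by apply/allP; rewrite /= m2 my m4 mx.
    + by rewrite !inE !negb_or n4 ny n4y.
    + by apply/allP; rewrite /= !inE !eqxx !orbT.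
  by rewrite !big_cons big_nil /=; move: o1 o2 d3 d4 dx dy; clear; lia.
- have d4 : nb v4 R <= 2.
    by rewrite (ham_nb _ hP) /= adj_irr (adjC v4 x) (negPf nx4) (adjC v4 v2) a24; case: (adj v4 v3); case: (adj v4 y).
  by apply: (@pendant_triangle _ _ _ oF x y v4 v3) => //; adjt.
- apply: (@pathlike_false x v2 [:: v3] v4 y hP) => //; rewrite ?a2y // (ham_nb _ hP) /= adj_irr.
  + by rewrite (adjC y x) (negPf nxy) (adjC y v2) a2y (adjC y v3) a3y; case: (adj y v4).
  + by rewrite a2y a24; case: (adj v2 x); case: (adj v2 v3).
  + by rewrite (adjC v4 x) (negPf nx4) (adjC v4 v2) a24; case: (adj v4 v3); case: (adj v4 y).
Qed.

(** This provides the second neighbour of either end from which [classify] reads off the shape of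
    the path. *)
Lemma ham_pendant x t : ham (x :: t) -> 2 < size t -> nb x R <= 1 -> False.
Proof.
case: t => [|v2 [|v3 t]] //; case/lastP: t => // t y; case/lastP: t => [|t y'].
  by move=> h _; apply: pendant4 h.
case/lastP: t => [|t w]; first by move=> h _; apply: pendant5 h.
by rewrite -!cats1 -!catA /= => h _; apply: (ham_long_pendant oF h).
Qed.

End PendantSmall.

(** * Spanning cycles *)

Section Cyclic.
Variable G : sgraph.
Implicit Types (u v w x y z : G) (S A B C D : {set G}) (s t : seq G).
Implicit Types (F : {set {set G}}).

Local Notation adj := (@adj G).

Variables (m : nat) (F : {set {set G}}).
Hypothesis oF : opt m F.

Local Notation R := (rest F).
Local Notation load := (load F).
Local Notation ham := (ham F).

Lemma set3 A : #|A| = 3 -> exists a b c, uniq [:: a; b; c] /\ A =i [:: a; b; c].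
Proof.
rewrite cardE => sA; have := enum_uniq A; have : enum A =i A by move=> u; rewrite mem_enum.
case: (enum A) sA => [|a [|b [|c [|? ?]]]] // _ e us.
by exists a, b, c; split=> // u; rewrite -e.
Qed.

Lemma k33_list C A : k33 C A -> exists a1 a2 a3 b1 b2 b3,
  [/\ uniq [:: a1; a2; a3; b1; b2; b3], {subset [:: a1; a2; a3] <= A},
      {subset [:: b1; b2; b3] <= C :\: A}, {subset [:: a1; a2; a3; b1; b2; b3] <= C} &
      forall a b, a \in [:: a1; a2; a3] -> b \in [:: b1; b2; b3] -> adj a b].
Proof.
move=> [sAC A3 C6 kA].
have B3 : #|C :\: A| = 3 by rewrite cardsD (setIidPr sAC) A3 C6.
have [a1 [a2 [a3 [ua eA]]]] := set3 A3; have [b1 [b2 [b3 [ub eB]]]] := set3 B3.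
exists a1, a2, a3, b1, b2, b3; split.
- rewrite -[X in uniq X]/([:: a1; a2; a3] ++ [:: b1; b2; b3]) cat_uniq ua ub andbT.
  by apply/hasPn => b; rewrite -eB => /setDP[_]; apply: contra; rewrite eA.
- by move=> u; rewrite eA.
- by move=> u; rewrite eB.
- move=> u; rewrite -[X in u \in X]/([:: a1; a2; a3] ++ [:: b1; b2; b3]) mem_cat -eA -eB.
  by case/orP=> [/(subsetP sAC)//|/setDP[]].
- by move=> a b; rewrite -eA -eB => aA /setDP[bC bA]; apply: kA.
Qed.

Lemma k33_compl C A : k33 C A -> k33 C (C :\: A).
Proof.
move=> [sAC A3 C6 kA]; split=> //; first exact: subsetDl.
  by rewrite cardsD (setIidPr sAC) A3 C6.
move=> a b /setDP[aC aA] bC; rewrite inE bC andbT negbK => bA.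
by rewrite adjC; apply: kA.
Qed.

Lemma k33_comm C A : k33 C A -> C :\: (C :\: A) = A.
Proof. by case=> sAC _ _ _; rewrite setDDr setDv set0U (setIidPr sAC). Qed.

Lemma win1s C s1 s2 : C \in F -> chs [set u in s1] -> chs [set u in s2] ->
  uniq (s1 ++ s2) -> {subset s1 ++ s2 <= C :|: R} -> False.
Proof.
move=> CF c1 c2 us sub; apply: (win1 oF CF c1 c2).
- apply: disjoint_mem => u; rewrite !inE => u1 u2.
  by move: us; rewrite cat_uniq => /and3P[_ /hasPn/(_ u u2)]; rewrite /= u1.
- by apply/subsetP => u; rewrite inE => u1; apply: sub; rewrite mem_cat u1.
- by apply/subsetP => u; rewrite inE => u2; apply: sub; rewrite mem_cat u2 orbT.
Qed.

Lemma uniq_CR C s t : C \in F -> uniq s -> uniq t -> {subset s <= C} -> {subset t <= R} ->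
  uniq (s ++ t).
Proof.
move=> CF us ut sC tR; rewrite cat_uniq us ut andbT /=; apply/hasPn => u /tR uR.
by apply/negP => /sC; apply/negP; apply: mem_rest_notin uR.
Qed.

(* Each path is closed by two vertices of its own side and one of the other side. *)
Lemma two_arcs C A x t y t' : C \in F -> k33 C A ->
  sorted adj (x :: t) -> sorted adj (y :: t') -> uniq ((x :: t) ++ y :: t') ->
  {subset (x :: t) ++ y :: t' <= R} -> 0 < size t -> 0 < size t' ->
  (forall a, a \in A -> adj x a && adj (last x t) a) ->
  (forall b, b \in C :\: A -> adj y b && adj (last y t') b) -> False.
Proof.
move=> CF kC pt pt' us sR st st' hA hB.
have [a1 [a2 [a3 [b1 [b2 [b3 [uab sA sB sC kab]]]]]]] := k33_list kC.
have uall : uniq ([:: a1; a2; a3; b1; b2; b3] ++ ((x :: t) ++ y :: t')).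
  exact: (uniq_CR CF uab us).
pose s1 := a1 :: a2 :: b1 :: x :: t; pose s2 := b2 :: b3 :: a3 :: y :: t'.
have pm : perm_eq (s1 ++ s2) ([:: a1; a2; a3; b1; b2; b3] ++ ((x :: t) ++ y :: t')).
  by rewrite /s1 /s2; permt.
have u12 : uniq (s1 ++ s2) by rewrite (perm_uniq pm).
have [u1 [_ u2]] : uniq s1 /\ (~~ has (mem s1) s2 /\ uniq s2).
  by move: u12; rewrite cat_uniq => /and3P[].
have adjA a : a \in [:: a1; a2; a3] -> adj x a && adj (last x t) a by move/sA/hA.
have adjB b : b \in [:: b1; b2; b3] -> adj y b && adj (last y t') b by move/sB/hB.
apply: (@win1s C s1 s2 CF) => //.
- have /andP[xa1 _] := adjA a1 (mem_head _ _).
  have /andP[xa2 la2] : adj x a2 && adj (last x t) a2 by apply: adjA; rewrite !inE eqxx orbT.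
  apply: (chs_arc pt u1) => //; try by rewrite adjC kab // !inE eqxx ?orbT.
  exact: sub_set_seq.
- have /andP[yb2 _] : adj y b2 && adj (last y t') b2 by apply: adjB; rewrite !inE eqxx orbT.
  have /andP[yb3 lb3] : adj y b3 && adj (last y t') b3 by apply: adjB; rewrite !inE eqxx !orbT.
  apply: (chs_arc pt' u2) => //; try by rewrite kab // !inE eqxx ?orbT.
  exact: sub_set_seq.
- move=> u; rewrite (perm_mem pm) mem_cat => /orP[/sC|/sR]; first exact: inU_C.
  exact: inU_R.
Qed.

Lemma nbsP v C u : (u \in nbs v C) = (u \in C) && adj v u.
Proof. by rewrite inE. Qed.

(** Otherwise the edge [u v] and two vertices of [A] form a K_4 minus an edge, smaller than [C]. *)
Lemma k33_adj_neq C u v A : C \in F -> k33 C A -> u \in R -> v \in R -> adj u v ->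
  nbs u C = A -> nbs v C = A -> False.
Proof.
move=> CF [sAC A3 C6 _] uR vR uv nu nv.
have /card_gt1P[a [b [aA bA nab]]] : 1 < #|A| by rewrite A3.
have: a \in nbs u C /\ b \in nbs u C by rewrite nu.
have: a \in nbs v C /\ b \in nbs v C by rewrite nv.
rewrite !nbsP => -[/andP[aC va] /andP[bC vb]] [/andP[_ ua] /andP[_ ub]].
apply: (@no_k4m _ _ _ oF C u a v b) => //; rewrite ?C6 //; try adjt.
by apply/allP; rewrite /= (inU_R _ uR) (inU_R _ vR) !inU_C.
Qed.

Lemma ham_rot P x t s : ham P -> cycle adj P -> P = s ++ x :: t -> ham (x :: t ++ s) /\ cycle adj (x :: t ++ s).
Proof.
move=> [pP uP eP] cP E; have Er : x :: t ++ s = rot (size s) P by rewrite E rot_size_cat.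
have cr : cycle adj (x :: t ++ s) by rewrite Er rot_cycle.
split=> //; split; last by move=> u; rewrite Er mem_rot eP.
  by move: cr; rewrite /= rcons_path => /andP[].
by rewrite Er rot_uniq.
Qed.

Lemma ham_cyc_at P u : ham P -> cycle adj P -> u \in R ->
  exists t, [/\ ham (u :: t), cycle adj (u :: t) & size (u :: t) = size P].
Proof.
move=> hP cP; have [_ _ <-] := hP => uP; case/splitPr: uP hP cP => s t hP cP.
have [h c] := ham_rot hP cP erefl; exists (t ++ s); split=> //.
by rewrite /= !size_cat /= addnS addnC.
Qed.

(** Rotation makes every vertex of the cycle an end of a Hamiltonian path. *)
Lemma ham_cyc_nb P u : ham P -> cycle adj P -> u \in R -> nb u R <= 2.
Proof. by move=> hP cP /(ham_cyc_at hP cP)[t [h _ _]]; apply: (ham_head_nb oF h). Qed.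

Lemma nb_ge3 v (a b c : G) S : a \in S -> b \in S -> c \in S -> uniq [:: a; b; c] ->
  adj v a -> adj v b -> adj v c -> 2 < nb v S.
Proof.
move=> aS bS cS us va vb vc; have := @count_le_nb _ v [:: a; b; c] S us.
by rewrite /= va vb vc; apply; apply/allP; rewrite /= aS bS cS.
Qed.

Lemma cyc_cl4 P u us C : ham P -> cycle adj P -> C \in F -> cl4 C -> u \in R ->
  2 < nb u C -> uniq (u :: us) -> {subset us <= R} -> \sum_(v <- us) nb v C <= 8.
Proof.
move=> hP cP CF cl uR lt /= /andP[uus uus'] sus; have [t [h _ _]] := ham_cyc_at hP cP uR.
apply: (ham_cl4 oF h) => // v vus; case: h => _ _ e.
have := sus _ vus; rewrite -e in_cons => /orP[/eqP E|//].
by rewrite -E vus in uus.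
Qed.

(** On a cycle of length five [v1 v5] is an edge; the five pairs listed are nonadjacent for every
    length from five on. *)
Lemma cyc5_nadj v1 v2 v3 v4 v5 s : ham [:: v1, v2, v3, v4, v5 & s] ->
  cycle adj [:: v1, v2, v3, v4, v5 & s] ->
  [/\ ~~ adj v1 v3, ~~ adj v1 v4, ~~ adj v2 v4, ~~ adj v2 v5 & ~~ adj v3 v5].
Proof.
set P := (X in ham X) => hP cP; have [_ uP eP] := hP.
have mP u : u \in P -> u \in R by rewrite eP.
have le2 u : u \in P -> nb u R <= 2 by move/mP; apply: (ham_cyc_nb hP cP).
have nadj u a b c : u \in P -> a \in P -> b \in P -> c \in P -> adj u a -> adj u b -> uniq [:: a; b; c] ->
    ~~ adj u c.
  move=> uP' aP bP cP' ua ub us; apply/negP => uc; have := le2 u uP'; rewrite leqNgt => /negP[].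
  by apply: (nb_ge3 (mP _ aP) (mP _ bP) (mP _ cP') us).
have [m1 m2 m3 m4] : [/\ v1 \in P, v2 \in P, v3 \in P & v4 \in P] by split; rewrite !inE eqxx ?orbT.
have m5 : v5 \in P by rewrite !inE eqxx ?orbT.
pose l := last v5 s; have ml : l \in P by rewrite /P !in_cons -in_cons /l mem_last !orbT.
have [p12 p23 p34 /andP[p45 /andP[pl lv1]]] : [/\ adj v1 v2, adj v2 v3, adj v3 v4 &
    adj v4 v5 && (path adj v5 s && adj l v1)].
  by move: cP; rewrite /= rcons_path => /and5P[-> -> -> -> ->].
have ul : l \notin [:: v2; v3; v4].
  have : uniq ([:: v2; v3; v4] ++ v5 :: s) by move: uP => /= /andP[].
  by rewrite cat_uniq => /and3P[_ /hasPn/(_ l (mem_last _ _))].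
have /and5P[n1 n2 n3 n4 _] := uP.
move: n1 n2 n3 n4 ul; rewrite !inE !negb_or => /and5P[n12 n13 n14 n15 _] /and4P[n23 n24 n25 _]
  /and3P[n34 n35 _] /andP[n45 _] /and3P[l2 l3 l4].
split.
- by apply: (nadj v1 v2 l v3) => //; try adjt; rewrite /= !inE !negb_or eq_sym l2 n23 l3.
- by apply: (nadj v1 v2 l v4) => //; try adjt; rewrite /= !inE !negb_or eq_sym l2 n24 l4.
- by apply: (nadj v2 v1 v3 v4) => //; try adjt; rewrite /= !inE !negb_or n13 n14 n34.
- by apply: (nadj v2 v1 v3 v5) => //; try adjt; rewrite /= !inE !negb_or n13 n15 n35.
- by apply: (nadj v3 v2 v4 v5) => //; try adjt; rewrite /= !inE !negb_or n24 n25 n45.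
Qed.

(** The five nonadjacent pairs form a 5-cycle, so each vertex is counted twice and the loads add up
    to at least [15 * m]. A K_4 receives at most 12, as 4 + 8 if one of the vertices has three
    neighbours in it. Hence there is no K_4 and three neighbours everywhere. *)
Lemma cyc5_head v1 v2 v3 v4 v5 s C : ham [:: v1, v2, v3, v4, v5 & s] ->
  cycle adj [:: v1, v2, v3, v4, v5 & s] -> C \in F -> ~ cl4 C /\ nb v1 C = 3.
Proof.
set P := (X in ham X) => hP cP CF; have [_ uP eP] := hP.
have mP u : u \in P -> u \in R by rewrite eP.
have [a13 a14 a24 a25 a35] := cyc5_nadj hP cP.
have [m1 m2 m3 m4] : [/\ v1 \in P, v2 \in P, v3 \in P & v4 \in P] by split; rewrite !inE eqxx ?orbT.
have m5 : v5 \in P by rewrite !inE eqxx ?orbT.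
have uU : uniq [:: v1; v2; v3; v4; v5].
  exact: subseq_uniq (prefix_subseq [:: v1; v2; v3; v4; v5] s) uP.
have pair u v : u \in P -> v \in P -> u != v -> ~~ adj u v -> 6 * m <= load u + load v.
  move=> mu mv n a; have := ore_load oF n a.
  have := ham_cyc_nb hP cP (mP _ mu); have := ham_cyc_nb hP cP (mP _ mv); clear; lia.
move: (uU); rewrite /= !inE !negb_or => /and5P[/and4P[n12 n13 n14 n15] /and3P[n23 n24 n25] /andP[n34 n35] n45 _].
have o1 := pair _ _ m1 m3 n13 a13; have o2 := pair _ _ m1 m4 n14 a14.
have o3 := pair _ _ m2 m4 n24 a24; have o4 := pair _ _ m2 m5 n25 a25.
have o5 := pair _ _ m3 m5 n35 a35.
have le4 E u : E \in F -> u \in P -> nb u E <= 4 by move=> EF /mP; apply: (nb_le4 oF EF).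
have up E : E \in F -> cl4 E -> \sum_(u <- [:: v1; v2; v3; v4; v5]) nb u E <= 12.
  move=> EF cl; have l1 := le4 E v1 EF m1; have l2 := le4 E v2 EF m2.
  have l3 := le4 E v3 EF m3; have l4 := le4 E v4 EF m4; have l5 := le4 E v5 EF m5.
  have key u us : perm_eq (u :: us) [:: v1; v2; v3; v4; v5] -> 2 < nb u E ->
      \sum_(v <- us) nb v E <= 8.
    move=> pm lt.
    have sub : {subset u :: us <= R}.
      by move=> v; rewrite (perm_mem pm) => vI; apply: mP; move: vI; rewrite !inE => /or4P[->|->|->|/orP[]->]; rewrite ?orbT.
    apply: (cyc_cl4 hP cP EF cl (sub u (mem_head _ _)) lt); first by rewrite (perm_uniq pm).
    by move=> v vus; apply: sub; rewrite in_cons vus orbT.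
  rewrite !big_cons big_nil /=.
  case: (leqP (nb v1 E) 2) => [k1|lt]; last first.
    by have := key v1 [:: v2; v3; v4; v5] _ lt; rewrite !big_cons big_nil => /(_ (perm_refl _)); move: l1; clear; lia.
  case: (leqP (nb v2 E) 2) => [k2|lt]; last first.
    have := key v2 [:: v1; v3; v4; v5] _ lt; rewrite !big_cons big_nil.
    by move=> H; have {}H := H ltac:(permt); move: H l2; clear; lia.
  case: (leqP (nb v3 E) 2) => [k3|lt]; last first.
    have := key v3 [:: v1; v2; v4; v5] _ lt; rewrite !big_cons big_nil.
    by move=> H; have {}H := H ltac:(permt); move: H l3; clear; lia.
  case: (leqP (nb v4 E) 2) => [k4|lt]; last first.
    have := key v4 [:: v1; v2; v3; v5] _ lt; rewrite !big_cons big_nil.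
    by move=> H; have {}H := H ltac:(permt); move: H l4; clear; lia.
  case: (leqP (nb v5 E) 2) => [k5|lt]; last first.
    have := key v5 [:: v1; v2; v3; v4] _ lt; rewrite !big_cons big_nil.
    by move=> H; have {}H := H ltac:(permt); move: H l5; clear; lia.
  by move: k1 k2 k3 k4 k5; clear; lia.
have up' E : E \in F -> \sum_(u <- [:: v1; v2; v3; v4; v5]) nb u E <= 15.
  move=> EF; case: (dichotomy oF EF) => [cl|le3]; first by apply: leq_trans (up E EF cl) _.
  apply: (@sum_nb_le _ _ 3) => u uI; apply/le3/mP; move: uI.
  by rewrite !inE => /or4P[->|->|->|/orP[]->]; rewrite ?orbT.
have ge : 15 * m <= \sum_(u <- [:: v1; v2; v3; v4; v5]) load u.
  by rewrite !big_cons big_nil; move: o1 o2 o3 o4 o5; clear; lia.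
have := loads_eq oF up' ge CF; rewrite !big_cons !big_nil /= => H.
case: (dichotomy oF CF) => [cl|le3].
  by have := up C CF cl; rewrite !big_cons big_nil; move: H; clear; lia.
have k1 := le3 v1 (mP _ m1); have k2 := le3 v2 (mP _ m2); have k3 := le3 v3 (mP _ m3).
have k4 := le3 v4 (mP _ m4); have k5 := le3 v5 (mP _ m5).
split; last by move: k1 k2 k3 k4 k5 H; clear; lia.
by move=> cl; have := up C CF cl; rewrite !big_cons big_nil; move: H; clear; lia.
Qed.

End Cyclic.

Section Cyclic2.
Variable G : sgraph.
Implicit Types (u v w x y z : G) (S A B C D : {set G}) (s t : seq G).
Implicit Types (F : {set {set G}}).

Local Notation adj := (@adj G).

Variables (m : nat) (F : {set {set G}}).
Hypothesis oF : opt m F.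

Local Notation R := (rest F).
Local Notation load := (load F).
Local Notation ham := (ham F).

(** [x] replaces [d], and by [dia_nb3] the vertex [d] sees all of [t], more than [sw_path]
    allows. *)
Lemma all3_dia C a b c d x t : C \in F -> dia C a b c d -> x \in R ->
  sorted adj t -> uniq t -> {subset t <= R :\ x} -> 2 < size t ->
  2 < nb x C -> (forall u, u \in t -> 2 < nb u C) -> False.
Proof.
move=> CF dC xR pt ut sR st nx H; have [_ xd xab] := dia_nb3 oF CF dC xR nx.
have [aC bC cC dC'] := dia_mem dC; have [xc _ _] := dia_nb3 oF CF dC xR nx.
have cs : chs (sw C d x) by apply: (dia_sw CF dC xR); rewrite xab xc.
have := sw_path oF CF dC' xR cs pt ut sR; rewrite leqNgt => /negP[].
suff -> : count (adj d) t = size t by [].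
apply/eqP; rewrite -all_count; apply/allP => u uT.
have /setD1P[_ uR] := sR u uT.
by have [_ ud _] := dia_nb3 oF CF dC uR (H u uT); rewrite adjC.
Qed.

Lemma nb3_side C A v : C \in F -> k33 C A -> v \in R -> 2 < nb v C -> nbs v C <> A ->
  nbs v C = C :\: A.
Proof. by move=> CF kC vR lt nA; case: (k33_nb oF CF kC vR lt). Qed.

Lemma k33_opp C u v A : C \in F -> k33 C A -> u \in R -> v \in R -> adj u v ->
  2 < nb v C -> nbs u C = A -> nbs v C = C :\: A.
Proof.
move=> CF kC uR vR uv lt nu; apply: nb3_side => // nv.
exact: (k33_adj_neq oF CF kC uR vR uv nu nv).
Qed.

Lemma side_adj C A v u : nbs v C = A -> u \in A -> adj v u.
Proof. by move=> <-; rewrite nbsP => /andP[]. Qed.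

(** Consecutive vertices see opposite sides of a K_{3,3}, so [v5] sees the same side as [v1]. On
    five vertices these two are adjacent, a contradiction; from six on, the arcs [v1 v2 v3] and
    [v4 v5 v6] are closed by different sides. *)
Lemma cyc5_false P : 0 < m -> ham P -> cycle adj P -> 4 < size P -> False.
Proof.
move=> m0 hP cP sP; have /card_gt0P[C CF] : 0 < #|F| by rewrite (opt_card oF).
have all3 u : u \in R -> ~ cl4 C /\ nb u C = 3.
  move=> uR; have [t [h c]] := ham_cyc_at hP cP uR.
  case: t h c => [|v2 [|v3 [|v4 [|v5 s]]]] h c Es; try by move: sP; rewrite -Es.
  exact: (cyc5_head oF h c CF).
have lt3 u : u \in R -> 2 < nb u C by move/all3 => [_ ->].
case: P hP cP sP => [|v1 [|v2 [|v3 [|v4 [|v5 s]]]]] // hP cP _.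
have [pP uP eP] := hP.
have mP u : u \in [:: v1, v2, v3, v4, v5 & s] -> u \in R by rewrite eP.
have [m1 m2 m3 m4] : [/\ v1 \in R, v2 \in R, v3 \in R & v4 \in R].
  by split; apply: mP; rewrite !inE eqxx ?orbT.
have m5 : v5 \in R by apply: mP; rewrite !inE eqxx ?orbT.
have [p12 p23 p34 /andP[p45 p5]] : [/\ adj v1 v2, adj v2 v3, adj v3 v4 &
    adj v4 v5 && path adj v5 (rcons s v1)].
  by move: cP; rewrite /= => /and5P[-> -> -> -> ->].
have [] := member_type oF CF m2 m1 _ (lt3 _ m2) (lt3 _ m1).
- by move: uP; rewrite /= !inE negb_or => /and3P[/andP[n12 _] _ _]; rewrite eq_sym.
- by have [] := all3 _ m1.
- case=> a [b [c [d dC]]].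
  apply: (@all3_dia C a b c d v1 [:: v2; v3; v4] CF dC m1) => //=; last 2 first.
  + exact: lt3.
  + by move=> u; rewrite !inE => /or3P[]/eqP->; apply: lt3.
  + by rewrite p23 p34.
  + have : uniq [:: v2; v3; v4].
      by move: uP => /= /andP[_ u2]; apply: (subseq_uniq (prefix_subseq [:: v2; v3; v4] (v5 :: s))).
    by [].
  + move=> u uI; rewrite in_setD1; apply/andP; split.
      by move: uP => /= /andP[h _]; apply: contraNneq h => <-; move: uI; rewrite !inE => /or3P[]->; rewrite ?orbT.
    by apply: mP; move: uI; rewrite !inE => /or3P[]->; rewrite ?orbT.
set A := nbs v1 C => kA; have kB := k33_compl kA.
have o2 := k33_opp CF kA m1 m2 p12 (lt3 _ m2) erefl.
have o3 : nbs v3 C = A by rewrite (k33_opp CF kB m2 m3 p23 (lt3 _ m3) o2) k33_comm.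
have o4 := k33_opp CF kA m3 m4 p34 (lt3 _ m4) o3.
have o5 : nbs v5 C = A by rewrite (k33_opp CF kB m4 m5 p45 (lt3 _ m5) o4) k33_comm.
case: s p5 hP cP pP uP eP mP => [|v6 s].
  by rewrite /= => /andP[p51 _] *; apply: (k33_adj_neq oF CF kA m5 m1 p51 o5).
move=> /= /andP[p56 _] hP cP pP uP eP mP.
have m6 : v6 \in R by apply: mP; rewrite !inE eqxx ?orbT.
have o6 := k33_opp CF kA m5 m6 p56 (lt3 _ m6) o5.
apply: (@two_arcs _ _ _ oF C A v1 [:: v2; v3] v4 [:: v5; v6] CF kA) => //=.
- by rewrite p12 p23.
- by rewrite p45 p56.
- exact: (subseq_uniq (prefix_subseq [:: v1; v2; v3; v4; v5; v6] s)).
- by apply/allP; rewrite /= m1 m2 m3 m4 m5 m6.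
- by move=> a aA; rewrite (side_adj erefl aA) (side_adj o3 aA).
- by move=> a aA; rewrite (side_adj o4 aA) (side_adj o6 aA).
Qed.

(* With [w], [w'] the other two vertices of [C], the chorded cycles are on [u1 u2 z w] and
   [u3 u4 z' w']. *)
Lemma c4_split C u1 u2 u3 u4 z z' : C \in F -> cl4 C -> uniq [:: u1; u2; u3; u4] ->
  {subset [:: u1; u2; u3; u4] <= R} -> adj u1 u2 -> adj u3 u4 ->
  z \in C -> z' \in C -> z != z' -> adj z u1 -> adj z u2 -> adj z' u3 -> adj z' u4 ->
  (forall w, w \in C -> (adj w u1 || adj w u2) && (adj w u3 || adj w u4)) -> False.
Proof.
move=> CF [C4 cl] us sR a12 a34 zC z'C nzz z1 z2 z3 z4 H.
have [w [w' [wC w'C uw]]] : exists w w', [/\ w \in C, w' \in C & uniq [:: z; w; z'; w']].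
  have : 1 < #|C :\ z :\ z'|.
    have := cardsD1 z C; have := cardsD1 z' (C :\ z).
    by rewrite !inE zC z'C (eq_sym z') nzz C4 /=; clear; lia.
  case/card_gt1P=> w [w' []]; rewrite !inE => /and3P[wz' wz wC] /and3P[wz'' wz0 w'C] nww.
  exists w, w'; split=> //; rewrite /= !inE !negb_or nzz nww wz' (eq_sym z w) wz (eq_sym z w') wz0.
  by rewrite (eq_sym z') wz''.
have zw : adj z w by apply: cl => //; move: uw; rewrite /= !inE !negb_or => /andP[/andP[]].
have zw' : adj z' w'.
  by apply: cl => //; move: uw; rewrite /= !inE !negb_or => /and4P[_ _ ->].
have key p q r o : adj p q -> adj r p -> adj r q -> adj r o -> adj o p || adj o q ->
    o != p -> o != q -> chs [set u in [:: p; q; r; o]].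
  move=> pq rp rq ro /orP[op|oq] np nq.
    apply: (@chs_k4m _ _ p q r o) => //; try adjt; first by rewrite eq_sym.
    exact: sub_set_seq.
  apply: (@chs_k4m _ _ q p r o) => //; try adjt; first by rewrite eq_sym.
  by move=> u; rewrite !inE orbCA.
have neq u v : u \in C -> v \in [:: u1; u2; u3; u4] -> u != v.
  by move=> uC /sR vR; apply: contraTneq uC => ->; apply: mem_rest_notin vR.
have /andP[h12 _] := H w wC; have /andP[_ h34] := H w' w'C.
apply: (@win1s _ _ _ oF C [:: u1; u2; z; w] [:: u3; u4; z'; w'] CF).
- by apply: key => //; apply: neq; rewrite ?inE ?eqxx ?orbT.
- by apply: key => //; apply: neq; rewrite ?inE ?eqxx ?orbT.
- rewrite (perm_uniq (_ : perm_eq _ ([:: z; w; z'; w'] ++ [:: u1; u2; u3; u4]))); last by permt.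
  apply: (uniq_CR CF uw us) => //; apply/allP; rewrite /= zC wC z'C w'C //.
- move=> v vI; have /orP[vu|vz] : (v \in [:: u1; u2; u3; u4]) || (v \in [:: z; w; z'; w']).
  + by move: vI; rewrite !inE; do ![case/orP=> [->|]; rewrite ?orbT //]; move->; rewrite ?orbT.
  + exact/inU_R/sR.
  + by apply: inU_C; move: vz; rewrite !inE => /or4P[]/eqP->.
Qed.

(** Each diagonal is a nonadjacent pair and sends [6 * m] edges. A K_4 receives at most 12, as 4 + 8
    or as 2 + 2 + 4 + 4. *)
Lemma cyc4_nb C u1 u2 u3 u4 : ham [:: u1; u2; u3; u4] -> cycle adj [:: u1; u2; u3; u4] ->
  C \in F -> [/\ \sum_(u <- [:: u1; u2; u3; u4]) nb u C = 12,
    6 * m <= load u1 + load u3 & 6 * m <= load u2 + load u4].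
Proof.
set P := (X in ham X) => hP cP CF; have [_ uP eP] := hP.
have mP u : u \in P -> u \in R by rewrite eP.
have [m1 m2 m3 m4] : [/\ u1 \in P, u2 \in P, u3 \in P & u4 \in P] by split; rewrite !inE eqxx ?orbT.
have [p12 p23 p34 p41] : [/\ adj u1 u2, adj u2 u3, adj u3 u4 & adj u4 u1].
  by move: cP => /= /and5P[-> -> -> ->].
have := uP; rewrite /= !inE !negb_or => /and4P[/and3P[n12 n13 n14] /andP[n23 n24] n34 _].
have a13 : ~~ adj u1 u3.
  apply/negP => a; have := ham_cyc_nb oF hP cP (mP _ m1); rewrite leqNgt => /negP[].
  apply: (nb_ge3 (mP _ m2) (mP _ m3) (mP _ m4)) => //; last by rewrite adjC.
  by rewrite /= !inE !negb_or n23 n24 n34.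
have a24 : ~~ adj u2 u4.
  apply/negP => a; have := ham_cyc_nb oF hP cP (mP _ m2); rewrite leqNgt => /negP[].
  apply: (nb_ge3 (mP _ m1) (mP _ m3) (mP _ m4)) => //; last by rewrite adjC.
  by rewrite /= !inE !negb_or n13 n14 n34.
have d u : u \in P -> nb u R <= 2 by move/mP; apply: (ham_cyc_nb oF hP cP).
have o1 : 6 * m <= load u1 + load u3.
  by have := ore_load oF n13 a13; have := d _ m1; have := d _ m3; clear; lia.
have o2 : 6 * m <= load u2 + load u4.
  by have := ore_load oF n24 a24; have := d _ m2; have := d _ m4; clear; lia.
split=> //; apply: (@loads_eq _ _ _ oF [:: u1; u2; u3; u4] 12) CF; last first.
  by rewrite !big_cons big_nil; move: o1 o2; clear; lia.
move=> E EF; case: (dichotomy oF EF) => [cl|le3]; last first.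
  by apply: (@sum_nb_le _ _ 3) => u uI; apply/le3/mP.
have le4 u : u \in P -> nb u E <= 4 by move/mP; apply: (nb_le4 oF EF).
have key u us : perm_eq (u :: us) P -> 2 < nb u E -> \sum_(v <- us) nb v E <= 8.
  move=> pm lt; have sub v : v \in u :: us -> v \in R by rewrite (perm_mem pm) => /mP.
  apply: (cyc_cl4 oF hP cP EF cl (sub u (mem_head _ _)) lt); first by rewrite (perm_uniq pm).
  by move=> v vus; apply: sub; rewrite in_cons vus orbT.
have l1 := le4 u1 m1; have l2 := le4 u2 m2; have l3 := le4 u3 m3; have l4 := le4 u4 m4.
rewrite !big_cons big_nil /=.
case: (leqP (nb u1 E) 2) => [k1|lt]; last first.
  have := key u1 [:: u2; u3; u4] _ lt; rewrite !big_cons big_nil.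
  by move=> H; have {}H := H ltac:(rewrite /P; permt); move: H l1; clear; lia.
case: (leqP (nb u2 E) 2) => [k2|lt]; last first.
  have := key u2 [:: u1; u3; u4] _ lt; rewrite !big_cons big_nil.
  by move=> H; have {}H := H ltac:(rewrite /P; permt); move: H l2; clear; lia.
by move: k1 k2 l3 l4; clear; lia.
Qed.

(** Some [u] on the cycle has three neighbours in [C], so 12 arises only as 4 + 8: [u] sees all of
    [C], and every [z] sees exactly two of the other three vertices. *)
Lemma cyc4_cl4 C u1 u2 u3 u4 : ham [:: u1; u2; u3; u4] -> cycle adj [:: u1; u2; u3; u4] ->
  C \in F -> cl4 C -> forall z, z \in C -> count (adj z) [:: u1; u2; u3; u4] = 3.
Proof.
set P := (X in ham X) => hP cP CF cl; have [_ uP eP] := hP.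
have mP u : u \in P -> u \in R by rewrite eP.
have [S12 _ _] := cyc4_nb hP cP CF.
have [u [us [pm lt]]] : exists u us, perm_eq (u :: us) P /\ 2 < nb u C.
  move: S12; rewrite !big_cons big_nil => S12.
  case: (leqP (nb u1 C) 2) => [k1|lt]; last by exists u1, [:: u2; u3; u4].
  case: (leqP (nb u2 C) 2) => [k2|lt]; last by exists u2, [:: u1; u3; u4]; split=> //; rewrite /P; permt.
  case: (leqP (nb u3 C) 2) => [k3|lt]; last by exists u3, [:: u1; u2; u4]; split=> //; rewrite /P; permt.
  exists u4, [:: u1; u2; u3]; split; first by rewrite /P; permt.
  by move: S12 k1 k2 k3; clear; lia.
have sub v : v \in u :: us -> v \in R by rewrite (perm_mem pm) => /mP.
have uR := sub u (mem_head _ _).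
have [t [h _ _]] := ham_cyc_at hP cP uR.
have le2 z : z \in C -> count (adj z) us <= 2.
  move=> zC; have [pt ut et] := h.
  apply: leq_trans (sw_path oF CF zC uR (cl4_nb_sw CF cl zC uR lt) (path_sorted pt) _ (subset_behead h)).
    rewrite -!size_filter; apply: uniq_leq_size.
      by apply: filter_uniq; move: uP; rewrite -(perm_uniq pm) => /andP[].
    move=> v; rewrite !mem_filter => /andP[-> vus] /=.
    have := sub v; rewrite in_cons vus orbT -et in_cons => /(_ isT) /orP[/eqP E|//].
    by move: uP; rewrite -(perm_uniq pm) /= -E vus.
  by case/andP: ut.
have {}S12 : nb u C + \sum_(z in C) count (adj z) us = 12.
  by rewrite -S12 -(perm_big _ pm) /= big_cons nb_double_seq.
have n4 := nb_le4 oF CF uR.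
have le8 : \sum_(z in C) count (adj z) us <= \sum_(z in C) 2 by apply: leq_sum.
have S2 : \sum_(z in C) 2 = 8 by rewrite sum_nat_const cl.1.
have eq8 : \sum_(z in C) count (adj z) us = 8 by move: S12 n4 le8; rewrite S2; clear; lia.
have full : #|C| <= nb u C by rewrite cl.1; move: S12; rewrite eq8; clear; lia.
move=> z zC; rewrite (_ : count _ _ = count (adj z) (u :: us)); last first.
  by apply/esym; move/permP: pm => ->.
rewrite /= adjC (nb_full full zC) add1n; congr _.+1.
apply/eqP; rewrite eqn_leq le2 //= leqNgt; apply/negP => lz.
have : \sum_(z in C) count (adj z) us < \sum_(z in C) 2.
  rewrite (big_setD1 z) //= [X in _ < X](big_setD1 z) //=.
  have : \sum_(i in C :\ z) count (adj i) us <= \sum_(i in C :\ z) 2.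
    by apply: leq_sum => i /setD1P[_ /le2].
  move: (\sum_(i in C :\ z) count (adj i) us) (\sum_(i in C :\ z) 2) lz; clear; lia.
by rewrite S2 eq8.
Qed.

Lemma count4 (a : pred G) u1 u2 u3 u4 : count a [:: u1; u2; u3; u4] = 3 ->
  [\/ [/\ ~~ a u1, a u2, a u3 & a u4], [/\ a u1, ~~ a u2, a u3 & a u4],
      [/\ a u1, a u2, ~~ a u3 & a u4] | [/\ a u1, a u2, a u3 & ~~ a u4]].
Proof.
rewrite /=; case: (a u1); case: (a u2); case: (a u3); case: (a u4) => // _.
- by constructor 4. - by constructor 3. - by constructor 2. - by constructor 1.
Qed.

(** If two vertices of [C] missed different vertices of the cycle, the cycle could be cut into two
    opposite edges such that each of the two sees both ends of one, and [c4_split] would apply. *)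
Lemma cyc4_zero C u1 u2 u3 u4 : ham [:: u1; u2; u3; u4] -> cycle adj [:: u1; u2; u3; u4] ->
  C \in F -> cl4 C -> exists2 u, u \in [:: u1; u2; u3; u4] & forall z, z \in C ->
   forall v, v \in [:: u1; u2; u3; u4] -> adj z v = (v != u).
Proof.
set P := (X in ham X) => hP cP CF cl; have [_ uP eP] := hP.
have mP u : u \in P -> u \in R by rewrite eP.
have c3 := cyc4_cl4 hP cP CF cl.
have [p12 p23 p34 p41] : [/\ adj u1 u2, adj u2 u3, adj u3 u4 & adj u4 u1].
  by move: cP => /= /and5P[-> -> -> ->].
have /card_gt0P[z zC] : 0 < #|C| by rewrite cl.1.
have := uP; rewrite /= !inE !negb_or => /and4P[/and3P[n12 n13 n14] /andP[n23 n24] n34 _].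
have h w : w \in C -> (adj w u1 || adj w u2) && (adj w u3 || adj w u4) /\
    (adj w u2 || adj w u3) && (adj w u4 || adj w u1).
  by move=> /c3 /=; case: (adj w u1); case: (adj w u2); case: (adj w u3); case: (adj w u4).
have uP' : uniq [:: u2; u3; u4; u1].
  by rewrite (perm_uniq (_ : perm_eq _ P)) // /P; permt.
have sP' : {subset [:: u2; u3; u4; u1] <= R}.
  move=> v vI; apply: mP; move: vI; rewrite !inE.
  by case/or4P=> ->; rewrite ?orbT.
have k1 w w' : w \in C -> w' \in C -> w != w' -> adj w u1 -> adj w u2 -> adj w' u3 -> adj w' u4 -> False.
  move=> wC w'C nww b1 b2 b3 b4.
  by apply: (c4_split CF cl uP mP p12 p34 wC w'C nww b1 b2 b3 b4) => o /h[].
have k2 w w' : w \in C -> w' \in C -> w != w' -> adj w u2 -> adj w u3 -> adj w' u4 -> adj w' u1 -> False.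
  move=> wC w'C nww b1 b2 b3 b4.
  by apply: (c4_split CF cl uP' sP' p23 p41 wC w'C nww b1 b2 b3 b4) => o /h[].
have [u uI Hz] : exists2 u, u \in P & forall v, v \in P -> adj z v = (v != u).
  have E (a b : G) : a != b -> b != a by rewrite eq_sym.
  have [[b1 b2 b3 b4]|[b1 b2 b3 b4]|[b1 b2 b3 b4]|[b1 b2 b3 b4]] := count4 (c3 z zC);
    [exists u1|exists u2|exists u3|exists u4]; rewrite ?inE ?eqxx ?orbT // => v;
    rewrite !inE => /or4P[]/eqP->; rewrite ?eqxx ?(negPf b1) ?(negPf b2) ?(negPf b3) ?(negPf b4) ?b1 ?b2 ?b3 ?b4;
    by rewrite ?n12 ?n13 ?n14 ?n23 ?n24 ?n34 // E.
exists u => // w wC v vI; case: (eqVneq w z) => [->|nwz]; first exact: Hz.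
have nzw : z != w by rewrite eq_sym.
have Hz1 := Hz u1; have Hz2 := Hz u2; have Hz3 := Hz u3; have Hz4 := Hz u4.
move: Hz1 Hz2 Hz3 Hz4; rewrite !inE !eqxx !orbT => /(_ isT) Z1 /(_ isT) Z2 /(_ isT) Z3 /(_ isT) Z4.
have [W1|W1|W1|W1] := count4 (c3 w wC); case: W1 => W1 W2 W3 W4;
have [Y1|Y1|Y1|Y1] := count4 (c3 z zC); case: Y1 => Y1 Y2 Y3 Y4;
  try (by case: (k1 w z)); try (by case: (k1 z w)); try (by case: (k2 w z)); try (by case: (k2 z w));
  rewrite -(Hz v vI); move: vI; rewrite !inE => /or4P[]/eqP->;
  by rewrite ?(negPf W1) ?(negPf W2) ?(negPf W3) ?(negPf W4) ?W1 ?W2 ?W3 ?W4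
    ?(negPf Y1) ?(negPf Y2) ?(negPf Y3) ?(negPf Y4) ?Y1 ?Y2 ?Y3 ?Y4.
Qed.

End Cyclic2.

Section Cyclic3.
Variable G : sgraph.
Implicit Types (u v w x y z : G) (S A B C D : {set G}) (s t : seq G).
Implicit Types (F : {set {set G}}).

Local Notation adj := (@adj G).

Variables (m : nat) (F : {set {set G}}).
Hypothesis oF : opt m F.

Local Notation R := (rest F).
Local Notation ham := (ham F).

(** [p'] replaces [d] in [C] and [p] replaces [d'] in [C']; the displaced vertices and the edge
    [q q'] form the third chorded cycle. *)
Lemma two_k4 C C' (p q p' q' : G) : C \in F -> C' \in F -> C != C' -> cl4 C -> cl4 C' ->
  {subset [:: p; q; p'; q'] <= R} -> uniq [:: p; q; p'; q'] -> adj q q' ->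
  (forall z, z \in C -> [&& adj z p', adj z q & adj z q']) ->
  (forall z, z \in C' -> [&& adj z p, adj z q & adj z q']) -> False.
Proof.
move=> CF C'F nCC cl cl' sR us qq H H'.
have [/card_gt0P[d dC] /card_gt0P[d' dC']] : 0 < #|C| /\ 0 < #|C'| by rewrite cl.1 cl'.1.
have [pR qR p'R q'R] : [/\ p \in R, q \in R, p' \in R & q' \in R].
  by split; apply: sR; rewrite !inE eqxx ?orbT.
have dCC := mem_disj oF CF C'F nCC.
have full E v : E \in F -> cl4 E -> (forall z, z \in E -> adj z v) -> 2 < nb v E.
  move=> EF clE h; suff -> : nb v E = 4 by [].
  rewrite -clE.1; apply: eq_card => u; rewrite inE; case: (boolP (u \in E)) => //= uE.
  by rewrite adjC h.
have cs : chs (sw C d p').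
  by apply: (cl4_nb_sw CF cl dC p'R); apply: full => // z /H/and3P[].
have cs' : chs (sw C' d' p).
  by apply: (cl4_nb_sw C'F cl' dC' pR); apply: full => // z /H'/and3P[].
have nR E z v : E \in F -> z \in E -> v \in R -> z != v.
  by move=> EF zE vR; apply: contraTneq zE => ->; apply: mem_rest_notin vR.
have ndd : d != d' by apply/eqP => E; apply: (disjointE dCC dC); rewrite E.
have c3 : chs [set u in [:: q; d; q'; d']].
  have /and3P[_ dq dq'] := H _ dC; have /and3P[_ dq1 dq1'] := H' _ dC'.
  by apply: (@chs_k4m _ _ q d q' d') => //; try adjt; apply: sub_set_seq.
move: us; rewrite /= !inE !negb_or => /and4P[/and3P[npq npp npq'] /andP[nqp' nqq'] np'q' _].
apply: (win2 oF CF C'F nCC cs cs' c3).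
- apply: disjoint_mem => u; rewrite !in_setU1 !in_setD1.
  case/orP=> [/eqP->|/andP[_ uC]]; case/orP=> [/eqP E|/andP[_ uC']].
  + by rewrite E eqxx in npp.
  + by rewrite (negPf (mem_rest_notin C'F p'R)) in uC'.
  + by rewrite E (negPf (mem_rest_notin CF pR)) in uC.
  + exact: (disjointE dCC uC uC').
- apply: disjoint_mem => u; rewrite in_setU1 in_setD1 !inE.
  case/orP=> [/eqP->|/andP[nud uC]].
    by rewrite (eq_sym p' q) (negPf nqp') (negPf np'q') !(eq_sym p') (negPf (nR _ _ _ CF dC p'R)) (negPf (nR _ _ _ C'F dC' p'R)).
  rewrite (negPf nud) (negPf (nR _ _ _ CF uC qR)) (negPf (nR _ _ _ CF uC q'R)) /=.
  by move/eqP => E; apply: (disjointE dCC uC); rewrite E.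
- apply: disjoint_mem => u; rewrite in_setU1 in_setD1 !inE.
  case/orP=> [/eqP->|/andP[nud uC]].
    by rewrite (negPf npq) (negPf npq') !(eq_sym p) (negPf (nR _ _ _ CF dC pR)) (negPf (nR _ _ _ C'F dC' pR)).
  rewrite (negPf nud) (negPf (nR _ _ _ C'F uC qR)) (negPf (nR _ _ _ C'F uC q'R)) /= orbF.
  by move/eqP => E; apply: (disjointE dCC dC); rewrite -E.
- apply/subsetP => u /(subsetP (sw_sub C d p'R)); rewrite !in_setU.
  by case/orP=> ->; rewrite ?orbT.
- apply/subsetP => u /(subsetP (sw_sub C' d' pR)); rewrite !in_setU.
  by case/orP=> ->; rewrite ?orbT.
- apply/subsetP => u; rewrite inE => uI; rewrite !in_setU.
  by move: uI; rewrite !inE -!/(_ \in rest F) => /or4P[]/eqP->; rewrite ?dC ?dC' ?qR ?q'R ?orbT // -in_setC ?qR ?q'R ?orbT.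
Qed.

(** [C] receives at most four edges from [u1] and [u3], two below the average, so some member [E]
    receives more than six and is a K_4. The cycle vertex that [E] misses is then [u2] or [u4], and
    [two_k4] applies. *)
Lemma cyc4_nozero C u1 u2 u3 u4 : ham [:: u1; u2; u3; u4] -> cycle adj [:: u1; u2; u3; u4] ->
  C \in F -> cl4 C -> (forall z, z \in C ->
   forall v, v \in [:: u1; u2; u3; u4] -> adj z v = (v != u1)) -> False.
Proof.
set P := (X in ham X) => hP cP CF cl HC; have [_ uP eP] := hP.
have mP u : u \in P -> u \in R by rewrite eP.
have [m1 m2 m3 m4] : [/\ u1 \in P, u2 \in P, u3 \in P & u4 \in P] by split; rewrite !inE eqxx ?orbT.
have [p12 p23 p34 p41] : [/\ adj u1 u2, adj u2 u3, adj u3 u4 & adj u4 u1].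
  by move: cP => /= /and5P[-> -> -> ->].
have zero E (u v : G) : E \in F -> cl4 E -> (forall z, z \in E -> forall v, v \in P -> adj z v = (v != u)) ->
    u \in P -> nb u E = 0 /\ nb v E <= 4.
  move=> EF clE HE uI; split; last by rewrite -clE.1 nb_le.
  by apply: eq_card0 => z; rewrite inE; case: (boolP (z \in E)) => //= zE; rewrite adjC HE // eqxx.
case: (boolP [exists E in F, 6 < nb u1 E + nb u3 E]) => [/exists_inP[E EF lt]|]; last first.
  rewrite negb_exists_in => /forall_inP H.
  have [_ o1 _] := cyc4_nb oF hP cP CF.
  have [n1 n3] := zero C u1 u3 CF cl HC m1.
  have := @loads_lt _ _ _ oF [:: u1; u3] 6 2 C _ CF.
  rewrite !big_cons !big_nil => /(_ _)/(_ _)-h; have {}h := h ltac:(move=> E EF; rewrite !big_cons big_nil; move: (H E EF); clear; lia)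
    ltac:(rewrite n1; move: n3; clear; lia).
  by move: h o1; clear; lia.
have clE : cl4 E.
  case: (dichotomy oF EF) => // le3; have := le3 _ (mP _ m1); have := le3 _ (mP _ m3).
  by move: lt; clear; lia.
have [v vI HE] := cyc4_zero oF hP cP EF clE.
have nCE : C != E.
  apply: contraTneq lt => <-; have [-> n3] := zero C u1 u3 CF cl HC m1.
  by rewrite -leqNgt; move: n3; clear; lia.
move: uP; rewrite /= !inE !negb_or => /and4P[/and3P[n12 n13 n14] /andP[n23 n24] n34 _].
have n1 (a b : G) : a != b -> b != a by rewrite eq_sym.
move: vI HE; rewrite !inE => /or4P[]/eqP-> HE.
- have [k1 k3] := zero E u1 u3 EF clE HE m1; move: lt; rewrite k1; move: k3; clear; lia.
- apply: (@two_k4 C E u1 u3 u2 u4 CF EF nCE cl clE) => //.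
  + by apply/allP; rewrite /= !mP.
  + by rewrite /= !inE !negb_or n13 n12 n14 (n1 _ _ n23) n34 n24.
  + by move=> z zC; rewrite !HC // !(n1 u1).
  + by move=> z zC; rewrite !HE // n12 (n1 _ _ n23) (n1 _ _ n24).
- have [k1 k3] := zero E u3 u1 EF clE HE m3; move: lt; rewrite k1; move: k3; clear; lia.
- apply: (@two_k4 C E u1 u3 u4 u2 CF EF nCE cl clE) => //; try adjt.
  + by apply/allP; rewrite /= !mP.
  + by rewrite /= !inE !negb_or n13 n12 n14 n34 (n1 _ _ n23) (n1 _ _ n24).
  + by move=> z zC; rewrite !HC // !(n1 u1).
  + by move=> z zC; rewrite !HE // n14 n34 n24.
Qed.

(** A K_4 would miss one vertex of the cycle, which a rotation turns into [u1]. Without K_4 all four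
    vertices have three neighbours in [C], and going over [u2] brings the side of [u1] back at
    [u3]. *)
Lemma cyc4_str u1 u2 u3 u4 C : ham [:: u1; u2; u3; u4] -> cycle adj [:: u1; u2; u3; u4] ->
  C \in F -> k33 C (nbs u1 C) /\ nbs u3 C = nbs u1 C.
Proof.
set P := (X in ham X) => hP cP CF; have [pP uP eP] := hP.
have mP u : u \in P -> u \in R by rewrite eP.
have [m1 m2 m3 m4] : [/\ u1 \in P, u2 \in P, u3 \in P & u4 \in P] by split; rewrite !inE eqxx ?orbT.
have [p12 p23 p34 p41] : [/\ adj u1 u2, adj u2 u3, adj u3 u4 & adj u4 u1].
  by move: cP => /= /and5P[-> -> -> ->].
have [h2 c2] := ham_rot hP cP (t := [:: u3; u4]) (s := [:: u1]) erefl.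
have [h3 c3] := ham_rot hP cP (t := [:: u4]) (s := [:: u1; u2]) erefl.
have [h4 c4] := ham_rot hP cP (t := [::]) (s := [:: u1; u2; u3]) erefl.
rewrite /= in h2 c2 h3 c3 h4 c4.
have ncl : ~ cl4 C.
  move=> cl; have [u uI H] := cyc4_zero oF hP cP CF cl.
  have H' (Q : seq G) : {subset Q <= P} -> forall z, z \in C -> forall v, v \in Q -> adj z v = (v != u).
    by move=> sQ z zC v /sQ; apply: H.
  have sub2 : {subset [:: u2; u3; u4; u1] <= P} by apply/allP; rewrite /= m1 m2 m3 m4.
  have sub3 : {subset [:: u3; u4; u1; u2] <= P} by apply/allP; rewrite /= m1 m2 m3 m4.
  have sub4 : {subset [:: u4; u1; u2; u3] <= P} by apply/allP; rewrite /= m1 m2 m3 m4.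
  move: uI H H'; rewrite !inE => /or4P[]/eqP-> H H'.
  - exact: (cyc4_nozero hP cP CF cl H).
  - exact: (@cyc4_nozero C u2 u3 u4 u1 h2 c2 CF cl (H' _ sub2)).
  - exact: (@cyc4_nozero C u3 u4 u1 u2 h3 c3 CF cl (H' _ sub3)).
  - exact: (@cyc4_nozero C u4 u1 u2 u3 h4 c4 CF cl (H' _ sub4)).
case: (dichotomy oF CF) => // le3.
have [k1 k2 k3 k4] : [/\ nb u1 C = 3, nb u2 C = 3, nb u3 C = 3 & nb u4 C = 3].
  have [] := cyc4_nb oF hP cP CF; rewrite !big_cons big_nil => S12 _ _.
  have l1 := le3 _ (mP _ m1); have l2 := le3 _ (mP _ m2).
  have l3 := le3 _ (mP _ m3); have l4 := le3 _ (mP _ m4).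
  by split; move: S12 l1 l2 l3 l4; clear; lia.
have n21 : u2 != u1 by rewrite eq_sym; apply: adj_neq.
have [] := member_type oF CF (mP _ m2) (mP _ m1) n21; rewrite ?k1 ?k2 //.
- case=> a [b [c [d dC]]].
  exfalso; apply: (@all3_dia _ _ _ oF C a b c d u1 [:: u2; u3; u4] CF dC (mP _ m1) (path_sorted pP)) => //.
  + by case/andP: uP.
  + exact: (subset_behead hP).
  + by rewrite k1.
  + by move=> u; rewrite !inE => /or3P[]/eqP->; rewrite ?k2 ?k3 ?k4.
move=> kA; split=> //.
have o2 := k33_opp oF CF kA (mP _ m1) (mP _ m2) p12 _ erefl.
have {}o2 := o2 ltac:(by rewrite k2).
have o3 := k33_opp oF CF (k33_compl kA) (mP _ m2) (mP _ m3) p23 _ o2.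
by rewrite o3 ?k3 // (k33_comm kA).
Qed.

End Cyclic3.

(** * Paths with named ends *)

Section Paths.
Variable G : sgraph.
Implicit Types (u v w x y z : G) (S A B C D L M N : {set G}) (s t : seq G).

Local Notation adj := (@adj G).

(** Both ends are named so that reversal and concatenation treat them alike. *)
Definition pth x y s := exists t, [/\ s = x :: t, sorted adj s & last x t = y].

Lemma pth1 x : pth x x [:: x]. Proof. by exists [::]. Qed.

Lemma pth_sorted x y s : pth x y s -> sorted adj s. Proof. by case=> t []. Qed.

Lemma pth_rev x y s : pth x y s -> pth y x (rev s).
Proof.
case=> t [-> ps <-]; exists (rev (belast x t)); split; last first.
- by case: t {ps} => //= z t; rewrite rev_cons last_rcons.
- by rewrite rev_sorted (eq_sorted (e' := adj)) // => u v; rewrite adjC.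
- by rewrite -rev_rcons -lastI.
Qed.

Lemma pth_cat x y x' y' s t : pth x y s -> pth x' y' t -> adj y x' -> pth x y' (s ++ t).
Proof.
case=> s' [-> ps <-] [t' [-> pt <-]] a; exists (s' ++ x' :: t'); split=> //.
  by rewrite /= cat_path /= a; apply/andP.
by rewrite last_cat.
Qed.

Lemma pth_head x y s : pth x y s -> x \in s. Proof. by case=> t [-> _ _]; apply: mem_head. Qed.

Lemma pth_last x y s : pth x y s -> y \in s.
Proof. by case=> t [-> _ <-]; apply: mem_last. Qed.

Lemma pth_size x y s : pth x y s -> 0 < size s. Proof. by case=> t [-> _ _]. Qed.

Lemma pth_neq x y s : pth x y s -> uniq s -> 1 < size s -> x != y.
Proof.
case=> [[|z t]] [-> _ <-] //= /andP[xt _] _.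
by apply: contraNneq xt => ->; apply: mem_last.
Qed.

Lemma pth_head_nb x y s : pth x y s -> 1 < size s -> exists2 w, w \in s & adj x w.
Proof.
case=> [[|z t]] [-> ps _] //= _; exists z; first by rewrite !inE eqxx orbT.
by case/andP: ps.
Qed.

Lemma pth_last_nb x y s : pth x y s -> 1 < size s -> exists2 w, w \in s & adj y w.
Proof.
move=> /pth_rev/pth_head_nb; rewrite size_rev => H /H[w]; rewrite mem_rev => ? ?; by exists w.
Qed.

Lemma count_gt1 (a : pred G) u v s : u \in s -> v \in s -> u != v -> a u -> a v -> 1 < count a s.
Proof.
move=> us vs nuv au av; rewrite -size_filter; have: {subset [:: u; v] <= filter a s}.
  by apply/allP; rewrite /= !mem_filter au av us vs.
by move/(uniq_leq_size _); apply; rewrite /= inE nuv.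
Qed.

Lemma count_gt2 (a : pred G) u v w s : u \in s -> v \in s -> w \in s -> uniq [:: u; v; w] ->
  a u -> a v -> a w -> 2 < count a s.
Proof.
move=> us vs ws nuv au av aw; rewrite -size_filter; have: {subset [:: u; v; w] <= filter a s}.
  by apply/allP; rewrite /= !mem_filter au av aw us vs ws.
by move/(uniq_leq_size _); apply.
Qed.

Lemma chs_closep S z x y s : pth x y s -> uniq (z :: s) -> adj z x -> adj z y ->
  1 < count (adj x) s -> {subset z :: s <= S} -> chs S.
Proof.
case=> t [-> ps <-] us zx zy c2 sS; apply: (chs_close ps us) => //.
by move: c2; rewrite /= adj_irr.
Qed.

Lemma chs_closep_last S z x y s : pth x y s -> uniq (z :: s) -> adj z x -> adj z y ->
  1 < count (adj y) s -> {subset z :: s <= S} -> chs S.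
Proof.
move=> /pth_rev ps us zx zy c2 sS; apply: (@chs_closep S z y x (rev s) ps) => //.
- by move: us; rewrite /= mem_rev rev_uniq.
- by rewrite count_rev.
- by move=> u; rewrite in_cons mem_rev => h; apply: sS.
Qed.

Lemma chs_arcp S x y s a1 a2 b : pth x y s -> uniq (a1 :: a2 :: b :: s) -> 1 < size s ->
  adj x a1 -> adj x a2 -> adj y a2 -> adj b a1 -> adj b a2 ->
  {subset a1 :: a2 :: b :: s <= S} -> chs S.
Proof. by case=> t [-> ps <-] us st *; apply: (chs_arc (a1 := a1) (a2 := a2) (b := b) ps). Qed.

Variables (m : nat) (F : {set {set G}}).
Hypothesis oF : opt m F.

Local Notation R := (rest F).
Local Notation load := (load F).

Lemma pth_end_nb x y s : pth x y s -> uniq s -> {subset s <= R} ->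
  (forall u, u \in R -> adj x u -> u \in s) -> nb x R <= 2.
Proof.
case=> t [-> ps _] us sR H; apply: (end_nb oF ps us sR) => u uR xu.
move: (H u uR xu); rewrite in_cons => /orP[/eqP E|//].
by rewrite E adj_irr in xu.
Qed.

Lemma load_pair x y a b : x != y -> adj x a -> adj x b -> uniq [:: a; b; y] ->
  a \in R -> b \in R -> y \in R -> nb x R <= 2 -> nb y R <= 2 ->
  6 * m <= load x + load y.
Proof.
move=> nxy xa xb us aR bR yR dx dy.
have axy : ~~ adj x y.
  by apply/negP => axy; move: dx; rewrite leqNgt (nb_ge3 aR bR yR us xa xb axy).
by have := ore_load oF nxy axy; move: dx dy; clear; lia.
Qed.

Lemma win_sw_seq C z v s : C \in F -> z \in C -> v \in R -> chs (sw C z v) ->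
  v \notin s -> {subset s <= R} -> chs [set u in z :: s] -> False.
Proof.
move=> CF zC vR cs vs sR c; apply: (win_sw oF CF zC vR cs); apply: chsS c.
apply/subsetP => u; rewrite inE in_cons in_setU1 in_setD1 => /orP[->//|us].
by rewrite (sR _ us) andbT; apply/orP; right; apply: contraNneq vs => <-.
Qed.

Lemma notin_R C z s : C \in F -> z \in C -> {subset s <= R} -> z \notin s.
Proof. by move=> CF zC sR; apply/negP => /sR zR; have := mem_rest_notin CF zR; rewrite zC. Qed.

(** [v] takes the place of [z]: the cycle [v b1 a2 b2 a3 b3] has the chord [v b2]. *)
Lemma k33_sw C A z v : k33 C A -> C \in F -> v \in R -> z \in A ->
  (forall b, b \in C :\: A -> adj v b) -> chs (sw C z v).
Proof.
move=> kC CF vR zA H; have [sAC A3 C6 kA] := kC.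
have vC := mem_rest_notin CF vR.
have B3 : #|C :\: A| = 3 by rewrite cardsD (setIidPr sAC) A3 C6.
have [b1 [b2 [b3 [ub eB]]]] := set3 B3.
have : 1 < #|A :\ z| by have := cardsD1 z A; rewrite zA A3; clear; lia.
case/card_gt1P=> a2 [a3 []]; rewrite !inE => /andP[a2z a2A] /andP[a3z a3A] na.
have [a2C a3C] : a2 \in C /\ a3 \in C by split; apply: (subsetP sAC).
have bP b : b \in [:: b1; b2; b3] -> [/\ b \in sw C z v, b \notin A, adj v b, adj a2 b & adj a3 b].
  rewrite -eB => bB; have /setDP[bC bA] := bB; split=> //; try exact: kA; last exact: H.
  by rewrite in_setU1 in_setD1 bC andbT; apply/orP; right; apply: contraNneq bA => ->.
have [m1 n1 v1 a21 a31] := bP b1 (mem_head _ _).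
have [m2 n2 v2 a22 a32] : [/\ b2 \in sw C z v, b2 \notin A, adj v b2, adj a2 b2 & adj a3 b2].
  by apply: bP; rewrite !inE eqxx orbT.
have [m3 n3 v3 a23 a33] : [/\ b3 \in sw C z v, b3 \notin A, adj v b3, adj a2 b3 & adj a3 b3].
  by apply: bP; rewrite !inE eqxx !orbT.
have ne b a : b \notin A -> a \in A -> (b != a) && (a != b).
  by move=> bA aA; rewrite (eq_sym a) andbb; apply: contraNneq bA => ->.
have nv u : u \in C -> v != u by move=> uC; apply: contraNneq vC => ->.
have bC b : b \in [:: b1; b2; b3] -> b \in C by rewrite -eB => /setDP[].
apply: (@chs_mk _ _ v [:: b1; a2] b2 [:: a3; b3]) => //.
- move: ub; rewrite /= !inE !negb_or => /and3P[/andP[-> ->] -> _].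
  have [-> -> -> -> ->] : [/\ v != b1, v != a2, v != b2, v != a3 & v != b3].
    by split; apply: nv => //; apply: bC; rewrite !inE eqxx ?orbT.
  rewrite na.
  have /andP[-> _] := ne _ _ n1 a2A; have /andP[-> _] := ne _ _ n1 a3A.
  have /andP[_ ->] := ne _ _ n2 a2A; have /andP[-> _] := ne _ _ n2 a3A.
  by have /andP[_ ->] := ne _ _ n3 a2A; have /andP[_ ->] := ne _ _ n3 a3A.
- by rewrite /= v1 (adjC b1) a21 a22 (adjC b2) a32 a33 (adjC b3) v3.
- by apply/allP; rewrite /= m1 m2 m3 !in_setU1 !in_setD1 eqxx a2C a3C a2z a3z !orbT.
Qed.

End Paths.

(** * Dumbbells *)

Section Dumbbell.
Variable G : sgraph.
Implicit Types (u v w x y z : G) (S A B C D : {set G}) (s t : seq G).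

Local Notation adj := (@adj G).

Variables (m : nat) (F : {set {set G}}).
Hypothesis oF : opt m F.

Local Notation R := (rest F).

(* Two paths [L], [N] closed into cycles by the two ends of a connecting path [M]. *)
Definition db x x' (L : seq G) (m0 m1 : G) (M : seq G) y' y (N : seq G) :=
  [/\ pth x x' L, pth m0 m1 M & pth y' y N] /\
  [/\ uniq (L ++ M ++ N), {subset L ++ M ++ N <= R}, (1 < size L) && (1 < size N)
    & [&& adj x m0, adj x' m0, adj y' m1 & adj y m1]].

Lemma db_flipL x x' L m0 m1 M y' y N :
  db x x' L m0 m1 M y' y N -> db x' x (rev L) m0 m1 M y' y N.
Proof.
case=> [[pL pM pN] [us sR sz /and4P[a1 a2 a3 a4]]]; split.
  by split=> //; apply: pth_rev.
have pm : perm_eq (rev L ++ M ++ N) (L ++ M ++ N) by permt.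
split; rewrite ?size_rev ?a1 ?a2 ?a3 ?a4 //; first by rewrite (perm_uniq pm).
by move=> u; rewrite (perm_mem pm); apply: sR.
Qed.

Lemma db_rev x x' L m0 m1 M y' y N :
  db x x' L m0 m1 M y' y N -> db y y' (rev N) m1 m0 (rev M) x' x (rev L).
Proof.
case=> [[pL pM pN] [us sR sz /and4P[a1 a2 a3 a4]]]; split.
  by split; apply: pth_rev.
have pm : perm_eq (rev N ++ rev M ++ rev L) (L ++ M ++ N) by permt.
split; rewrite ?size_rev ?a1 ?a2 ?a3 ?a4 //; first by rewrite (perm_uniq pm).
  by move=> u; rewrite (perm_mem pm); apply: sR.
by rewrite andbC.
Qed.

Lemma db_flipN x x' L m0 m1 M y' y N :
  db x x' L m0 m1 M y' y N -> db x x' L m0 m1 M y y' (rev N).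
Proof.
move=> h; have := db_rev (db_flipL (db_rev h)).
by rewrite !revK.
Qed.

(** [x] replaces [z], and [z] closes the path from [x'] through [M] and [N] to [y]. The chord is at
    [y], which has the two neighbours [m1] and [w] on this path. *)
Lemma db_win x x' L m0 m1 M y' y N C z : db x x' L m0 m1 M y' y N ->
  C \in F -> z \in C -> chs (sw C z x) -> adj z x' -> adj z y -> False.
Proof.
case=> [[pL pM pN] [us sR /andP[sL sN] /and4P[a1 a2 a3 a4]]] CF zC cs zx' zy.
have x'L := pth_last pL; have xL := pth_head pL.
have mR u : u \in L ++ M ++ N -> u \in R by apply: sR.
have xR : x \in R by apply: mR; rewrite mem_cat xL.
have sub : {subset x' :: M ++ N <= L ++ M ++ N}.
  by move=> u; rewrite in_cons !mem_cat => /orP[/eqP->|->]; rewrite ?x'L ?orbT.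
have us' : uniq (x' :: M ++ N).
  move: us; rewrite cat_uniq => /and3P[_ h u2]; rewrite cons_uniq u2 andbT.
  by apply: contra h => h; apply/hasP; exists x'.
have pD : pth x' y (x' :: M ++ N).
  by apply: (pth_cat (pth1 x') (pth_cat pM pN _)) => //; rewrite adjC.
apply: (win_sw_seq oF CF zC xR cs (s := x' :: M ++ N)).
- rewrite in_cons negb_or; have uL : uniq L by move: us; rewrite cat_uniq => /andP[].
  rewrite (pth_neq pL uL sL) /=; move: us; rewrite cat_uniq => /and3P[_ h _].
  by apply: contra h => h; apply/hasP; exists x.
- by move=> u /sub/sR.
have [w wN yw] := pth_last_nb pN sN; have m1M := pth_last pM.
apply: (@chs_closep_last _ _ z _ _ _ pD) => //; last exact: sub_set_seq.
- rewrite cons_uniq us' andbT; apply: (notin_R CF zC) => u /sub; exact: sR.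
- apply: (@count_gt1 _ _ m1 w) => //; try by rewrite in_cons mem_cat ?m1M ?wN ?orbT.
  move: us'; rewrite cons_uniq cat_uniq => /and4P[_ _ h _].
  by apply: contraNneq h => E; apply/hasP; exists w; rewrite //= -E.
Qed.

Lemma db_winL x x' L m0 m1 M y' y N C z : db x x' L m0 m1 M y' y N ->
  C \in F -> z \in C -> chs (sw C z x) -> adj z x' -> adj z y || adj z y' -> False.
Proof.
move=> h CF zC cs zx' /orP[zy|zy]; first exact: (db_win h CF zC cs zx' zy).
exact: (db_win (db_flipN h) CF zC cs zx' zy).
Qed.

Lemma db_mem x x' L m0 m1 M y' y N : db x x' L m0 m1 M y' y N ->
  [/\ x \in R, x' \in R, y' \in R & y \in R] /\ x != x' /\ y' != y.
Proof.
case=> [[pL pM pN] [us sR /andP[sL sN] _]].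
have [uL uN] : uniq L /\ uniq N.
  by move: us; rewrite !cat_uniq => /and3P[-> _ /and3P[_ _ ->]].
split; last by split; [apply: pth_neq pL uL sL|apply: pth_neq pN uN sN].
by split; apply: sR; rewrite !mem_cat ?(pth_head pL) ?(pth_last pL) ?(pth_head pN) ?(pth_last pN) ?orbT.
Qed.

(** [x] or [x'] sees at least three vertices of [C], and [y] or [y'] at least two, so some [z] is
    seen from both cycles. If [z] is adjacent to [x'], then [x] has at most one neighbour in
    [C :\ z], as it could replace [z] otherwise; the same holds with [x] and [x'] interchanged. This
    leaves fewer than six edges. *)
Lemma db_cl4 x x' L m0 m1 M y' y N C : db x x' L m0 m1 M y' y N ->
  C \in F -> cl4 C -> 6 <= nb x C + nb x' C -> 4 <= nb y C + nb y' C -> False.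
Proof.
move=> h CF cl lx ly; have [[xR x'R y'R yR] _] := db_mem h.
have cU u v : nb u C + nb v C <= 2 * #|nbs u C :|: nbs v C|.
  rewrite /nb -cardsUI mulSn mul1n leq_add2l; apply: subset_leq_card.
  by apply: subset_trans (subsetIl _ _) (subsetUl _ _).
have [z] : exists z, z \in (nbs x C :|: nbs x' C) :&: (nbs y C :|: nbs y' C).
  apply/set0Pn; rewrite -card_gt0; have c1 := cU x x'; have c2 := cU y y'.
  have := cardsUI (nbs x C :|: nbs x' C) (nbs y C :|: nbs y' C).
  have : #|(nbs x C :|: nbs x' C) :|: (nbs y C :|: nbs y' C)| <= 4.
    by rewrite -cl.1; apply: subset_leq_card; apply/subsetP => u; rewrite !inE -!andb_orr => /andP[].
  by move: c1 c2 lx ly; clear; lia.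
rewrite !inE -!andb_orr => /andP[/andP[zC zx] /andP[_ zy]].
have zy' : adj z y || adj z y' by rewrite adjC [adj z y']adjC.
have nx := nb_le4 oF CF xR; have nx' := nb_le4 oF CF x'R.
have Ex := nbD1 x zC; have Ex' := nbD1 x' zC.
have k : adj x z -> nb x' (C :\ z) <= 1.
  move=> xz; rewrite leqNgt; apply/negP => lt.
  by apply: (db_winL (db_flipL h) CF zC (cl4_sw CF cl zC x'R lt) _ zy'); rewrite adjC.
have k' : adj x' z -> nb x (C :\ z) <= 1.
  move=> xz; rewrite leqNgt; apply/negP => lt.
  by apply: (db_winL h CF zC (cl4_sw CF cl zC xR lt) _ zy'); rewrite adjC.
move: k k' zx Ex Ex' lx nx nx'; case: (adj x z); case: (adj x' z) => //= k k' _.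
- have := k isT; have := k' isT; clear; lia.
- have := k isT; clear; lia.
- have := k' isT; clear; lia.
Qed.

(** One chorded cycle is [N] closed by [a1], [a2], [b1]. In the other, [a3] is adjacent to [q], [x']
    and [x] on the path that runs from [q] over [g] along [L] to [x'], then over [m0] to [x]. *)
Lemma db_second q (a1 a2 a3 b1 g : G) x x' t m0 m1 M y' y N C :
  db x x' (x :: g :: t) m0 m1 M y' y N -> C \in F -> 0 < size t ->
  uniq ([:: a1; a2; a3; b1] ++ q :: (x :: g :: t) ++ M ++ N) ->
  {subset [:: a1; a2; a3; b1; q] <= C :|: R} ->
  (forall a, a \in [:: a1; a2; a3] -> [&& adj x a, adj x' a, adj y' a, adj y a & adj b1 a && adj q a]) ->
  adj q g -> False.
Proof.
case=> [[pL pM pN] [us sR /andP[_ sN] /and4P[c1 c2 c3 c4]]] CF st ua sC H qg.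
set L := x :: g :: t in pL us sR ua.
have m0M := pth_head pM.
have /and5P[x1 x'1 y'1 y1 /andP[b11 q1]] := H a1 (mem_head _ _).
have h2 : a2 \in [:: a1; a2; a3] by rewrite !inE eqxx orbT.
have h3 : a3 \in [:: a1; a2; a3] by rewrite !inE eqxx !orbT.
have /and5P[x2 x'2 y'2 y2 /andP[b12 q2]] := H a2 h2.
have /and5P[x3 x'3 y'3 y3 /andP[b13 q3]] := H a3 h3.
pose s1 := a1 :: a2 :: b1 :: N; pose p := q :: (g :: t) ++ [:: m0; x]; pose s2 := a3 :: p.
have pm : perm_eq (s1 ++ s2) ([:: a1; a2; a3; b1] ++ q :: L ++ [:: m0] ++ N).
  by rewrite /s1 /s2 /p /L; permt.
have us0 : uniq ([:: a1; a2; a3; b1] ++ q :: L ++ [:: m0] ++ N).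
  case: pM => tM [EM _ _]; rewrite EM in ua.
  apply: subseq_uniq ua; apply: cat_subseq => //.
  rewrite /= !eqxx; apply: cat_subseq => //; rewrite /= eqxx.
  exact: suffix_subseq.
have us12 : uniq (s1 ++ s2) by rewrite (perm_uniq pm).
have [u1 [_ u2]] : uniq s1 /\ (~~ has (mem s1) s2 /\ uniq s2).
  by move: us12; rewrite cat_uniq => /and3P[].
have x'L : x' \in g :: t.
  by case: pL => t' [E _ <-]; case: E => <-; apply: (mem_last g t).
have pt : sorted adj p.
  case: pL => t' [E ps El]; case: E => E; rewrite -E /= in El.
  move: ps => /= /andP[_ ps]; rewrite /p /= qg cat_path ps /=.
  by rewrite El c2 adjC c1.
apply: (@win1s _ _ _ oF C s1 s2 CF).
- apply: (chs_arcp pN u1) => //; exact: sub_set_seq.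
- apply: (chs_path3 pt u2); last exact: sub_set_seq.
  apply: (@count_gt2 _ _ q x' x); rewrite ?(adjC a3) //.
  + by rewrite mem_head.
  + by rewrite /p in_cons mem_cat x'L orbT.
  + by rewrite /p !(in_cons, mem_cat) eqxx !orbT.
  + have : uniq p by move: u2; rewrite /s2 cons_uniq => /andP[].
    rewrite /p -cat_cons cat_uniq cons_uniq => /and3P[/andP[qn _] /hasPn hx _].
    have xn : x \notin q :: g :: t by apply: hx; rewrite !inE eqxx orbT.
    rewrite /= !inE !negb_or; have -> : q != x' by apply: contraNneq qn => ->.
    have -> : q != x by move: xn; rewrite in_cons negb_or eq_sym => /andP[].
    by rewrite /= ?andbT; apply: contraNneq xn => <-; rewrite in_cons x'L orbT.
- exact: us12.
- move=> u; rewrite (perm_mem pm) mem_cat in_cons => /or3P[uI|/eqP->|uI].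
  + by apply: sC; move: uI; rewrite !inE => /or4P[]->; rewrite ?orbT.
  + by apply: sC; rewrite !inE eqxx !orbT.
  + apply: inU_R; apply: sR; rewrite !mem_cat.
    have : (u \in L) || ((u \in [:: m0]) || (u \in N)) by rewrite -!mem_cat.
    by rewrite mem_seq1 => /or3P[->|/eqP->|->]; rewrite ?m0M ?orbT.
Qed.

End Dumbbell.

Section Dumbbell2.
Variable G : sgraph.
Implicit Types (u v w x y z : G) (S A B C D : {set G}) (s t : seq G).

Local Notation adj := (@adj G).

Variables (m : nat) (F : {set {set G}}).
Hypothesis oF : opt m F.

Local Notation R := (rest F).
Local Notation load := (load F).

(** In a member [g] sees only vertices of [nbs x C], and at most one, since two would form a K_4
    minus an edge with the edge [x g]. So [y] and [g] send at most [4 * m] edges to the members;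
    with five uncovered neighbours this is less than [6 * m + 4]. *)
Lemma second_vertex x g y : 0 < m -> x \in R -> g \in R -> adj x g -> y != g -> ~~ adj y g ->
  nb y R <= 2 -> nb g R <= 3 ->
  (forall C, C \in F -> [/\ k33 C (nbs x C), nbs y C = nbs x C &
     forall b, b \in C -> adj g b -> b \in nbs x C]) -> False.
Proof.
move=> m0 xR gR xg nyg ayg dy dg H.
have lg : load g <= 1 * m.
  apply: (sumF_le oF) => C CF; have [[sA A3 C6 kA] _ gA] := H C CF.
  rewrite leqNgt; apply/negP => /card_gt1P[a [b []]]; rewrite !inE.
  move=> /andP[aC ga] /andP[bC gb] nab.
  have := gA a aC ga; have := gA b bC gb; rewrite !nbsP => /andP[_ xb] /andP[_ xa].
  apply: (@no_k4m _ _ _ oF C x a g b CF) => //; rewrite ?C6 //; try adjt.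
  by apply/allP; rewrite /= (inU_R _ xR) (inU_R _ gR) !inU_C.
have ly : load y <= 3 * m.
  by apply: (sumF_le oF) => C CF; have [[_ A3 _ _] E _] := H C CF; rewrite -nbs_card E A3.
have := ore_load oF nyg ayg; move: lg ly dy dg m0; clear; lia.
Qed.

Lemma k33_pick C A q : k33 C A -> q \notin A -> exists a1 a2 a3 b,
  [/\ uniq [:: a1; a2; a3; b; q], {subset [:: a1; a2; a3; b] <= C},
      {subset [:: a1; a2; a3] <= A} & forall a, a \in [:: a1; a2; a3] -> adj b a].
Proof.
move=> kC qA; have [a1 [a2 [a3 [b1 [b2 [b3 [us sA sB sC kab]]]]]]] := k33_list kC.
have qnA : q \notin [:: a1; a2; a3] by apply/negP => /sA; apply/negP.
have [b bI nbq] : exists2 b, b \in [:: b1; b2] & b != q.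
  case: (eqVneq b1 q) => [E|n]; last by exists b1; rewrite ?inE ?eqxx.
  exists b2; rewrite ?inE ?eqxx ?orbT // -E eq_sym.
  by move: us; rewrite /= !inE !negb_or => /and5P[_ _ _ /andP[-> _] _].
have bI3 : b \in [:: b1; b2; b3] by move: bI; rewrite !inE => /orP[]->; rewrite ?orbT.
exists a1, a2, a3, b; split=> //; last by move=> a aI; rewrite adjC; apply: kab.
  have ua : uniq ([:: a1; a2; a3] ++ [:: b1; b2; b3]) by [].
  move: ua; rewrite cat_uniq => /and3P[ua /hasPn h _].
  have bn := h b bI3; rewrite -[X in uniq X]/([:: a1; a2; a3] ++ [:: b; q]) cat_uniq ua /=.
  by rewrite (negPf bn) (negPf qnA) mem_seq1 nbq.
move=> u; rewrite -[X in u \in X]/([:: a1; a2; a3] ++ [:: b]) mem_cat mem_seq1.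
case/orP=> [uI|/eqP->]; apply: sC; first by move: uI; rewrite !inE => /or3P[]->; rewrite ?orbT.
by move: bI3; rewrite !inE => /or3P[]->; rewrite ?orbT.
Qed.

(** A vertex off the dumbbell that sees [g] and the side seen by the ends would give two chorded
    cycles by [db_second]. Hence [g] sees no vertex of the other side of a member and no uncovered
    vertex off the dumbbell, and [second_vertex] applies. The last hypothesis is vacuous if the
    dumbbell spans the rest. *)
Lemma db_k33 x g x' t m0 m1 M y' y N : db F x x' (x :: g :: t) m0 m1 M y' y N -> 0 < m ->
  nb x R <= 2 -> nb y R <= 2 ->
  (forall C, C \in F -> k33 C (nbs x C) /\
     forall e, e \in [:: x'; y'; y] -> nbs e C = nbs x C) ->
  (forall q, q \in R -> q \notin (x :: g :: t) ++ M ++ N -> adj q g ->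
     forall C, C \in F -> nbs q C = nbs x C) -> False.
Proof.
move=> h m_gt0 dx dy H HW; have [[pL pM pN] [us sR /andP[_ sN] /and4P[c1 c2 c3 c4]]] := h.
have [[xR x'R y'R yR] _] := db_mem h.
have gR : g \in R by apply: sR; rewrite !in_cons eqxx orbT.
have xg : adj x g by case: pL => t' [[<-] /= /andP[]].
have /card_gt0P[C0 C0F] : 0 < #|F| by rewrite (opt_card oF).
have st : 0 < size t.
  case: t pL {h us sR HW} => // pL; have Eg : x' = g by case: pL => t' [[<-] _ <-].
  have [kC /(_ x')E] := H C0 C0F; exfalso.
  apply: (k33_adj_neq oF C0F kC xR gR xg erefl); rewrite -Eg; apply: E.
  by rewrite inE eqxx.
have key q C : C \in F -> q \in C :|: R -> q \notin nbs x C -> q \notin (x :: g :: t) ++ M ++ N ->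
    (forall a, a \in nbs x C -> adj q a) -> ~~ adj q g.
  move=> CF qCR qA qn qadj; apply/negP => qg; have [kC E] := H C CF.
  have [a1 [a2 [a3 [b [ua sC sA ba]]]]] := k33_pick kC qA.
  apply: (@db_second _ _ _ oF q a1 a2 a3 b g x x' t m0 m1 M y' y N C h CF st) => //.
  - have uC : uniq [:: a1; a2; a3; b] := subseq_uniq (prefix_subseq [:: a1; a2; a3; b] [:: q]) ua.
    rewrite cat_uniq uC cons_uniq us qn !andbT.
    apply/hasPn => u; rewrite in_cons => /orP[/eqP->|/sR uR].
      have : uniq ([:: a1; a2; a3; b] ++ [:: q]) by [].
      by rewrite cat_uniq => /and3P[_ /hasPn/(_ q (mem_head _ _))].
    apply/negP => /sC; apply/negP; exact: mem_rest_notin uR.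
  - move=> u; rewrite -[X in u \in X]/([:: a1; a2; a3; b] ++ [:: q]) mem_cat mem_seq1.
    by case/orP=> [/sC/inU_C//|/eqP->].
  - move=> a aI; have aA := sA a aI.
    have Ex' := E x'; have Ey' := E y'; have Ey := E y; rewrite !inE !eqxx !orbT in Ex' Ey' Ey.
    rewrite (side_adj erefl aA) (side_adj (Ex' isT) aA) (side_adj (Ey' isT) aA).
    by rewrite (side_adj (Ey isT) aA) ba // qadj.
have [w wN yw] := pth_last_nb pN sN.
have gL : g \in x :: g :: t by rewrite !inE eqxx orbT.
have dis u : u \in M ++ N -> u \notin x :: g :: t.
  by move: us; rewrite cat_uniq => /and3P[_ /hasPn hh _] /hh.
have ne u v : u \in M ++ N -> v \in x :: g :: t -> u != v.
  by move=> /dis h1 h2; apply: contraNneq h1 => ->.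
have m1M := pth_last pM; have yN := pth_last pN.
apply: (@second_vertex x g y) => //.
- by apply: ne; rewrite // mem_cat yN orbT.
- apply/negP => yg; move: dy; rewrite leqNgt => /negP[].
  apply: (@nb_ge3 _ y m1 w g) => //; try (apply: sR; rewrite !mem_cat ?m1M ?wN ?orbT //).
  have n1 : m1 != g by apply: ne; rewrite // mem_cat m1M.
  have n2 : w != g by apply: ne; rewrite // mem_cat wN orbT.
  rewrite /= !inE negb_or n1 n2 !andbT.
  move: us; rewrite !cat_uniq => /and3P[_ _ /and3P[_ /hasPn hh _]].
  by apply: contraTneq wN => <-; apply: contraL m1M => /hh.
- have qn u : u \in R -> adj g u -> u \in (x :: g :: t) ++ M ++ N.
    move=> uR gu; apply/negPn/negP => un; have ug : adj u g by rewrite adjC.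
    have E := HW u uR un ug C0 C0F; have [kC _] := H C0 C0F.
    have : ~~ adj u g; last by rewrite ug.
    apply: (key u C0) => //; first exact: inU_R.
      by rewrite nbsP (negPf (mem_rest_notin C0F uR)).
    by move=> a aA; apply: (side_adj E).
  apply: leq_trans (nb_le_count qn) _; rewrite /= adj_irr.
  have : count (adj g) (t ++ M ++ N) <= 2.
    have u3 : uniq (x :: (g :: t ++ M ++ N)) by [].
    have pall : sorted adj ((x :: g :: t) ++ M ++ N).
      apply: (pth_sorted (pth_cat pL (pth_cat pM pN _) _)) => //; by rewrite adjC.
    apply: (path3_rest oF).
    + by move: pall => /= /andP[_ /path_sorted].
    + by case/andP: u3.
    + by move=> u uI; apply: sR; rewrite /= in_cons uI orbT.
  by case: (adj g x); clear; lia.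
move=> C CF; have [kC E] := H C CF; split=> //; first by apply: E; rewrite !inE eqxx !orbT.
move=> b bC gb; apply/negPn/negP => bA; have : ~~ adj b g; last by rewrite adjC gb.
apply: (key b C) => //; first exact: inU_C.
  by apply/negP => /sR bR; have := mem_rest_notin CF bR; rewrite bC.
by move=> a aA; have [sAC _ _ kA] := kC; rewrite adjC; apply: kA.
Qed.

(** If [x'] saw the other side, take [z] on the side seen by [y]: of [x] and [x'] one sees the
    opposite side and can replace [z], while the other is adjacent to [z], as [y] is. *)
Lemma db_sides x x' L m0 m1 M y' y N C : db F x x' L m0 m1 M y' y N -> C \in F ->
  (forall e, e \in [:: x; x'; y'; y] -> nb e C = 3) -> k33 C (nbs x C) ->
  nbs x' C = nbs x C.
Proof.
move=> h CF n3 kC; have [[xR x'R y'R yR] _] := db_mem h.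
have n3' e : e \in [:: x; x'; y'; y] -> 2 < nb e C by move/n3->.
case: (k33_nb oF CF kC x'R (n3' x' _)) => // [|Ex']; first by rewrite !inE eqxx orbT.
have kB := k33_compl kC.
case: (k33_nb oF CF kC yR (n3' y _)) => [|Ey|Ey]; first by rewrite !inE eqxx !orbT.
- have /card_gt0P[z zA] : 0 < #|nbs x C| by have [_ -> _ _] := kC.
  have zC : z \in C by have [sA _ _ _] := kC; apply: (subsetP sA).
  exfalso; apply: (db_winL oF (db_flipL h) CF zC _ _ (z := z)).
  + by apply: (k33_sw kC CF x'R zA) => b bB; apply: (side_adj Ex').
  + by rewrite adjC (side_adj erefl zA).
  + by rewrite adjC (side_adj Ey zA).
- have /card_gt0P[z zB] : 0 < #|C :\: nbs x C| by have [_ -> _ _] := kB.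
  have zC : z \in C by have [sA _ _ _] := kB; apply: (subsetP sA).
  exfalso; apply: (db_winL oF h CF zC _ _ (z := z)).
  + by apply: (k33_sw kB CF xR zB) => b; rewrite (k33_comm kC); apply: (side_adj erefl).
  + by rewrite adjC (side_adj Ex' zB).
  + by rewrite adjC (side_adj Ey zB).
Qed.

Lemma db_ham x x' L m0 m1 M y' y N : db F x x' L m0 m1 M y' y N -> 0 < m ->
  {subset R <= L ++ M ++ N} -> False.
Proof.
move=> h m_gt0 cov; have [[pL pM pN] [us sR /andP[sL sN] /and4P[c1 c2 c3 c4]]] := h.
have [[xR x'R y'R yR] [nxx nyy]] := db_mem h.
have end_le (a a' b b' e0 e1 : G) (L' M' N' : seq G) : db F a a' L' e0 e1 M' b' b N' ->
    {subset R <= L' ++ M' ++ N'} -> nb a R <= 2.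
  case=> [[pL' pM' pN'] [us' sR' _ /and4P[d1 d2 d3 d4]]] cov'.
  have pp : pth a b (L' ++ M' ++ N').
    by apply: (pth_cat pL' (pth_cat pM' pN' _)) => //; rewrite adjC.
  by apply: (pth_end_nb oF pp us' sR') => u /cov'.
have covL : {subset R <= rev L ++ M ++ N} by move=> u /cov; rewrite !mem_cat mem_rev.
have covR : {subset R <= rev N ++ rev M ++ rev L}.
  by move=> u /cov; rewrite !mem_cat !mem_rev => /or3P[]->; rewrite ?orbT.
have covRL : {subset R <= rev (rev N) ++ rev M ++ rev L}.
  by move=> u /covR; rewrite !mem_cat !mem_rev.
have dx := end_le _ _ _ _ _ _ _ _ _ h cov.
have dx' := end_le _ _ _ _ _ _ _ _ _ (db_flipL h) covL.
have dy := end_le _ _ _ _ _ _ _ _ _ (db_rev h) covR.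
have dy' := end_le _ _ _ _ _ _ _ _ _ (db_flipL (db_rev h)) covRL.
have mm0 := pth_head pM.
have sides e f : e \in L -> adj e m0 -> f \in N -> (exists2 w, w \in L & adj e w) ->
    nb e R <= 2 -> nb f R <= 2 -> 6 * m <= load e + load f.
  move=> eL em0 fN [w wL ew] de df.
  have dis u : u \in M ++ N -> u \notin L.
    by move: us; rewrite cat_uniq => /and3P[_ /hasPn hh _] /hh.
  have ne u v : u \in L -> v \in M ++ N -> u != v.
    by move=> h1 /dis h2; apply: contraNneq h2 => <-.
  have nfm : m0 != f.
    move: us; rewrite !cat_uniq => /and3P[_ _ /and3P[_ /hasPn hh _]].
    by apply: contraNneq (hh f fN) => <-.
  apply: (load_pair oF _ ew em0) => //; try (apply: sR; rewrite !mem_cat ?wL ?mm0 ?fN ?orbT //).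
    by apply: ne; rewrite // mem_cat fN orbT.
  by rewrite /= !inE negb_or nfm !ne // mem_cat ?mm0 ?fN ?orbT.
have [w wL xw] := pth_head_nb pL sL; have [w' w'L x'w'] := pth_last_nb pL sL.
have o1 : 6 * m <= load x + load y.
  apply: (sides x y) => //; [exact: pth_head pL|exact: pth_last pN|by exists w].
have o2 : 6 * m <= load x' + load y'.
  apply: (sides x' y') => //; [exact: pth_last pL|exact: pth_head pN|by exists w'].
have mT : {subset [:: x; x'; y'; y] <= R} by apply/allP; rewrite /= xR x'R y'R yR.
(* Twelve edges would mean at least six from one pair of ends and at least four from the other,
   which [db_cl4] excludes. *)
have up C : C \in F -> cl4 C -> \sum_(u <- [:: x; x'; y'; y]) nb u C <= 11.
  move=> CF cl; rewrite !big_cons big_nil leqNgt; apply/negP => lt.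
  have [lx|lx] := leqP 6 (nb x C + nb x' C); case: (leqP 4 (nb y C + nb y' C)) => ly.
  - exact: (db_cl4 oF h CF cl lx ly).
  - have := nb_le4 oF CF xR; have := nb_le4 oF CF x'R; move: lx ly lt; clear; lia.
  - have := nb_le4 oF CF yR; have := nb_le4 oF CF y'R => l1 l2.
    by apply: (db_cl4 oF (db_rev h) CF cl); move: lx ly lt l1 l2; clear; lia.
  - move: lx ly lt; clear; lia.
have up' C : C \in F -> \sum_(u <- [:: x; x'; y'; y]) nb u C <= 12.
  move=> CF; case: (dichotomy oF CF) => [/(up C CF)/leqW //|le3].
  by apply: (@sum_nb_le _ _ 3) => u /mT/le3.
have ge : 12 * m <= \sum_(u <- [:: x; x'; y'; y]) load u.
  by rewrite !big_cons big_nil; move: o1 o2; clear; lia.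
have all3 C : C \in F -> forall e, e \in [:: x; x'; y'; y] -> nb e C = 3.
  move=> CF; have S12 := loads_eq oF up' ge CF.
  case: (dichotomy oF CF) => [/(up C CF)|le3]; first by rewrite S12.
  move: S12; rewrite !big_cons big_nil => S12.
  have l1 := le3 x xR; have l2 := le3 x' x'R; have l3 := le3 y' y'R; have l4 := le3 y yR.
  by move=> e; rewrite !inE => /or4P[]/eqP->; move: S12 l1 l2 l3 l4; clear; lia.
have kall C : C \in F -> k33 C (nbs x C).
  move=> CF; have n3 := all3 C CF.
  have [nx nx' ny] : [/\ nb x C = 3, nb x' C = 3 & nb y C = 3].
    by split; apply: n3; rewrite !inE eqxx ?orbT.
  have [] := member_type oF CF x'R xR _ _ _; rewrite ?nx ?nx' 1?eq_sym //.
    by move=> cl; have := up C CF cl; rewrite (loads_eq oF up' ge CF).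
  case=> a [b [c [d dC]]]; have [_ _ _ dC'] := dia_mem dC.
  have [xc xd xab] := dia_nb3 oF CF dC xR (eq_leq (esym nx)).
  have [_ x'd _] := dia_nb3 oF CF dC x'R (eq_leq (esym nx')).
  have [_ yd _] := dia_nb3 oF CF dC yR (eq_leq (esym ny)).
  exfalso; apply: (db_win oF h CF dC'); try adjt.
  by apply: (dia_sw CF dC xR); rewrite xab xc.
have same C : C \in F -> forall e, e \in [:: x'; y'; y] -> nbs e C = nbs x C.
  move=> CF; have kC := kall C CF; have n3 := all3 C CF.
  have n3' e : e \in [:: y; y'; x'; x] -> nb e C = 3.
    by move=> eI; apply: n3; move: eI; rewrite !inE => /or4P[]->; rewrite ?orbT.
  have Ex' := db_sides h CF n3 kC.
  have [nx' ny ny'] : [/\ 2 < nb x' C, 2 < nb y C & 2 < nb y' C].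
    by split; rewrite n3 // !inE eqxx ?orbT.
  have Ey' : nbs y' C = nbs y C.
    apply: (db_sides (db_rev h) CF n3').
    by case: (k33_nb oF CF kC yR ny) => -> //; apply: k33_compl.
  have Ey : nbs y C = nbs x C.
    case: (k33_nb oF CF kC yR ny) => // Ey; exfalso.
    have [tL [EL psL lL]] := pL; have [tN [EN psN lN]] := pN.
    apply: (@two_arcs _ _ _ oF C (nbs x C) x tL y' tN CF kC).
    - by rewrite -EL.
    - by rewrite -EN.
    - by rewrite -EL -EN; apply: subseq_uniq us; apply: cat_subseq => //; apply: suffix_subseq.
    - by rewrite -EL -EN => u; rewrite mem_cat => uI; apply: sR; rewrite !mem_cat; case/orP: uI => ->; rewrite ?orbT.
    - by move: sL; rewrite EL.
    - by move: sN; rewrite EN.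
    - by move=> a aA; rewrite lL (side_adj erefl aA) (side_adj Ex' aA).
    - by move=> a aA; rewrite lN (side_adj Ey aA) (side_adj (etrans Ey' Ey) aA).
  by move=> e; rewrite !inE => /or3P[]/eqP->; rewrite ?Ey' ?Ey.
case: (pL) => tL [EL psL lL]; rewrite EL in h cov sL.
case: tL {EL psL lL} h cov sL => // g t h cov _.
apply: (db_k33 h m_gt0 dx dy) => [C CF|q qR qn]; first by split; [apply: kall|apply: same].
by rewrite (cov q qR) in qn.
Qed.

End Dumbbell2.

(** * Theta graphs *)

Section Theta.
Variable G : sgraph.
Implicit Types (u v w x y z : G) (S A B C D : {set G}) (s t : seq G).

Local Notation adj := (@adj G).

Variables (m : nat) (F : {set {set G}}).
Hypothesis oF : opt m F.

Local Notation R := (rest F).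
Local Notation load := (load F).

(* Three internally disjoint paths from [h1] to [h2], with interiors [T1], [T2], [T3]
   running from [f_i] to [l_i]. *)
Definition th (h1 h2 f1 l1 : G) (T1 : seq G) f2 l2 (T2 : seq G) f3 l3 (T3 : seq G) :=
  [/\ pth f1 l1 T1, pth f2 l2 T2 & pth f3 l3 T3] /\
  [/\ uniq (h1 :: h2 :: T1 ++ T2 ++ T3), {subset h1 :: h2 :: T1 ++ T2 ++ T3 <= R},
      [&& adj h1 f1, adj h1 f2 & adj h1 f3] & [&& adj l1 h2, adj l2 h2 & adj l3 h2]].

Lemma th_rot h1 h2 f1 l1 T1 f2 l2 T2 f3 l3 T3 :
  th h1 h2 f1 l1 T1 f2 l2 T2 f3 l3 T3 -> th h1 h2 f2 l2 T2 f3 l3 T3 f1 l1 T1.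
Proof.
case=> [[p1 p2 p3] [us sR /and3P[a1 a2 a3] /and3P[b1 b2 b3]]]; split=> //.
have pm : perm_eq (h1 :: h2 :: T2 ++ T3 ++ T1) (h1 :: h2 :: T1 ++ T2 ++ T3) by permt.
split; rewrite ?a1 ?a2 ?a3 ?b1 ?b2 ?b3 //; first by rewrite (perm_uniq pm).
by move=> u; rewrite (perm_mem pm); apply: sR.
Qed.

Lemma th_swap h1 h2 f1 l1 T1 f2 l2 T2 f3 l3 T3 :
  th h1 h2 f1 l1 T1 f2 l2 T2 f3 l3 T3 -> th h1 h2 f1 l1 T1 f3 l3 T3 f2 l2 T2.
Proof.
case=> [[p1 p2 p3] [us sR /and3P[a1 a2 a3] /and3P[b1 b2 b3]]]; split=> //.
have pm : perm_eq (h1 :: h2 :: T1 ++ T3 ++ T2) (h1 :: h2 :: T1 ++ T2 ++ T3) by permt.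
split; rewrite ?a1 ?a2 ?a3 ?b1 ?b2 ?b3 //; first by rewrite (perm_uniq pm).
by move=> u; rewrite (perm_mem pm); apply: sR.
Qed.

Lemma th_flip h1 h2 f1 l1 T1 f2 l2 T2 f3 l3 T3 :
  th h1 h2 f1 l1 T1 f2 l2 T2 f3 l3 T3 ->
  th h2 h1 l1 f1 (rev T1) l2 f2 (rev T2) l3 f3 (rev T3).
Proof.
case=> [[p1 p2 p3] [us sR /and3P[a1 a2 a3] /and3P[b1 b2 b3]]]; split.
  by split; apply: pth_rev.
have pm : perm_eq (h2 :: h1 :: rev T1 ++ rev T2 ++ rev T3) (h1 :: h2 :: T1 ++ T2 ++ T3) by permt.
split; rewrite -1?(adjC f1) ?(adjC _ h1) ?(adjC h2) ?a1 ?a2 ?a3 ?b1 ?b2 ?b3 //; first by rewrite (perm_uniq pm).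
by move=> u; rewrite (perm_mem pm); apply: sR.
Qed.

(** The path runs back along [T1], over [h1] along [T2], and over [h2] back along [T3]. By the
    symmetries, each [f_i] and each [l_i] is an end of such a path. *)
Lemma th_path h1 h2 f1 l1 T1 f2 l2 T2 f3 l3 T3 : th h1 h2 f1 l1 T1 f2 l2 T2 f3 l3 T3 ->
  exists t, [/\ pth l1 f3 (l1 :: t), perm_eq (l1 :: t) (h1 :: h2 :: T1 ++ T2 ++ T3),
    uniq (l1 :: t), {subset l1 :: t <= R} & sorted adj t].
Proof.
case=> [[p1 p2 p3] [us sR /and3P[a1 a2 a3] /and3P[b1 b2 b3]]].
have p : pth l1 f3 (rev T1 ++ [:: h1] ++ T2 ++ [:: h2] ++ rev T3).
  apply: (pth_cat (pth_rev p1) (pth_cat (pth1 h1) (pth_cat p2 (pth_cat (pth1 h2) (pth_rev p3) _) _) _)) => //;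
  by rewrite adjC.
have pm : perm_eq (rev T1 ++ [:: h1] ++ T2 ++ [:: h2] ++ rev T3) (h1 :: h2 :: T1 ++ T2 ++ T3) by permt.
have [t [E ps _]] := p; exists t; rewrite E in p pm ps; split=> //.
- by rewrite (perm_uniq pm).
- by move=> u; rewrite (perm_mem pm); apply: sR.
- by move: ps => /= /path_sorted.
Qed.

Lemma th_mem h1 h2 f1 l1 T1 f2 l2 T2 f3 l3 T3 : th h1 h2 f1 l1 T1 f2 l2 T2 f3 l3 T3 ->
  [/\ h1 \in R, h2 \in R, l1 \in R & f1 \in R].
Proof.
case=> [[p1 p2 p3] [us sR _ _]]; split; apply: sR; rewrite ?(in_cons, mem_cat) ?eqxx ?orbT //.
  by rewrite (pth_last p1) !orbT.
by rewrite (pth_head p1) !orbT.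
Qed.

(* Without [l1] the theta graph still has a Hamiltonian path. *)
Lemma th_sw h1 h2 f1 l1 T1 f2 l2 T2 f3 l3 T3 C z (a b c : G) :
  th h1 h2 f1 l1 T1 f2 l2 T2 f3 l3 T3 -> C \in F -> z \in C -> chs (sw C z l1) ->
  {subset [:: a; b; c] <= h1 :: h2 :: T1 ++ T2 ++ T3} -> uniq [:: l1; a; b; c] ->
  adj z a -> adj z b -> adj z c -> False.
Proof.
move=> h CF zC cs sub us za zb zc; have [t [_ pm ut tR pt]] := th_path h.
have [_ _ l1R _] := th_mem h.
have := sw_path oF CF zC l1R cs pt _ _; rewrite leqNgt => H.
move: us; rewrite cons_uniq => /andP[l1n us].
have mt u : u \in [:: a; b; c] -> u \in t.
  move=> uI; have := sub u uI; rewrite -(perm_mem pm) in_cons => /orP[/eqP E|//].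
  by rewrite -E uI in l1n.
have /negP[] : ~~ (2 < count (adj z) t).
  apply: H; first by case/andP: ut.
  move=> u uT; rewrite in_setD1 tR ?in_cons ?uT ?orbT // andbT.
  by move: ut => /= /andP[h' _]; apply: contraNneq h' => <-.
by apply: (count_gt2 (mt a _) (mt b _) (mt c _) us) => //; rewrite !inE eqxx ?orbT.
Qed.

Lemma th_cl4 h1 h2 f1 l1 T1 f2 l2 T2 f3 l3 T3 C us :
  th h1 h2 f1 l1 T1 f2 l2 T2 f3 l3 T3 -> C \in F -> cl4 C -> 2 < nb l1 C ->
  {subset us <= h1 :: h2 :: T1 ++ T2 ++ T3} -> uniq (l1 :: us) ->
  \sum_(u <- us) nb u C <= 8.
Proof.
move=> h CF cl lt sub /= /andP[l1n us']; have [t [_ pm ut tR pt]] := th_path h.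
have [_ _ l1R _] := th_mem h.
apply: (cl4_path oF CF cl l1R lt pt _ _ us').
- by case/andP: ut.
- move=> u uT; rewrite in_setD1 tR ?in_cons ?uT ?orbT // andbT.
  by move: ut => /= /andP[h' _]; apply: contraNneq h' => <-.
- move=> u uI; have := sub u uI; rewrite -(perm_mem pm) in_cons => /orP[/eqP E|//].
  by rewrite -E uI in l1n.
Qed.

Lemma th_l_nb h1 h2 f1 l1 T1 f2 l2 T2 f3 l3 T3 : th h1 h2 f1 l1 T1 f2 l2 T2 f3 l3 T3 ->
  exists2 w, w \in h1 :: T1 & adj l1 w.
Proof.
case=> [[p1 _ _] [_ _ /and3P[a1 _ _] _]]; case: (leqP (size T1) 1) => [le|lt].
  exists h1; rewrite ?mem_head // adjC; case: p1 le => t [-> _ <-]; by case: t.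
by have [w wT lw] := pth_last_nb p1 lt; exists w; rewrite // in_cons wT orbT.
Qed.

Lemma th_uniq h1 h2 f1 l1 T1 f2 l2 T2 f3 l3 T3 : th h1 h2 f1 l1 T1 f2 l2 T2 f3 l3 T3 ->
  [/\ h1 != h2, uniq T1,
      forall u, u \in T1 ++ T2 ++ T3 -> (u != h1) && (u != h2) &
      forall u v, u \in T1 -> v \in T2 ++ T3 -> u != v].
Proof.
case=> _ [us _ _ _]; move: us; rewrite !cons_uniq => /and3P[h1n h2n ut].
move: h1n; rewrite in_cons negb_or => /andP[-> h1n]; split=> //.
- by move: ut; rewrite cat_uniq => /andP[].
- move=> u uT; apply/andP; split; [apply: contraNneq h1n|apply: contraNneq h2n] => <- //.
- move=> u v uT vT; move: ut; rewrite cat_uniq => /and3P[_ /hasPn/(_ v vT) hv _].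
  by apply: contraNneq hv => <-.
Qed.

Section Cover.
Variables (h1 h2 f1 l1 : G) (T1 : seq G) (f2 l2 : G) (T2 : seq G) (f3 l3 : G) (T3 : seq G).
Hypothesis hT : th h1 h2 f1 l1 T1 f2 l2 T2 f3 l3 T3.
Hypothesis cov : {subset R <= h1 :: h2 :: T1 ++ T2 ++ T3}.

Lemma th_end_le : nb l1 R <= 2.
Proof.
have [t [p pm ut tR _]] := th_path hT.
by apply: (pth_end_nb oF p ut tR) => u /cov; rewrite -(perm_mem pm).
Qed.

(** Two of the interiors and [h2] form a path on which [h1] has at most two neighbours by
    [path3_rest]; the first vertices of the two interiors already account for both. *)
Lemma th_hub : nb h1 R <= 3 /\ ~~ adj h1 h2.
Proof.
have [[p1 p2 p3] [us sR /and3P[a1 a2 a3] /and3P[b1 b2 b3]]] := hT.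
have two f l T f' l' T' : pth f l T -> pth f' l' T' -> adj l h2 -> adj l' h2 -> adj h1 f -> adj h1 f' ->
    subseq (T ++ T') (T1 ++ T2 ++ T3) \/ subseq (T' ++ T) (T1 ++ T2 ++ T3) ->
    [/\ count (adj h1) T = 1, count (adj h1) T' = 1 & adj h1 h2 = false].
  move=> p p' b b' a a' sub; pose s := T ++ [:: h2] ++ rev T'.
  have ps : pth f f' s.
    by apply: (pth_cat p (pth_cat (pth1 h2) (pth_rev p') _) _) => //; rewrite adjC.
  have pm : perm_eq (h1 :: s) (h1 :: h2 :: T ++ T') by rewrite /s; permt.
  have pm' : perm_eq (h1 :: h2 :: T ++ T') (h1 :: h2 :: T' ++ T) by permt.
  have us' : uniq (h1 :: s).
    rewrite (perm_uniq pm); case: sub => sub; last rewrite (perm_uniq pm');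
    by apply: subseq_uniq us; rewrite /= !eqxx.
  have sR' : {subset h1 :: s <= R}.
    move=> u; rewrite (perm_mem pm) => uI; apply: sR.
    case: sub => sub; last rewrite (perm_mem pm') in uI;
    by apply: (mem_subseq _ uI); rewrite /= !eqxx.
  have := path3_rest oF (pth_sorted ps) us' sR'.
  rewrite /s !count_cat count_rev /= addn0.
  have : 0 < count (adj h1) T by rewrite -has_count; apply/hasP; exists f; rewrite ?(pth_head p).
  have : 0 < count (adj h1) T' by rewrite -has_count; apply/hasP; exists f'; rewrite ?(pth_head p').
  case: (adj h1 h2) => /= g1 g2 g3; first by exfalso; move: g1 g2 g3; clear; lia.
  by split=> //; move: g1 g2 g3; clear; lia.
have [c1 c2 n12] : [/\ count (adj h1) T1 = 1, count (adj h1) T2 = 1 & adj h1 h2 = false].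
  by apply: (two f1 l1 T1 f2 l2 T2) => //; left; rewrite catA prefix_subseq.
have [_ c3 _] : [/\ count (adj h1) T2 = 1, count (adj h1) T3 = 1 & adj h1 h2 = false].
  by apply: (two f2 l2 T2 f3 l3 T3) => //; left; apply: suffix_subseq.
split; last by rewrite n12.
apply: leq_trans (nb_le_count (s := h1 :: h2 :: T1 ++ T2 ++ T3) _) _; first by move=> u /cov.
by rewrite /= !count_cat adj_irr n12 c1 c2 c3.
Qed.

End Cover.

Lemma cov_rot h1 h2 (T1 T2 T3 : seq G) : {subset R <= h1 :: h2 :: T1 ++ T2 ++ T3} ->
  {subset R <= h1 :: h2 :: T2 ++ T3 ++ T1}.
Proof.
move=> c u /c; have pm : perm_eq (h1 :: h2 :: T1 ++ T2 ++ T3) (h1 :: h2 :: T2 ++ T3 ++ T1) by permt.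
by rewrite (perm_mem pm).
Qed.

Lemma cov_flip h1 h2 (T1 T2 T3 : seq G) : {subset R <= h1 :: h2 :: T1 ++ T2 ++ T3} ->
  {subset R <= h2 :: h1 :: rev T1 ++ rev T2 ++ rev T3}.
Proof.
move=> c u /c; have pm : perm_eq (h1 :: h2 :: T1 ++ T2 ++ T3) (h2 :: h1 :: rev T1 ++ rev T2 ++ rev T3) by permt.
by rewrite (perm_mem pm).
Qed.

Lemma th_load h1 h2 f1 l1 T1 f2 l2 T2 f3 l3 T3 : th h1 h2 f1 l1 T1 f2 l2 T2 f3 l3 T3 ->
  {subset R <= h1 :: h2 :: T1 ++ T2 ++ T3} -> 6 * m <= load l1 + load l2.
Proof.
move=> h cov; have [w wT lw] := th_l_nb h; have [n12 u1 nh nT] := th_uniq h.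
have [[p1 p2 p3] [us sR /and3P[a1 a2 a3] /and3P[b1 b2 b3]]] := h.
have l1T := pth_last p1; have l2T := pth_last p2.
have nl : l1 != l2 by apply: nT; rewrite // mem_cat l2T.
have [_ nl2] : true /\ (l2 != h1) && (l2 != h2) by split=> //; apply: nh; rewrite !mem_cat l2T orbT.
case/andP: nl2 => nl21 nl22.
have wR : w \in R.
  by apply: sR; move: wT; rewrite !(in_cons, mem_cat) => /orP[->|->]; rewrite ?orbT.
have [hR h2R l1R _] := th_mem h; have [_ _ l2R _] := th_mem (th_rot h).
apply: (load_pair oF nl b1 lw _ h2R wR l2R (th_end_le h cov)); last first.
  exact: (th_end_le (th_rot h) (cov_rot cov)).
rewrite /= !inE negb_or (eq_sym h2 l2) nl22 !andbT; apply/andP; split.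
  move: wT; rewrite in_cons => /orP[/eqP->|wT]; first by rewrite eq_sym.
  by rewrite eq_sym; have /andP[] := nh w ltac:(by rewrite mem_cat wT).
move: wT; rewrite in_cons => /orP[/eqP->|wT]; first by rewrite eq_sym.
by apply: nT; rewrite // mem_cat l2T.
Qed.

(** A K_4 in which some [l_i] has three neighbours receives at most 12 edges from the list [U]
    instead of 15, more than the slack in [low] permits. In any other K_4 the pair [l1], [l2] stays
    below its six edges, and no member can make up for that. *)
Lemma th_nocl4 h1 h2 f1 l1 T1 f2 l2 T2 f3 l3 T3 C : th h1 h2 f1 l1 T1 f2 l2 T2 f3 l3 T3 ->
  {subset R <= h1 :: h2 :: T1 ++ T2 ++ T3} -> C \in F -> ~ cl4 C.
Proof.
move=> h cov CF cl; have hr := th_rot h; have hrr := th_rot hr.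
have cr := cov_rot cov; have crr := cov_rot cr.
have o1 := th_load h cov; have o2 := th_load hr cr; have o3 := th_load hrr crr.
have [dh1 nh12] := th_hub h cov; have [dh2 _] := th_hub (th_flip h) (cov_flip cov).
have [n12 _ nh nT] := th_uniq h; have [_ _ _ nT'] := th_uniq hr.
have oh := ore_load oF n12 nh12.
have [[p1 p2 p3] [us sR _ _]] := h.
have m1 := pth_last p1; have m2 := pth_last p2; have m3 := pth_last p3.
pose U := [:: l1; l2; l3; h1; h2].
have sU : {subset U <= h1 :: h2 :: T1 ++ T2 ++ T3}.
  by apply/allP; rewrite /= !(in_cons, mem_cat) !eqxx m1 m2 m3 !orbT.
have uU : uniq U.
  rewrite /= !inE !negb_or n12 andbT.
  have /andP[-> ->] := nh l1 ltac:(by rewrite !mem_cat m1).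
  have /andP[-> ->] := nh l2 ltac:(by rewrite !mem_cat m2 orbT).
  have /andP[-> ->] := nh l3 ltac:(by rewrite !mem_cat m3 !orbT).
  have -> : l1 != l2 by apply: nT; rewrite // mem_cat m2.
  have -> : l1 != l3 by apply: nT; rewrite // mem_cat m3 orbT.
  by have -> : l2 != l3 by apply: nT'; rewrite // mem_cat m3.
have le4 E u : E \in F -> u \in U -> nb u E <= 4 by move=> EF uI; apply: (nb_le4 oF EF); apply/sR/sU.
have key E u us' : E \in F -> cl4 E -> perm_eq (u :: us') U -> 2 < nb u E ->
    (exists f T a b c d e e', th h1 h2 f u T a b c d e e' /\
       perm_eq (h1 :: h2 :: T ++ c ++ e') (h1 :: h2 :: T1 ++ T2 ++ T3)) ->
    \sum_(v <- us') nb v E <= 8.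
  move=> EF clE pm lt [f [T [a [b [c [d [e [e' [hh pm']]]]]]]]].
  apply: (th_cl4 hh EF clE lt); last by rewrite (perm_uniq pm).
  by move=> v vI; rewrite (perm_mem pm') sU // -(perm_mem pm) in_cons vI orbT.
have up E : E \in F -> cl4 E -> \sum_(u <- U) nb u E <= 12 \/
    [/\ nb l1 E <= 2, nb l2 E <= 2 & nb l3 E <= 2].
  move=> EF clE; have k1 := le4 E l1 EF; have k2 := le4 E l2 EF; have k3 := le4 E l3 EF.
  have {}k1 : nb l1 E <= 4 by apply: k1; rewrite !inE eqxx ?orbT.
  have {}k2 : nb l2 E <= 4 by apply: k2; rewrite !inE eqxx ?orbT.
  have {}k3 : nb l3 E <= 4 by apply: k3; rewrite !inE eqxx ?orbT.
  rewrite !big_cons big_nil.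
  case: (leqP (nb l1 E) 2) => [g1|lt]; last first.
    left; have := key E l1 [:: l2; l3; h1; h2] EF clE (perm_refl _) lt _.
    rewrite !big_cons big_nil => H; have {}H := H ltac:(by exists f1, T1, f2, l2, T2, f3, l3, T3).
    by move: H k1; clear; lia.
  case: (leqP (nb l2 E) 2) => [g2|lt]; last first.
    left; have := key E l2 [:: l1; l3; h1; h2] EF clE _ lt _.
    rewrite !big_cons big_nil => H; have {}H := H ltac:(rewrite /U; permt)
       ltac:(exists f2, T2, f3, l3, T3, f1, l1, T1; split=> //; permt).
    by move: H k2; clear; lia.
  case: (leqP (nb l3 E) 2) => [g3|lt]; first by right.
  left; have := key E l3 [:: l1; l2; h1; h2] EF clE _ lt _.
  rewrite !big_cons big_nil => H; have {}H := H ltac:(rewrite /U; permt)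
     ltac:(exists f3, T3, f1, l1, T1, f2, l2, T2; split=> //; permt).
  by move: H k3; clear; lia.
have up15 E : E \in F -> \sum_(u <- U) nb u E <= 15.
  move=> EF; case: (dichotomy oF EF) => [/(up E EF)[le|[g1 g2 g3]]|le3].
  - by apply: leq_trans le _.
  - have := le4 E h1 EF; have := le4 E h2 EF; rewrite !inE !eqxx !orbT => /(_ isT) k2 /(_ isT) k1.
    by rewrite !big_cons big_nil; move: g1 g2 g3 k1 k2; clear; lia.
  - by apply: (@sum_nb_le _ _ 3) => u uI; apply/le3/sR/sU.
(* The term 4 is lost at the hubs, which may have three uncovered neighbours each. *)
have low : 30 * m <= 2 * (\sum_(u <- U) load u) + 4.
  by rewrite !big_cons big_nil; move: o1 o2 o3 oh dh1 dh2; clear; lia.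
have no3 E : E \in F -> cl4 E -> [/\ nb l1 E <= 2, nb l2 E <= 2 & nb l3 E <= 2].
  move=> EF clE; case: (up E EF clE) => // le.
  have := loads_lt oF (d := 3) up15 EF; rewrite (leq_add2r 3 _ 12) => /(_ le).
  by move: low; move: (\sum_(u <- U) load u) => n; clear; lia.
have up6 E : E \in F -> \sum_(u <- [:: l1; l2]) nb u E <= 6.
  move=> EF; rewrite !big_cons big_nil; case: (dichotomy oF EF) => [/(no3 E EF)[]|le3].
    by clear; lia.
  have := le3 l1; have := le3 l2; rewrite !sR ?sU ?inE ?eqxx ?orbT // => /(_ isT) k1 /(_ isT) k2.
  by move: k1 k2; clear; lia.
have [g1 g2 _] := no3 C CF cl; have := loads_lt oF (d := 2) up6 CF.
by rewrite !big_cons !big_nil => H; move: H o1 g1 g2; clear; lia.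
Qed.

Lemma th_l3 h1 h2 f1 l1 T1 f2 l2 T2 f3 l3 T3 C : th h1 h2 f1 l1 T1 f2 l2 T2 f3 l3 T3 ->
  {subset R <= h1 :: h2 :: T1 ++ T2 ++ T3} -> C \in F -> nb l1 C = 3.
Proof.
move=> h cov CF; have o1 := th_load h cov.
have le3 E u : E \in F -> u \in R -> nb u E <= 3.
  by move=> EF; case: (dichotomy oF EF) => [/(th_nocl4 h cov EF)//|]; apply.
have [_ _ l1R _] := th_mem h; have [_ _ l2R _] := th_mem (th_rot h).
have up E : E \in F -> \sum_(u <- [:: l1; l2]) nb u E <= 6.
  move=> EF; have := le3 E _ EF l1R; have := le3 E _ EF l2R.
  by rewrite !big_cons big_nil; clear; lia.
have ge : 6 * m <= \sum_(u <- [:: l1; l2]) load u by rewrite !big_cons big_nil addn0.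
have := loads_eq oF up ge CF; have := le3 C _ CF l1R; have := le3 C _ CF l2R.
by rewrite !big_cons big_nil; clear; lia.
Qed.

End Theta.

Section Theta2.
Variable G : sgraph.
Implicit Types (u v w x y z : G) (S A B C D : {set G}) (s t : seq G).

Local Notation adj := (@adj G).

Variables (m : nat) (F : {set {set G}}).
Hypothesis oF : opt m F.

Local Notation R := (rest F).
Local Notation th := (th F).

(** One chorded cycle runs from [q] over [g] to [l1] and back through [a2], [b1], [a1], with chord
    [q a2]. In the other, [a3] is adjacent to [f1], [f2], [f3] on a path through both hubs. *)
Lemma th_second q (a1 a2 a3 b1 g : G) h1 h2 f1 l1 t f2 l2 T2 f3 l3 T3 C :
  th h1 h2 f1 l1 (f1 :: g :: t) f2 l2 T2 f3 l3 T3 -> C \in F ->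
  uniq ([:: a1; a2; a3; b1] ++ q :: h1 :: h2 :: (f1 :: g :: t) ++ T2 ++ T3) ->
  {subset [:: a1; a2; a3; b1; q] <= C :|: R} ->
  (forall a, a \in [:: a1; a2; a3] -> [&& adj f1 a, adj l1 a, adj f2 a, adj f3 a & adj b1 a && adj q a]) ->
  adj q g -> False.
Proof.
case=> [[p1 p2 p3] [us sR /and3P[c1 c2 c3] /and3P[d1 d2 d3]]] CF ua sC H qg.
have h2' : a2 \in [:: a1; a2; a3] by rewrite !inE eqxx orbT.
have h3' : a3 \in [:: a1; a2; a3] by rewrite !inE eqxx !orbT.
have /and5P[x1 x'1 y'1 y1 /andP[b11 q1]] := H a1 (mem_head _ _).
have /and5P[x2 x'2 y'2 y2 /andP[b12 q2]] := H a2 h2'.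
have /and5P[x3 x'3 y'3 y3 /andP[b13 q3]] := H a3 h3'.
pose s1 := q :: (g :: t) ++ a2 :: [:: b1; a1].
pose p := [:: f1] ++ [:: h1] ++ T2 ++ [:: h2] ++ rev T3; pose s2 := a3 :: p.
have pm : perm_eq (s1 ++ s2) ([:: a1; a2; a3; b1] ++ q :: h1 :: h2 :: (f1 :: g :: t) ++ T2 ++ T3).
  by rewrite /s1 /s2 /p; permt.
have us12 : uniq (s1 ++ s2) by rewrite (perm_uniq pm).
have [u1 [_ u2]] : uniq s1 /\ (~~ has (mem s1) s2 /\ uniq s2).
  by move: us12; rewrite cat_uniq => /and3P[].
have pp : pth f1 f3 p.
  apply: (pth_cat (pth1 f1) (pth_cat (pth1 h1) (pth_cat p2 (pth_cat (pth1 h2) (pth_rev p3) _) _) _)) => //;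
  by rewrite adjC.
apply: (@win1s _ _ _ oF C s1 s2 CF).
- apply: (@chs_mk _ _ q (g :: t) a2 [:: b1; a1]) => //; last exact: sub_set_seq.
  case: p1 => t' [E ps El]; case: E => E; rewrite -E /= in El.
  move: ps => /= /andP[_ ps]; rewrite qg rcons_cat cat_path ps /= El x'2 (adjC a2) b12 b11.
  by rewrite (adjC a1) q1.
- apply: (chs_path3 (pth_sorted pp) u2); last exact: sub_set_seq.
  apply: (@count_gt2 _ _ f1 f2 f3); rewrite ?(adjC a3) //.
  + by rewrite /p mem_head.
  + by rewrite /p !mem_cat (pth_head p2) !orbT.
  + by rewrite /p !mem_cat mem_rev (pth_head p3) !orbT.
  + have : uniq ([:: f1] ++ T2 ++ T3).
      apply: subseq_uniq us; apply: subseq_trans (suffix_subseq [:: h1; h2] _).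
      by apply: cat_subseq; rewrite // sub1seq mem_head.
    rewrite !cat_uniq => /and3P[_ /hasPn n1 /and3P[_ /hasPn n2 _]].
    have := n1 f2; have := n1 f3; have := n2 f3.
    rewrite !mem_cat (pth_head p2) (pth_head p3) !orbT => /(_ isT) k1 /(_ isT) k2 /(_ isT) k3.
    rewrite /= !inE negb_or !(eq_sym f1) !andbT.
    move: k2 k3; rewrite /= !mem_seq1 => -> -> /=.
    by apply: contraNneq k1 => <-; apply: pth_head p2.
- exact: us12.
- move=> u; rewrite (perm_mem pm) mem_cat in_cons => /or3P[uI|/eqP->|uI].
  + by apply: sC; move: uI; rewrite !inE => /or4P[]->; rewrite ?orbT.
  + by apply: sC; rewrite !inE eqxx !orbT.
  + by apply: inU_R; apply: sR.
Qed.

(** The counterpart of [db_k33]: [g] is the successor of the end [f1], and [th_second] plays the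
    part of [db_second]. *)
Lemma th_k33 h1 h2 f1 l1 g t f2 l2 T2 f3 l3 T3 :
  th h1 h2 f1 l1 (f1 :: g :: t) f2 l2 T2 f3 l3 T3 -> 0 < m -> nb f2 R <= 2 ->
  (forall C, C \in F -> k33 C (nbs f1 C) /\
     forall e, e \in [:: l1; f2; f3] -> nbs e C = nbs f1 C) ->
  (forall q, q \in R -> q \notin h1 :: h2 :: (f1 :: g :: t) ++ T2 ++ T3 -> adj q g ->
     forall C, C \in F -> nbs q C = nbs f1 C) -> False.
Proof.
move=> h m_gt0 df2 H HW; have [[p1 p2 p3] [us sR /and3P[c1 c2 c3] /and3P[d1 d2 d3]]] := h.
have [h1R h2R l1R f1R] := th_mem h; have [_ _ _ f2R] := th_mem (th_rot h).
have gR : g \in R by apply: sR; rewrite !in_cons eqxx !orbT.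
have f1g : adj f1 g by case: p1 => t' [[<-] /= /andP[]].
have /card_gt0P[C0 C0F] : 0 < #|F| by rewrite (opt_card oF).
have key q C : C \in F -> q \in C :|: R -> q \notin nbs f1 C ->
    q \notin h1 :: h2 :: (f1 :: g :: t) ++ T2 ++ T3 ->
    (forall a, a \in nbs f1 C -> adj q a) -> ~~ adj q g.
  move=> CF qCR qA qn qadj; apply/negP => qg; have [kC E] := H C CF.
  have [a1 [a2 [a3 [b [ua sC sA ba]]]]] := k33_pick kC qA.
  apply: (@th_second q a1 a2 a3 b g h1 h2 f1 l1 t f2 l2 T2 f3 l3 T3 C h CF) => //.
  - have uC : uniq [:: a1; a2; a3; b] := subseq_uniq (prefix_subseq [:: a1; a2; a3; b] [:: q]) ua.
    rewrite cat_uniq uC cons_uniq us qn !andbT.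
    apply/hasPn => u; rewrite in_cons => /orP[/eqP->|/sR uR].
      have : uniq ([:: a1; a2; a3; b] ++ [:: q]) by [].
      by rewrite cat_uniq => /and3P[_ /hasPn/(_ q (mem_head _ _))].
    apply/negP => /sC; apply/negP; exact: mem_rest_notin uR.
  - move=> u; rewrite -[X in u \in X]/([:: a1; a2; a3; b] ++ [:: q]) mem_cat mem_seq1.
    by case/orP=> [/sC/inU_C//|/eqP->].
  - move=> a aI; have aA := sA a aI.
    have El := E l1; have E2 := E f2; have E3 := E f3; rewrite !inE !eqxx !orbT in El E2 E3.
    rewrite (side_adj erefl aA) (side_adj (El isT) aA) (side_adj (E2 isT) aA).
    by rewrite (side_adj (E3 isT) aA) ba // qadj.
have [n12 _ nh nT] := th_uniq h.
have gT : g \in f1 :: g :: t by rewrite !inE eqxx orbT.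
have f2T : f2 \in T2 ++ T3 by rewrite mem_cat (pth_head p2).
apply: (@second_vertex _ _ _ oF f1 g f2) => //.
- by rewrite eq_sym; apply: nT.
- have [w wT lw] := th_l_nb (th_flip (th_rot h)).
  have wS : (w == h2) || (w \in T2) by move: wT; rewrite in_cons mem_rev.
  have wR : w \in R.
    by apply: sR; rewrite !(in_cons, mem_cat); case/orP: wS => ->; rewrite ?orbT.
  apply/negP => f2g; move: df2; rewrite leqNgt => /negP[].
  apply: (@nb_ge3 _ f2 h1 w g) => //; last by rewrite adjC.
  have gh : (g != h1) && (g != h2) by apply: nh; rewrite mem_cat gT.
  case/andP: gh => gh1 gh2.
  rewrite /= !inE negb_or ![_ == g]eq_sym gh1 !andbT /=; apply/andP; split.
    case/orP: wS => [/eqP->//|wT2].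
    by have /andP[] := nh w ltac:(by rewrite !mem_cat wT2 orbT); rewrite eq_sym.
  by case/orP: wS => [/eqP->//|wT2]; apply: nT; rewrite // mem_cat wT2.
- have qn u : u \in R -> adj g u -> u \in h1 :: h2 :: (f1 :: g :: t) ++ T2 ++ T3.
    move=> uR gu; apply/negPn/negP => un; have ug : adj u g by rewrite adjC.
    have E := HW u uR un ug C0 C0F; have [kC _] := H C0 C0F.
    have : ~~ adj u g; last by rewrite ug.
    apply: (key u C0) => //; first exact: inU_R.
      by rewrite nbsP (negPf (mem_rest_notin C0F uR)).
    by move=> a aA; apply: (side_adj E).
  pose P := (f1 :: g :: t) ++ [:: h2] ++ rev T2 ++ [:: h1] ++ T3.
  have pP : pth f1 l3 P.
    by apply: (pth_cat p1 (pth_cat (pth1 h2) (pth_cat (pth_rev p2) (pth_cat (pth1 h1) p3 _) _) _)); rewrite // adjC.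
  have pm : perm_eq P (h1 :: h2 :: (f1 :: g :: t) ++ T2 ++ T3) by rewrite /P; permt.
  have qn' u : u \in R -> adj g u -> u \in P by move=> uR gu; rewrite (perm_mem pm) qn.
  apply: leq_trans (nb_le_count qn') _; rewrite /P /= adj_irr.
  have : count (adj g) (t ++ h2 :: rev T2 ++ h1 :: T3) <= 2.
    have uP : uniq P by rewrite (perm_uniq pm).
    apply: (path3_rest oF).
    + by move: (pth_sorted pP) => /= /andP[_ /path_sorted].
    + by move: uP => /= /andP[].
    + by move=> u uI; apply: sR; rewrite -(perm_mem pm) /P /= in_cons uI orbT.
  by case: (adj g f1); clear; lia.
move=> C CF; have [kC E] := H C CF; split=> //; first by apply: E; rewrite !inE eqxx !orbT.
move=> b bC gb; apply/negPn/negP => bA; have : ~~ adj b g; last by rewrite adjC gb.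
apply: (key b C) => //; first exact: inU_C.
  by apply/negP => /sR bR; have := mem_rest_notin CF bR; rewrite bC.
by move=> a aA; have [sAC _ _ kA] := kC; rewrite adjC; apply: kA.
Qed.

(** [f1] replaces [z], which closes the path from [l2] back to [h1], along [T3] to [h2] and on to
    [l1]. The chord is at [l2], which sees [h2] besides its neighbour on [T2] or [h1]. *)
Lemma th_close h1 h2 f1 l1 T1 f2 l2 T2 f3 l3 T3 C z :
  th h1 h2 f1 l1 T1 f2 l2 T2 f3 l3 T3 -> 1 < size T1 -> C \in F -> z \in C ->
  chs (sw C z f1) -> adj z l1 -> adj z l2 -> False.
Proof.
move=> h sT CF zC cs zl1 zl2.
have [[p1 p2 p3] [us sR /and3P[c1 c2 c3] /and3P[d1 d2 d3]]] := h.
have [_ h2R l1R f1R] := th_mem h; have [n12 uT1 nh nT] := th_uniq h.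
have [w wT lw] := th_l_nb (th_rot h).
pose P := rev T2 ++ [:: h1] ++ T3 ++ [:: h2] ++ [:: l1].
have pP : pth l2 l1 P.
  by apply: (pth_cat (pth_rev p2) (pth_cat (pth1 h1) (pth_cat p3 (pth_cat (pth1 h2) (pth1 l1) _) _) _)); rewrite // adjC.
have nfl := pth_neq p1 uT1 sT.
have l1T := pth_last p1.
have pm : perm_eq P (h1 :: h2 :: [:: l1] ++ T2 ++ T3) by rewrite /P; permt.
have sub : subseq (h1 :: h2 :: [:: l1] ++ T2 ++ T3) (h1 :: h2 :: T1 ++ T2 ++ T3).
  apply: (@cat_subseq _ [:: h1; h2] _ [:: h1; h2]) => //.
  by apply: cat_subseq => //; rewrite sub1seq.
have PR : {subset P <= R} by move=> u; rewrite (perm_mem pm) => /(mem_subseq sub)/sR.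
have uP : uniq P by rewrite (perm_uniq pm); apply: subseq_uniq sub us.
have f1P : f1 \notin P.
  rewrite (perm_mem pm) !in_cons !negb_or nfl.
  have f1T := pth_head p1; have /andP[-> ->] := nh f1 ltac:(by rewrite mem_cat f1T).
  by apply/negP => f1I; have := nT f1 f1 f1T f1I; rewrite eqxx.
apply: (win_sw_seq oF CF zC f1R cs f1P PR).
apply: (@chs_closep _ _ z _ _ _ pP) => //; last exact: sub_set_seq.
  by rewrite cons_uniq uP andbT; apply: (notin_R CF zC).
apply: (@count_gt1 _ _ h2 w) => //.
- by rewrite /P !(mem_cat, in_cons) eqxx !orbT.
- by rewrite /P !mem_cat mem_rev; move: wT; rewrite in_cons => /orP[/eqP->|->//]; rewrite in_cons eqxx !orbT.
- move: wT; rewrite in_cons => /orP[/eqP->|wT2]; first by rewrite eq_sym.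
  by have /andP[_] := nh w ltac:(by rewrite !mem_cat wT2 orbT); rewrite eq_sym.
Qed.

End Theta2.

Section Theta3.
Variable G : sgraph.
Implicit Types (u v w x y z : G) (S A B C D : {set G}) (s t : seq G).

Local Notation adj := (@adj G).

Variables (m : nat) (F : {set {set G}}).
Hypothesis oF : opt m F.

Local Notation R := (rest F).
Local Notation th := (th F).

Lemma k33_out C A e : k33 C A -> C \in F -> e \in R -> nbs e C = C :\: A ->
  exists z, [/\ z \in C, z \in A & chs (sw C z e)].
Proof.
move=> kC CF eR E; have [sA A3 _ _] := kC.
have /card_gt0P[z zA] : 0 < #|A| by rewrite A3.
exists z; split=> //; first exact: (subsetP sA).
by apply: (k33_sw kC CF eR zA) => b; apply: (side_adj E).
Qed.

Lemma k33_out' C A e : k33 C A -> C \in F -> e \in R -> nbs e C = A ->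
  exists z, [/\ z \in C, z \in C :\: A & chs (sw C z e)].
Proof. by move=> kC CF eR E; apply: (k33_out (k33_compl kC)) => //; rewrite k33_comm. Qed.

(** If [l2] saw the other side, exchanges by [th_sw] would force [l3] to that side and reduce [T2]
    and [T3] to single vertices. Then [T1] and the path [l2 h1 l3] are closed by different sides. *)
Lemma th_side h1 h2 f1 l1 T1 f2 l2 T2 f3 l3 T3 C A :
  th h1 h2 f1 l1 T1 f2 l2 T2 f3 l3 T3 -> 1 < size T1 -> C \in F -> k33 C A ->
  (forall e, e \in [:: f1; l1; f2; l2; f3; l3] -> 2 < nb e C) ->
  nbs f1 C = A -> nbs l1 C = A -> nbs l2 C = A.
Proof.
move=> h sT CF kC n3 Ef El; have [n12 u1 nh nT] := th_uniq h.
have [_ u2 _ nT2] := th_uniq (th_rot h); have [_ u3 _ _] := th_uniq (th_rot (th_rot h)).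
have [p1 p2 p3] := h.1; have [us sR /and3P[c1 c2 c3] /and3P[d1 d2 d3]] := h.2.
have [h1R h2R l1R f1R] := th_mem h; have [_ _ l2R f2R] := th_mem (th_rot h).
have [_ _ l3R f3R] := th_mem (th_rot (th_rot h)).
have nfl := pth_neq p1 u1 sT.
have f1T := pth_head p1; have l1T := pth_last p1; have f2T := pth_head p2.
have l2T := pth_last p2; have f3T := pth_head p3; have l3T := pth_last p3.
have q2 e : e \in T2 -> (f1 != e) && (l1 != e).
  by move=> eT; rewrite !nT // mem_cat eT.
have q3 e : e \in T3 -> (f1 != e) && (l1 != e).
  by move=> eT; rewrite !nT // mem_cat eT orbT.
have q23 e e' : e \in T2 -> e' \in T3 -> e != e'.
  by move=> eT eT'; apply: nT2; rewrite // mem_cat eT'.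
case: (k33_nb oF CF kC l2R (n3 l2 _)) => // [|E2]; first by rewrite !inE eqxx !orbT.
exfalso; have [z [zC zA cz]] := k33_out kC CF l2R E2.
have [z' [z'C z'B cz']] := k33_out' kC CF l1R El.
have [/andP[g1 g2] /andP[g3 g4]] := (q2 l2 l2T, q3 l3 l3T); have g5 := q23 _ _ l2T l3T.
have zf1 : adj z f1 by rewrite adjC (side_adj Ef zA).
have zl1 : adj z l1 by rewrite adjC (side_adj El zA).
have z'l2 : adj z' l2 by rewrite adjC (side_adj E2 z'B).
case: (k33_nb oF CF kC l3R (n3 l3 _)) => [|E3|E3]; first by rewrite !inE eqxx !orbT.
  apply: (@th_sw _ _ _ oF _ _ _ _ _ _ _ _ _ _ _ C z f1 l1 l3 (th_rot h) CF zC cz) => //.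
  - by apply/allP; rewrite /= !(in_cons, mem_cat) f1T l1T l3T !orbT.
  - by rewrite /= !inE !negb_or ![l2 == _]eq_sym g1 g2 eq_sym g5 nfl g3 g4.
  - by rewrite adjC (side_adj E3 zA).
have z'l3 : adj z' l3 by rewrite adjC (side_adj E3 z'B).
have s3 : size T3 <= 1.
  rewrite leqNgt; apply/negP => s3; have nfl3 := pth_neq p3 u3 s3.
  have /andP[r1 r2] := q3 f3 f3T.
  case: (k33_nb oF CF kC f3R (n3 f3 _)) => [|E|E]; first by rewrite !inE eqxx !orbT.
    have [y [yC yA cy]] := k33_out kC CF l3R E3.
    apply: (@th_sw _ _ _ oF _ _ _ _ _ _ _ _ _ _ _ C y f1 l1 f3 (th_rot (th_rot h)) CF yC cy).
    - by apply/allP; rewrite /= !(in_cons, mem_cat) f1T l1T f3T !orbT.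
    - by rewrite /= !inE !negb_or ![l3 == _]eq_sym g3 g4 nfl r1 r2 nfl3.
    - by rewrite adjC (side_adj Ef yA).
    - by rewrite adjC (side_adj El yA).
    - by rewrite adjC (side_adj E yA).
  apply: (@th_sw _ _ _ oF _ _ _ _ _ _ _ _ _ _ _ C z' l2 l3 f3 h CF z'C cz') => //.
  - by apply/allP; rewrite /= !(in_cons, mem_cat) l2T l3T f3T !orbT.
  - by rewrite /= !inE !negb_or g2 g4 r2 g5 (q23 _ _ l2T f3T) eq_sym nfl3.
  - by rewrite adjC (side_adj E z'B).
have s2 : size T2 <= 1.
  rewrite leqNgt; apply/negP => s2; have nfl2 := pth_neq p2 u2 s2.
  have /andP[r1 r2] := q2 f2 f2T.
  case: (k33_nb oF CF kC f2R (n3 f2 _)) => [|E|E]; first by rewrite !inE eqxx !orbT.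
    apply: (@th_sw _ _ _ oF _ _ _ _ _ _ _ _ _ _ _ C z f1 l1 f2 (th_rot h) CF zC cz) => //.
    - by apply/allP; rewrite /= !(in_cons, mem_cat) f1T l1T f2T !orbT.
    - by rewrite /= !inE !negb_or ![l2 == _]eq_sym g1 g2 nfl r1 r2 nfl2.
    - by rewrite adjC (side_adj E zA).
  apply: (@th_sw _ _ _ oF _ _ _ _ _ _ _ _ _ _ _ C z' l2 f2 l3 h CF z'C cz') => //.
  - by apply/allP; rewrite /= !(in_cons, mem_cat) l2T l3T f2T !orbT.
  - by rewrite /= !inE !negb_or g2 g4 r2 g5 (eq_sym l2) nfl2 (q23 _ _ f2T l3T).
  - by rewrite adjC (side_adj E z'B).
have ET2 : T2 = [:: l2] by case: p2 s2 => t [-> _ <-]; case: t.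
have ET3 : T3 = [:: l3] by case: p3 s3 => t [-> _ <-]; case: t.
have Ef2 : f2 = l2 by move: f2T; rewrite ET2 mem_seq1 => /eqP.
have Ef3 : f3 = l3 by move: f3T; rewrite ET3 mem_seq1 => /eqP.
have [t1 [E1 ps1 L1]] := p1.
have sub : subseq (h1 :: T1 ++ [:: l2; l3]) (h1 :: h2 :: T1 ++ T2 ++ T3).
  by rewrite ET2 ET3 (@cat_subseq _ [:: h1] _ [:: h1; h2]) //= eqxx.
have pm : perm_eq (T1 ++ [:: l2; h1; l3]) (h1 :: T1 ++ [:: l2; l3]) by permt.
apply: (@two_arcs _ _ _ oF C A f1 t1 l2 [:: h1; l3] CF kC); rewrite -?E1 //.
- by rewrite /= -Ef2 -Ef3 c3 (adjC f2) c2.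
- by rewrite (perm_uniq pm); apply: subseq_uniq sub us.
- by move=> u; rewrite (perm_mem pm) => /(mem_subseq sub)/sR.
- by move: sT; rewrite E1.
- by move=> a aA; rewrite L1 (side_adj Ef aA) (side_adj El aA).
- by move=> b bB; rewrite /= (side_adj E2 bB) (side_adj E3 bB).
Qed.

Lemma th_ham_long h1 h2 f1 l1 T1 f2 l2 T2 f3 l3 T3 :
  th h1 h2 f1 l1 T1 f2 l2 T2 f3 l3 T3 -> {subset R <= h1 :: h2 :: T1 ++ T2 ++ T3} ->
  0 < m -> 1 < size T1 -> False.
Proof.
move=> h cov m_gt0 sT; have [n12 u1 nh nT] := th_uniq h.
have [_ u2 _ nT2] := th_uniq (th_rot h).
have [p1 p2 p3] := h.1.
have [h1R h2R l1R f1R] := th_mem h; have [_ _ l2R f2R] := th_mem (th_rot h).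
have [_ _ l3R f3R] := th_mem (th_rot (th_rot h)).
have nfl := pth_neq p1 u1 sT.
have f1T := pth_head p1; have l1T := pth_last p1; have f2T := pth_head p2.
have l2T := pth_last p2; have f3T := pth_head p3; have l3T := pth_last p3.
have [g1 g2] : f1 != l2 /\ l1 != l2 by rewrite !nT // mem_cat l2T.
have [g3 g4] : f1 != l3 /\ l1 != l3 by rewrite !nT // mem_cat l3T orbT.
have g5 : l2 != l3 by rewrite nT2 // mem_cat l3T.
have n3 C : C \in F -> forall e, e \in [:: f1; l1; f2; l2; f3; l3] -> nb e C = 3.
  move=> CF e; rewrite !inE => /orP[/eqP->|/orP[/eqP->|/or4P[]/eqP->]].
  - exact: (th_l3 oF (th_flip h) (cov_flip cov)).
  - exact: (th_l3 oF h cov).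
  - exact: (th_l3 oF (th_flip (th_rot h)) (cov_flip (cov_rot cov))).
  - exact: (th_l3 oF (th_rot h) (cov_rot cov)).
  - exact: (th_l3 oF (th_flip (th_rot (th_rot h))) (cov_flip (cov_rot (cov_rot cov)))).
  - exact: (th_l3 oF (th_rot (th_rot h)) (cov_rot (cov_rot cov))).
have n3' C : C \in F -> forall e, e \in [:: f1; l1; f2; l2; f3; l3] -> 2 < nb e C.
  by move=> CF e /(n3 C CF)->.
have kall C : C \in F -> k33 C (nbs f1 C).
  move=> CF; have n := n3' C CF.
  have [] := member_type oF CF l2R f1R _ _ _; rewrite ?n 1?eq_sym ?inE ?eqxx ?orbT //.
    by move=> cl; case: (th_nocl4 oF h cov CF cl).
  case=> a [b [c [d dC]]]; have [_ _ _ dC'] := dia_mem dC; exfalso.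
  have [_ f1d _] := dia_nb3 oF CF dC f1R (n f1 ltac:(by rewrite !inE eqxx ?orbT)).
  have [_ l1d _] := dia_nb3 oF CF dC l1R (n l1 ltac:(by rewrite !inE eqxx ?orbT)).
  have [l2c _ ab] := dia_nb3 oF CF dC l2R (n l2 ltac:(by rewrite !inE eqxx ?orbT)).
  have [_ l3d _] := dia_nb3 oF CF dC l3R (n l3 ltac:(by rewrite !inE eqxx ?orbT)).
  apply: (@th_sw _ _ _ oF _ _ _ _ _ _ _ _ _ _ _ C d f1 l1 l3 (th_rot h) CF dC'); try adjt.
  - by apply: (dia_sw CF dC l2R); rewrite ab l2c.
  - by apply/allP; rewrite /= !(in_cons, mem_cat) f1T l1T l3T !orbT.
  - by rewrite /= !inE !negb_or ![l2 == _]eq_sym g1 g2 (eq_sym l3) g5 nfl g3 g4.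
(* If [l1] saw the side opposite to that of [f1], then [th_close] would apply as soon as [l2] or
   [l3] sees the side of [l1]. Otherwise [l1] replaces a vertex that is adjacent to [f1], [l2] and
   [l3]. *)
have same1 C : C \in F -> nbs l1 C = nbs f1 C.
  move=> CF; have kC := kall C CF; have n := n3' C CF; set A := nbs f1 C in kC *.
  have Ef : nbs f1 C = A by [].
  case: (k33_nb oF CF kC l1R (n l1 _)) => // [|E1]; first by rewrite !inE eqxx !orbT.
  exfalso; have [z [zC zB cz]] := k33_out' kC CF f1R Ef.
  have zl1 : adj z l1 by rewrite adjC (side_adj E1 zB).
  case: (k33_nb oF CF kC l2R (n l2 _)) => [|E2|E2]; first by rewrite !inE eqxx !orbT.
    case: (k33_nb oF CF kC l3R (n l3 _)) => [|E3|E3]; first by rewrite !inE eqxx !orbT.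
      have [y [yC yA cy]] := k33_out kC CF l1R E1.
      apply: (@th_sw _ _ _ oF _ _ _ _ _ _ _ _ _ _ _ C y f1 l2 l3 h CF yC cy).
      - by apply/allP; rewrite /= !(in_cons, mem_cat) f1T l2T l3T !orbT.
      - by rewrite /= !inE !negb_or (eq_sym l1) nfl g2 g4 g1 g3 g5.
      - by rewrite adjC (side_adj Ef yA).
      - by rewrite adjC (side_adj E2 yA).
      - by rewrite adjC (side_adj E3 yA).
    apply: (th_close oF (th_swap h) sT CF zC cz zl1).
    by rewrite adjC (side_adj E3 zB).
  apply: (th_close oF h sT CF zC cz zl1).
  by rewrite adjC (side_adj E2 zB).
have nflip C : C \in F -> forall e, e \in [:: l1; f1; l2; f2; l3; f3] -> 2 < nb e C.
  by move=> CF e eI; apply: n3' => //; move: eI; rewrite !inE; do 5 (case/orP=> [->|]; rewrite ?orbT //); move->; rewrite ?orbT.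
have nswap C : C \in F -> forall e, e \in [:: l1; f1; l3; f3; l2; f2] -> 2 < nb e C.
  by move=> CF e eI; apply: n3' => //; move: eI; rewrite !inE; do 5 (case/orP=> [->|]; rewrite ?orbT //); move->; rewrite ?orbT.
have sT' : 1 < size (rev T1) by rewrite size_rev.
have [t1 [E1 ps1 L1]] := p1; case: t1 => [|g t] in E1 ps1 L1; first by rewrite E1 in sT.
have h' := h; rewrite E1 in h'.
apply: (th_k33 oF h' m_gt0).
- exact: (th_end_le oF (th_flip (th_rot h)) (cov_flip (cov_rot cov))).
- move=> C CF; have kC := kall C CF; split=> // e; have El := same1 C CF.
  rewrite !inE => /or3P[]/eqP-> //.
    exact: (th_side (th_flip h) sT' CF kC (nflip C CF) El erefl).
  exact: (th_side (th_flip (th_swap h)) sT' CF kC (nswap C CF) El erefl).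
- by move=> q /cov; rewrite E1 => qI /negP[].
Qed.

End Theta3.

(** * The uncovered part is K_{2,3} *)

Section K23.
Variable G : sgraph.
Implicit Types (u v w x y z : G) (S A B C D : {set G}).

Local Notation adj := (@adj G).

Variables (m : nat) (F : {set {set G}}).
Hypothesis oF : opt m F.
Local Notation R := (rest F).
Local Notation load := (load F).
Local Notation th := (th F).

Definition k23 (h1 h2 s1 s2 s3 : G) := [/\ uniq [:: h1; h2; s1; s2; s3],
  R =i [:: h1; h2; s1; s2; s3], [&& adj h1 s1, adj h1 s2 & adj h1 s3]
  & [&& adj h2 s1, adj h2 s2 & adj h2 s3]].

Lemma k23_rot h1 h2 s1 s2 s3 : k23 h1 h2 s1 s2 s3 -> k23 h1 h2 s2 s3 s1.
Proof.
case=> us RE /and3P[a1 a2 a3] /and3P[b1 b2 b3].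
have pm : perm_eq [:: h1; h2; s2; s3; s1] [:: h1; h2; s1; s2; s3] by permt.
by split; rewrite ?(perm_uniq pm) ?a1 ?a2 ?a3 ?b1 ?b2 ?b3 // => u; rewrite (perm_mem pm).
Qed.

Lemma k23_swap h1 h2 s1 s2 s3 : k23 h1 h2 s1 s2 s3 -> k23 h1 h2 s1 s3 s2.
Proof.
case=> us RE /and3P[a1 a2 a3] /and3P[b1 b2 b3].
have pm : perm_eq [:: h1; h2; s1; s3; s2] [:: h1; h2; s1; s2; s3] by permt.
by split; rewrite ?(perm_uniq pm) ?a1 ?a2 ?a3 ?b1 ?b2 ?b3 // => u; rewrite (perm_mem pm).
Qed.

Lemma k23_flip h1 h2 s1 s2 s3 : k23 h1 h2 s1 s2 s3 -> k23 h2 h1 s1 s2 s3.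
Proof.
case=> us RE /and3P[a1 a2 a3] /and3P[b1 b2 b3].
have pm : perm_eq [:: h2; h1; s1; s2; s3] [:: h1; h2; s1; s2; s3] by permt.
by split; rewrite ?(perm_uniq pm) ?a1 ?a2 ?a3 ?b1 ?b2 ?b3 // => u; rewrite (perm_mem pm).
Qed.

Lemma k23_mem h1 h2 s1 s2 s3 : k23 h1 h2 s1 s2 s3 ->
  [/\ h1 \in R, h2 \in R, s1 \in R, s2 \in R & s3 \in R].
Proof. by case=> _ RE _ _; rewrite !RE !inE !eqxx !orbT. Qed.

Lemma k23_th h1 h2 s1 s2 s3 : k23 h1 h2 s1 s2 s3 ->
  th h1 h2 s1 s1 [:: s1] s2 s2 [:: s2] s3 s3 [:: s3] /\
  {subset R <= h1 :: h2 :: [:: s1] ++ [:: s2] ++ [:: s3]}.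
Proof.
case=> us RE /and3P[a1 a2 a3] /and3P[b1 b2 b3]; split; last by move=> u; rewrite RE.
split; first by split; apply: pth1.
split; rewrite ?a1 ?a2 ?a3 ?(adjC _ h2) ?b1 ?b2 ?b3 //.
by move=> u uI; rewrite RE.
Qed.

Lemma k23_nadj h1 h2 s1 s2 s3 : k23 h1 h2 s1 s2 s3 -> ~~ adj h1 h2 /\ ~~ adj s1 s2.
Proof.
move=> h; have [t cov] := k23_th h; have [_ ->] := th_hub oF t cov; split=> //.
have [_ _ s1R s2R _] := k23_mem h; have [us _ /and3P[a1 a2 a3] /and3P[b1 b2 b3]] := h.
apply/negP => s12; have [h1R h2R _ _ _] := k23_mem h.
have := th_end_le oF t cov; rewrite leqNgt => /negP[].
apply: (@nb_ge3 _ s1 h1 h2 s2) => //; try adjt.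
by move: us; rewrite /= !inE !negb_or => /andP[/and4P[-> _ -> _] /andP[/and3P[_ -> _] _]].
Qed.

Lemma k23_s h1 h2 s1 s2 s3 C : k23 h1 h2 s1 s2 s3 -> C \in F -> nb s1 C = 3.
Proof. by move=> h CF; have [t cov] := k23_th h; apply: (th_l3 oF t cov). Qed.

Lemma k23_nocl4 h1 h2 s1 s2 s3 C : k23 h1 h2 s1 s2 s3 -> C \in F -> ~ cl4 C.
Proof. by move=> h CF; have [t cov] := k23_th h; apply: (th_nocl4 oF t cov). Qed.

Lemma k23_le3 h1 h2 s1 s2 s3 C u : k23 h1 h2 s1 s2 s3 -> C \in F -> u \in R -> nb u C <= 3.
Proof.
move=> h CF uR; case: (dichotomy oF CF) => [cl|]; last exact.
by case: (k23_nocl4 h CF cl).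
Qed.

(** The hubs may have three uncovered neighbours each, which leaves a slack of 2: the room for one
    member K_4 minus an edge. *)
Lemma k23_load h1 h2 s1 s2 s3 : k23 h1 h2 s1 s2 s3 -> 6 * m <= load h1 + load h2 + 2.
Proof.
move=> h; have [t cov] := k23_th h; have [d1 n12] := th_hub oF t cov.
have [t' cov'] := k23_th (k23_flip h); have [d2 _] := th_hub oF t' cov'.
have nh : h1 != h2 by case: h => /= /andP[]; rewrite !inE !negb_or => /and4P[].
by have := ore_load oF nh n12; move: d1 d2; clear; lia.
Qed.

(* The remaining four vertices form a 4-cycle. *)
Lemma k23_sw h1 h2 s1 s2 s3 C z : k23 h1 h2 s1 s2 s3 -> C \in F -> z \in C ->
  chs (sw C z s1) -> adj z h1 -> adj z s2 -> False.
Proof.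
move=> h CF zC cs zh zs; have [us RE /and3P[a1 a2 a3] /and3P[b1 b2 b3]] := h.
have [h1R h2R s1R s2R s3R] := k23_mem h.
have sub : {subset [:: h1; s3; h2; s2] <= R} by apply/allP; rewrite /= h1R h2R s2R s3R.
have pm : perm_eq [:: h1; h2; s1; s2; s3] (s1 :: [:: h1; s3; h2; s2]) by permt.
move: us; rewrite (perm_uniq pm) => us; have us' : uniq [:: h1; s3; h2; s2] by case/andP: us.
apply: (win_sw_seq oF CF zC s1R cs (s := [:: h1; s3; h2; s2])) => //; first by case/andP: us.
have p : pth h1 s2 [:: h1; s3; h2; s2].
  by exists [:: s3; h2; s2]; split=> //=; rewrite a3 (adjC s3) b3 b2.
apply: (@chs_closep _ _ z _ _ _ p) => //; last exact: sub_set_seq.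
  by rewrite cons_uniq us' andbT; apply: (notin_R CF zC).
apply: (@count_gt1 _ _ s3 s2) => //; rewrite ?inE ?eqxx ?orbT //.
by move: us'; rewrite /= !inE !negb_or => /and4P[_ /andP[_]].
Qed.

(* Removing one of the [s_i], a vertex seeing the other two and a hub wins. *)
Lemma k23_side h1 h2 s1 s2 s3 C A : k23 h1 h2 s1 s2 s3 -> C \in F -> k33 C A ->
  nbs s1 C = A -> nbs s2 C = C :\: A -> nb h1 C = 0.
Proof.
move=> h CF kC E1 E2; apply/eqP; rewrite -leqn0 leqNgt; apply/negP => /nb_gt0[z zC hz].
have [_ _ s1R s2R s3R] := k23_mem h.
have zh : adj z h1 by rewrite adjC.
case: (boolP (z \in A)) => zA.
  have cz : chs (sw C z s2) by apply: (k33_sw kC CF s2R zA) => b; apply: (side_adj E2).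
  apply: (k23_sw (k23_swap (k23_rot h)) CF zC cz zh).
  by rewrite adjC (side_adj E1 zA).
have zB : z \in C :\: A by rewrite in_setD zA.
have cz : chs (sw C z s1).
  by apply: (k33_sw (k33_compl kC) CF s1R zB) => b; rewrite k33_comm //; apply: (side_adj E1).
by apply: (k23_sw h CF zC cz zh); rewrite adjC (side_adj E2 zB).
Qed.

(** Opposite sides would leave both hubs without neighbours in [C] by [k23_side], a loss of 6
    against a slack of 2. *)
Lemma k23_same h1 h2 s1 s2 s3 C : k23 h1 h2 s1 s2 s3 -> C \in F -> k33 C (nbs s1 C) ->
  nbs s2 C = nbs s1 C.
Proof.
move=> h CF kC; have [h1R h2R s1R s2R s3R] := k23_mem h.
case: (k33_nb oF CF kC s2R) => // [|E]; first by rewrite (k23_s (k23_rot h)).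
have z1 := k23_side h CF kC erefl E; have z2 := k23_side (k23_flip h) CF kC erefl E.
have up C' : C' \in F -> \sum_(u <- [:: h1; h2]) nb u C' <= 6.
  move=> C'F; rewrite !big_cons big_nil.
  by have := k23_le3 h C'F h1R; have := k23_le3 h C'F h2R; clear; lia.
have := loads_lt oF (d := 6) up CF; have := k23_load h.
by rewrite !big_cons !big_nil z1 z2 => l /(_ isT); move: l; clear; lia.
Qed.

Lemma k23_none h1 h2 s1 s2 s3 : k23 h1 h2 s1 s2 s3 ->
  (forall C, C \in F -> ~ exists a b c d, dia C a b c d) ->
  forall C, C \in F -> [/\ k33 C (nbs s1 C), nbs s2 C = nbs s1 C & nbs s3 C = nbs s1 C].
Proof.
move=> h nod C CF; have [h1R h2R s1R s2R s3R] := k23_mem h.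
have kC : k33 C (nbs s1 C).
  have ns : s2 != s1.
    by case: h => us _ _ _; move: us; rewrite /= !inE !negb_or (eq_sym s2 s1) => /and4P[_ _ /andP[-> _]].
  have [] := member_type oF CF s2R s1R ns _ _; rewrite ?(k23_s h) ?(k23_s (k23_rot h)) //.
    by move=> cl; case: (k23_nocl4 h CF cl).
  by move/(nod C CF).
split=> //; first exact: k23_same h CF kC.
exact: k23_same (k23_swap h) CF kC.
Qed.

(* After exchanging [s1] for [z], the end [z] of a Hamiltonian path of the rest is pendant. *)
Lemma k23_pend h1 h2 s1 s2 s3 C z : k23 h1 h2 s1 s2 s3 -> C \in F -> z \in C ->
  chs (sw C z s1) -> nb z C <= nb s1 (C :\ z) -> adj z s2 -> adj z s3.
Proof.
move=> h CF zC cs le zs2; apply/negPn/negP => nzs3.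
have [h1R h2R s1R s2R s3R] := k23_mem h.
have [us RE /and3P[a1 a2 a3] /and3P[b1 b2 b3]] := h.
have [_ /(_ le) oF'] := swap oF CF zC s1R cs.
have nz1 : ~~ adj z h1 by apply/negP => zh; apply: (k23_sw h CF zC cs zh zs2).
have nz2 : ~~ adj z h2 by apply/negP => zh; apply: (k23_sw (k23_flip h) CF zC cs zh zs2).
have zn u : u \in R -> z != u by move=> uR; apply: contraTneq zC => ->; apply: mem_rest_notin uR.
have RE' : rest (upd F C (sw C z s1)) =i [:: z; s2; h1; s3; h2].
  have /and5P[/and4P[_ n1 _ _] /and3P[n2 _ _] /andP[n3 n4] _ _] :
      [&& [&& h1 != h2, h1 != s1, h1 != s2 & h1 != s3], [&& h2 != s1, h2 != s2 & h2 != s3],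
          (s1 != s2) && (s1 != s3), s2 != s3 & true].
    by move: us; rewrite /= !inE !negb_or.
  move=> u; rewrite (swap_rest oF u CF zC s1R) RE !inE.
  case: (eqVneq u s1) => [->|_].
    rewrite andbF orbF [s1 == z]eq_sym (negPf (zn _ s1R)) (negPf n3) (negPf n4).
    by rewrite ![s1 == _]eq_sym (negPf n1) (negPf n2).
  rewrite /= andbT; case: (u == z) => //=; case: (u == h1); rewrite ?orbT //=; case: (u == h2); rewrite ?orbT //=.
  by rewrite orbF.
have pm : perm_eq [:: s2; h1; s3; h2; s1] [:: h1; h2; s1; s2; s3] by permt.
have us2 : uniq [:: s2; h1; s3; h2].
  by apply: (subseq_uniq (s2 := [:: s2; h1; s3; h2; s1])); rewrite ?(perm_uniq pm) //; exact: (prefix_subseq [:: s2; h1; s3; h2] [:: s1]).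
apply: (@ham_pendant _ m _ oF' z [:: s2; h1; s3; h2]) => //.
  split=> //; first by rewrite /= zs2 adjC a2 a3 (adjC s3) b3.
  by rewrite cons_uniq us2 andbT !inE !negb_or !zn.
apply: leq_trans (nb_le_count (s := [:: z; s2; h1; s3; h2]) _) _; first by move=> u; rewrite RE'.
by rewrite /= adj_irr zs2 (negPf nzs3) (negPf nz1) (negPf nz2).
Qed.

(** Each [s_i] sees exactly one of [a], [b]. Suppose [s1] and [s2] differ. If [s3] agrees with [s1],
    then [s1] replaces [b], which sees [s2] but not [s3], against [k23_pend]; if [s3] agrees with
    [s2], then [s2] replaces [a]. *)
Lemma k23_dia2 h1 h2 s1 s2 s3 C a b c d : k23 h1 h2 s1 s2 s3 -> C \in F -> dia C a b c d ->
  adj s1 a -> adj s2 a.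
Proof.
move=> h CF dC s1a; apply/negPn/negP => ns2a.
have [h1R h2R s1R s2R s3R] := k23_mem h; have [aC bC _ _] := dia_mem dC.
have [s1c s1d s1ab] := dia_nb3 oF CF dC s1R ltac:(by rewrite (k23_s h)).
have [s2c s2d s2ab] := dia_nb3 oF CF dC s2R ltac:(by rewrite (k23_s (k23_rot h))).
have [s3c s3d s3ab] := dia_nb3 oF CF dC s3R ltac:(by rewrite (k23_s (k23_rot (k23_rot h)))).
have s2b : adj s2 b by move: s2ab; rewrite (negPf ns2a); case: (adj s2 b).
have ns1b : ~~ adj s1 b by move: s1ab; rewrite s1a; case: (adj s1 b).
have [EC [u4 ab ac ad [bc [bd ncd]]]] := dC.
have card3 e f g v : {subset [:: e; f; g] <= C} -> uniq [:: f; g] -> adj v f -> adj v g -> True by [].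
have dsw e f v : dia C e f c d -> v \in R -> adj v c -> adj v d -> adj v f -> ~~ adj v e ->
    chs (sw C e v) /\ nb e C <= nb v (C :\ e).
  move=> dC' vR vc vd vf nve; have [eC fC cC dC''] := dia_mem dC'.
  have [EC' [u4' ef ec ed [fc [fd _]]]] := dC'; split.
    move: u4'; rewrite /= !inE !negb_or => /and4P[/and3P[nef nec ned] /andP[nfc nfd] ncd' _].
    apply: (@chs_k4m _ _ v c f d); try adjt.
    by apply/allP; rewrite /= !in_setU1 !in_setD1 eqxx fC cC dC'' ![_ == e]eq_sym nef nec ned !orbT.
  have := nbD1 v eC; rewrite (negPf nve) add0n => <-.
  by rewrite !(dia_nbE _ dC') adj_irr vc vd vf (negPf nve) ef ec ed.
case: (boolP (adj s3 a)) => s3a.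
  have ns3b : ~~ adj s3 b by move: s3ab; rewrite s3a; case: (adj s3 b).
  have [cs le] := dsw b a s1 (dia_perm dC) s1R s1c s1d s1a ns1b.
  have : adj b s3 by apply: (k23_pend h CF bC cs le); rewrite adjC.
  by rewrite adjC (negPf ns3b).
have [cs le] := dsw a b s2 dC s2R s2c s2d s2b ns2a.
have : adj a s3 by apply: (k23_pend (k23_swap (k23_rot h)) CF aC cs le); rewrite adjC.
by rewrite adjC (negPf s3a).
Qed.

(** By [k23_sw] the hubs do not see the ends of the missing edge, so each has at most two neighbours
    in [C0]. This uses up the slack, and every other member is tight for the hubs. *)
Lemma k23_one h1 h2 s1 s2 s3 C0 a b c d : k23 h1 h2 s1 s2 s3 -> C0 \in F -> dia C0 a b c d ->
  adj s1 a ->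
  [/\ forall s, s \in [:: s1; s2; s3] -> [&& adj s a, ~~ adj s b, adj s c & adj s d],
      forall e, e \in [:: h1; h2] -> [&& adj e a, adj e b, ~~ adj e c & ~~ adj e d] &
      forall C, C \in F -> C != C0 -> [/\ k33 C (nbs s1 C), nbs s2 C = nbs s1 C,
        nbs s3 C = nbs s1 C, nbs h1 C = C :\: nbs s1 C & nbs h2 C = C :\: nbs s1 C]].
Proof.
move=> h C0F dC0 s1a; have [h1R h2R s1R s2R s3R] := k23_mem h.
have hub C (p q r t : G) : C \in F -> dia C p q r t -> adj s1 p ->
    (forall e, e \in [:: s1; s2; s3] -> [&& adj e p, ~~ adj e q, adj e r & adj e t]) /\
    (forall e, e \in [:: h1; h2] -> ~~ adj e r /\ ~~ adj e t).
  move=> CF dC s1p; have s2p := k23_dia2 h CF dC s1p; have s3p := k23_dia2 (k23_swap h) CF dC s1p.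
  have [pC qC rC tC] := dia_mem dC; have sall e : e \in [:: s1; s2; s3] ->
      [&& adj e p, ~~ adj e q, adj e r & adj e t].
    move=> eI; have [ep eR] : adj e p /\ e \in R.
      by move: eI; rewrite !in_cons in_nil orbF => /or3P[]/eqP->.
    have n3 : 2 < nb e C.
      move: eI; rewrite !inE => /or3P[]/eqP->; first by rewrite (k23_s h).
        by rewrite (k23_s (k23_rot h)).
      by rewrite (k23_s (k23_rot (k23_rot h))).
    have [er et eE] := dia_nb3 oF CF dC eR n3; rewrite ep er et andbT /=.
    by move: eE; rewrite ep; case: (adj e q).
  split=> // e eI.
  have ns1 z : z \in C -> chs (sw C z s1) -> adj z s2 -> ~~ adj e z.
    move=> zC cs zs2; apply/negP => ez; rewrite adjC in ez.
    move: eI ez; rewrite !inE => /orP[]/eqP-> ez; first exact: (k23_sw h CF zC cs ez zs2).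
    exact: (k23_sw (k23_flip h) CF zC cs ez zs2).
  have /and4P[_ ns1q s1r s1t] := sall s1 (mem_head _ _).
  have /and4P[_ _ s2r s2t] : [&& adj s2 p, ~~ adj s2 q, adj s2 r & adj s2 t].
    by apply: sall; rewrite !inE eqxx orbT.
  split; apply: ns1 => //; try by rewrite adjC.
    by apply: (dia_sw CF (dia_swap dC) s1R); rewrite s1p s1t; case: (adj s1 q).
  by apply: (dia_sw CF dC s1R); rewrite s1p s1r; case: (adj s1 q).
have h2le C : C \in F -> (exists p q r t, dia C p q r t) ->
    nb h1 C <= 2 /\ nb h2 C <= 2.
  move=> CF [p [q [r [t dC]]]].
  have [p' [q' [dC' s1p]]] : exists p' q', dia C p' q' r t /\ adj s1 p'.
    have [_ _ ab] := dia_nb3 oF CF dC s1R ltac:(by rewrite (k23_s h)).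
    case: (boolP (adj s1 p)) ab => s1p; first by exists p, q.
    by case: (boolP (adj s1 q)) => // s1q; exists q, p; split=> //; apply: dia_perm.
  have [_ hh] := hub C _ _ _ _ CF dC' s1p.
  have le2 e : e \in [:: h1; h2] -> nb e C <= 2.
    move=> /hh[er et]; rewrite (dia_nbE e dC') (negPf er) (negPf et).
    by case: (adj e p'); case: (adj e q').
  by split; apply: le2; rewrite !inE eqxx ?orbT.
have lo := k23_load h.
have [sA hA] := hub _ _ _ _ _ C0F dC0 s1a; have [l1 l2] := h2le C0 C0F ltac:(by exists a, b, c, d).
(* With the slack booked at [C0] the total is at least [6 * m], while no term exceeds 6. *)
pose f C := nb h1 C + nb h2 C + (C == C0) * 2.
have up C : C \in F -> f C <= 6.
  move=> CF; rewrite /f; case: eqVneq => [->|_] /=; first by move: l1 l2; clear; lia.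
  by have := k23_le3 h CF h1R; have := k23_le3 h CF h2R; clear; lia.
have tot : 6 * m <= \sum_(C in F) f C.
  rewrite /f !big_split /=; have -> : \sum_(C in F) (C == C0) * 2 = 2; last exact: lo.
  by rewrite (bigD1 C0) //= eqxx big1 // => C /andP[_ /negPf->].
have eq6 := sumF_eq oF up tot.
have [e1 e2] : nb h1 C0 = 2 /\ nb h2 C0 = 2.
  by have := eq6 C0 C0F; rewrite /f eqxx; move: l1 l2; clear; lia.
split=> //.
- move=> e eI; have [ec ed] := hA e eI; rewrite ec ed !andbT.
  have : nb e C0 = 2 by move: eI; rewrite !inE => /orP[]/eqP->.
  by rewrite (dia_nbE e dC0) (negPf ec) (negPf ed); case: (adj e a); case: (adj e b).
- move=> C CF nC; have S6 := eq6 C CF; rewrite /f (negPf nC) addn0 in S6.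
  have [n1 n2] : nb h1 C = 3 /\ nb h2 C = 3.
    by have := k23_le3 h CF h1R; have := k23_le3 h CF h2R; move: S6; clear; lia.
  have nd : ~ exists p q r t, dia C p q r t by move=> /(h2le C CF)[]; rewrite n1.
  have ns : s2 != s1.
    by case: h => us _ _ _; move: us; rewrite /= !inE !negb_or (eq_sym s2 s1) => /and4P[_ _ /andP[-> _]].
  have kC : k33 C (nbs s1 C).
    have [] := member_type oF CF s2R s1R ns _ _; rewrite ?(k23_s h) ?(k23_s (k23_rot h)) //.
    by move=> cl; case: (k23_nocl4 h CF cl).
  have [us RE /and3P[a1 a2 a3] /and3P[b1 b2 b3]] := h.
  split=> //; [exact: k23_same h CF kC|exact: k23_same (k23_swap h) CF kC| |].
    by apply: (k33_opp oF CF kC s1R h1R _ _ erefl); rewrite ?n1 // adjC.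
  by apply: (k33_opp oF CF kC s1R h2R _ _ erefl); rewrite ?n2 // adjC.
Qed.

End K23.

(** * Reconstructing the extremal graphs *)

Section Final.
Variable G : sgraph.
Implicit Types (u v w x y z : G) (S A B C D : {set G}).

Local Notation adj := (@adj G).

Variables (m : nat) (F : {set {set G}}).
Hypothesis oF : opt m F.
Local Notation R := (rest F).

Lemma cover_or u : u \in R \/ exists2 C, C \in F & u \in C.
Proof.
by case: (boolP (u \in cover F)) => [/bigcupP[C]|]; [right; exists C|left; rewrite in_setC].
Qed.

Lemma card_cover : #|G| = \sum_(C in F) #|C| + #|R|.
Proof. by have := opt_triv oF; rewrite /trivIset => /eqP->; rewrite cardsC. Qed.

Section Hubs.
Variables h1 h2 s1 s3 : G.
Hypothesis us : uniq [:: h1; h2; s1; s3].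
Hypothesis sR : {subset [:: h1; h2; s1; s3] <= R}.
Hypothesis nocl4 : forall C, C \in F -> ~ cl4 C.
Hypothesis deg1 : degree s1 <= 3 * m + 2.

Let s1n : s1 \notin [:: h1; h2].
Proof.
by move: us; rewrite -[X in uniq X]/([:: h1; h2] ++ [:: s1; s3]) cat_uniq => /and3P[_ /= /norP[]].
Qed.

Let s3n : s3 \notin [:: h1; h2].
Proof.
by move: us; rewrite -[X in uniq X]/([:: h1; h2] ++ [:: s1; s3]) cat_uniq => /and3P[_ /= /norP[_ /norP[]]].
Qed.

Let s13 : s1 != s3.
Proof. by move: us; rewrite /= !inE !negb_or => /and4P[_ _ ->]. Qed.

(* After exchanging [s3] for [b], the Ore condition for [s1] and [b] is tight. *)
Lemma fin_b C b : C \in F -> k33 C (nbs s1 C) ->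
  (forall q, q \in R -> q \notin [:: h1; h2] -> nbs q C = nbs s1 C) ->
  b \in C -> b \notin nbs s1 C ->
  [/\ opt m (upd F C (sw C b s3)), adj b h1, adj b h2 &
      forall C', C' \in F -> C' != C -> nb b C' = 3].
Proof.
move=> CF kC same bC bA; have s3R : s3 \in R by apply: sR; rewrite !inE eqxx !orbT.
have s1R : s1 \in R by apply: sR; rewrite !inE eqxx !orbT.
have E3 := same s3 s3R s3n; have [_ A3 C6 _] := kC.
have nb3 : ~~ adj s3 b by move: bA; rewrite -E3 nbsP bC.
have nb1 : ~~ adj s1 b by move: bA; rewrite nbsP bC.
have bB : b \in C :\: nbs s1 C by rewrite in_setD bA.
have cs : chs (sw C b s3).
  by apply: (k33_sw (k33_compl kC) CF s3R bB) => z; rewrite k33_comm //; apply: (side_adj E3).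
have le : nb b C <= nb s3 (C :\ b).
  have := nbD1 s3 bC; rewrite (negPf nb3) add0n => <-; rewrite -!nbs_card E3.
  apply/subset_leq_card/subsetP => u; rewrite [u \in nbs b C]nbsP => /andP[uC bu].
  apply/negPn/negP => uA; have := no_inner6 oF CF kC bC uC; rewrite (negPf bA) (negPf uA) bu.
  by move/(_ erefl).
have [_ /(_ le) oF'] := swap oF CF bC s3R cs.
pose F' := upd F C (sw C b s3).
have no4 C' : C' \in F' -> ~ cl4 C'.
  rewrite (swap_mem b s3 C' CF) => /orP[/eqP->|/andP[C'F _]]; last exact: nocl4.
  by case; rewrite (sw_card CF bC s3R) C6.
have bR' : b \in rest F' by rewrite (swap_rest oF _ CF bC s3R) eqxx.
have up C' : C' \in F' -> nb b C' <= 3.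
  by move=> C'F; case: (dichotomy oF' C'F) => [/(no4 C' C'F)//|]; apply.
(* Any other uncovered neighbour [q] of [b] would have [b] in [nbs q C], the side to which [b] does
   not belong. *)
have upR : nb b (rest F') <= count (adj b) [:: h1; h2].
  apply: nb_le_count => u; rewrite (swap_rest oF _ CF bC s3R) => /orP[/eqP->|/andP[uR _] bu].
    by rewrite adj_irr.
  by apply/negPn/negP => un; move: bA; rewrite -(same u uR un) nbsP bC adjC bu.
have nsb : s1 != b by apply: contraTneq bC => <-; apply: mem_rest_notin s1R.
have := opt_ore oF nsb nb1; rewrite (degree_load oF' b).
have := sumF_le oF' up; move: upR deg1; rewrite /load -/F' /= addn0.
set L := \sum_(C in F') nb b C => k1 k2 k3 k4.
have [b1 b2 eL] : [/\ adj b h1, adj b h2 & 3 * m <= L].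
  by move: k1 k2 k3 k4; case: (adj b h1); case: (adj b h2) => /=; clear; split => //; lia.
split=> // C' C'F nC; apply: (sumF_eq oF' up eL).
by rewrite (swap_mem b s3 C' CF) C'F nC orbT.
Qed.

(** Otherwise [b] has a neighbour [b'] on the wrong side of [C']. By [fin_b] both are adjacent to
    both hubs, so [b h1 b' h2] is a cycle with chord [b b'], while [s1] and [s3] take their places
    in [C] and [C']. *)
Lemma fin_bb C C' b : C \in F -> C' \in F -> C != C' -> k33 C (nbs s1 C) -> k33 C' (nbs s1 C') ->
  (forall q, q \in R -> q \notin [:: h1; h2] -> nbs q C = nbs s1 C) ->
  (forall q, q \in R -> q \notin [:: h1; h2] -> nbs q C' = nbs s1 C') ->
  b \in C -> b \notin nbs s1 C -> nbs b C' = nbs s1 C'.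
Proof.
move=> CF C'F nC kC kC' same same' bC bA.
have [h1R h2R s1R s3R] : [/\ h1 \in R, h2 \in R, s1 \in R & s3 \in R].
  by split; apply: sR; rewrite !inE eqxx ?orbT.
have [oF' b1 b2 n3] := fin_b CF kC same bC bA.
have bR' : b \in rest (upd F C (sw C b s3)) by rewrite (swap_rest oF _ CF bC s3R) eqxx.
have C'F' : C' \in upd F C (sw C b s3) by rewrite (swap_mem b s3 C' CF) C'F (eq_sym C' C) nC orbT.
case: (k33_nb oF' C'F' kC' bR') => [|//|E]; first by rewrite n3 // eq_sym.
have [_ B3 _ _] := k33_compl kC'; have /card_gt0P[b' b'B] : 0 < #|C' :\: nbs s1 C'| by rewrite B3.
have bb' := side_adj E b'B; move: b'B; rewrite in_setD => /andP[b'A b'C].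
have [_ b'1 b'2 _] := fin_b C'F kC' same' b'C b'A.
have bB : b \in C :\: nbs s1 C by rewrite in_setD bA.
have b'B : b' \in C' :\: nbs s1 C' by rewrite in_setD b'A.
have E3 := same' s3 s3R s3n.
have cs : chs (sw C b s1).
  by apply: (k33_sw (k33_compl kC) CF s1R bB) => z; rewrite k33_comm //; apply: (side_adj erefl).
have cs' : chs (sw C' b' s3).
  by apply: (k33_sw (k33_compl kC') C'F s3R b'B) => z; rewrite k33_comm //; apply: (side_adj E3).
have nh : h1 != h2 by move: us; rewrite /= !inE !negb_or => /andP[/andP[]].
have inD u : u \in [:: b; b'; h1; h2] -> [\/ u = b, u = b' | u \in R /\ u \in [:: h1; h2]].
  rewrite !in_cons => /or4P[/eqP->|/eqP->|/eqP->|]; [by constructor 1|by constructor 2| |].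
    by constructor 3; rewrite h1R eqxx.
  by rewrite orbF => /eqP->; constructor 3; rewrite h2R !eqxx orbT.
have dj := mem_disj oF CF C'F nC.
have nR C1 u : C1 \in F -> u \in C1 -> u \notin R.
  by move=> C1F uC; apply: contraL uC; apply: mem_rest_notin.
exfalso; apply: (@win2 _ _ _ oF C C' [set u in [:: b; b'; h1; h2]] (sw C b s1) (sw C' b' s3)) => //.
- apply: (@chs_k4m _ _ b h1 b' h2) => //; try (by rewrite adjC).
  by apply/allP; rewrite /= !inE !eqxx !orbT.
- apply: disjoint_mem => u; rewrite inE => /inD[->|->|[uR un]] /setU1P[E1|/setD1P[n1 u1]].
  + by move: bC; apply/negP; rewrite E1 (mem_rest_notin CF s1R).
  + by rewrite eqxx in n1.
  + by move: b'C; apply/negP; rewrite E1 (mem_rest_notin C'F s1R).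
  + exact: (disjointE dj u1 b'C).
  + by move: s1n; rewrite -E1 un.
  + by move: (nR C u CF u1); rewrite uR.
- apply: disjoint_mem => u; rewrite inE => /inD[->|->|[uR un]] /setU1P[E1|/setD1P[n1 u1]].
  + by move: bC; apply/negP; rewrite E1 (mem_rest_notin CF s3R).
  + exact: (disjointE dj bC u1).
  + by move: b'C; apply/negP; rewrite E1 (mem_rest_notin C'F s3R).
  + by rewrite eqxx in n1.
  + by move: s3n; rewrite -E1 un.
  + by move: (nR C' u C'F u1); rewrite uR.
- apply: disjoint_mem => u /setU1P[->|/setD1P[_ u1]] /setU1P[E1|/setD1P[_ u2]].
  + by move: s13; rewrite E1 eqxx.
  + by move: (nR C' s1 C'F u2); rewrite s1R.
  + by move: (nR C u CF u1); rewrite E1 s3R.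
  + exact: (disjointE dj u1 u2).
- apply/subsetP => u; rewrite inE => /inD[->|->|[uR _]].
  + by rewrite !in_setU bC.
  + by rewrite !in_setU b'C orbT.
  + by rewrite !in_setU uR !orbT.
- apply/subsetP => u /setU1P[->|/setD1P[_ u1]]; rewrite !in_setU ?s1R ?u1 ?orbT //.
- apply/subsetP => u /setU1P[->|/setD1P[_ u1]]; rewrite !in_setU ?s3R ?u1 ?orbT //.
Qed.

End Hubs.

(** A vertex outside [X] is an uncovered non-hub or lies on the far side of a member. In the second
    case [fin_b] joins it to the hubs, its own K_{3,3} to the near side, and [fin_bb] to the near
    sides of the other members. *)
Lemma fin h1 h2 s1 s3 : uniq [:: h1; h2; s1; s3] -> {subset [:: h1; h2; s1; s3] <= R} ->
  (forall q, q \in R -> q \notin [:: h1; h2] -> forall u, u \in R -> adj q u = (u \in [:: h1; h2])) ->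
  (forall C, C \in F -> k33 C (nbs s1 C) /\
     forall q, q \in R -> q \notin [:: h1; h2] -> nbs q C = nbs s1 C) ->
  let X := [set u | adj s1 u] in
  [/\ #|X| = 3 * m + 2, 3 * m + 2 <= #|~: X| & forall x y, x \in X -> y \notin X -> adj x y].
Proof.
move=> us sR nbR H X.
have s1R : s1 \in R by apply: sR; rewrite !inE eqxx !orbT.
have s1n : s1 \notin [:: h1; h2].
  by move: us; rewrite -[X in uniq X]/([:: h1; h2] ++ [:: s1; s3]) cat_uniq => /and3P[_ /= /norP[]].
have nocl C : C \in F -> ~ cl4 C by move=> CF [C4 _]; have [[_ _ C6 _] _] := H C CF; rewrite C6 in C4.
have nh : h1 != h2 by move: us; rewrite /= !inE !negb_or => /andP[/andP[]].
have deg1 : degree s1 = 3 * m + 2.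
  rewrite (degree_load oF s1) addnC; congr (_ + _).
    rewrite /load -[m](opt_card oF) mulnC -sum_nat_const; apply: eq_bigr => C CF.
    by have [[_ A3 _ _] _] := H C CF; rewrite -nbs_card.
  have E : [set u in R | adj s1 u] = [set u in [:: h1; h2]].
    apply/setP => u; rewrite in_set [RHS]in_set; case: (boolP (u \in R)) => [uR|uR] /=.
      exact: nbR.
    apply/esym/negP => uI; case/negP: uR; apply: sR.
    by move: uI; rewrite !in_cons orbF => /orP[]->; rewrite ?orbT.
  have u2 : uniq [:: h1; h2] by rewrite /= inE nh.
  by rewrite /nb E; apply: etrans (card_uniqP u2); apply: eq_card => u; rewrite in_set.
have cardX : #|X| = 3 * m + 2 by rewrite -deg1.
have cR : 4 <= #|R|.
  apply: (@leq_trans #|[:: h1; h2; s1; s3]|); first by rewrite (card_uniqP us).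
  exact/subset_leq_card/subsetP.
split=> //.
  have := cardsC X; rewrite (card_cover) cardX.
  have -> : \sum_(C in F) #|C| = 6 * m.
    rewrite -[m](opt_card oF) mulnC -sum_nat_const; apply: eq_bigr => C CF.
    by have [[_ _ C6 _] _] := H C CF.
  by move: cR; clear; lia.
move=> x y; rewrite !in_set => s1x ns1y.
case: (cover_or y) => [yR|[C CF yC]].
  have yn : y \notin [:: h1; h2] by rewrite -(nbR s1 s1R s1n y yR).
  rewrite adjC; case: (cover_or x) => [xR|[C CF xC]].
    by rewrite (nbR y yR yn x xR) -(nbR s1 s1R s1n x xR).
  by have [_ E] := H C CF; apply: (side_adj (E y yR yn)); rewrite nbsP xC.
have [kC E] := H C CF; have yA : y \notin nbs s1 C by rewrite nbsP yC.
have [oF' y1 y2 n3] := fin_b us sR nocl (eq_leq deg1) CF kC E yC yA.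
case: (cover_or x) => [xR|[C' C'F xC]].
  have : x \in [:: h1; h2] by rewrite -(nbR s1 s1R s1n x xR).
  by rewrite adjC !inE => /orP[]/eqP->.
have xA : x \in nbs s1 C' by rewrite nbsP xC.
case: (eqVneq C C') => [EC|nC].
  by rewrite -EC in xA; have [_ _ _ kA] := kC; apply: kA.
have [kC' E'] := H C' C'F.
by rewrite adjC; apply: (side_adj (fin_bb us sR nocl (eq_leq deg1) CF C'F nC kC kC' E E' yC yA)).
Qed.

(** Exchanges move vertices of the other members into a new K_{2,3}: one outside [X] replaces [s3],
    one in [X] replaces the hub [h1]. The relations of the [s_i] and of the hubs to [C0] then hold
    for them as well. *)
Lemma fin2 h1 h2 s1 s2 s3 C0 a b c d : k23 F h1 h2 s1 s2 s3 -> C0 \in F -> dia C0 a b c d ->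
  adj s1 a -> let X := [set u | adj s1 u] in
  [/\ a \in X, #|X| = 3 * m + 2, #|~: X| = 3 * m + 1,
      forall x y, x \in X -> y \notin X -> adj x y &
      forall x, x \in X -> x != a -> adj a x].
Proof.
move=> h C0F dC s1a X; have [h1R h2R s1R s2R s3R] := k23_mem h.
have [us RE /and3P[a1 a2 a3] /and3P[b1 b2 b3]] := h.
have [sA hA kA] := k23_one oF h C0F dC s1a.
have [aC bC cC dC'] := dia_mem dC.
have [EC [u4 ab ac ad [bc [bd ncd]]]] := dC.
have [_ ns12] := k23_nadj oF h; have [_ ns13] := k23_nadj oF (k23_swap h).
have C04 : #|C0| = 4 by rewrite EC (cardsE _) (card_uniqP u4).
have nocl C : C \in F -> ~ cl4 C by move=> CF; apply: (k23_nocl4 oF h CF).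
have /and4P[_ ns1b s1c s1d] := sA s1 (mem_head _ _).
have nb1R : nb s1 R = 2.
  apply/eqP; rewrite eqn_leq; have [t cov] := k23_th h; rewrite (th_end_le oF t cov) /=.
  apply: (@nb_ge2 _ s1 h1 h2) => //; try by rewrite adjC.
  by move: us; rewrite /= !inE !negb_or => /andP[/and4P[]].
have deg1 : degree s1 = 3 * m + 2.
  rewrite (degree_load oF s1) addnC nb1R; congr (_ + _).
  rewrite /load -[m](opt_card oF) mulnC -sum_nat_const; apply: eq_bigr => C CF.
  exact: (k23_s oF h CF).
have cardX : #|X| = 3 * m + 2 by rewrite -deg1.
have cR : #|R| = 5 by rewrite (eq_card RE) (card_uniqP us).
have m0 : 0 < m by rewrite -(opt_card oF) (cardsD1 C0) C0F.
have us' : uniq [:: h1; h2; s1; s3].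
  by apply: subseq_uniq us; rewrite /= !eqxx; case: (s3 == s2) => //=; rewrite eqxx.
have sR : {subset [:: h1; h2; s1; s3] <= R} by apply/allP; rewrite /= h1R h2R s1R s3R.
have same C : C \in F -> C != C0 -> k33 C (nbs s1 C) /\
    forall q, q \in R -> q \notin [:: h1; h2] -> nbs q C = nbs s1 C.
  move=> CF nC; have [kC E2 E3 _ _] := kA C CF nC; split=> // q.
  rewrite RE -[X in q \in X]/([:: h1; h2] ++ [:: s1; s2; s3]) mem_cat => /orP[->//|].
  by rewrite !in_cons orbF => /or3P[]/eqP->.
have bside C b' : C \in F -> C != C0 -> b' \in C -> b' \notin nbs s1 C ->
    [/\ adj b' h1, adj b' h2, adj b' a, adj b' c & adj b' d].
  move=> CF nC b'C b'A; have [kC E] := same C CF nC.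
  have [oF' b'1 b'2 n3] := fin_b us' sR nocl (eq_leq deg1) CF kC E b'C b'A.
  have n0 := n3 C0 C0F ltac:(by rewrite eq_sym).
  set F' := upd _ _ _ in oF'.
  have C0F' : C0 \in F' by rewrite (swap_mem b' s3 C0 CF) C0F (eq_sym C0 C) nC orbT.
  have b'R : b' \in rest F' by rewrite (swap_rest oF _ CF b'C s3R) eqxx.
  have b'n u : u \in R -> b' != u by move=> uR; apply: contraTneq b'C => ->; apply: mem_rest_notin uR.
  have pm : perm_eq [:: h1; h2; s1; s2; s3] (s3 :: [:: h1; h2; s1; s2]) by permt.
  have pm' : perm_eq [:: h1; h2; s1; b'; s2] (b' :: [:: h1; h2; s1; s2]) by permt.
  have us3 : uniq (s3 :: [:: h1; h2; s1; s2]) by rewrite -(perm_uniq pm).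
  have h' : k23 F' h1 h2 s1 b' s2.
    split; rewrite ?a1 ?a2 ?b1 ?b2 ?[adj h1 b']adjC ?[adj h2 b']adjC ?b'1 ?b'2 //.
      rewrite (perm_uniq pm') cons_uniq; move: us3; rewrite cons_uniq => /andP[_ ->]; rewrite andbT.
      by apply/negP; rewrite !in_cons !orbF; apply/negP; rewrite !negb_or !b'n.
    move=> u; rewrite (swap_rest oF u CF b'C s3R) (perm_mem pm') [in RHS]in_cons; congr (_ || _).
    rewrite RE (perm_mem pm) in_cons; case: (eqVneq u s3) => [->|] /=; last by rewrite andbT.
    by apply/esym/negP; move: us3; rewrite cons_uniq => /andP[/negP].
  have b'a : adj b' a := k23_dia2 oF' h' C0F' dC s1a.
  by have [b'c b'd _] := dia_nb3 oF' C0F' dC b'R ltac:(by rewrite n0); split.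
have aside C x : C \in F -> C != C0 -> x \in nbs s1 C -> adj a x /\ adj b x.
  move=> CF nC xA; have [kC E2 E3 Eh1 Eh2] := kA C CF nC.
  have xC : x \in C by move: xA; rewrite nbsP => /andP[].
  have cs : chs (sw C x h1) by apply: (k33_sw kC CF h1R xA) => y; apply: (side_adj Eh1).
  have [_ A3 _ kk] := kC; have [_ B3 _ _] := k33_compl kC.
  have le : nb x C <= nb h1 (C :\ x).
    have nx : ~~ adj h1 x by apply/negP => hx; have := nbsP h1 C x; rewrite xC hx Eh1 in_setD xA.
    have := nbD1 h1 xC; rewrite (negPf nx) add0n => <-; rewrite -!nbs_card Eh1.
    apply/subset_leq_card/subsetP => u; rewrite [u \in nbs x C]nbsP => /andP[uC xu].
    rewrite in_setD uC andbT; apply/negP => uA.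
    by have := no_inner6 oF CF kC xC uC; rewrite xA uA xu => /(_ erefl).
  have [_ /(_ le) oF'] := swap oF CF xC h1R cs; set F' := upd _ _ _ in oF'.
  have C0F' : C0 \in F' by rewrite (swap_mem x h1 C0 CF) C0F (eq_sym C0 C) nC orbT.
  have xn u : u \in R -> x != u by move=> uR; apply: contraTneq xC => ->; apply: mem_rest_notin uR.
  have x1 : adj x s1 by rewrite adjC (side_adj erefl xA).
  have x2 : adj x s2 by rewrite adjC (side_adj E2 xA).
  have x3 : adj x s3 by rewrite adjC (side_adj E3 xA).
  have h' : k23 F' x h2 s1 s2 s3.
    split; rewrite ?x1 ?x2 ?x3 ?b1 ?b2 ?b3 //.
      rewrite cons_uniq; move: us; rewrite cons_uniq => /andP[_ ->]; rewrite andbT.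
      by apply/negP; rewrite !in_cons !orbF; apply/negP; rewrite !negb_or !xn.
    move=> u; rewrite (swap_rest oF u CF xC h1R) [in RHS]in_cons; congr (_ || _).
    rewrite RE in_cons; case: (eqVneq u h1) => [->|] /=; last by rewrite andbT.
    by apply/esym/negP; move: us; rewrite cons_uniq => /andP[/negP].
  have [_ /(_ x (mem_head _ _)) /and4P[xa xb _ _] _] := k23_one oF' h' C0F' dC s1a.
  by rewrite !(adjC _ x).
have C0or u : u \in C0 -> [\/ u = a, u = b, u = c | u = d].
  rewrite EC in_set !in_cons orbF => /or4P[]/eqP->; by [constructor 1|constructor 2|constructor 3|constructor 4].
have [ha1 hb1 _ _] := and4P (hA h1 (mem_head _ _)).
have [ha2 hb2 _ _] := and4P (hA h2 ltac:(by rewrite !inE eqxx orbT)).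
have Ror u : u \in R -> [\/ u = h1, u = h2 | u \in [:: s1; s2; s3]].
  rewrite RE -[X in u \in X]/([:: h1; h2] ++ [:: s1; s2; s3]) mem_cat.
  by case/orP=> [|uI]; [rewrite !inE => /orP[]/eqP->; by [constructor 1|constructor 2]|constructor 3].
have sh e : e \in [:: s1; s2; s3] -> adj e h1 /\ adj e h2.
  by rewrite !in_cons orbF => /or3P[]/eqP->; split; rewrite adjC.
have Xor x : x \in X -> [\/ x = h1 \/ x = h2, x = a, x = c \/ x = d |
    exists C, [/\ C \in F, C != C0 & x \in nbs s1 C]].
  rewrite in_set => s1x; case: (cover_or x) => [/Ror[->|->|]|[C CF xC]].
  - by constructor 1; left.
  - by constructor 1; right.
  - rewrite !in_cons orbF => /or3P[]/eqP E; rewrite E in s1x.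
    + by rewrite adj_irr in s1x.
    + by rewrite (negPf ns12) in s1x.
    + by rewrite (negPf ns13) in s1x.
  - case: (eqVneq C C0) => [E|nC]; last by constructor 4; exists C; rewrite nbsP xC.
    rewrite E in xC; case: (C0or x xC) => E'; rewrite E' in s1x *.
    + by constructor 2.
    + by rewrite (negPf ns1b) in s1x.
    + by constructor 3; left.
    + by constructor 3; right.
split=> //; first by rewrite in_set.
- have := cardsC X; rewrite card_cover cardX cR (bigD1 C0) //= C04.
  have -> : \sum_(C in F | C != C0) #|C| = 6 * m.-1.
    rewrite (eq_bigr (fun _ => 6)) => [|C /andP[CF nC]]; last by have [[_ _ C6 _] _] := same C CF nC.
    rewrite sum_nat_cond_const mulnC; congr (_ * _).
    have := cardsD1 C0 F; rewrite C0F (opt_card oF) => ->.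
    by apply: eq_card => C; rewrite !inE andbC.
  by move: m0; clear; lia.
- move=> x y /Xor xX; rewrite in_set => ns1y; case: (cover_or y) => [/Ror[E|E|yI]|[C CF yC]].
  + by move: ns1y; rewrite E adjC a1.
  + by move: ns1y; rewrite E adjC b1.
  + have /and4P[ya _ yc yd] := sA y yI; have [y1 y2] := sh y yI.
    have yE C : C \in F -> C != C0 -> nbs y C = nbs s1 C.
      by move=> CF nC; have [_ E2 E3 _ _] := kA C CF nC; move: yI; rewrite !in_cons orbF => /or3P[]/eqP->.
    rewrite adjC; case: xX => [[]->|->|[]->|[C [CF nC xA]]] //.
    by apply: (side_adj (yE C CF nC)).
  + case: (eqVneq C C0) => [E|nC].
      rewrite E in yC; case: (C0or y yC) => E'; rewrite E' in ns1y *.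
      * by rewrite s1a in ns1y.
      * case: xX => [[]->|->|[]->|[C' [C'F nC' xA]]] //; try by rewrite adjC.
        by have [_] := aside C' x C'F nC' xA; rewrite adjC.
      * by rewrite s1c in ns1y.
      * by rewrite s1d in ns1y.
    have yA : y \notin nbs s1 C by rewrite nbsP yC.
    have [y1 y2 ya yc yd] := bside C y CF nC yC yA; have [kC E] := same C CF nC.
    case: xX => [[]->|->|[]->|[C' [C'F nC' xA]]]; try by rewrite adjC.
    case: (eqVneq C C') => [EC'|nCC].
      by rewrite -EC' in xA; have [_ _ _ kk] := kC; apply: kk.
    have [kC' E'] := same C' C'F nC'.
    by rewrite adjC; apply: (side_adj (fin_bb us' sR nocl (eq_leq deg1) CF C'F nCC kC kC' E E' yC yA)).
- move=> x /Xor[[]->|->|[]->|[C [CF nC xA]]] //; try by rewrite adjC.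
    by rewrite eqxx.
  by have [] := aside C x CF nC xA.
Qed.

End Final.

(** * Dumbbell or theta graph: the shape of a path whose ends have second neighbours *)

Section Classify.
Variable G : sgraph.
Implicit Types (u v w x y z : G) (S A B C D : {set G}).

Local Notation adj := (@adj G).

Lemma cat_cases (T : Type) (u w : T) (L E S N : seq T) : L ++ u :: E = S ++ w :: N ->
  [\/ [/\ L = S, u = w & E = N], exists M, S = L ++ u :: M /\ E = M ++ w :: N |
      exists M, L = S ++ w :: M /\ N = M ++ u :: E].
Proof.
elim: L S => [|a L IH] [|b S] /=.
- by case=> -> ->; constructor 1.
- by case=> -> ->; constructor 2; exists S.
- by case=> <- <-; constructor 3; exists L.
case=> <- /IH[[-> -> ->]|[M [-> ->]]|[M [-> ->]]].
- by constructor 1.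
- by constructor 2; exists M.
- by constructor 3; exists M.
Qed.

Lemma pth_split x y (s t : seq G) : pth x y (s ++ t) -> 0 < size s -> 0 < size t ->
  exists z z', [/\ pth x z s, pth z' y t & adj z z'].
Proof.
case=> r []; case: s => // x' s; case: t => // z' t /= [-> <-]; rewrite cat_path /= last_cat /=.
move=> /and3P[ps a pt] <- _ _; exists (last x s), z'; split=> //; first by exists s.
by exists t.
Qed.

Lemma pth_eq_last x y z (s : seq G) : pth x y s -> pth x z s -> y = z.
Proof. by case=> t [-> _ <-] [t' [[->] _ <-]]. Qed.

Lemma pth_head_eq x y u (s : seq G) : pth x y (u :: s) -> x = u.
Proof. by case=> t [[->]]. Qed.

Lemma pth_last_eq x y u (s : seq G) : pth x y (rcons s u) -> y = u.
Proof. by move=> /pth_rev; rewrite rev_rcons => /pth_head_eq. Qed.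

(** [1 < size L] says that [u] is not the successor of [x], so that [u] closes a cycle with the part
    of the path before it. *)
Lemma second_nb x y (P : seq G) : pth x y P -> 1 < count (adj x) P ->
  exists (L : seq G) u (E : seq G), [/\ P = L ++ u :: E, adj x u & 1 < size L].
Proof.
case=> t [-> ps _]; rewrite /= adj_irr; case: t ps => [|v t] //= /andP[_ ps].
case: (adj x v) => /= lt; (have [|s1 [u [s2 [-> xu _ _]]]] := @split_count _ (adj x) t; first by move: lt; clear; lia);
by exists [:: x, v & s1], u, s2.
Qed.

Variables (m : nat) (F : {set {set G}}).
Hypothesis oF : opt m F.
Local Notation R := (rest F).

(** The order of [u], the second neighbour of [x], and [w], that of [y], decides. If [u] comes no
    later than [w], the part from [u] to [w] joins two cycles: a dumbbell. If [w] comes first, then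
    [w] and [u] are the hubs of a theta graph; they are not consecutive, since otherwise [w] would
    see its predecessor, [u] and [y] and so close a chorded cycle. *)
Lemma classify x y P : pth x y P -> uniq P -> {subset P <= R} -> ~~ adj x y ->
  1 < count (adj x) P -> 1 < count (adj y) P ->
  (exists x' L m0 m1 M y' N, db F x x' L m0 m1 M y' y N /\ perm_eq (L ++ M ++ N) P) \/
  (exists h1 h2 f1 l1 T1 f2 T2 l3 T3, th F h1 h2 f1 l1 T1 f2 x T2 y l3 T3 /\
     perm_eq (h1 :: h2 :: T1 ++ T2 ++ T3) P).
Proof.
move=> p uP PR nxy cx cy; have [L [u [E [EP xu sL]]]] := second_nb p cx.
have [|L' [w [E' [EP' yw sN]]]] := second_nb (pth_rev p); first by rewrite count_rev.
have {EP' sN} [S [N [EP' sN]]] : exists (S N : seq G), P = S ++ w :: N /\ 1 < size N.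
  by exists (rev E'), (rev L'); rewrite size_rev -[P]revK EP' rev_cat rev_cons cat_rcons.
have dbc (M : seq G) m1 : P = L ++ M ++ N -> pth u m1 M -> m1 = w ->
    exists x' L m0 m1 M y' N, db F x x' L m0 m1 M y' y N /\ perm_eq (L ++ M ++ N) P.
  move=> EP2 pM Em; rewrite EP2 in p uP PR.
  have [||x' [z [pL pMN a0]]] := pth_split p; rewrite ?size_cat ?(ltnW sL) //.
    by rewrite addn_gt0 (pth_size pM).
  have [||m1' [y' [pM' pN a]]] := pth_split pMN; rewrite ?(pth_size pM) ?(ltnW sN) //.
  have Eu : z = u by case: pM pMN => t [-> _ _] /pth_head_eq.
  rewrite Eu in pMN pM' a0; have Ew := pth_eq_last pM' pM; rewrite Ew Em in a pM'.
  exists x', L, u, w, M, y', N; rewrite EP2; split=> //; split=> //; split=> //.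
    by rewrite sL.
  by rewrite xu yw (adjC y') a a0.
case: (cat_cases (etrans (esym EP) EP')) => [[ES Eu EE]|[M [ES EE]]|[M [EL EN]]].
- left; apply: (dbc [:: u] u) => //; last exact: pth1.
  by rewrite EP' -ES -Eu.
- have EP2 : P = L ++ (u :: rcons M w) ++ N by rewrite EP' ES -catA /= cat_rcons.
  left; have p2 := p; rewrite EP2 in p2.
  have [||x' [z [_ pMN _]]] := pth_split p2; rewrite ?(ltnW sL) //.
  have [||m1 [y' [pM _ _]]] := pth_split pMN; rewrite ?(ltnW sN) //.
  have Eh1 := pth_head_eq pM; rewrite Eh1 in pM; apply: (dbc _ m1 EP2 pM).
  by move: pM; rewrite -rcons_cons => /pth_last_eq.
have {dbc} EP2 : P = S ++ [:: w] ++ M ++ [:: u] ++ E by rewrite EP EL -catA.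
rewrite EP2 in p uP PR; have uwy : u != y by apply: contraTneq xu => ->.
have S0 : 0 < size S.
  case: S p {EL EP' EP2 uP PR} => // p; have Eh2 := pth_head_eq p; rewrite Eh2 in nxy.
  by rewrite adjC yw in nxy.
have E0 : 0 < size E.
  case: E p {EL EP' EP2 uP PR EP EN} => // p; move: p.
  by rewrite cats0 !catA cats1 => /pth_last_eq E; rewrite E eqxx in uwy.
have [//||x2 [w' [pS p' a1]]] := pth_split p; first by rewrite size_cat.
have Eh3 := pth_head_eq p'; rewrite Eh3 in p' a1.
have pm : perm_eq (w :: rev S ++ M ++ [:: u] ++ E) (S ++ [:: w] ++ M ++ [:: u] ++ E) by permt.
case: (posnP (size M)) => [/size0nil M0|M0].
  rewrite M0 cat0s in p' pm uP PR; exfalso; apply: (rest_nochs oF).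
  have [||w1 [u1 [_ pE _]]] := pth_split p'; rewrite ?size_cat //.
  have Eh4 := pth_head_eq pE; rewrite Eh4 in pE.
  have pp : pth x2 y (rev S ++ [:: u] ++ E) by apply: (pth_cat (pth_rev pS) pE).
  have us : uniq (w :: rev S ++ [:: u] ++ E) by rewrite (perm_uniq pm).
  apply: (@chs_path3 _ _ w (rev S ++ [:: u] ++ E) (pth_sorted pp) us); last first.
    by move=> v; rewrite (perm_mem pm); apply: PR.
  have a3 : adj w u.
    have [||w2 [u2 [pw pu a3]]] := pth_split p'; rewrite ?size_cat //.
    by rewrite -(pth_head_eq pu) -[w](_ : w2 = w) //; case: pw => t [[<-] _ <-].
  have x2S := pth_last pS; have yE : y \in E.
    by move: (pth_last pE); rewrite in_cons eq_sym (negPf uwy).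
  apply: (@count_gt2 _ _ x2 u y); rewrite ?mem_cat ?mem_rev ?x2S ?yE ?mem_head ?orbT //.
  - have hh v : v \in [:: u] ++ E -> x2 != v.
      move: us; rewrite cons_uniq cat_uniq => /and4P[_ _ /hasPn hh _] vI.
      by apply: contraNneq (hh v vI) => <-; rewrite [in_mem _ _]mem_rev.
    by rewrite /= !inE negb_or uwy !hh // ?mem_cat ?yE ?mem_head ?orbT.
  - by rewrite adjC.
  - by rewrite adjC.
have [||w1 [f1 [pw p2 a2]]] := pth_split p'; rewrite ?size_cat ?addn_gt0 ?M0 //.
have Ew1 : w1 = w by case: pw => t [[<-] _ <-].
rewrite Ew1 in a2.
have [//||l1 [u1 [pM p3 a3]]] := pth_split p2; first by rewrite size_cat.
have Eh5 := pth_head_eq p3; rewrite Eh5 in p3 a3.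
have [//|//|u2 [l3 [pu pE a4]]] := pth_split p3.
have Eu2 : u2 = u by case: pu => t [[<-] _ <-].
rewrite Eu2 in a4; right; exists w, u, f1, l1, M, x2, (rev S), l3, (rev E).
have pm2 : perm_eq (w :: u :: M ++ rev S ++ rev E) (S ++ [:: w] ++ M ++ [:: u] ++ E) by permt.
rewrite EP2; split=> //; split; first by split=> //; apply: pth_rev.
split.
- by rewrite (perm_uniq pm2).
- by move=> v; rewrite (perm_mem pm2); apply: PR.
- by rewrite a2 (adjC w x2) a1 (adjC w y) yw.
- by rewrite a3 xu adjC a4.
Qed.

End Classify.

(** * The rest has a Hamiltonian path *)

Section Hamiltonian.
Variable G : sgraph.
Implicit Types (u v w x y z : G) (S A B C D : {set G}).

Local Notation adj := (@adj G).

(** Edges inside [X] or its complement are still allowed; [extremal_exact] removes them. For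
    [k = m.+1] the constants are [3 * k - 1] and [3 * k - 2], and [a] becomes the part of size
    one. *)
Definition extremal (m : nat) := exists X : {set G},
  (forall x y, x \in X -> y \notin X -> adj x y) /\ #|X| = 3 * m + 2 /\
  (3 * m + 2 <= #|~: X| \/
   #|~: X| = 3 * m + 1 /\ exists2 a, a \in X & forall x, x \in X -> x != a -> adj a x).

Variables (m : nat) (F : {set {set G}}).
Hypothesis oF : opt m F.
Local Notation R := (rest F).

Lemma nb2_eq q h1 h2 : h1 \in R -> h2 \in R -> h1 != h2 -> adj q h1 -> adj q h2 -> nb q R <= 2 ->
  forall u, u \in R -> adj q u = (u \in [:: h1; h2]).
Proof.
move=> h1R h2R nh q1 q2 le u uR; rewrite !inE.
case: eqVneq => [->//|n1]; case: eqVneq => [->//|n2] /=; apply/negP => qu.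
move: le; rewrite leqNgt => /negP[]; apply: (@nb_ge3 _ q h1 h2 u) => //.
by rewrite /= !inE negb_or nh !(eq_sym _ u) n1 n2.
Qed.

Lemma extremal_fin h1 h2 s1 s3 : uniq [:: h1; h2; s1; s3] -> {subset [:: h1; h2; s1; s3] <= R} ->
  (forall q, q \in R -> q \notin [:: h1; h2] -> [&& adj q h1, adj q h2 & nb q R <= 2]) ->
  (forall C, C \in F -> k33 C (nbs s1 C) /\
     forall q, q \in R -> q \notin [:: h1; h2] -> nbs q C = nbs s1 C) -> extremal m.
Proof.
move=> us sR H HC; have nh : h1 != h2 by move: us; rewrite /= !inE !negb_or => /andP[/andP[]].
have [h1R h2R] : h1 \in R /\ h2 \in R by split; apply: sR; rewrite !inE eqxx ?orbT.
have [|c1 c2 c3] := fin oF us sR _ HC; last by exists [set u | adj s1 u]; split=> //; split=> //; left.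
by move=> q qR qn; have /and3P[q1 q2 le] := H q qR qn; apply: nb2_eq.
Qed.

Lemma k23_extremal h1 h2 s1 s2 s3 : k23 F h1 h2 s1 s2 s3 -> extremal m.
Proof.
move=> h; have [us RE /and3P[a1 a2 a3] /and3P[b1 b2 b3]] := h.
have [h1R h2R s1R s2R s3R] := k23_mem h.
have sor q : q \in R -> q \notin [:: h1; h2] -> [\/ q = s1, q = s2 | q = s3].
  rewrite RE -[X in q \in X]/([:: h1; h2] ++ [:: s1; s2; s3]) mem_cat => /orP[->//|].
  by rewrite !inE => /or3P[]/eqP->; [constructor 1|constructor 2|constructor 3].
case: (Classical_Prop.classic (exists2 C, C \in F & exists a b c d, dia C a b c d)) => [|nod].
  case=> C CF [a' [b' [c [d dC']]]].
  have [a [b [dC s1a]]] : exists a b, dia C a b c d /\ adj s1 a.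
    have [_ _ ab] := dia_nb3 oF CF dC' s1R ltac:(by rewrite (k23_s oF h)).
    case: (boolP (adj s1 a')) ab => s1a; first by exists a', b'.
    by case: (boolP (adj s1 b')) => // s1b; exists b', a'; split=> //; apply: dia_perm.
  have [c1 c2 c3 c4 c5] := fin2 oF h CF dC s1a.
  exists [set u | adj s1 u]; split=> //; split=> //; right; split=> //.
  by exists a.
have us' : uniq [:: h1; h2; s1; s3].
  by apply: subseq_uniq us; rewrite /= !eqxx; case: (s3 == s2) => //=; rewrite eqxx.
have all C : C \in F -> [/\ k33 C (nbs s1 C), nbs s2 C = nbs s1 C & nbs s3 C = nbs s1 C].
  by apply: (k23_none oF h) => C' C'F dC; apply: nod; exists C'.
apply: (@extremal_fin h1 h2 s1 s3) => //.
- by apply/allP; rewrite /= h1R h2R s1R s3R.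
- move=> q qR qn; have [t cov] := k23_th h; case: (sor q qR qn) => ->.
  + by rewrite adjC a1 adjC b1 (th_end_le oF t cov).
  + by rewrite adjC a2 adjC b2 (th_end_le oF (th_rot t) (cov_rot cov)).
  + by rewrite adjC a3 adjC b3 (th_end_le oF (th_rot (th_rot t)) (cov_rot (cov_rot cov))).
- by move=> C CF; have [kC E2 E3] := all C CF; split=> // q qR /(sor q qR)[]->.
Qed.

Lemma size1_pth x y (s : seq G) : pth x y s -> size s <= 1 -> s = [:: x] /\ y = x.
Proof. by case=> -[|z t] [-> _ <-]. Qed.

Lemma th_extremal h1 h2 f1 l1 T1 f2 l2 T2 f3 l3 T3 : th F h1 h2 f1 l1 T1 f2 l2 T2 f3 l3 T3 ->
  0 < m -> {subset R <= h1 :: h2 :: T1 ++ T2 ++ T3} -> extremal m.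
Proof.
move=> h m0 cov; have [p1 p2 p3] := h.1.
case: (ltnP 1 (size T1)) => [s1|/(size1_pth p1)[E1 L1]]; first by case: (th_ham_long oF h cov m0 s1).
case: (ltnP 1 (size T2)) => [s2|/(size1_pth p2)[E2 L2]].
  by case: (th_ham_long oF (th_rot h) (cov_rot cov) m0 s2).
case: (ltnP 1 (size T3)) => [s3|/(size1_pth p3)[E3 L3]].
  by case: (th_ham_long oF (th_rot (th_rot h)) (cov_rot (cov_rot cov)) m0 s3).
have [_ [us sR a b]] := h; rewrite E1 E2 E3 L1 L2 L3 in us sR b cov.
apply: (@k23_extremal h1 h2 f1 f2 f3); split=> //; last by rewrite !(adjC h2).
by move=> u; apply/idP/idP => [/cov|/sR].
Qed.

Lemma ham_case x y P : 0 < m -> pth x y P -> uniq P -> P =i R -> 3 < size P -> extremal m.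
Proof.
move=> m0 p uP PE sP; have hP : ham F P by split=> //; apply: pth_sorted p.
have xR : x \in R by rewrite -PE (pth_head p).
have yR : y \in R by rewrite -PE (pth_last p).
have big v s : pth v s P -> 1 < count (adj v) P.
  case=> t [E _ _]; rewrite -(ham_nb v hP) ltnNge; apply/negP => le.
  by apply: (@ham_pendant _ _ _ oF v t) => //; rewrite -?E //; move: sP; rewrite E.
have cx := big _ _ p; have cy : 1 < count (adj y) P.
  have hP' := ham_rev hP; have [t [E _ _]] := pth_rev p.
  rewrite -(ham_nb y hP) ltnNge; apply/negP => le.
  apply: (@ham_pendant _ _ _ oF y t) => //; rewrite -?E //.
  by move: sP; rewrite -(size_rev P) E.
case: (boolP (adj x y)) => [xy|nxy].
  have cP : cycle adj P.
    by case: p => t [E ps L]; rewrite E /= rcons_path L adjC xy andbT; rewrite E in ps.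
  case: (ltnP 4 (size P)) => [s5|s4]; first by case: (cyc5_false oF m0 hP cP s5).
  case: P p uP PE sP hP big cx cy cP s4 => [|u1 [|u2 [|u3 [|u4 [|]]]]] // p uP PE _ hP _ _ _ cP _.
  have [u1R u2R u3R u4R] : [/\ u1 \in R, u2 \in R, u3 \in R & u4 \in R].
    by rewrite -!PE !inE !eqxx !orbT.
  have pm : perm_eq [:: u2; u4; u1; u3] [:: u1; u2; u3; u4] by permt.
  have /and5P[a12 a23 a34 a41 _] : [&& adj u1 u2, adj u2 u3, adj u3 u4, adj u4 u1 & true] := cP.
  have two q : q \in R -> q \notin [:: u2; u4] -> q = u1 \/ q = u3.
    rewrite -PE -(perm_mem pm) -[X in q \in X]/([:: u2; u4] ++ [:: u1; u3]) mem_cat.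
    by case/orP=> [->//|]; rewrite !inE => /orP[]/eqP->; [left|right].
  (* The 4-cycle is K_{2,2}, with [u2] and [u4] in the role of the hubs. *)
  apply: (@extremal_fin u2 u4 u1 u3).
  - by rewrite (perm_uniq pm).
  - by apply/allP; rewrite /= u1R u2R u3R u4R.
  - move=> q qR qn; rewrite (ham_cyc_nb oF hP cP qR).
    by case: (two q qR qn) => ->; rewrite ?a12 ?a34 ?(adjC u1 u4) ?(adjC u3 u2) ?a41 ?a23.
  - move=> C CF; have [kC E] := cyc4_str oF hP cP CF; split=> // q qR /(two q qR)[]-> //.
have PR : {subset P <= R} by move=> u; rewrite PE.
case: (classify oF p uP PR nxy cx cy).
  case=> x' [L [m1 [m2 [M [y' [N [h pm]]]]]]].
  by case: (db_ham oF h m0) => u; rewrite -PE (perm_mem pm).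
case=> h1 [h2 [f1 [l1 [T1 [f2 [T2 [l3 [T3 [h pm]]]]]]]]].
by apply: (th_extremal h m0) => u; rewrite -PE (perm_mem pm).
Qed.

End Hamiltonian.

(** * Longest paths that do not span the uncovered part *)

Section Longest.
Variable G : sgraph.
Implicit Types (u v w x y z : G) (S A B C D : {set G}) (P Q : seq G).

Local Notation adj := (@adj G).

(** The bound ranges over all optimal packings, so that a path extended after an exchange
    contradicts it too. *)
Definition longest (m : nat) n := forall F (s : seq G), opt m F -> sorted adj s -> uniq s ->
  {subset s <= rest F} -> size s <= n.

Variables (m : nat) (F : {set {set G}}).
Hypothesis oF : opt m F.
Local Notation R := (rest F).
Local Notation load := (load F).

Lemma cl4_nb_in C z : cl4 C -> z \in C -> nb z C <= 3.
Proof.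
case=> C4 _ zC; rewrite (nbD1 z zC) adj_irr; apply: leq_trans (nb_le _ _) _.
by move: C4; rewrite (cardsD1 z) zC; clear; lia.
Qed.

Lemma k33_nb_in C A z : C \in F -> k33 C A -> z \in C -> z \notin A -> nb z C <= 3.
Proof.
move=> CF kA zC zA; rewrite -[3](_ : #|A| = 3); last by have [_ -> _ _] := kA.
apply/subset_leq_card/subsetP => u; rewrite inE => /andP[uC zu].
apply/negPn/negP => uA; have := no_inner6 oF CF kA zC uC; rewrite (negPf zA) (negPf uA) zu.
by move/(_ erefl).
Qed.

Definition lp x y P := [/\ pth x y P, uniq P, {subset P <= R} & longest m (size P)].

Lemma lp_rev x y P : lp x y P -> lp y x (rev P).
Proof.
case=> p uP PR lP; split; rewrite ?rev_uniq ?size_rev //; first exact: pth_rev.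
by move=> u; rewrite mem_rev; apply: PR.
Qed.

Lemma lp_perm x y P a b Q : lp x y P -> pth a b Q -> perm_eq Q P -> lp a b Q.
Proof.
case=> p uP PR lP q pm; split; rewrite ?(perm_uniq pm) ?(perm_size pm) //.
by move=> u; rewrite (perm_mem pm); apply: PR.
Qed.

Lemma lp_ext x y P F' z : lp x y P -> opt m F' -> {subset z :: P <= rest F'} -> z \notin P ->
  ~~ adj z x.
Proof.
case=> p uP PR lP oF' sub zP; apply/negP => zx.
have := lP F' (z :: P) oF'; rewrite cons_uniq zP uP ltnn => H; suff: false by [].
by apply: H => //; have [t [E ps _]] := p; rewrite E /= zx; rewrite E in ps.
Qed.

Lemma lp_out x y P u : lp x y P -> u \in R -> adj x u -> u \in P.
Proof.
move=> h uR xu; apply/negPn/negP => uP; have [_ _ PR _] := h.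
have /negP[] := lp_ext h oF (z := u) ltac:(by move=> v; rewrite in_cons => /orP[/eqP->|/PR]) uP.
by rewrite adjC.
Qed.

Lemma lp_le x y P : lp x y P -> nb x R <= 2.
Proof.
move=> h; have [p uP PR _] := h; apply: (pth_end_nb oF p uP PR) => u; exact: lp_out h.
Qed.

(** The exchange leaves [P] uncovered and uncovers [z]; an edge [z x] would then extend the path. *)
Lemma lp_swap x y P C z w : lp x y P -> C \in F -> z \in C -> w \in R -> w \notin P ->
  chs (sw C z w) -> nb z C <= nb w (C :\ z) -> ~~ adj z x.
Proof.
move=> h CF zC wR wP cs le; have [_ /(_ le) oF'] := swap oF CF zC wR cs.
have [p uP PR _] := h; apply: (lp_ext h oF'); last exact: (notin_R CF zC).
move=> u; rewrite in_cons (swap_rest oF u CF zC wR) => /orP[->//|uIP].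
by rewrite (PR u uIP) /=; apply/orP; right; apply: contraNneq wP => <-.
Qed.

(** No member receives more than six edges from [x] and [w]: in a K_4 that does, [w] could replace a
    neighbour of [x] without loss of edges, against [lp_swap]. The degree condition turns this into
    equality. *)
Lemma lp_load x y P w : lp x y P -> w \in R -> w \notin P -> nb w R <= 2 ->
  [/\ nb x R = 2, nb w R = 2 & forall C, C \in F -> nb x C + nb w C = 6].
Proof.
move=> h wR wP dw; have [p uP PR _] := h; have dx := lp_le h.
have xP := pth_head p; have xR := PR x xP.
have nxw : x != w by apply: contraTneq xP => ->.
have axw : ~~ adj x w by apply/negP => /(lp_out h wR); apply/negP.
have up C : C \in F -> \sum_(u <- [:: x; w]) nb u C <= 6.
  move=> CF; rewrite !big_cons big_nil addn0 leqNgt; apply/negP => lt.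
  have lx := nb_le4 oF CF xR; have lw := nb_le4 oF CF wR.
  have cl : cl4 C.
    case: (dichotomy oF CF) => // le3; have := le3 x xR; have := le3 w wR.
    by move: lt; clear; lia.
  have [C4 cC] := cl; have w3 : 2 < nb w C by move: lt lx; clear; lia.
  have swp z : z \in C -> 3 <= nb w (C :\ z) -> ~~ adj z x.
    move=> zC le; apply: (lp_swap h CF zC wR wP); first exact: (cl4_nb_sw CF cl).
    exact: leq_trans (cl4_nb_in cl zC) le.
  case: (leqP 4 (nb w C)) => [w4|w4].
    have [|z zC xz] := @nb_gt0 _ x C; first by move: lt lw; clear; lia.
    have /negP[] := swp z zC ltac:(by have := nbD1 w zC; case: (adj w z); move: w4; clear; lia).
    by rewrite adjC.
  have [|z zC wz] := @nb_lt _ w C; first by rewrite C4.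
  have /negP[] := swp z zC ltac:(by have := nbD1 w zC; rewrite (negPf wz) add0n => <-).
  by rewrite adjC; apply: (nb_full (S := C)) => //; rewrite C4; move: lt w4; clear; lia.
have S := ore_load oF nxw axw; have tot := loads_le oF up.
rewrite !big_cons big_nil addn0 in tot.
have [e1 e2 ge] : [/\ nb x R = 2, nb w R = 2 & 6 * m <= load x + load w].
  by move: S tot dx dw; clear; split; lia.
have ge' : 6 * m <= \sum_(u <- [:: x; w]) load u by rewrite !big_cons big_nil addn0.
by split=> // C CF; have := loads_eq oF up ge' CF; rewrite !big_cons big_nil addn0.
Qed.

(* Exchanging [w] for a common neighbour [z] of both ends turns the path into a cycle. *)
Lemma lp_close x y P C z w : lp x y P -> C \in F -> z \in C -> w \in R -> w \notin P ->
  chs (sw C z w) -> adj z x -> adj z y -> nb x R = 2 -> False.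
Proof.
move=> h CF zC wR wP cs zx zy dx; have [p uP PR _] := h.
apply: (win_sw_seq oF CF zC wR cs wP PR).
apply: (@chs_closep _ _ z _ _ _ p) => //; last exact: sub_set_seq.
  by rewrite cons_uniq uP andbT; apply: (notin_R CF zC).
by rewrite -dx; apply: nb_le_count => u; apply: (lp_out h).
Qed.

(** [x] and [y] both complete [w] to six edges. So [lp_close] excludes that [w] has fewer than three
    neighbours in [C], and [lp_swap] that it has four. In K_4 and in K_4 minus an edge [w] could
    replace a common neighbour of [x] and [y]. In K_{3,3}, an end that sees the side opposite to
    that of [w] contradicts [lp_swap]. *)
Lemma lp_sides x y P w C : lp x y P -> w \in R -> w \notin P -> nb w R <= 2 -> C \in F ->
  [/\ k33 C (nbs x C), nbs y C = nbs x C & nbs w C = nbs x C].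
Proof.
move=> h wR wP dw CF; have [p uP PR _] := h; have h' := lp_rev h.
have wP' : w \notin rev P by rewrite mem_rev.
have [dx _ /(_ C CF) sx] := lp_load h wR wP dw; have [dy _ /(_ C CF) sy] := lp_load h' wR wP' dw.
have xR : x \in R by apply/PR/(pth_head p).
have yR : y \in R by apply/PR/(pth_last p).
have xw : w != x by apply: contraNneq wP => ->; apply: pth_head p.
have w3 : nb w C = 3.
  have le := nb_le4 oF CF xR; have lw := nb_le4 oF CF wR.
  case: (ltnP (nb w C) 3) => [lt|ge].
    have x4 : 3 < nb x C by move: lt sx; clear; lia.
    have y4 : 3 < nb y C by move: lt sy; clear; lia.
    have [C4 _] := nb4_card oF CF xR x4; have cl := nb4_cl4 oF CF xR x4.
    have [|z zC wz] := @nb_lt _ w C; first by rewrite C4; move: lt; clear; lia.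
    exfalso; apply: (lp_close h CF zC wR wP _ _ _ dx).
    - apply: (cl4_sw CF cl zC wR); have := nbD1 w zC; rewrite (negPf wz) add0n => <-.
      by move: le sx; clear; lia.
    - by rewrite adjC; apply: (nb_full (S := C)); rewrite ?C4.
    - by rewrite adjC; apply: (nb_full (S := C)); rewrite ?C4.
  case: (ltnP 3 (nb w C)) => [lt|]; last by move: ge; clear; lia.
  have [C4 _] := nb4_card oF CF wR lt; have cl := nb4_cl4 oF CF wR lt.
  have [|z zC xz] := @nb_gt0 _ x C; first by move: lw sx; clear; lia.
  have /negP[] : ~~ adj z x; last by rewrite adjC.
  apply: (lp_swap h CF zC wR wP); first by apply: (cl4_nb_sw CF cl) => //; apply: ltnW.
  have := nbD1 w zC; rewrite (nb_full (S := C) (v := w)) ?C4 // => E.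
  apply: leq_trans (cl4_nb_in cl zC) _; move: E lt; clear; lia.
have [x3 y3] : nb x C = 3 /\ nb y C = 3 by move: sx sy w3; clear; lia.
have kC : k33 C (nbs x C).
  case: (member_type oF CF wR xR xw _ _) => [||cl|[a [b [c [d dC]]]]|//]; rewrite ?w3 ?x3 //.
    have [C4 _] := cl.
    have [z zC /andP[xz yz]] : exists2 z, z \in C & adj x z && adj y z.
      have /card_gt0P[z] : 0 < #|nbs x C :&: nbs y C|.
        have := subset_leq_card (_ : nbs x C :|: nbs y C \subset C); rewrite C4 cardsU !nbs_card x3 y3.
        have -> : nbs x C :|: nbs y C \subset C.
          by apply/subsetP => u; rewrite in_setU !nbsP => /orP[]/andP[].
        by move=> /(_ isT); clear; lia.
      by rewrite in_setI !nbsP => /andP[/andP[zC xz] /andP[_ yz]]; exists z; rewrite // xz.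
    exfalso; apply: (lp_close h CF zC wR wP _ _ _ dx); try by rewrite adjC.
    by apply: (cl4_nb_sw CF cl) => //; rewrite w3.
  have [_ _ _ dC'] := dia_mem dC.
  have [wc _ wab] := dia_nb3 oF CF dC wR ltac:(by rewrite w3).
  have [_ xd _] := dia_nb3 oF CF dC xR ltac:(by rewrite x3).
  have [_ yd _] := dia_nb3 oF CF dC yR ltac:(by rewrite y3).
  exfalso; apply: (lp_close h CF dC' wR wP _ _ _ dx); try by rewrite adjC.
  by apply: (dia_sw CF dC wR); rewrite wab wc.
have [sA A3 C6 kk] := kC; have [_ B3 _ _] := k33_compl kC.
have opp e e' Q A : lp e e' Q -> w \notin Q -> k33 C A -> nbs e C = C :\: A -> nbs w C = A -> False.
  move=> hQ wQ kA Ee Ew; have [z [zC zB cz]] := k33_out' kA CF wR Ew.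
  have /negP[] : ~~ adj z e; last by rewrite adjC (side_adj Ee zB).
  apply: (lp_swap hQ CF zC wR wQ cz).
  have zA : z \notin A by move: zB; rewrite in_setD => /andP[].
  have := nbD1 w zC; have -> : adj w z = false.
    by apply/negP => wz; move: zA; rewrite -Ew nbsP zC wz.
  rewrite add0n => <-; rewrite w3; apply: (k33_nb_in CF kA zC zA).
case: (k33_nb oF CF kC wR) => [|Ew|Ew]; first by rewrite w3.
  split=> //; case: (k33_nb oF CF kC yR) => [|//|Ey]; first by rewrite y3.
  by case: (opp y x _ _ h' wP' kC Ey Ew).
by case: (opp x y _ _ h wP (k33_compl kC) _ Ew); rewrite k33_comm.
Qed.

Lemma longest_in S u0 : u0 \in S -> exists a b Q, [/\ pth a b Q, uniq Q, {subset Q <= S} &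
  forall u, u \in S -> adj a u || adj b u -> u \in Q].
Proof.
move=> u0S; pose ok (s : seq G) := [/\ sorted adj s, uniq s, {subset s <= S} & 0 < size s].
(* A list without repetitions has at most [#|G|] entries, so minimising the difference maximises the
   length. *)
have [|Q [[sQ uQ QS Q0] maxQ]] := @exists_minimizer _ ok (fun s => #|G| - size s).
  by exists [:: u0]; split=> // u; rewrite mem_seq1 => /eqP->.
have max s : ok s -> size s <= size Q.
  move=> oks; have := maxQ s oks; case: oks => _ us _ _.
  by have := max_card (mem s); rewrite (card_uniqP us); clear; lia.
case: Q sQ uQ QS Q0 {maxQ} max => // a t sQ uQ QS _ max.
have p : pth a (last a t) (a :: t) by exists t.
exists a, (last a t), (a :: t); split=> // u uS /orP[au|bu]; apply/negPn/negP => uQ'.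
  have := max (u :: a :: t); rewrite /= ltnn => H; suff: false by [].
  apply: H; split=> //; first by rewrite /= adjC au.
    by rewrite cons_uniq uQ'.
  by move=> v; rewrite in_cons => /orP[/eqP->//|/QS].
have := max (u :: rev (a :: t)); rewrite /= size_rev ltnn => H; suff: false by [].
apply: H; split=> //.
- have [t' [E ps _]] := pth_rev p; rewrite E in ps *.
  by rewrite /= adjC bu.
- by rewrite cons_uniq mem_rev uQ' rev_uniq.
- by move=> v; rewrite in_cons mem_rev => /orP[/eqP->//|/QS].
Qed.

(* Let [v] be the first vertex of the path [P] adjacent to an end of a longest path [Q] off [P],
   say to [a]. The other end of [Q] has all its neighbours on [Q] and the part of [P] from [v] on. *)
Lemma lp_w x y P u0 : lp x y P -> u0 \in R -> u0 \notin P ->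
  exists w, [/\ w \in R, w \notin P & nb w R <= 2].
Proof.
move=> h u0R u0P; have [p uP PR _] := h.
have [|a [b [Q [q uQ QS out]]]] := @longest_in [set u in R | u \notin P] u0.
  by rewrite in_set u0R.
have QR u : u \in Q -> u \in R by move=> /QS; rewrite in_set => /andP[].
have QP u : u \in Q -> u \notin P by move=> /QS; rewrite in_set => /andP[].
have key s1 v s2 c d Q' : P = s1 ++ v :: s2 -> count [pred v | adj v a || adj v b] s1 = 0 ->
    pth c d Q' -> perm_eq Q' Q -> (forall u, adj c u -> adj a u || adj b u) -> adj v d ->
    nb c R <= 2.
  move=> EP c1 q' pm cab vd; rewrite EP in p uP.
  have [z pv] : exists z, pth v z (v :: s2).
    exists (last v s2), s2; split=> //; have := pth_sorted p.
    by rewrite -[sorted _ _]/(sorted adj (s1 ++ v :: s2)) => /cat_sorted2[].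
  have qv : pth c z (Q' ++ v :: s2) by apply: (pth_cat q' pv); rewrite adjC.
  apply: (pth_end_nb oF qv).
  - rewrite cat_uniq (perm_uniq pm) uQ; move: uP; rewrite cat_uniq => /and3P[_ _ ->].
    rewrite andbT; apply/hasPn => u uI; rewrite [in_mem _ _](perm_mem pm); apply/negP => /QP.
    by rewrite EP mem_cat uI orbT.
  - move=> u; rewrite mem_cat (perm_mem pm) => /orP[/QR//|uI]; apply: PR.
    by rewrite EP mem_cat uI orbT.
  - move=> u uR cu; have cab' := cab u cu; rewrite mem_cat (perm_mem pm).
    case: (boolP (u \in P)) => uIP; last by rewrite out // in_set uR.
    move: uIP; rewrite EP mem_cat => /orP[us|->]; last by rewrite orbT.
    have : has [pred v | adj v a || adj v b] s1 by apply/hasP; exists u; rewrite //= !(adjC u).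
    by rewrite has_count c1.
have aQ := pth_head q; have bQ := pth_last q.
case: (posnP (count [pred v | adj v a || adj v b] P)) => [c0|].
  exists a; split; [exact: QR|exact: QP|].
  apply: (pth_end_nb oF q uQ QR) => u uR au; apply: out; rewrite ?au // in_set uR.
  apply/negP => uIP; have : has [pred v | adj v a || adj v b] P.
    by apply/hasP; exists u; rewrite //= adjC au.
  by rewrite has_count c0.
move=> /split_count[s1 [v [s2 [EP /orP[va|vb] c1 _]]]].
  exists b; split; [exact: QR|exact: QP|apply: (key s1 v s2 b a (rev Q) EP c1) => //].
  - exact: pth_rev.
  - by rewrite perm_rev.
  - by move=> u ->; rewrite orbT.
exists a; split; [exact: QR|exact: QP|apply: (key s1 v s2 a b Q EP c1) => //].
by move=> u ->.
Qed.

End Longest.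

(** * A longest uncovered path that misses an uncovered vertex *)

Section NonHamiltonian.
Variable G : sgraph.
Implicit Types (u v w x y z : G) (S A B C D : {set G}) (P Q : seq G).

Local Notation adj := (@adj G).

Variables (m : nat) (F : {set {set G}}).
Hypothesis oF : opt m F.
Hypothesis m0 : 0 < m.
Local Notation R := (rest F).
Local Notation lp := (lp m F).

Lemma lp_end a b Q u0 : lp a b Q -> u0 \in R -> u0 \notin Q -> nb a R = 2 /\
  forall C, C \in F -> k33 C (nbs a C) /\ nbs b C = nbs a C.
Proof.
move=> h uR uQ; have [w [wR wQ dw]] := lp_w oF h uR uQ; split.
  by have [] := lp_load oF h wR wQ dw.
by move=> C CF; have [] := lp_sides oF h wR wQ dw CF.
Qed.

(** This serves the last hypothesis of [db_k33] and [th_k33]: a vertex off the path adjacent to [g]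
    becomes the end of a path of the same length that misses [x], so [lp_end] applies to it. *)
Lemma lp_repl x y g Q q : lp x y (x :: g :: Q) -> q \in R -> q \notin x :: g :: Q -> adj q g ->
  lp q y (q :: g :: Q) /\ x \notin q :: g :: Q.
Proof.
case=> [[t [[<-] ps L]]] us sR lg qR qn qg.
have nqx : x != q by apply: contraNneq qn => <-; apply: mem_head.
have ps' : path adj g Q by move: ps => /= /andP[].
move: us; rewrite cons_uniq => /andP[xn us].
move: qn; rewrite in_cons negb_or => /andP[_ qn].
split; last by rewrite in_cons negb_or nqx.
split.
- by exists (g :: Q); split; rewrite //= qg.
- by rewrite cons_uniq qn.
- by move=> u; rewrite in_cons => /orP[/eqP->//|uI]; apply: sR; rewrite in_cons uI orbT.
- exact: lg.
Qed.

(** Reversing [L] or [N] turns [x'] or [y'] into an end of a longest path, so [lp_end] shows that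
    all four ends see the same side of each member. *)
Lemma lp_db x y P u0 x' L h0 h1 M y' N : lp x y P -> u0 \in R -> u0 \notin P ->
  db F x x' L h0 h1 M y' y N -> perm_eq (L ++ M ++ N) P -> False.
Proof.
move=> h uR uP hd pm.
have cat a b e0 e1 c d (L' M' N' : seq G) : db F a b L' e0 e1 M' c d N' -> pth a d (L' ++ M' ++ N').
  case=> [[pL pM pN] [_ _ _ /and4P[d1 d2 d3 d4]]].
  by apply: (pth_cat pL (pth_cat pM pN _)) => //; rewrite adjC.
have h1' : lp x y (L ++ M ++ N) := lp_perm h (cat _ _ _ _ _ _ _ _ _ hd) pm.
have h2 : lp x' y (rev L ++ M ++ N).
  by apply: (lp_perm h (cat _ _ _ _ _ _ _ _ _ (db_flipL hd))); apply: perm_trans pm; permt.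
have h3 : lp x y' (L ++ M ++ rev N).
  by apply: (lp_perm h (cat _ _ _ _ _ _ _ _ _ (db_flipN hd))); apply: perm_trans pm; permt.
have un1 : u0 \notin L ++ M ++ N by rewrite (perm_mem pm).
have un2 : u0 \notin rev L ++ M ++ N by move: un1; rewrite !mem_cat mem_rev.
have un3 : u0 \notin L ++ M ++ rev N by move: un1; rewrite !mem_cat mem_rev.
have [dx s1] := lp_end h1' uR un1; have [_ s2] := lp_end h2 uR un2; have [_ s3] := lp_end h3 uR un3.
have dy := lp_le oF (lp_rev h).
have [[pL _ _] [_ _ /andP[sL _] _]] := hd.
case: pL => tL [EL _ _]; rewrite EL in hd sL h1'.
case: tL {EL} hd sL h1' => // g t hd _ h1'.
apply: (db_k33 oF hd m0 _ dy); first by rewrite dx.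
  move=> C CF; have [k1 E1] := s1 C CF; have [_ E2] := s2 C CF; have [_ E3] := s3 C CF.
  by split=> // e; rewrite !inE => /or3P[]/eqP->; rewrite -?E2 ?E1 ?E3.
move=> q qR qn qg C CF; have [hq xq] := lp_repl h1' qR qn qg.
have xR : x \in R by have [_ _ sR _] := h1'; apply: sR; apply: mem_head.
have [_ sq] := lp_end hq xR xq; have [_ Eq] := sq C CF; have [_ E1] := s1 C CF.
by rewrite -Eq E1.
Qed.

Lemma lp_th_long P u0 h1 h2 f1 l1 T1 f2 l2 T2 f3 l3 T3 : longest G m (size P) ->
  u0 \in R -> u0 \notin P ->
  th F h1 h2 f1 l1 T1 f2 l2 T2 f3 l3 T3 -> perm_eq (h1 :: h2 :: T1 ++ T2 ++ T3) P ->
  1 < size T1 -> False.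
Proof.
move=> lg uR uP h pm sT.
have ends e1 e2 a1 b1 (S1 : seq G) a2 b2 (S2 : seq G) a3 b3 (S3 : seq G) : th F e1 e2 a1 b1 S1 a2 b2 S2 a3 b3 S3 ->
    perm_eq (e1 :: e2 :: S1 ++ S2 ++ S3) P -> nb b1 R = 2 /\ nb a3 R <= 2 /\
    forall C, C \in F -> k33 C (nbs b1 C) /\ nbs a3 C = nbs b1 C.
  move=> h' pm'; have [t [p pmt ut tR _]] := th_path h'; have pm2 := perm_trans pmt pm'.
  have hl : lp b1 a3 (b1 :: t) by split; rewrite ?(perm_size pm2).
  have un : u0 \notin b1 :: t by rewrite (perm_mem pm2).
  have [d s] := lp_end hl uR un; split=> //; split=> //; exact: (lp_le oF (lp_rev hl)).
have [d1 [_ s13]] := ends _ _ _ _ _ _ _ _ _ _ _ h pm.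
have [_ [df2 s12]] := ends _ _ _ _ _ _ _ _ _ _ _ (th_swap h) ltac:(by apply: perm_trans pm; permt).
have [_ [_ s32]] := ends _ _ _ _ _ _ _ _ _ _ _ (th_rot (th_rot h)) ltac:(by apply: perm_trans pm; permt).
have [_ [_ s31]] := ends _ _ _ _ _ _ _ _ _ _ _ (th_rot (th_swap h)) ltac:(by apply: perm_trans pm; permt).
have all C : C \in F -> k33 C (nbs f1 C) /\ forall e, e \in [:: l1; f2; f3; l3] -> nbs e C = nbs f1 C.
  move=> CF; have [k1 E13] := s13 C CF; have [_ E12] := s12 C CF.
  have [_ E32] := s32 C CF; have [_ E31] := s31 C CF.
  have E : nbs f1 C = nbs l1 C by rewrite E31 -E32 E12.
  rewrite E; split=> // e; rewrite !inE => /or4P[]/eqP-> //.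
  by rewrite -E32 E12.
have [[p1 p2 p3] [us sR /and3P[c1 c2 c3] /and3P[e1 e2 e3]]] := h.
have [t1 [E1 ps1 L1]] := p1; case: t1 => [|g t] in E1 ps1 L1; first by rewrite E1 in sT.
rewrite E1 in h pm p1 us sR.
apply: (th_k33 oF h m0 df2).
  move=> C CF; have [kC E] := all C CF; split=> // e eI; apply: E; move: eI.
  by rewrite !inE => /or3P[]->; rewrite ?orbT.
move=> q qR qn qg C CF; have [kC E] := all C CF.
have pp : pth f1 l3 ((f1 :: g :: t) ++ [:: h2] ++ rev T2 ++ [:: h1] ++ T3).
  by apply: (pth_cat p1 (pth_cat (pth1 h2) (pth_cat (pth_rev p2) (pth_cat (pth1 h1) p3 _) _) _)) => //; rewrite adjC.
have pm1 : perm_eq ((f1 :: g :: t) ++ [:: h2] ++ rev T2 ++ [:: h1] ++ T3) (h1 :: h2 :: (f1 :: g :: t) ++ T2 ++ T3).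
  by permt.
have hl : lp f1 l3 ((f1 :: g :: t) ++ [:: h2] ++ rev T2 ++ [:: h1] ++ T3).
  split; rewrite ?(perm_uniq pm1) ?(perm_size pm1) ?(perm_size pm) //.
  by move=> u; rewrite (perm_mem pm1); apply: sR.
have [|hq xq] := lp_repl hl qR _ qg.
  by rewrite -cat_cons [in_mem _ _](perm_mem pm1).
have f1R : f1 \in R by apply: sR; rewrite !(in_cons, mem_cat) eqxx !orbT.
have [_ sq] := lp_end hq f1R xq; have [_ Eq] := sq C CF.
by rewrite -Eq E // !inE eqxx !orbT.
Qed.

(** A further uncovered vertex adjacent to one hub is the end of another longest path and has two
    neighbours on it, which can only be the hubs. Hence the rest is K_{2,t}, once no vertex avoids
    both hubs. *)
Lemma lp_k23 h1 h2 s1 s2 s3 u0 : longest G m 5 -> u0 \in R -> u0 \notin [:: h1; h2; s1; s2; s3] ->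
  th F h1 h2 s1 s1 [:: s1] s2 s2 [:: s2] s3 s3 [:: s3] -> extremal G m.
Proof.
move=> lg uR un [_ [us sR /and3P[a1 a2 a3] /and3P[b1 b2 b3]]]; rewrite -[[:: s1] ++ _]/[:: s1; s2; s3] in us sR.
have [h1R h2R s1R s2R s3R] : [/\ h1 \in R, h2 \in R, s1 \in R, s2 \in R & s3 \in R].
  by split; apply: sR; rewrite !inE eqxx ?orbT.
have lp5 (a b c d e : G) : uniq [:: a; b; c; d; e] -> {subset [:: a; b; c; d; e] <= R} ->
    [&& adj a b, adj b c, adj c d & adj d e] -> lp a e [:: a; b; c; d; e].
  move=> u5 sub /and4P[ab bc cd de]; split=> //; exists [:: b; c; d; e]; split=> //=.
  by rewrite ab bc cd de.
have sp (r t v : G) : perm_eq [:: h1; h2; r; t; v] [:: h1; h2; s1; s2; s3] ->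
    [&& adj h1 r, adj h1 t, adj t h2 & adj v h2] -> lp r v [:: r; h1; t; h2; v].
  move=> pm /and4P[hr ht th vh]; have pm' : perm_eq [:: r; h1; t; h2; v] [:: h1; h2; r; t; v] by permt.
  have pm2 := perm_trans pm' pm; apply: lp5; first by rewrite (perm_uniq pm2).
    by move=> u; rewrite (perm_mem pm2); apply: sR.
  by rewrite adjC hr ht th adjC vh.
have l13 : lp s1 s3 [:: s1; h1; s2; h2; s3] by apply: sp; rewrite ?a1 ?a2 ?b2 ?b3.
have l12 : lp s1 s2 [:: s1; h1; s3; h2; s2] by apply: sp; rewrite ?a1 ?a3 ?b2 ?b3 //; permt.
have l21 : lp s2 s1 [:: s2; h1; s3; h2; s1] by apply: sp; rewrite ?a2 ?a3 ?b1 ?b3 //; permt.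
have l31 : lp s3 s1 [:: s3; h1; s2; h2; s1] by apply: sp; rewrite ?a3 ?a2 ?b2 ?b1 //; permt.
have pm13 : perm_eq [:: s1; h1; s2; h2; s3] [:: h1; h2; s1; s2; s3] by permt.
have pm12 : perm_eq [:: s1; h1; s3; h2; s2] [:: h1; h2; s1; s2; s3] by permt.
have pm21 : perm_eq [:: s2; h1; s3; h2; s1] [:: h1; h2; s1; s2; s3] by permt.
have pm31 : perm_eq [:: s3; h1; s2; h2; s1] [:: h1; h2; s1; s2; s3] by permt.
have out q : q \in R -> q \notin [:: h1; h2; s1; s2; s3] -> [/\ ~~ adj q s1, ~~ adj q s2 & ~~ adj q s3].
  move=> qR qn; split; rewrite adjC; apply: contra qn.
  - by move/(lp_out oF l13 qR); rewrite (perm_mem pm13).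
  - by move/(lp_out oF l21 qR); rewrite (perm_mem pm21).
  - by move/(lp_out oF l31 qR); rewrite (perm_mem pm31).
have un1 : u0 \notin [:: s1; h1; s2; h2; s3] by rewrite (perm_mem pm13).
have un2 : u0 \notin [:: s1; h1; s3; h2; s2] by rewrite (perm_mem pm12).
have un3 : u0 \notin [:: s2; h1; s3; h2; s1] by rewrite (perm_mem pm21).
have [d1 k1] := lp_end l13 uR un1; have [_ k2] := lp_end l12 uR un2.
have hubs q e e' : q \in R -> q \notin [:: h1; h2; s1; s2; s3] ->
    lp q s2 [:: q; e; s1; e'; s2] -> perm_eq [:: e; s1; e'; s2] [:: h1; h2; s1; s2] ->
    [/\ adj q e, adj q e', nb q R = 2 & forall C, C \in F -> nbs q C = nbs s1 C].
  move=> qR qn lq pm; have [nq1 nq2 nq3] := out q qR qn.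
  have s3n : s3 \notin [:: q; e; s1; e'; s2].
    rewrite in_cons negb_or; apply/andP; split.
      by apply: contraNneq qn => <-; rewrite !inE eqxx !orbT.
    rewrite (perm_mem pm); have pm' : perm_eq [:: h1; h2; s1; s2; s3] (s3 :: [:: h1; h2; s1; s2]) by permt.
    by move: us; rewrite (perm_uniq pm') cons_uniq => /andP[].
  have [dq kq] := lp_end lq s3R s3n.
  have le : nb q R <= count (adj q) [:: q; e; s1; e'; s2].
    by apply: nb_le_count => u; apply: (lp_out oF lq).
  move: le; rewrite dq /= adj_irr (negPf nq1) (negPf nq2).
  case: (adj q e); case: (adj q e') => // _; split=> // C CF.
  have [_ <-] := kq C CF; have [_ ->] := k2 C CF; by [].
have u4 : uniq [:: h1; h2; s1; s2].
  by apply: subseq_uniq us; exact: (prefix_subseq [:: h1; h2; s1; s2] [:: s3]).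
have hub q : q \in R -> q \notin [:: h1; h2; s1; s2; s3] -> adj q h1 || adj q h2 ->
    [/\ adj q h1, adj q h2, nb q R = 2 & forall C, C \in F -> nbs q C = nbs s1 C].
  move=> qR qn; have q4 : q \notin [:: h1; h2; s1; s2].
    by apply: contra qn; rewrite -[X in _ -> q \in X]/([:: h1; h2; s1; s2] ++ [:: s3]) mem_cat => ->.
  have mk e e' : perm_eq [:: e; s1; e'; s2] [:: h1; h2; s1; s2] ->
      [&& adj q e, adj e s1, adj s1 e' & adj e' s2] -> lp q s2 [:: q; e; s1; e'; s2].
    move=> pm ad; apply: lp5 => //; first by rewrite cons_uniq (perm_mem pm) (perm_uniq pm) q4.
    move=> u; rewrite in_cons (perm_mem pm) => /orP[/eqP->//|uI]; apply: sR.
    by rewrite -[X in _ \in X]/([:: h1; h2; s1; s2] ++ [:: s3]) mem_cat uI.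
  case/orP=> qh.
    apply: (hubs q h1 h2) => //; last by permt.
    by apply: mk; rewrite ?qh ?a1 ?b1 1?adjC ?b2 //; permt.
  have [] := hubs q h2 h1 qR qn _ _; last by move=> ? ?; split.
    by apply: mk; rewrite ?qh ?(adjC h2) ?b1 ?(adjC s1) ?a1 ?a2 //; permt.
  by permt.
have /card_gt0P[C0 C0F] : 0 < #|F| by rewrite (opt_card oF).
(* The ends of a longest path [Q] among the vertices avoiding both hubs see the same side of [C0] as
   [s1] does. Then [e1], [e2], [g1] close [Q], and [e3] closes the path [s1 h1 s2 h2 s3]: two
   chorded cycles in place of one. *)
have all q : q \in R -> q \notin [:: h1; h2; s1; s2; s3] -> adj q h1 || adj q h2.
  move=> qR qn; apply/negPn/negP => nqh.
  pose K := [set u in R | (u \notin [:: h1; h2; s1; s2; s3]) && ~~ (adj u h1 || adj u h2)].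
  have [|a [b [Q [pQ uQ QK outQ]]]] := @longest_in _ K q; first by rewrite in_set qR qn.
  have QR u : u \in Q -> u \in R by move=> /QK; rewrite in_set => /andP[].
  have Qn u : u \in Q -> u \notin [:: h1; h2; s1; s2; s3] by move=> /QK; rewrite in_set => /and3P[].
  have Qh u : u \in Q -> ~~ (adj u h1 || adj u h2) by move=> /QK; rewrite in_set => /and3P[].
  have stay c u : c \in Q -> u \in R -> adj c u -> u \in K.
    move=> cQ uR' cu; have [n1 n2 n3] := out c (QR c cQ) (Qn c cQ); have := Qh c cQ.
    rewrite negb_or => /andP[nh1 nh2].
    have uP : u \notin [:: h1; h2; s1; s2; s3].
      apply/negP; rewrite !in_cons orbF.
      by do 4 (case/orP=> [/eqP E|]; first by rewrite E ?(negPf nh1) ?(negPf nh2) ?(negPf n1) ?(negPf n2) in cu);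
        move=> /eqP E; rewrite E (negPf n3) in cu.
    rewrite in_set uR' uP /=; apply/negP => uh; have [uh1 uh2 du _] := hub u uR' uP uh.
    have : 2 < nb u R; last by rewrite du.
    apply: (@nb_ge3 _ u h1 h2 c) => //; [exact: QR| |by rewrite adjC].
    move: us (Qn c cQ); rewrite /= !inE !negb_or => /andP[/andP[-> _] _] /andP[cn1 /andP[cn2 _]].
    by rewrite ![_ == c]eq_sym cn1 cn2.
  have aQ := pth_head pQ; have bQ := pth_last pQ.
  have da : nb a R <= 2.
    by apply: (pth_end_nb oF pQ uQ QR) => u uR' au; apply: outQ; rewrite ?au //; apply: (stay a).
  have db : nb b R <= 2.
    apply: (pth_end_nb oF (pth_rev pQ)); rewrite ?rev_uniq //; first by move=> u; rewrite mem_rev; apply: QR.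
    by move=> u uR' bu; rewrite mem_rev; apply: outQ; rewrite ?bu ?orbT //; apply: (stay b).
  have np c : c \in Q -> c \notin [:: s1; h1; s2; h2; s3] by move=> cQ; rewrite (perm_mem pm13) Qn.
  have [_ da2 _] := lp_load oF l13 (QR a aQ) (np a aQ) da.
  have [kC E3 Ea] := lp_sides oF l13 (QR a aQ) (np a aQ) da C0F.
  have [_ _ Eb] := lp_sides oF l13 (QR b bQ) (np b bQ) db C0F.
  have sQ : 1 < size Q.
    apply: (@leq_trans (count (adj a) Q)); last exact: count_size.
    by rewrite -da2; apply: nb_le_count => u uR' au; apply: outQ; rewrite ?au //; apply: (stay a).
  have [e1 [e2 [e3 [g1 [g2 [g3 [ue sA sB sC kab]]]]]]] := k33_list kC.
  have e1A : e1 \in nbs s1 C0 by apply: sA; rewrite !inE eqxx.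
  have e2A : e2 \in nbs s1 C0 by apply: sA; rewrite !inE eqxx ?orbT.
  have e3A : e3 \in nbs s1 C0 by apply: sA; rewrite !inE eqxx ?orbT.
  have [p13 u13 sR13 _] := l13.
  have uc : uniq [:: e1; e2; g1; e3].
    have pme : perm_eq [:: e1; e2; e3; g1; g2; g3] ([:: e1; e2; g1; e3] ++ [:: g2; g3]) by permt.
    by move: ue; rewrite (perm_uniq pme) cat_uniq => /and3P[].
  have uall : uniq ([:: e1; e2; g1; e3] ++ (Q ++ [:: s1; h1; s2; h2; s3])).
    apply: (@uniq_CR _ F C0) => //.
    - rewrite cat_uniq uQ u13 andbT; apply/hasPn => u uI; apply/negP => uQ'.
      by move: (np u uQ'); rewrite uI.
    - by move=> u uI; apply: sC; move: uI; rewrite !inE => /or4P[]->; rewrite ?orbT.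
    - by move=> u; rewrite mem_cat => /orP[/QR|/sR13].
  have pmu : perm_eq ((e1 :: e2 :: g1 :: Q) ++ e3 :: [:: s1; h1; s2; h2; s3]) ([:: e1; e2; g1; e3] ++ (Q ++ [:: s1; h1; s2; h2; s3])).
    by permt.
  have uall' : uniq ((e1 :: e2 :: g1 :: Q) ++ e3 :: [:: s1; h1; s2; h2; s3]) by rewrite (perm_uniq pmu).
  have [uu1 [_ uu2]] : uniq (e1 :: e2 :: g1 :: Q) /\ (true /\ uniq (e3 :: [:: s1; h1; s2; h2; s3])).
    by move: uall'; rewrite cat_uniq => /and3P[].
  have g1I : g1 \in [:: g1; g2; g3] by rewrite mem_head.
  apply: (@win1s _ _ _ oF C0 (e1 :: e2 :: g1 :: Q) (e3 :: [:: s1; h1; s2; h2; s3]) C0F) => //.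
  - apply: (chs_arcp pQ uu1 sQ); rewrite ?(side_adj Ea) ?(side_adj Eb) //; last exact: sub_set_seq.
      by rewrite adjC; apply: kab; rewrite // !inE eqxx.
    by rewrite adjC; apply: kab; rewrite // !inE eqxx ?orbT.
  - apply: (@chs_closep _ _ e3 _ _ _ p13) => //; last exact: sub_set_seq.
    + by rewrite adjC (side_adj erefl e3A).
    + by rewrite adjC (side_adj E3 e3A).
    + by rewrite -d1; apply: nb_le_count => u; apply: (lp_out oF l13).
  - move=> u; rewrite (perm_mem pmu) mem_cat => /orP[uI|].
      by apply: inU_C; apply: sC; move: uI; rewrite !inE => /or4P[]->; rewrite ?orbT.
    by rewrite mem_cat => /orP[/QR|/sR13] => ?; apply: inU_R.
have us' : uniq [:: h1; h2; s1; s3].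
  by apply: subseq_uniq us; rewrite /= !eqxx; case: (s3 == s2) => //=; rewrite eqxx.
have sor q : q \notin [:: h1; h2] -> [\/ q = s1, q = s2, q = s3 | q \notin [:: h1; h2; s1; s2; s3]].
  move=> qn; case: (boolP (q \in [:: h1; h2; s1; s2; s3])) => [|_]; last by constructor 4.
  rewrite -[X in q \in X]/([:: h1; h2] ++ [:: s1; s2; s3]) mem_cat (negPf qn) /= !inE.
  by case/or3P=> /eqP->; [constructor 1|constructor 2|constructor 3].
apply: (extremal_fin oF us').
- by apply/allP; rewrite /= h1R h2R s1R s3R.
- move=> q qR /sor[->|->|->|qn].
  + by rewrite adjC a1 b1 (lp_le oF l13).
  + by rewrite adjC a2 b2 (lp_le oF l21).
  + by rewrite adjC a3 b3 (lp_le oF l31).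
  + by have [-> -> ->] := hub q qR qn (all q qR qn).
- move=> C CF; have [kC E3] := k1 C CF; have [_ E2] := k2 C CF; split=> // q qR /sor[->|->|->|qn] //.
  by have [_ _ _ H] := hub q qR qn (all q qR qn); apply: H.
Qed.

Lemma nonham_case x y P u0 : lp x y P -> u0 \in R -> u0 \notin P -> extremal G m.
Proof.
move=> h uR uP; have [p us PR lg] := h; have [dx s] := lp_end h uR uP.
have uP' : u0 \notin rev P by rewrite mem_rev.
have h' := lp_rev h; have [dy _] := lp_end h' uR uP'.
have /card_gt0P[C0 C0F] : 0 < #|F| by rewrite (opt_card oF).
have [kC E] := s C0 C0F.
have nxy : ~~ adj x y.
  apply/negP => xy; apply: (k33_adj_neq oF C0F kC _ _ xy erefl E); apply: PR.
    exact: pth_head p.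
  exact: pth_last p.
have cx : 1 < count (adj x) P by rewrite -dx; apply: nb_le_count => u; apply: (lp_out oF h).
have cy : 1 < count (adj y) P.
  by rewrite -dy -count_rev; apply: nb_le_count => u; apply: (lp_out oF h').
case: (classify oF p us PR nxy cx cy).
  by case=> x' [L [g1 [g2 [M [y' [N [hd pm]]]]]]]; case: (lp_db h uR uP hd pm).
case=> h1 [h2 [f1 [l1 [T1 [f2 [T2 [l3 [T3 [ht pm]]]]]]]]].
have [p1 p2 p3] := ht.1.
case: (ltnP 1 (size T1)) => [s1|/(size1_pth p1)[E1 L1]]; first by case: (lp_th_long lg uR uP ht pm s1).
case: (ltnP 1 (size T2)) => [s2|/(size1_pth p2)[E2 L2]].
  case: (lp_th_long lg uR uP (th_rot ht) _ s2).
  by apply: perm_trans pm; permt.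
case: (ltnP 1 (size T3)) => [s3|/(size1_pth p3)[E3 L3]].
  case: (lp_th_long lg uR uP (th_rot (th_rot ht)) _ s3).
  by apply: perm_trans pm; permt.
rewrite E1 E2 E3 in ht pm.
apply: (@lp_k23 h1 h2 f1 f2 y u0) => //.
- by rewrite -[5]/(size [:: h1; h2; f1; f2; y]) (perm_size pm).
- by rewrite (perm_mem pm).
- by move: ht; rewrite L1 L2 L3.
Qed.

End NonHamiltonian.

(** * Choosing the optimal packing and the longest path *)

Section Core.
Variable G : sgraph.
Implicit Types (u v w x y z : G) (S A B C D : {set G}).
Variable m : nat.

Local Notation adj := (@adj G).

Lemma card_rest (F : {set {set G}}) : #|rest F| = #|G| - #|cover F|.
Proof. by rewrite -(cardsC (cover F)) addKn. Qed.

Lemma opt_cover (F F' : {set {set G}}) : opt m F -> opt m F' -> #|cover F| = #|cover F'|.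
Proof.
move=> [p1 c1 m1 _ _] [p2 c2 m2 _ _].
by have := m1 F' p2 c2; have := m2 F p1 c1; clear; lia.
Qed.

(** The packing and the path are chosen together, as [longest] demands. All optimal packings cover
    equally many vertices, so the new one also leaves at least four uncovered. *)
Lemma opt_extremal (F : {set {set G}}) : opt m F -> 0 < m -> 4 <= #|rest F| -> extremal G m.
Proof.
move=> oF m0 r4.
pose ok (p : {set {set G}} * seq G) := opt m p.1 /\ [/\ sorted adj p.2, uniq p.2 & {subset p.2 <= rest p.1}].
have [|[F1 P] [[/= oF1 [sP uP PR]] maxP]] := @exists_minimizer _ ok (fun p => #|G| - size p.2).
  by exists (F, [::]).
have sz (s : seq G) : uniq s -> size s <= #|G| by move/card_uniqP<-; apply: max_card.
have lg : longest G m (size P).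
  move=> F' s oF' ss us sR; have := maxP (F', s) ltac:(by split) => /=.
  by rewrite leq_sub2lE // sz.
have r4' : 4 <= #|rest F1| by rewrite card_rest (opt_cover oF1 oF) -card_rest.
case: P sP uP PR lg {maxP} => [|x t] sP uP PR lg.
  have /card_gt0P[u uR] : 0 < #|rest F1| by apply: leq_trans r4'.
  by have := lg F1 [:: u] oF1 isT isT; rewrite ltnn => H; suff: false by []; apply: H => v; rewrite mem_seq1 => /eqP->.
have p : pth x (last x t) (x :: t) by exists t.
case: (boolP [exists u in rest F1, u \notin x :: t]) => [/exists_inP[u uR un]|].
  by apply: (nonham_case oF1 m0 (x := x) (y := last x t) (P := x :: t) _ uR un); split.
rewrite negb_exists_in => /forall_inP H.
have PE : x :: t =i rest F1.
  by move=> u; apply/idP/idP => [/PR//|uR]; apply/negPn; apply: H.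
apply: (ham_case oF1 m0 p uP PE); apply: leq_trans r4' _.
by rewrite -(eq_card PE) (card_uniqP uP).
Qed.

Lemma edges_le (C : {set G}) : edges C <= #|G| * #|G|.
Proof.
rewrite /edges; apply: (@leq_trans (\sum_(x in C) #|G|)).
  by apply: leq_sum => x _; apply: leq_trans (nb_le _ _) (max_card _).
by rewrite sum_nat_const leq_mul2r max_card orbT.
Qed.

Lemma core (F : {set {set G}}) : 0 < m -> packing F -> #|F| = m -> #|cover F| + 4 <= #|G| ->
  (forall F' : {set {set G}}, packing F' -> #|F'| <> m.+1) ->
  (forall x y, x != y -> ~~ adj x y -> 6 * m + 4 <= degree x + degree y) -> extremal G m.
Proof.
move=> m0 pF cF le nop ore.
have [|F1 [[p1 c1] min1]] := @exists_minimizer _ (fun F' => packing F' /\ #|F'| = m) (fun F' : {set {set G}} => #|cover F'|).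
  by exists F.
(* [B] bounds the number of inner edges, so minimising [B - e F'] maximises [e F']. *)
pose B := #|G| * #|G| * m; pose e (F' : {set {set G}}) := \sum_(C in F') edges C.
have [|F2 [[p2 c2 e2] min2]] := @exists_minimizer _ (fun F' => [/\ packing F', #|F'| = m & #|cover F'| <= #|cover F1|])
   (fun F' => B - e F').
  by exists F1.
have eB (F' : {set {set G}}) : #|F'| = m -> e F' <= B.
  move=> cF'; rewrite /B -cF' mulnC -sum_nat_const; apply: leq_sum => C _; exact: edges_le.
apply: (@opt_extremal F2) => //.
  split=> // F' p' c'; case: (ltnP #|cover F2| #|cover F'|) => [|ge]; [by left|right].
  have := min1 F2 (conj p2 c2); have := min1 F' (conj p' c') => l1 l2.
  have := min2 F' ltac:(by split=> //; apply: leq_trans ge e2).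
  have := eB F' c'; have := eB F2 c2; rewrite -/(e F') -/(e F2).
  by move: ge e2 l1 l2; clear; lia.
rewrite card_rest; have := min1 F (conj pF cF).
by move: e2 le; clear; lia.
Qed.

End Core.

(** * From complete joins to complete multipartite graphs *)

Section Exact.
Variable G : sgraph.
Implicit Types (u v w x y z a : G) (S A B C D X : {set G}).
Variable m : nat.

Local Notation adj := (@adj G).

Definition exact1 := exists X : {set G}, [/\ #|X| = 3 * m + 2, 3 * m + 2 <= #|~: X| &
  forall x y, adj x y = ((x \in X) != (y \in X))].

Definition exact2 := exists (a : G) (X Y : {set G}),
  [/\ [/\ a \notin X, a \notin Y & forall u, [|| u == a, u \in X | u \in Y]],
      [disjoint X & Y], #|X| = 3 * m + 1, #|Y| = 3 * m + 1 &
      forall x y, adj x y = (x != y) && [|| x == a, y == a | (x \in X) != (y \in X)]].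

Definition joined A B := forall u v, u \in A -> v \in B -> adj u v.

Lemma joinedC A B : joined A B -> joined B A.
Proof. by move=> j u v uB vA; rewrite adjC; apply: j. Qed.

Lemma joinedS A B A' B' : A' \subset A -> B' \subset B -> joined A B -> joined A' B'.
Proof. by move=> /subsetP sA /subsetP sB j u v /sA uA /sB; apply: j. Qed.

Lemma joined_disjoint A B : joined A B -> [disjoint A & B].
Proof. by move=> j; apply: disjoint_mem => u uA uB; have := j u u uA uB; rewrite adj_irr. Qed.

Lemma pack_k33 A B j : joined A B -> 3 * j <= #|A| -> 3 * j <= #|B| ->
  exists F : {set {set G}}, [/\ packing F, #|F| = j & cover F \subset A :|: B].
Proof.
elim: j A B => [|j IH] A B jAB cA cB.
  by exists set0; rewrite cards0 /cover big_set0 sub0set; split=> //; apply: packing_set0.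
have /card_gt2P[x1 [x2 [x3 [[x1A x2A x3A] [n12 n23 n31]]]]] : 2 < #|A| by move: cA; clear; lia.
have /card_gt2P[y1 [y2 [y3 [[y1B y2B y3B] [k12 k23 k31]]]]] : 2 < #|B| by move: cB; clear; lia.
have [|||F [pF cF sF]] := IH (A :\ x1 :\ x2 :\ x3) (B :\ y1 :\ y2 :\ y3).
- by apply: joinedS jAB; apply/subsetP => u; rewrite !in_setD1 => /and4P[].
- by move: cA; rewrite (cardsD1 x1) (cardsD1 x2 (A :\ x1)) (cardsD1 x3 (A :\ x1 :\ x2)); clear;
  case: (_ \in _); case: (_ \in _); case: (_ \in _); lia.
- by move: cB; rewrite (cardsD1 y1) (cardsD1 y2 (B :\ y1)) (cardsD1 y3 (B :\ y1 :\ y2)); clear;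
  case: (_ \in _); case: (_ \in _); case: (_ \in _); lia.
pose s := [:: x1; y1; x2; y2; x3; y3].
have sAB : {subset s <= A :|: B}.
  by apply/allP; rewrite /= !in_setU x1A x2A x3A y1B y2B y3B !orbT.
have ne u v : u \in A -> v \in B -> u != v by move=> uA vB; apply/adj_neq/jAB.
have us : uniq s.
  rewrite /= !inE !negb_or (ne x1 y1) // (ne x1 y2) // (ne x1 y3) // (eq_sym y1 x2) (eq_sym y1 x3).
  rewrite (ne x2 y1) // (ne x3 y1) // (ne x2 y2) // (ne x2 y3) // (eq_sym y2 x3) (ne x3 y2) //.
  by rewrite (ne x3 y3) // n12 n23 k12 k23 (eq_sym x1) n31 (eq_sym y1) k31.
have cs : chs [set u in s].
  apply: (@chs_mk _ _ x1 [:: y1; x2] y2 [:: x3; y3]) => //; last exact: sub_set_seq.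
    have jBA := joinedC jAB.
    by rewrite /= (jAB x1 y1) // (jBA y1 x2) // (jAB x2 y2) // (jBA y2 x3) // (jAB x3 y3) // (jBA y3 x1).
  exact: jAB.
have [|p _ c] := packingU pF (packing1 cs).
  rewrite cover_set1; apply: disjoint_mem => u /(subsetP sF); rewrite !in_setU !in_setD1 [u \in [set _ in s]]in_set.
  have xn v : v \in [:: x1; x2; x3] -> v \notin B by move=> vI; apply/negP => /(ne v v); rewrite eqxx => H;
    suff: false by []; apply: H; move: vI; rewrite !inE => /or3P[]/eqP->.
  have yn v : v \in [:: y1; y2; y3] -> v \notin A by move=> vI; apply/negP => vA; have := ne v v vA; rewrite eqxx => H;
    suff: false by []; apply: H; move: vI; rewrite !inE => /or3P[]/eqP->.
  case/orP=> /and4P[e1 e2 e3 uAB]; rewrite !in_cons orbF (negPf e1) (negPf e2) (negPf e3) /= => uI.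
    have : u \in [:: y1; y2; y3] by move: uI; rewrite !inE ?orbF.
    by move/yn; rewrite uAB.
  have : u \in [:: x1; x2; x3] by move: uI; rewrite !inE ?orbF.
  by move/xn; rewrite uAB.
exists (F :|: [set [set u in s]]); split=> //; first by rewrite c cF cards1 addn1.
rewrite coverU cover_set1 subUset; apply/andP; split.
  apply: subset_trans sF _; apply/subsetP => u; rewrite !in_setU !in_setD1.
  by case/orP=> /and4P[_ _ _ ->]; rewrite ?orbT.
by apply/subsetP => u; rewrite in_set => /sAB.
Qed.

Lemma pack_add F D A B : packing F -> cover F \subset A :|: B -> chs D ->
  (forall u, u \in D -> (u \notin A) && (u \notin B)) ->
  exists F', [/\ packing F', #|F'| = #|F|.+1 & cover F' \subset D :|: cover F].
Proof.
move=> pF sF cD nD; have [|p _ c] := packingU pF (packing1 cD).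
  rewrite cover_set1; apply: disjoint_mem => u /(subsetP sF); rewrite in_setU => uAB /nD.
  by case/andP=> /negPf n1 /negPf n2; move: uAB; rewrite n1 n2.
exists (F :|: [set D]); rewrite c cards1 addn1; split=> //.
by rewrite coverU cover_set1 setUC.
Qed.

Lemma k4m_split A B u v : joined A B -> u \in A -> v \in A -> adj u v -> 1 < #|B| ->
  exists y1 y2, [/\ y1 \in B, y2 \in B, y1 != y2 & chs [set w in [:: u; y1; v; y2]]].
Proof.
move=> j uA vA uv /card_gt1P[y1 [y2 [y1B y2B ny]]]; exists y1, y2; split=> //.
apply: (@chs_k4m _ _ u y1 v y2) => //; try exact: j; try by rewrite adjC; apply: j.
exact: sub_set_seq.
Qed.

Lemma card_D2 A u v c : c + 2 <= #|A| -> c <= #|A :\ u :\ v|.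
Proof.
by rewrite (cardsD1 u) (cardsD1 v (A :\ u)); case: (_ \in _); case: (_ \in _); clear; lia.
Qed.

(** The edge [u v] and two vertices of [B] form a chorded cycle with only two vertices on each side;
    [3 * m] vertices remain on both for [m] copies of K_{3,3}. *)
Lemma pack_inner A B u v : joined A B -> u \in A -> v \in A -> adj u v ->
  3 * m + 2 <= #|A| -> 3 * m + 2 <= #|B| -> exists F : {set {set G}}, packing F /\ #|F| = m.+1.
Proof.
move=> j uA vA uv cA cB; have [|y1 [y2 [y1B y2B ny cs]]] := k4m_split j uA vA uv.
  by move: cB; clear; lia.
have j' : joined (A :\ u :\ v) (B :\ y1 :\ y2).
  by apply: joinedS j; apply/subsetP => z; rewrite !in_setD1 => /and3P[].
have [||F [pF cF sF]] := pack_k33 (j := m) j'; try exact: card_D2.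
have dis := joined_disjoint j.
have [|F' [p' c' _]] := pack_add pF sF cs; last by exists F'; rewrite c' cF.
move=> w; rewrite in_set !inE => /or4P[]/eqP->; rewrite ?eqxx ?andbF //=.
- by rewrite (disjointFr dis uA) !andbF.
- by rewrite (disjointFl dis y1B) !andbF.
- by rewrite (disjointFr dis vA) !andbF.
- by rewrite (disjointFl dis y2B) !andbF.
Qed.

(** One chorded cycle consists of the edge [u v] and two vertices of [B], another of [a], a vertex
    [x] of [A] and two more vertices of [B]. They use three vertices of [A] and four of [B], which
    leaves enough for [m.-1] copies of K_{3,3}. *)
Lemma pack_inner2 A B u v a : 0 < m -> joined A B -> u \in A -> v \in A -> adj u v ->
  3 * m + 1 <= #|A| -> 3 * m + 1 <= #|B| -> a \notin A -> a \notin B ->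
  (forall w, w \in A -> adj a w) -> (forall w, w \in B -> adj a w) ->
  exists F : {set {set G}}, packing F /\ #|F| = m.+1.
Proof.
move=> m0 j uA vA uv cA cB aA aB adA adB; have [|y1 [y2 [y1B y2B ny cs]]] := k4m_split j uA vA uv.
  by move: cB m0; clear; lia.
pose A1 := A :\ u :\ v; pose B1 := B :\ y1 :\ y2.
have sA1 : A1 \subset A by apply/subsetP => z; rewrite !in_setD1 => /and3P[].
have sB1 : B1 \subset B by apply/subsetP => z; rewrite !in_setD1 => /and3P[].
have cA1 : 3 * m.-1 + 2 <= #|A1| by apply: card_D2; move: cA m0; clear; lia.
have cB1 : 3 * m.-1 + 2 <= #|B1| by apply: card_D2; move: cB m0; clear; lia.
have /card_gt0P[x xA1] : 0 < #|A1| by move: cA1; clear; lia.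
have /card_gt1P[z1 [z2 [z1B z2B nz]]] : 1 < #|B1| by move: cB1; clear; lia.
have xA := subsetP sA1 _ xA1; have z1B' := subsetP sB1 _ z1B; have z2B' := subsetP sB1 _ z2B.
have cs2 : chs [set w in [:: a; z1; x; z2]].
  apply: (@chs_k4m _ _ a z1 x z2) => //; try exact: adB; try exact: adA; try exact: j; last exact: sub_set_seq.
  - by rewrite adjC; apply: j.
  - by rewrite adjC; apply: adB.
have j1 : joined (A1 :\ x) (B1 :\ z1 :\ z2).
  apply: joinedS j; apply: subset_trans (subsetDl _ _) _ => //.
  by apply: subset_trans (subsetDl _ _) _.
have dis := joined_disjoint j.
have [||F [pF cF sF]] := pack_k33 (j := m.-1) j1.
- by move: cA1; rewrite (cardsD1 x) xA1; clear; lia.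
- exact: card_D2.
have [|F' [p' c' s']] := pack_add pF sF cs2.
  move=> w; rewrite in_set !in_cons orbF => /or4P[]/eqP->; rewrite !in_setD1 ?eqxx ?andbF //=.
  - by rewrite (negPf aA) (negPf aB) !andbF.
  - by rewrite (disjointFl dis z1B') !andbF.
  - by rewrite (disjointFr dis xA) !andbF.
  - by rewrite (disjointFl dis z2B') !andbF.
have s2 : cover F' \subset (a |: A1) :|: B1.
  apply: subset_trans s' _; rewrite subUset; apply/andP; split.
    apply/subsetP => w; rewrite in_set !in_cons orbF => /or4P[]/eqP->; rewrite !in_setU ?z1B ?z2B ?xA1 ?in_set1 ?eqxx ?orbT //.
  apply: subset_trans sF _; apply: setUSS; first exact: subset_trans (subD1set _ _) (subsetUr _ _).
  exact: subset_trans (subD1set _ _) (subD1set _ _).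
have [|F2 [p2 c2 _]] := pack_add p' s2 cs; last by exists F2; rewrite c2 c' cF prednK.
have na w : w \in A -> w != a by apply: contraTneq => ->.
have nb w : w \in B -> w != a by apply: contraTneq => ->.
move=> w; rewrite in_set !in_cons orbF => /or4P[]/eqP->; rewrite in_setU1 !in_setD1 ?eqxx ?andbF ?orbF //=.
- by rewrite na //= (disjointFr dis uA) !andbF.
- by rewrite (negPf (nb _ _)) // (disjointFl dis y1B) !andbF.
- by rewrite na //= (disjointFr dis vA) !andbF.
- by rewrite (negPf (nb _ _)) // (disjointFl dis y2B) !andbF.
Qed.

Lemma extremal_exact : 0 < m -> (forall F : {set {set G}}, packing F -> #|F| <> m.+1) ->
  extremal G m -> exact1 \/ exact2.
Proof.
move=> m0 nop [X [jX [cX cY]]].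
have j : joined X (~: X) by move=> x y xX; rewrite in_setC; apply: jX.
case: cY => [cY|[cY [a aX adX]]].
  have inX x y : x \in X -> y \in X -> ~~ adj x y.
    move=> xX yX; apply/negP => xy; have [|F [pF cF]] := pack_inner j xX yX xy _ cY; last exact: nop pF cF.
    by rewrite cX.
  have inY x y : x \notin X -> y \notin X -> ~~ adj x y.
    rewrite -!in_setC => xX yX; apply/negP => xy.
    have [|F [pF cF]] := pack_inner (joinedC j) xX yX xy cY; last exact: nop pF cF.
    by rewrite cX.
  left; exists X; split=> // x y; case: (boolP (x \in X)) => xX; case: (boolP (y \in X)) => yX /=.
  - by apply: negbTE; apply: inX.
  - exact: jX.
  - by rewrite adjC; apply: jX.
  - by apply: negbTE; apply: inY.
pose X0 := X :\ a.
have cX0 : #|X0| = 3 * m + 1 by move: cX; rewrite (cardsD1 a) aX -/X0; clear; lia.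
have j0 : joined X0 (~: X) by apply: joinedS j; rewrite ?subsetDl.
have aX0 : a \notin X0 by rewrite in_setD1 eqxx.
have aY : a \notin ~: X by rewrite in_setC aX.
have ad0 w : w \in X0 -> adj a w by rewrite in_setD1 => /andP[na wX]; apply: adX.
have adY w : w \in ~: X -> adj a w by apply: j.
have inX x y : x \in X0 -> y \in X0 -> ~~ adj x y.
  move=> xX yX; apply/negP => xy.
  by have [||F [pF cF]] := pack_inner2 m0 j0 xX yX xy _ _ aX0 aY ad0 adY;
    rewrite ?cX0 ?cY //; apply: nop pF cF.
have inY x y : x \in ~: X -> y \in ~: X -> ~~ adj x y.
  move=> xX yX; apply/negP => xy.
  by have [||F [pF cF]] := pack_inner2 m0 (joinedC j0) xX yX xy _ _ aY aX0 adY ad0;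
    rewrite ?cX0 ?cY //; apply: nop pF cF.
right; exists a, X0, (~: X); split=> //; last 1 first.
- move=> x y; case: (eqVneq x y) => [->|nxy] /=; first by rewrite adj_irr.
  case: (eqVneq x a) => [Ex|nx] /=.
    rewrite Ex; case: (boolP (y \in X)) => yX; first by apply: ad0; rewrite in_setD1 yX -Ex eq_sym nxy.
    by apply: adY; rewrite in_setC.
  case: (eqVneq y a) => [Ey|ny] /=.
    rewrite Ey adjC; case: (boolP (x \in X)) => xX; first by apply: ad0; rewrite in_setD1 xX nx.
    by apply: adY; rewrite in_setC.
  rewrite /X0 !in_setD1 nx ny /=; case: (boolP (x \in X)) => xX; case: (boolP (y \in X)) => yX /=.
  - by apply: negbTE; apply: inX; rewrite in_setD1 ?nx ?ny.
  - exact: jX.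
  - by rewrite adjC; apply: jX.
  - by apply: negbTE; apply: inY; rewrite in_setC.
- by split=> // u; rewrite in_setD1 in_setC; case: eqVneq => //= _; case: (u \in X).
- exact: joined_disjoint j0.
Qed.

End Exact.

Section Complete.
Variable G : sgraph.
Implicit Types (u v w x y z : G) (S A B C D : {set G}).
Local Notation adj := (@adj G).

(** The base of the induction on non-edges: a complete graph is cut into copies of K_4. *)
Lemma pack_k4 S j : (forall u v, u \in S -> v \in S -> u != v -> adj u v) -> 4 * j <= #|S| ->
  exists F : {set {set G}}, [/\ packing F, #|F| = j & cover F \subset S].
Proof.
elim: j S => [|j IH] S cS le.
  by exists set0; rewrite cards0 /cover big_set0 sub0set; split=> //; apply: packing_set0.
have /card_gt0P[a aS] : 0 < #|S| by move: le; clear; lia.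
have /card_gt2P[b [c [d [[bS' cS' dS'] [nbc ncd ndb]]]]] : 2 < #|S :\ a|.
  by move: le; rewrite (cardsD1 a) aS; clear; lia.
move: bS' cS' dS'; rewrite !in_setD1 => /andP[nba bS] /andP[nca cS0] /andP[nda dS].
have us : uniq [:: a; b; c; d] by rewrite /= !inE !negb_or ![a == _]eq_sym nba nca nda nbc ncd [b == d]eq_sym ndb.
have cs : chs [set u in [:: a; b; c; d]].
  apply: (@chs_k4m _ _ a b c d); last exact: sub_set_seq; rewrite ?cS // 1?eq_sym //.
have sS : [set u in [:: a; b; c; d]] \subset S.
  by apply/subsetP => u; rewrite in_set !in_cons orbF => /or4P[]/eqP->.
have [||F [pF cF sF]] := IH (S :\: [set u in [:: a; b; c; d]]).
- by move=> u v /setDP[uS _] /setDP[vS _]; apply: cS.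
- have c4 : #|[set u in [:: a; b; c; d]]| = 4.
    by apply: etrans (card_uniqP us); apply: eq_card => u; rewrite in_set.
  by rewrite cardsD (setIidPr sS) c4; move: le; clear; lia.
have [|p _ c'] := packingU pF (packing1 cs).
  by rewrite cover_set1; apply: disjoint_mem => u /(subsetP sF); rewrite in_setD => /andP[/negP].
exists (F :|: [set [set u in [:: a; b; c; d]]]); split=> //; first by rewrite c' cF cards1 addn1.
rewrite coverU cover_set1 subUset sS andbT; apply: subset_trans sF _; exact: subsetDl.
Qed.

End Complete.

Section Low.
Variables (G : sgraph) (m : nat).
Local Notation adj := (@adj G).

(** To be used for a newly added edge [x y]: before its addition [v] had one neighbour less, so the
    nonadjacent pair [v], [v'] fell below [6 * m + 4]. *)
Lemma exact_low x y : 0 < m -> exact1 G m \/ exact2 G m -> adj x y ->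
  exists v v' : G, [/\ v = x \/ v = y, v != v', ~~ adj v v', degree v <= 3 * m + 2
    & degree v' <= 3 * m + 2].
Proof.
move=> m0 [[X [cX cY E]]|[a [X [Y [[aX aY cov] dXY cX cY E]]]]] xy.
  have dY v : v \notin X -> degree v <= 3 * m + 2.
    move=> vX; rewrite -cX; apply/subset_leq_card/subsetP => u; rewrite in_set E (negPf vX).
    by case: (u \in X).
  have twin v : v \notin X -> exists2 v', v != v' & (v' \notin X).
    move=> vX; have /card_gt0P[v'] : 0 < #|~: X :\ v|.
      by move: cY; rewrite (cardsD1 v) in_setC vX; move: m0; clear; lia.
    by rewrite in_setD1 in_setC => /andP[n v'X]; exists v'; rewrite // eq_sym.
  have [v [vxy vX]] : exists v, (v = x \/ v = y) /\ v \notin X.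
    move: xy; rewrite E; case: (boolP (x \in X)) => xX; first by move=> yX; exists y; split; [right|case: (y \in X) yX].
    by exists x; split=> //; left.
  have [v' n v'X] := twin v vX; exists v, v'; split=> //; try exact: dY.
  by rewrite E (negPf vX) (negPf v'X).
have half (A B : {set G}) v : a \notin A -> a \notin B -> (forall u, [|| u == a, u \in A | u \in B]) ->
    [disjoint A & B] -> #|A| = 3 * m + 1 -> #|B| = 3 * m + 1 ->
    (forall u w, adj u w = (u != w) && [|| u == a, w == a | (u \in A) != (w \in A)]) -> v \in A ->
    exists v', [/\ v != v', ~~ adj v v', degree v <= 3 * m + 2 & degree v' <= 3 * m + 2].
  move=> aA aB covA dAB cA cB EA vA.
  have dA w : w \in A -> degree w <= 3 * m + 2.
    move=> wA; apply: (@leq_trans #|a |: B|); last by rewrite cardsU1 aB cB; clear; lia.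
    apply/subset_leq_card/subsetP => u; rewrite in_set EA wA in_setU1 => /andP[nwu].
    have -> : (w == a) = false by apply: contraNF aA => /eqP<-.
    by case: (eqVneq u a) => //= nua; have := covA u; rewrite (negPf nua) /=; case: (u \in A).
  have /card_gt0P[v'] : 0 < #|A :\ v| by move: cA; rewrite (cardsD1 v) vA; move: m0; clear; lia.
  rewrite in_setD1 => /andP[n v'A]; exists v'; split; rewrite 1?eq_sym ?dA //.
  rewrite EA vA v'A eqxx orbF negb_and negb_or; apply/orP; right.
  by apply/andP; split; apply: contraNneq aA => <-.
have [v [vxy va]] : exists v, (v = x \/ v = y) /\ v != a.
  case: (eqVneq x a) => [Ex|]; last by exists x; split=> //; left.
  by exists y; split; [right|rewrite -Ex eq_sym adj_neq].
have [v' [n1 n2 d1 d2]] : exists v', [/\ v != v', ~~ adj v v', degree v <= 3 * m + 2 & degree v' <= 3 * m + 2].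
  have := cov v; rewrite (negPf va) /= => /orP[vX|vY]; first exact: (half X Y).
  apply: (half Y X) => //; first by move=> u; rewrite [(u \in Y) || _]orbC.
    by rewrite disjoint_sym.
  move=> u w; rewrite E; case: (eqVneq u w) => //= nuw; case: eqVneq => //= ua; case: eqVneq => //= wa.
  have XY z : z != a -> (z \in X) = (z \notin Y).
    move=> za; have := cov z; rewrite (negPf za) /=; case: (boolP (z \in X)) => zX.
      by rewrite (disjointFr dXY zX).
    by move=> /= ->.
  by rewrite !XY //; case: (u \in Y); case: (w \in Y).
by exists v, v'.
Qed.

End Low.

(** * Edge-maximal counterexamples *)

Section AddEdge.
Variables (G : sgraph) (x y : G).
Hypothesis nxy : x != y.

Definition add_adj : rel G := fun u v => [|| adj u v, (u == x) && (v == y) | (u == y) && (v == x)].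

Lemma add_sym : symmetric add_adj.
Proof. by move=> u v; rewrite /add_adj adj_sym; congr (_ || _); rewrite orbC andbC [X in _ || X]andbC. Qed.

Lemma add_irr : irreflexive add_adj.
Proof.
move=> u; rewrite /add_adj adj_irr /=; case: (eqVneq u x) => [->|_]; last by rewrite andbF.
by rewrite (negPf nxy).
Qed.

Definition add_edge : sgraph := SGraph add_sym add_irr.

Lemma add_chs (S : {set G}) : @chs add_edge S -> ~~ ((x \in S) && (y \in S)) -> @chs G S.
Proof.
case=> [u [s1 [v [s2 [us cs ss uv sub]]]]] nS; exists u, s1, v, s2.
have ad w z : w \in S -> z \in S -> add_adj w z -> adj w z.
  move=> wS zS /or3P[//|/andP[/eqP ew /eqP ez]|/andP[/eqP ew /eqP ez]];
  by move: nS; rewrite -ew -ez wS zS.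
split=> //; last by apply: ad => //; apply: sub; rewrite ?in_cons ?mem_cat ?in_cons eqxx ?orbT.
apply: (@sub_in_cycle _ (mem S) add_adj) => //.
by apply/allP => w /sub.
Qed.

Lemma add_degree u : @degree G u <= @degree add_edge u.
Proof.
by apply/subset_leq_card/subsetP => w; rewrite !in_set /= /add_adj => ->.
Qed.

Lemma add_degree_end v : v = x \/ v = y -> ~~ adj x y -> @degree G v < @degree add_edge v.
Proof.
move=> vxy nadj; apply/proper_card/properP; split.
  by apply/subsetP => w; rewrite !in_set /= /add_adj => ->.
case: vxy => ->; [exists y|exists x]; rewrite !in_set /= /add_adj ?eqxx ?orbT //.
by rewrite adj_sym.
Qed.

End AddEdge.

Definition nonedges (G : sgraph) := #|[set p : G * G | (p.1 != p.2) && ~~ adj p.1 p.2]|.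

Lemma exact_of_ore (G : sgraph) m : 0 < m -> 4 * m.+1 <= #|G| ->
  (forall F : {set {set G}}, packing F -> #|F| <> m.+1) ->
  (forall x y : G, x != y -> ~~ adj x y -> 6 * m + 4 <= degree x + degree y) ->
  exact1 G m \/ exact2 G m.
Proof.
move=> m0; have [N] := ubnP (nonedges G); elim: N G => // N IH G ltN n4 nop ore.
case: (boolP [exists x : G, exists y : G, (x != y) && ~~ adj x y]); last first.
  move=> H; have cG (u v : G) : u \in [set: G] -> v \in [set: G] -> u != v -> adj u v.
    move=> _ _ nuv; apply/negPn/negP => nuv'; case/negP: H; apply/existsP; exists u.
    by apply/existsP; exists v; rewrite nuv.
  have [|F [pF cF _]] := pack_k4 (j := m.+1) cG; first by rewrite cardsT.
  by case: (nop F pF).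
case/existsP=> x /existsP[y /andP[nxy nadj]]; pose H := add_edge nxy.
case: (Classical_Prop.classic (exists F : {set {set H}}, packing F /\ #|F| = m.+1)) => [|nopH].
  case=> F [[tF cF] card].
  have [C CF CS] : exists2 C, C \in F & (x \in C) && (y \in C).
    case: (boolP [exists C in F, (x \in C) && (y \in C)]) => [/exists_inP[C]|]; first by exists C.
    rewrite negb_exists_in => /forall_inP nC; case: (nop F); last exact: card.
    by split=> // C CF; apply: (@add_chs G x y nxy) (cF C CF) (nC C CF).
  have card' : #|F :\ C| = m by move: card; rewrite (cardsD1 C) CF; clear; lia.
  have pF' : @packing G (F :\ C).
    have [t' c'] := @packing_subset H F (F :\ C) (subsetDl _ _) (conj tF cF).
    split=> // C' /setD1P[nC C'F]; apply: (@add_chs G x y nxy) (cF C' C'F) _.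
    apply/negP => /andP[xC' _]; case/andP: CS => xC _.
    exact: (disjointE ((trivIsetP tF) _ _ C'F CF nC) xC' xC).
  apply: extremal_exact => //; apply: (@core G m (F :\ C)) => //.
  (* [C] may lose its chorded cycle in [G], but its vertices are the four or more left uncovered. *)
  have dC : [disjoint cover (F :\ C) & C].
    apply: disjoint_mem => u /bigcupP[C' /setD1P[nC C'F] uC'] uC.
    exact: (disjointE ((trivIsetP tF) _ _ C'F CF nC) uC' uC).
  apply: (@leq_trans #|cover (F :\ C) :|: C|); last exact: max_card.
  rewrite cardsU (disjoint_setI0 dC) cards0 subn0 leq_add2l.
  exact: (@chs_card H C (cF C CF)).
have eH : exact1 H m \/ exact2 H m.
  apply: IH.
  - rewrite -ltnS; apply: leq_trans ltN; rewrite ltnS; apply/proper_card/properP; split.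
      by apply/subsetP => -[u v]; rewrite !in_set /= /add_adj negb_or => /and3P[-> ->].
    exists (x, y); rewrite !in_set /= ?nxy ?nadj //.
    by rewrite /add_adj !eqxx orbT andbF.
  - exact: n4.
  - by move=> F pF cF; apply: nopH; exists F.
  - move=> u v nuv; rewrite /= /add_adj negb_or => /andP[/(ore u v nuv) le _].
    by apply: leq_trans le _; apply: leq_add; apply: add_degree.
have [|v [v' [vxy n1 n2 d1 d2]]] := @exact_low H m x y m0 eH.
  by rewrite /= /add_adj !eqxx orbT.
have nv : ~~ adj (v : G) v' by move: n2; rewrite /= /add_adj negb_or => /andP[].
have := ore v v' n1 nv; have := add_degree nxy v'; have := add_degree_end nxy vxy nadj.
by rewrite -/H; move: d1 d2; clear; lia.
Qed.

(** * Cyclic sequences, isomorphisms and the converse *)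

Section Cycles.
Variable G : sgraph.
Local Notation adj := (@adj G).

Lemma chorded_chs (c : seq G) : chorded_cycle c -> chs [set u in c].
Proof.
case/and3P=> _ /andP[cc uc] /exists_inP[x xc /exists_inP[y yc /and3P[xy n1 n2]]].
have [i s E] := rot_to xc.
have us : uniq (x :: s) by rewrite -E rot_uniq.
have cs : cycle adj (x :: s) by rewrite -E rot_cycle.
have ys : y \in s.
  have : y \in x :: s by rewrite -E mem_rot.
  by rewrite in_cons => /orP[/eqP yx|//]; rewrite yx adj_irr in xy.
rewrite -!(next_rot i uc) E in n1 n2.
case/splitPr: ys E us cs n1 n2 => s1 s2 E us cs n1 n2.
exists x, s1, y, s2; split=> //; last by move=> u; rewrite -E mem_rot inE.
(* An empty arc would make [y] the successor or the predecessor of [x], which [has_chord]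
   forbids. *)
apply/andP; split; first by case: s1 n1 {E us cs n2} => //=; rewrite !eqxx.
have E2 : x :: s1 ++ y :: s2 = rot 0 ((x :: s1) ++ y :: s2) by rewrite rot0.
case: s2 E us cs n1 n2 E2 => // E us cs n1 n2 _.
have us' : uniq ((x :: s1) ++ [:: y]) by [].
have : next ((x :: s1) ++ [:: y]) y = x.
  by rewrite -(next_rot (size (x :: s1)) us' y) rot_size_cat /= eqxx.
by move=> Ex; move: n2; rewrite -[x :: s1 ++ [:: y]]/((x :: s1) ++ [:: y]) Ex eqxx.
Qed.

Lemma chs_chorded (S : {set G}) : chs S -> exists2 c, chorded_cycle c & {subset c <= S}.
Proof.
case=> x [s1 [y [s2 [us cs /andP[p1 p2] xy sub]]]]; exists (x :: s1 ++ y :: s2) => //.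
apply/and3P; split.
- by rewrite /= size_cat /=; move: p1 p2; clear; lia.
- by apply/andP.
apply/exists_inP; exists x; first exact: mem_head.
apply/exists_inP; exists y; first by rewrite in_cons mem_cat mem_head !orbT.
have us' : uniq ((x :: s1) ++ y :: s2) by [].
have Ey : next (x :: s1 ++ y :: s2) y = next (y :: s2 ++ x :: s1) y.
  by rewrite -cat_cons -(next_rot (size (x :: s1)) us' y) rot_size_cat.
rewrite xy Ey; case: s1 s2 p1 p2 us {cs sub us' Ey} => [|a s1] [|b s2] // _ _.
rewrite cons_uniq => /andP[xn]; rewrite cat_cons cons_uniq => /andP[an _].
rewrite /= !eqxx /=; apply/andP; split.
  by apply: contraNneq an => <-; rewrite mem_cat mem_head orbT.
by apply: contraNneq xn => ->; rewrite !(in_cons, mem_cat) eqxx !orbT.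
Qed.

Lemma cycles_packing k : has_disjoint_chorded_cycles k G <->
  exists F : {set {set G}}, packing F /\ #|F| = k.
Proof.
split=> [[C [cC dC]]|[F [[tF cF] <-]]].
  have dS i j : i != j -> [disjoint [set u in C i] & [set u in C j]].
    move=> nij; apply: disjoint_mem => u; rewrite !in_set => ui uj.
    by move: (disjointFr (dC i j nij) ui); rewrite uj.
  have inj : injective (fun i => [set u in C i]).
    move=> i j E; apply/eqP/negPn/negP => nij; have := dS i j nij; rewrite -E.
    case/and3P: (cC i); case: (C i) => // u s _ _ _ d.
    by apply: (disjointE d (u := u)); rewrite in_set mem_head.
  exists [set [set u in C i] | i : 'I_k]; rewrite card_imset // card_ord; split=> //; split.
    apply/trivIsetP => A B /imsetP[i _ ->] /imsetP[j _ ->] n; apply: dS.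
    by apply: contraNneq n => ->.
  by move=> A /imsetP[i _ ->]; apply/chorded_chs/cC.
have /fin_all_exists[f Hf] (i : 'I_#|F|) : exists c : seq G, chorded_cycle c /\ {subset c <= enum_val i}.
  by have [c c1 c2] := chs_chorded (cF _ (enum_valP i)); exists c.
exists f; split=> [i|i j nij]; first by have [] := Hf i.
have [[_ si] [_ sj]] := (Hf i, Hf j).
have d := (trivIsetP tF) _ _ (enum_valP i) (enum_valP j).
have /d{}d : enum_val i != enum_val j by apply: contraNneq nij => /enum_val_inj->.
by apply/pred0P => u /=; apply/negP => /andP[/si ui /sj uj]; apply: (disjointE d ui uj).
Qed.

(** If [x] is in [X], then [y] is not, and the neighbours [z] and [b] of [y] on the cycle join [x]
    in [X]; otherwise [y] and the neighbours [a] and [w] of [x] are in [X]. The three are distinct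
    because they are an end of the chord and one vertex from each arc. *)
Lemma chs_bip (S X : {set G}) : chs S ->
  (forall u v, u \in S -> v \in S -> adj u v -> (u \in X) != (v \in X)) -> 3 <= #|S :&: X|.
Proof.
case=> x [s1 [y [s2 [us cs /andP[p1 p2] xy sub]]]] H.
have [a [z [aI zI xa zy]]] : exists a z, [/\ a \in s1, z \in s1, adj x a & adj z y].
  case: s1 p1 cs {us sub} => // a s _; rewrite /= rcons_cat cat_path /= => /and4P[xa _ zy _].
  by exists a, (last a s); rewrite mem_head mem_last.
have [b [w [bI wI yb wx]]] : exists b w, [/\ b \in s2, w \in s2, adj y b & adj w x].
  case: s2 p2 cs {us sub} => // b s _.
  rewrite /= rcons_cat cat_path /= rcons_path => /and4P[_ _ yb /andP[_ wx]].
  by exists b, (last b s); rewrite mem_head mem_last.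
have [xS yS] : x \in S /\ y \in S by split; apply: sub; rewrite !(in_cons, mem_cat) eqxx ?orbT.
have s1S u : u \in s1 -> u \in S by move=> uI; apply: sub; rewrite in_cons mem_cat uI orbT.
have s2S u : u \in s2 -> u \in S by move=> uI; apply: sub; rewrite in_cons mem_cat in_cons uI !orbT.
have hxy := H x y xS yS xy; have hxa := H x a xS (s1S a aI) xa; have hzy := H z y (s1S z zI) yS zy.
have hyb := H y b yS (s2S b bI) yb; have hwx := H w x (s2S w wI) xS wx.
move: us; rewrite cons_uniq mem_cat in_cons !negb_or cat_uniq => /and3P[/and3P[n1 nxy n2] _ /andP[/hasPn h1]].
rewrite cons_uniq => /andP[n3 _].
have ne12 u v : u \in s1 -> v \in s2 -> u != v.
  by move=> uI vI; apply: contraTneq uI => ->; apply: h1; rewrite in_cons vI orbT.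
have nx1 u : u \in s1 -> x != u by move=> uI; apply: contraNneq n1 => ->.
have nx2 u : u \in s2 -> x != u by move=> uI; apply: contraNneq n2 => ->.
have ny1 u : u \in s1 -> y != u by move=> uI; apply: contraTneq uI => <-; apply: h1; apply: mem_head.
have ny2 u : u \in s2 -> y != u by move=> uI; apply: contraNneq n3 => ->.
have key (p q r : G) : uniq [:: p; q; r] -> {subset [:: p; q; r] <= S :&: X} -> 3 <= #|S :&: X|.
  move=> /card_uniqP u3 sub3; apply: (@leq_trans #|[:: p; q; r]|); first by rewrite u3.
  exact/subset_leq_card/subsetP.
case: (boolP (x \in X)) => xX.
  apply: (key x z b).
    by rewrite /= !inE negb_or nx1 // nx2 // ne12.
  have yX : y \notin X by move: hxy; rewrite xX; case: (y \in X).
  have zX : z \in X by move: hzy; rewrite (negPf yX); case: (z \in X).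
  have bX : b \in X by move: hyb; rewrite (negPf yX); case: (b \in X).
  by apply/allP; rewrite /= !in_setI xS xX s1S // s2S // zX bX.
apply: (key y a w).
  by rewrite /= !inE negb_or ny1 // ny2 // ne12.
have yX : y \in X by move: hxy; rewrite (negPf xX); case: (y \in X).
have aX : a \in X by move: hxa; rewrite (negPf xX); case: (a \in X).
have wX : w \in X by move: hwx; rewrite (negPf xX); case: (w \in X).
by apply/allP; rewrite /= !in_setI yS yX s1S // s2S // aX wX.
Qed.

Lemma sum_cardI_le (F : {set {set G}}) X : trivIset F -> \sum_(C in F) #|C :&: X| <= #|X|.
Proof.
move=> tF; have -> : \sum_(C in F) #|C :&: X| = \sum_(C in F) \sum_(u in C) (u \in X).
  apply: eq_bigr => C _; rewrite -sum1_card big_mkcond [RHS]big_mkcond /=.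
  by apply: eq_bigr => u _; rewrite in_setI; case: (u \in C); case: (u \in X).
apply: (@leq_trans (\sum_(u in cover F) (u \in X))); first by rewrite big_trivIset.
rewrite -sum1_card [X in _ <= X]big_mkcond /=.
rewrite big_mkcond /=; apply: leq_sum => u _.
by case: (u \in cover F); case: (u \in X).
Qed.

Lemma exact1_nopack m (F : {set {set G}}) : exact1 G m -> packing F -> #|F| <> m.+1.
Proof.
case=> X [cX _ E] [tF cF] card; have := sum_cardI_le X tF; rewrite cX.
have : \sum_(C in F) 3 <= \sum_(C in F) #|C :&: X|.
  by apply: leq_sum => C CF; apply: (chs_bip (cF C CF)) => u v _ _; rewrite E.
rewrite sum_nat_const card; move: (\sum_(C in F) _) => s; clear; lia.
Qed.

(** At most one member contains [a]. The [m] others take three vertices each from [X] and from [Y]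
    and leave one of either, so the remaining member would have at most three vertices. *)
Lemma exact2_nopack m (F : {set {set G}}) : exact2 G m -> packing F -> #|F| <> m.+1.
Proof.
case=> a [X [Y [[aX aY cov] dXY cX cY E]]] [tF cF] card.
have XY z : z != a -> (z \in X) = (z \notin Y).
  move=> za; have := cov z; rewrite (negPf za) /=; case: (boolP (z \in X)) => zX.
    by rewrite (disjointFr dXY zX).
  by move=> /= ->.
have three C : C \in F -> a \notin C -> 3 <= #|C :&: X| /\ 3 <= #|C :&: Y|.
  move=> CF aC; have na u : u \in C -> u != a by move=> uC; apply: contraNneq aC => <-.
  split; apply: (chs_bip (cF C CF)) => u v /na ua /na va.
    by rewrite E (negPf ua) (negPf va) => /andP[].
  by rewrite E (negPf ua) (negPf va) => /andP[_]; rewrite /= !XY //; case: (u \in Y); case: (v \in Y).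
have sX := sum_cardI_le X tF; have sY := sum_cardI_le Y tF; rewrite cX in sX; rewrite cY in sY.
case: (boolP [exists C in F, a \in C]) => [/exists_inP[C CF aC]|].
  have rest C' : C' \in F -> C' != C -> a \notin C'.
    move=> C'F n; apply/negP => aC'; exact: (disjointE ((trivIsetP tF) _ _ C'F CF n) aC' aC).
  have card' : #|F :\ C| = m by move: card; rewrite (cardsD1 C) CF; clear; lia.
  have lo (Z : {set G}) : (forall C', C' \in F -> a \notin C' -> 3 <= #|C' :&: Z|) ->
      3 * m + #|C :&: Z| <= \sum_(C in F) #|C :&: Z|.
    move=> H; rewrite (big_setD1 C) //= addnC leq_add2l -card' mulnC -sum_nat_const.
    by apply: leq_sum => C' /setD1P[n C'F]; apply: H => //; apply: rest.
  have lX := lo X (fun C' h h' => (three C' h h').1); have lY := lo Y (fun C' h h' => (three C' h h').2).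
  have := chs_card (cF C CF); have : #|C| <= 1 + #|C :&: X| + #|C :&: Y|.
    apply: (@leq_trans #|[set a] :|: (C :&: X) :|: (C :&: Y)|).
      apply/subset_leq_card/subsetP => u uC; have := cov u.
      by rewrite !in_setU !in_setI uC in_set1 orbA.
    apply: leq_trans (leq_card_setU _ _) _; rewrite leq_add2r.
    by apply: leq_trans (leq_card_setU _ _) _; rewrite cards1.
  by move: lX lY sX sY; move: (\sum_(_ in F) _) (\sum_(_ in F) _) => p q; clear; lia.
rewrite negb_exists_in => /forall_inP na.
have : \sum_(C in F) 3 <= \sum_(C in F) #|C :&: X|.
  by apply: leq_sum => C CF; have [] := three C CF (na C CF).
rewrite sum_nat_const card; move: sX; move: (\sum_(C in F) _) => p; clear; lia.
Qed.

Lemma leq_sigma2_ore n (x y : G) : leq_sigma2 n G -> x != y -> ~~ adj x y -> n <= degree x + degree y.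
Proof.
rewrite /leq_sigma2 /sigma2 => H nxy nadj; move: H.
rewrite (bigD1 (x, y)) /= ?nxy //.
set r := \big[_/_]_(_ | _) _; case: r => [r|]; last by [].
by rewrite oACE => /leq_trans; apply; apply: geq_minl.
Qed.

(** Colour classes of prescribed sizes avoid the dependent type of vertices. Conversely, a vertex is
    sent to its colour and its rank in the colour class, an injection between types of equal
    size. *)
Lemma iso_col (s : seq nat) : graph_iso G (complete_multipartite s) <->
  exists col : G -> 'I_(size s), (forall u v, adj u v = (col u != col v)) /\
    forall i, #|[set u | col u == i]| = nth 0 s i.
Proof.
split=> [[f [bf mf]]|[col [ad card]]].
  exists (fun u => tag (f u)); split=> [u v|i]; first by rewrite -mf.
  have [g fg gf] := bf.
  have inj : injective (fun j : 'I_(nth 0 s i) => g (existT _ i j)).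
    by move=> j j' /(can_inj gf); apply: eq_from_Tagged.
  rewrite -[RHS]card_ord -(card_imset _ inj); apply: eq_card => u; rewrite in_set.
  apply/eqP/imsetP => [E|[j _ ->]]; last by rewrite gf.
  case Ef : (f u) E => [i' j] /= E; subst i'; exists j => //.
  by rewrite -Ef fg.
have rk u : index u (enum [set v | col v == col u]) < nth 0 s (col u).
  by rewrite -card cardE index_mem mem_enum in_set.
pose f u : complete_multipartite s := existT (fun i : 'I_(size s) => 'I_(nth 0 s i)) (col u) (Ordinal (rk u)).
have injf : injective f.
  move=> u v E; have Ec : col u = col v := f_equal tag E.
  have Er : index u (enum [set w | col w == col u]) = index v (enum [set w | col w == col v]).
    exact: (f_equal (fun p : multipartite_vertex s => nat_of_ord (tagged p)) E).
  rewrite Ec in Er; have ui : u \in enum [set w | col w == col v] by rewrite mem_enum in_set Ec.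
  have vi : v \in enum [set w | col w == col v] by rewrite mem_enum in_set.
  by rewrite -(nth_index u ui) Er nth_index.
exists f; split; last by move=> u v; rewrite ad.
apply: inj_card_bij injf _.
rewrite card_tagged sumnE big_map big_enum -sum1_card (partition_big col xpredT) //=.
apply: leq_sum => i _; rewrite card_ord -card -sum1_card; apply: eq_leq; apply: eq_bigl => u.
by rewrite in_set.
Qed.

End Cycles.

Section Multipartite.
Variables (G : sgraph) (m : nat).

(** The bound on [#|G|] rules out truncation in [#|G| - 3 * m.+1] and makes the second part at least
    as large as the first. *)
Lemma exact1_iso : exact1 G m <-> 6 * m.+1 - 2 <= #|G| /\ graph_iso G (G1 #|G| m.+1).
Proof.
have s2 (i : 'I_2) : i = inord 0 \/ i = inord 1.
  by case: i => -[|[|i]] // ltp; [left|right]; apply: val_inj; rewrite /= inordK.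
have n01 : (inord 0 == inord 1 :> 'I_2) = false by apply/negP => /eqP/(congr1 val); rewrite /= !inordK.
have n10 : (inord 1 == inord 0 :> 'I_2) = false by rewrite eq_sym.
split=> [[X [cX cY E]]|[n_le /iso_col[col [ad card]]]].
  have tot : #|X| + #|~: X| = #|G| := cardsC X; split; first by move: cX cY tot; clear; lia.
  have E2 : #|~: X| = #|G| - 3 * m.+1 + 1 by move: cX cY tot; clear; lia.
  apply/iso_col; exists (fun u => if u \in X then inord 0 else inord 1 : 'I_2); split=> [u v|i].
    by rewrite E; case: (u \in X); case: (v \in X); rewrite ?eqxx ?n01 ?n10.
  case: (s2 i) => ->; rewrite inordK //=.
    have -> : [set u | (if u \in X then inord 0 else inord 1 : 'I_2) == inord 0] = X.
      by apply/setP => u; rewrite in_set; case: (u \in X); rewrite ?eqxx ?n10.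
    by move: cX; clear; lia.
  have -> : [set u | (if u \in X then inord 0 else inord 1 : 'I_2) == inord 1] = ~: X.
    by apply/setP => u; rewrite in_set in_setC; case: (u \in X); rewrite ?eqxx ?n01.
  exact: E2.
have c0 := card (inord 0 : 'I_2); rewrite inordK //= in c0.
have c1 := card (inord 1 : 'I_2); rewrite inordK //= in c1.
have E2 : 3 * m + 2 <= #|G| - 3 * m.+1 + 1 by move: n_le; clear; lia.
exists [set u | col u == (inord 0 : 'I_2)]; split.
- by rewrite c0; clear; lia.
- have -> : ~: [set u | col u == (inord 0 : 'I_2)] = [set u | col u == (inord 1 : 'I_2)].
    apply/setP => u; rewrite in_setC !in_set; by case: (s2 (col u)) => ->; rewrite eqxx ?n01 ?n10.
  by rewrite c1; exact: E2.
- move=> u v; rewrite ad !in_set; case: (s2 (col u)) => ->; case: (s2 (col v)) => ->;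
  by rewrite ?eqxx ?n01 ?n10.
Qed.

Lemma exact2_iso : exact2 G m <-> graph_iso G (G2 m.+1).
Proof.
have s3 (i : 'I_3) : [\/ i = inord 0, i = inord 1 | i = inord 2].
  by case: i => -[|[|[|i]]] // ltp; [constructor 1|constructor 2|constructor 3]; apply: val_inj; rewrite /= inordK.
have ne i j : i < 3 -> j < 3 -> (inord i == inord j :> 'I_3) = (i == j).
  by move=> li lj; rewrite -val_eqE /= !inordK.
split=> [[a [X [Y [[aX aY cov] dXY cX cY E]]]]|/iso_col[col [ad card]]].
  pose col u : 'I_3 := if u \in X then inord 0 else if u \in Y then inord 1 else inord 2.
  have colX u : (col u == inord 0) = (u \in X).
    by rewrite /col; case: (u \in X); first rewrite eqxx; case: (u \in Y); rewrite ?ne.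
  have colY u : (col u == inord 1) = (u \in Y).
    rewrite /col; case: (boolP (u \in X)) => uX; last by case: (u \in Y); rewrite ?ne.
    by rewrite (disjointFr dXY uX) ne.
  have cola u : (col u == inord 2) = (u == a).
    rewrite /col; case: (boolP (u \in X)) => uX.
      by rewrite ne //; apply/esym/negP => /eqP ua; rewrite -ua uX in aX.
    case: (boolP (u \in Y)) => uY.
      by rewrite ne //; apply/esym/negP => /eqP ua; rewrite -ua uY in aY.
    by have := cov u; rewrite (negPf uX) (negPf uY) !orbF eqxx => ->.
  apply/iso_col; exists col; split=> [u v|i].
    have cX' := colX; have cY' := colY.
    have -> : (col u != col v) = ~~ [|| (u \in X) && (v \in X), (u \in Y) && (v \in Y) | (u == a) && (v == a)].
      rewrite -!colX -!colY -!cola; congr (~~ _).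
      by case: (s3 (col u)) => ->; case: (s3 (col v)) => ->; rewrite !ne.
    rewrite E; case: (eqVneq u v) => [<-|nuv] /=.
      by rewrite !andbb; have := cov u; case: (u == a); case: (u \in X); case: (u \in Y).
    case: (eqVneq u a) => [ua|na] /=.
      by rewrite ua (negPf aX) (negPf aY) /= -ua eq_sym (negPf nuv).
    case: (eqVneq v a) => [va|na'] /=; first by rewrite va (negPf aX) (negPf aY) !andbF.
    have := cov u; have := cov v; rewrite (negPf na) (negPf na') /= orbF.
    case: (boolP (u \in X)) => uX; case: (boolP (v \in X)) => vX; rewrite ?(disjointFr dXY uX) ?(disjointFr dXY vX) //=;
    by case: (u \in Y); case: (v \in Y).
  case: (s3 i) => ->; rewrite inordK //=.
  - rewrite -[RHS](_ : #|X| = _); last by rewrite cX; clear; lia.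
    by apply: eq_card => u; rewrite in_set colX.
  - rewrite -[RHS](_ : #|Y| = _); last by rewrite cY; clear; lia.
    by apply: eq_card => u; rewrite in_set colY.
  - by apply: etrans (cards1 a); apply: eq_card => u; rewrite in_set in_set1 cola.
have c0 := card (inord 0 : 'I_3); rewrite inordK //= in c0.
have c1 := card (inord 1 : 'I_3); rewrite inordK //= in c1.
have c2 := card (inord 2 : 'I_3); rewrite inordK //= in c2.
have /cards1P[a Ea] : #|[set u | col u == (inord 2 : 'I_3)]| == 1 by rewrite c2.
have ca u : (col u == (inord 2 : 'I_3)) = (u == a) by rewrite -in_set1 -Ea in_set.
have col_a : col a = inord 2 by apply/eqP; rewrite ca.
exists a, [set u | col u == (inord 0 : 'I_3)], [set u | col u == (inord 1 : 'I_3)]; split.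
- split; rewrite ?in_set ?col_a ?ne // => u; rewrite -ca !in_set.
  by case: (s3 (col u)) => ->; rewrite !ne.
- apply: disjoint_mem => u; rewrite !in_set => /eqP-> /eqP E.
  by have := ne 0 1 isT isT; rewrite E eqxx.
- by rewrite c0; clear; lia.
- by rewrite c1; clear; lia.
- move=> u v; rewrite ad !in_set -!ca; case: (eqVneq u v) => [->|nuv] /=; first by rewrite eqxx.
  case: (s3 (col u)) => Eu; case: (s3 (col v)) => Ev; rewrite Eu Ev !ne //=.
  by move: nuv; have := ca u; have := ca v; rewrite Eu Ev !ne //= => /esym/eqP-> /esym/eqP->; rewrite eqxx.
Qed.

End Multipartite.

Theorem theorem9 (k : nat) (G : sgraph) (hk : 2 <= k) (hn : 4 * k <= #|G|)
    (hsigma : leq_sigma2 (6 * k - 2) G) :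
  ~ has_disjoint_chorded_cycles k G <->
  (6 * k - 2 <= #|G| /\ graph_iso G (G1 #|G| k)) \/ graph_iso G (G2 k).
Proof.
case: k hk hn hsigma => // m m0 hn hsigma; rewrite -exact1_iso -exact2_iso.
split=> [nop|ex /cycles_packing[F [pF cF]]]; last first.
  by case: ex => ex; [apply: exact1_nopack ex pF cF|apply: exact2_nopack ex pF cF].
apply: exact_of_ore => // [F pF cF|x y nxy nadj]; first by apply/nop/cycles_packing; exists F.
apply: leq_trans (leq_sigma2_ore hsigma nxy nadj); clear; lia.
Qed.
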